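(* Let $\mathrm{Oct}_0$ be the octagon and, for $n\in\mathbb Z$, let $\mathrm{Oct}_n$ be the translation surface in the minimal stratum $\mathcal H_2$ obtained from $\mathrm{Oct}_0$ by $n$ iterated left surgeries (by $|n|$ iterated right surgeries if $n<0$). Then: (i) the surfaces $\mathrm{Oct}_n$ are different from each other: if $n,m\in\mathbb Z$ and $n\neq m$, then $\mathrm{Oct}_n\neq \mathrm{Oct}_m$ as points of $\mathcal H_2$ (that is, they are not isomorphic as translation surfaces); (ii) any of them can be arbitrarily approximated by others: for every $m\in\mathbb Z$ and every neighbourhood $U$ of $\mathrm{Oct}_m$ in $\mathcal H_2$, there is $n\in\mathbb Z$ with $\mathrm{Oct}_n\in U$ and $\mathrm{Oct}_n\neq\mathrm{Oct}_m$.
   Context: **Translation surfaces.** A translation surface is a closed connected oriented surface obtained from polygons in $\mathbb C$ by gluing pairs of parallel edges via translations; equivalently a pair $(X,\omega)$ with $X$ a compact Riemann surface and $\omega$ a nonzero holomorphic $1$-form. Two translation surfaces are identified if they are isomorphic, i.e. there is a homeomorphism between them that is a translation in local charts (a biholomorphism matching the $1$-forms); no rotations are allowed. Singular points (saddles) are the cone points of angle $2\pi+2\pi d$, $d\ge 1$ (the zeroes of $\omega$ of order $d$). $\mathcal H_2$ denotes the minimal stratum in genus $2$: the moduli space of genus $2$ translation surfaces with exactly one singular point, which then has cone angle $6\pi$. Its topology is the one given by period coordinates: local charts (up to orbifold issues) are $(X,\omega)\mapsto\left(\int_{\gamma_1}\omega,\dots,\int_{\gamma_4}\omega\right)\in\mathbb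 C^4$, with $\gamma_1,\dots,\gamma_4$ a locally constant basis of $H_1(X;\mathbb Z)$. **The octagon and fakes.** The octagon $\mathrm{Oct}_0$ is the translation surface obtained by gluing opposite (parallel) sides by translations of a regular octagon in $\mathbb C$ having the segment $[0,1]$ as one of its edges. It lies in $\mathcal H_2$. A fake octagon is a translation surface different from $\mathrm{Oct}_0$, with the same absolute periods as $\mathrm{Oct}_0$ (as a polarized module) and with only one singular point. **Saddle connection surgery.** A closed saddle connection is a straight segment starting and ending at the same singular point, with no singular point in its interior. Given an oriented closed saddle connection $\gamma$ starting at the singular point $x$, a twin of $\gamma$ is a segment starting at $x$ with the same developed image (same direction and length) as $\gamma$; twins form with $\gamma$ at $x$ angles that are positive multiples of $2\pi$. Let $\eta$ be a twin of $\gamma$ that is an embedded segment. The saddle connection surgery along $\gamma$ and $\eta$ is: cut the surface along $\gamma$ and $\eta$, so that each of the two segments yields two boundary copies, one having the surface on its left and one having the surface on its right; then glue by translation the copy of $\gamma$ with the surface on its left to the copy of $\eta$ with the surface on its right, and the copy of $\gamma$ with the surface on its right to the copy of $\eta$ with the surface on its left. **Left and right surgeries.** The octagon has exactly three horizontal saddle connections, all closed: one of length $1$ and two of length $1+\sqrt2$. Let $\gamma$ be the one of length $1$, oriented from left to right. The angle at the singular point between the end of $\gamma$ and the start of $\gamma$ is $3\pi$, so $\gamma$ has two twins, each being an initial sub-segment of one of the longer horizontal saddle connections, forming angles $\pm\pi$ with the end of $\gamma$. Let $\gamma_L$ be the twin such that the angle at the singular point measured clockwise from the end of $\gamma$ to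 the start of $\gamma_L$ is $\pi$, and let $\gamma_R$ be the other twin. The left surgery is the saddle connection surgery along $\gamma$ and $\gamma_L$; the right surgery is the one along $\gamma$ and $\gamma_R$. Left and right surgeries produce surfaces in $\mathcal H_2$ and preserve the properties of having one horizontal saddle connection of length $1$ and two of length $1+\sqrt2$, and of the angle between the start and the end of the unit one being $3\pi$; hence at each step the left (right) surgery is defined by the same recipe, and can be iterated. For $n\geq 0$, $\mathrm{Oct}_n$ is obtained from $\mathrm{Oct}_0$ by $n$ left surgeries; for $n<0$, $\mathrm{Oct}_n$ is obtained from $\mathrm{Oct}_0$ by $|n|$ right surgeries. *)

(* Defs.v *)
From HB Require Import structures.
From Stdlib Require Import Relations.
From mathcomp Require Import all_boot all_order all_algebra all_fingroup.
From mathcomp Require Import all_classical all_reals all_analysis.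
Import Order.TTheory GRing.Theory Num.Theory.
Import numFieldNormedType.Exports.

Set Implicit Arguments.
Unset Strict Implicit.
Unset Printing Implicit Defensive.

Local Open Scope classical_set_scope.
Local Open Scope ring_scope.
Local Open Scope quotient_scope.

(* The plane C is written R * R: only its translations, its orientation and    *)
(* its Euclidean metric are used.                                              *)
Section Plane.
Variable R : realType.
Implicit Types u v : R * R.

Definition dot u v : R := u.1 * v.1 + u.2 * v.2.
Definition cross u v : R := u.1 * v.2 - u.2 * v.1.
Definition enorm u : R := Num.sqrt (dot u u).

(* unoriented angle, in [0, pi] *)
Definition angle u v : R := acos (dot u v / (enorm u * enorm v)).

End Plane.

(* Polygons in the plane with a pairing of their sides.  The polygons are      *)
(* encoded by their oriented sides d : 'I_nsides:                              *)
(* - [next d] is the side following d counterclockwise along its polygon, so   *)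
(*   that polygons are the orbits of [next], each lying to the left of its     *)
(*   sides;                                                                    *)
(* - [opp d] is the side glued to d;                                           *)
(* - [pos d] is the origin of d, so that d runs from pos d to pos (next d).    *)
Record polygon_gluing (R : realType) := PolygonGluing {
  nsides : nat;
  next : {perm 'I_nsides};
  opp : {perm 'I_nsides};
  pos : 'I_nsides -> R * R }.

HB.instance Definition _ (R : realType) := gen_eqMixin (polygon_gluing R).
HB.instance Definition _ (R : realType) := gen_choiceMixin (polygon_gluing R).

Section Gluing.
Variables (R : realType) (P : polygon_gluing R).
Implicit Types d e g : 'I_(nsides P).

Definition side d : R * R := pos (next P d) - pos d.

(* The second condition says that each polygon has at least three sides, the   *)
(* third one that it is strictly convex and counterclockwise: every vertex not *)
(* on the side d is strictly to the left of d.                                 *)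
Definition translation_surface : Prop :=
  [/\ (0 < nsides P)%N,
      (forall d, next P d != d /\ next P (next P d) != d),
      (forall d e, e \in porbit (next P) d -> e != d -> e != next P d ->
        0 < cross (side d) (pos e - pos d)),
      (forall d, opp P (opp P d) = d /\ side (opp P d) = - side d) &
      (forall d e, connect (fun x y => (y == next P x) || (y == opp P x)) d e)].

Definition polygon d : set (R * R) :=
  [set z | forall e, e \in porbit (next P) d -> 0 <= cross (side e) (z - pos e)].

(* Disjoint union of the closed polygons, with one copy of each polygon for    *)
(* each of its sides; [glue_step] identifies the copies with each other, and   *)
(* each side with the opposite one.                                            *)
Definition polygons := {d : 'I_(nsides P) & set_type (polygon d)}.

Definition glue_step (x y : polygons) : Prop :=
  (tag y = next P (tag x) /\ set_val (tagged y) = set_val (tagged x)) \/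
  (tag y = opp P (tag x) /\
   exists2 t : R, 0 <= t <= 1 &
     set_val (tagged x) = pos (tag x) + t *: side (tag x) /\
     set_val (tagged y) = pos (next P (tag y)) + t *: side (tag x)).

Definition glue (x y : polygons) : bool :=
  `[< clos_refl_sym_trans polygons glue_step x y >].

Lemma glue_refl : reflexive glue.
Proof. by move=> x; apply/asboolP; exact: rst_refl. Qed.

Lemma glue_sym : symmetric glue.
Proof. by move=> x y; apply/idP/idP => /asboolP h; apply/asboolP; exact: rst_sym. Qed.

Lemma glue_trans : transitive glue.
Proof. by move=> y x z /asboolP h /asboolP k; apply/asboolP; exact: rst_trans h k. Qed.

Canonical glue_equiv := EquivRel glue glue_refl glue_sym glue_trans.

Definition surface : topologicalType := quotient_topology {eq_quot glue_equiv}.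

Definition point d (z : set_type (polygon d)) : surface :=
  \pi_surface (existT _ d z : polygons).

(* The maximal translation atlas: on each polygon, a chart differs from the    *)
(* inclusion in the plane by a locally constant vector.  By injectivity, charts*)
(* avoid the cone points of angle larger than 2 pi.                            *)
Definition translation_chart (U : set surface) (h : surface -> R * R) : Prop :=
  [/\ open U,
      {in U &, injective h} &
      forall d (z : set_type (polygon d)), U (point z) ->
        \forall w \near z, h (point w) - set_val w = h (point z) - set_val z].

(* [rot d] is the side that follows d counterclockwise among the sides leaving *)
(* the origin of d, so that the vertices of the surface are the orbits of rot. *)
Definition rot : {perm 'I_(nsides P)} := ((next P)^-1 * opp P)%g.

(* interior angle of the polygon of d at the origin of d *)
Definition corner d : R := angle (side d) (- side ((next P)^-1%g d)).

Definition cone_angle d : R := \sum_(e in porbit rot d) corner e.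

Definition singular d : Prop := cone_angle d <> 2 * pi.

(* Euler's formula: #vertices - #edges + #faces = 2 - 2 * 2. *)
Definition genus2 : Prop :=
  (#|porbits rot| + #|porbits (next P)| + 2 = #|porbits (opp P)|)%N.

Definition in_H2 : Prop :=
  [/\ translation_surface, genus2 &
      exists2 d, singular d & forall e, singular e -> e \in porbit rot d].

End Gluing.

Section Isomorphism.
Variable R : realType.
Implicit Types P Q : polygon_gluing R.

(* A homeomorphism f that is a translation in local charts, i.e., such that f  *)
(* and its inverse g pull translation charts back to translation charts.       *)
Definition isomorphic P Q : Prop :=
  exists (f : surface P -> surface Q) (g : surface Q -> surface P),
    [/\ cancel f g /\ cancel g f,
        continuous f /\ continuous g,
        (forall U h, translation_chart U h ->
           translation_chart (f @^-1` U) (h \o f)) &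
        (forall U h, translation_chart U h ->
           translation_chart (g @^-1` U) (h \o g))].

Lemma isomorphic_refl P : isomorphic P P.
Proof. by exists id, id; split=> //; split=> // x; exact: cvg_id. Qed.

Lemma isomorphic_sym P Q : isomorphic P Q -> isomorphic Q P.
Proof. by move=> [f [g [[fK gK] [cf cg] hf hg]]]; exists g, f; split. Qed.

Lemma isomorphic_trans Q P S :
  isomorphic P Q -> isomorphic Q S -> isomorphic P S.
Proof.
move=> [f [g [[fK gK] [cf cg] hf hg]]] [f' [g' [[fK' gK'] [cf' cg'] hf' hg']]].
exists (f' \o f), (g \o g'); split.
- by split; [exact: can_comp | exact: can_comp].
- by split=> x; [exact: continuous_comp (cf _) (cf' _) |
                 exact: continuous_comp (cg' _) (cg _)].
- by move=> U h /hf' /hf.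
- by move=> U h /hg /hg'.
Qed.

Definition H2_gluing : set (polygon_gluing R) := [set P | in_H2 P].

Definition H2_iso (P Q : H2_gluing) : bool :=
  `[< isomorphic (set_val P) (set_val Q) >].

Lemma H2_iso_refl : reflexive H2_iso.
Proof. by move=> P; apply/asboolP; exact: isomorphic_refl. Qed.

Lemma H2_iso_sym : symmetric H2_iso.
Proof.
by move=> P Q; apply/idP/idP => /asboolP h; apply/asboolP; exact: isomorphic_sym.
Qed.

Lemma H2_iso_trans : transitive H2_iso.
Proof.
by move=> Q P S /asboolP h /asboolP k; apply/asboolP; exact: isomorphic_trans h k.
Qed.

Canonical H2_iso_equiv := EquivRel H2_iso H2_iso_refl H2_iso_sym H2_iso_trans.

End Isomorphism.

Definition H2 (R : realType) : Type := {eq_quot @H2_iso_equiv R}.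
HB.instance Definition _ (R : realType) :=
  Choice.copy (H2 R) {eq_quot @H2_iso_equiv R}.

Definition H2_point (R : realType) (P : polygon_gluing R) (hP : in_H2 P) : H2 R :=
  \pi_{eq_quot @H2_iso_equiv R} (SigSub (mem_set hP) : @H2_gluing R).

(* Integral homology and periods, computed on the cell decomposition given by  *)
(* the polygons; c d is the multiplicity of the oriented side d in the chain c.*)
Section Periods.
Variables (R : realType) (P : polygon_gluing R).
Local Notation chain := {ffun 'I_(nsides P) -> int}.

(* for each vertex, the sides leaving it balance those arriving at it *)
Definition cycle (c : chain) : Prop :=
  forall d, \sum_(e in porbit (rot P) d) c e =
            \sum_(e in porbit (rot P) d) c ((next P)^-1%g e).

(* c is an integral combination of the chains d + opp d, which represent 0,    *)
(* and of the boundaries of the polygons *)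
Definition null_homologous (c : chain) : Prop :=
  exists a f : 'I_(nsides P) -> int, forall e,
    c e = a e + a (opp P e) + \sum_(d in porbit (next P) e) f d.

Definition H1_basis (b : 'I_4 -> chain) : Prop :=
  (forall j, cycle (b j)) /\
  forall c, cycle c -> exists! m : {ffun 'I_4 -> int},
    null_homologous (c - \sum_j b j *~ m j).

Definition period (c : chain) : R * R := \sum_d side d *~ c d.

End Periods.

(* Period coordinates: the surfaces glued from polygons with the same          *)
(* combinatorics have a common homology, and when the singular point is the    *)
(* only vertex, a surface close to P is determined by its periods along a      *)
(* basis of it.  A set is open if it contains a ball in these coordinates      *)
(* around each of its points.                                                  *)
Section PeriodTopology.
Variable R : realType.

Definition period_open (U : set (H2 R)) : Prop :=
  forall n (next opp : {perm 'I_n}) (pos : 'I_n -> R * R)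
    (b : 'I_4 -> {ffun 'I_n -> int})
    (hP : in_H2 (PolygonGluing next opp pos)),
  #|porbits (rot (PolygonGluing next opp pos))| = 1%N ->
  H1_basis (P := PolygonGluing next opp pos) b ->
  U (H2_point hP) ->
  exists2 eps : R, 0 < eps &
    forall (pos' : 'I_n -> R * R) (hQ : in_H2 (PolygonGluing next opp pos')),
    (forall j, `|period (P := PolygonGluing next opp pos') (b j) -
                 period (P := PolygonGluing next opp pos) (b j)| < eps) ->
    U (H2_point hQ).

Lemma period_openT : period_open setT.
Proof. by move=> *; exists 1. Qed.

Lemma period_openI : setI_closed period_open.
Proof.
move=> U V oU oV n nx op ps b hP v1 hb [UP VP].
have [e e0 he] := oU _ _ _ _ _ hP v1 hb UP.
have [e' e'0 he'] := oV _ _ _ _ _ hP v1 hb VP.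
exists (Num.min e e'); first by rewrite lt_min e0.
move=> ps' hQ hlt; split; [apply: he|apply: he'] => j;
  by have := hlt j; rewrite lt_min => /andP[].
Qed.

Lemma period_open_bigU (I : Type) (f : I -> set (H2 R)) :
  (forall i, period_open (f i)) -> period_open (\bigcup_i f i).
Proof.
move=> of_ n nx op ps b hP v1 hb [i _ fP].
have [e e0 he] := of_ i _ _ _ _ _ hP v1 hb fP.
by exists e => // ps' hQ hlt; exists i => //; exact: he.
Qed.

HB.instance Definition _ := isOpenTopological.Build (H2 R)
  period_openT period_openI period_open_bigU.

End PeriodTopology.

Section Surgery.
Variables (R : realType) (P : polygon_gluing R).
Implicit Types d e g h : 'I_(nsides P).

Definition closed_saddle_connection g : Prop :=
  singular g /\ next P g \in porbit (rot P) g.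

Definition twin g h : Prop :=
  [/\ h != g, h \in porbit (rot P) g & side h = side g].

(* Distinct sides never cross, so only the ends of h have to be distinct. *)
Definition embedded h : Prop := next P h \notin porbit (rot P) h.

(* The angle at their common origin, counterclockwise from d to e, is theta. *)
Definition ccw_angle d e (theta : R) : Prop :=
  exists2 k : nat, iter k (rot P) d = e &
    theta = \sum_(i < k) corner (iter i (rot P) d).

(* The conjugate of opp by the transposition (g h) glues g to opp h and h to   *)
(* opp g.  Here g and h have the surface on their left, while opp g and opp h  *)
(* are the copies of the same segments having it on their right.               *)
Definition resew g h : polygon_gluing R :=
  PolygonGluing (next P) (opp P ^ tperm g h)%g (@pos R P).

Definition surgery g h (Q : polygon_gluing R) : Prop :=
  [/\ closed_saddle_connection g, twin g h, embedded h & Q = resew g h].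

Definition unit_saddle_connection g : Prop :=
  closed_saddle_connection g /\ side g = (1, 0).

(* Seen from its end point, g leaves as opp g. *)
Definition left_twin g h : Prop := twin g h /\ ccw_angle h (opp P g) pi.
Definition right_twin g h : Prop := twin g h /\ ccw_angle (opp P g) h pi.

End Surgery.

Section Octagons.
Variable R : realType.

(* The surgeries are performed on polygons having g and its twin among their   *)
(* sides.                                                                      *)
Definition left_surgery (x y : H2 R) : Prop :=
  exists (P Q : polygon_gluing R) (hP : in_H2 P) (hQ : in_H2 Q),
  exists g h : 'I_(nsides P),
    [/\ x = H2_point hP, y = H2_point hQ,
        unit_saddle_connection g, left_twin g h & surgery g h Q].

Definition right_surgery (x y : H2 R) : Prop :=
  exists (P Q : polygon_gluing R) (hP : in_H2 P) (hQ : in_H2 Q),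
  exists g h : 'I_(nsides P),
    [/\ x = H2_point hP, y = H2_point hQ,
        unit_saddle_connection g, right_twin g h & surgery g h Q].

(* the regular octagon having [0, 1] as its bottom side *)
Definition octagon : polygon_gluing R :=
  PolygonGluing (perm (addIr (1 : 'I_8))) (perm (addIr (4 : 'I_8)))
    (fun k : 'I_8 => (\sum_(j < k) cos (j%:R * (pi / 4)),
                      \sum_(j < k) sin (j%:R * (pi / 4)))).

Definition octagon_sequence (Oct : int -> H2 R) : Prop :=
  [/\ exists h : in_H2 octagon, Oct 0 = H2_point h,
      forall k : nat, left_surgery (Oct k%:Z) (Oct k.+1%:Z) &
      forall k : nat, right_surgery (Oct (- k%:Z)) (Oct (- k.+1%:Z))].

End Octagons.

(* Main.v *)
Require Import Defs.
From Stdlib Require Import Relations.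
From mathcomp Require Import all_boot all_order all_algebra all_fingroup.
From mathcomp Require Import all_classical all_reals all_analysis.
From mathcomp Require Import ring lra zify.
Import Order.TTheory GRing.Theory Num.Theory.
Import numFieldNormedType.Exports.
Import Defs.

(** Write l = 1 + sqrt 2 and h = cos (pi / 4) = sqrt 2 / 2. For reals p and
    s let T(p, s), named [model l h p s], be the surface made of two
    horizontal cylinders: one of height h and circumference l + 1 with
    twist p, and one of height 1 and circumference l with twist s. Its
    three horizontal saddle connections are gamma, of length 1, with the
    wide cylinder on both sides, and alpha_1 and alpha_2, of length l,
    which have the wide cylinder above, respectively below, and the other
    cylinder on the other side. Cutting the octagon along two horizontal
    diagonals shows that it is T(-h, 0) ([octagon_isomorphic]).

    The left surgery exchanges the upper side of gamma with that of the
    first unit of alpha_1, which changes T(p, s) into T(p - 1, s + 1); the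
    right surgery uses alpha_2 and is the inverse ([left_surgery_model],
    [right_surgery_model]). Hence Oct_n = T(-h - n, n). Dehn twists in the
    cylinders give T(p, s) = T(p, s + l) = T(p + l + 1, s), so that T(p, s)
    depends only on the classes of p modulo l + 1 and of s modulo l.

    Conversely the class of s modulo l is an invariant
    ([model_isomorphic_shear]): an isomorphism preserves the singular
    point, gamma and the half-turns around the singular point, hence
    alpha_2, and then the segments that cross the narrow cylinder. Since l
    is irrational, the surfaces Oct_n are distinct ([fake_inj]). They
    accumulate on each other because the powers a - b sqrt 2 of the unit 3
    - 2 sqrt 2 tend to 0: up to twists, the parameters of Oct_(m - 2 b)
    differ from those of Oct_m by (l + 1) (a - b sqrt 2) and 2 l (a - b
    sqrt 2) ([fake_dense]; note that l + 1 = 2 + sqrt 2), and the periods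
    of T(p, s) along a basis of its homology are 1, l, p + i h and s + i
    ([model_nbhs]).

    A point of the moduli space is an isomorphism class of gluings, and a
    surgery may be performed on any gluing of the class having the two
    segments among its sides. That its result is determined by the class is
    the delicate part. Isomorphisms are handled through [local_iso], a
    condition on small displacements equivalent to the one on charts. An
    isomorphism from a gluing to T(p, s) takes a saddle connection gamma
    and its twins to horizontal rays from the singular point ([onto_ex]);
    it respects half-turns around the singular point, hence distinguishes
    left from right twins ([onto_left], [onto_right]); and it extends to
    the surfaces sewn again along corresponding segments
    ([resew_isomorphic]). This gives the uniqueness of the surgeries
    ([left_surgery_unique], [right_surgery_unique]). Explicit isomorphisms
    come from flips of diagonals ([flip_isomorphic]) and from subdivisions
    ([split_isomorphic]) of triangulations given by tables. *)

Set Implicit Arguments.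
Unset Strict Implicit.
Unset Printing Implicit Defensive.
Local Open Scope classical_set_scope.
Local Open Scope ring_scope.
Local Open Scope quotient_scope.

(** * Plane vectors and points of a surface *)

Lemma scale_mul (R : realType) (t a : R) : t *: (a : R^o) = t * a.
Proof. by []. Qed.

Lemma vec_eq (R : realType) (u v : R * R) : u.1 = v.1 -> u.2 = v.2 -> u = v.
Proof. by case: u v => [a b] [c d] /= -> ->. Qed.

Ltac vring := rewrite ?/cross /= ?scale_mul; ring.
Ltac veq := apply: vec_eq; vring.

Section Vectors.
Variable R : realType.
Implicit Types u v w : R * R.

Lemma vec_normE u (e : R) : (`|u| < e) = (`|u.1| < e) && (`|u.2| < e).
Proof. by rewrite /Num.norm /= gt_max. Qed.

Lemma vec_normP u (e : R) : reflect (`|u.1| < e /\ `|u.2| < e) (`|u| < e).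
Proof. by rewrite vec_normE; exact: andP. Qed.

Lemma crossC u v : cross u v = - cross v u.
Proof. by vring. Qed.

Lemma crossvv u : cross u u = 0.
Proof. by vring. Qed.

Lemma crossDr u v w : cross u (v + w) = cross u v + cross u w.
Proof. by vring. Qed.

Lemma crossZr u (t : R) v : cross u (t *: v) = t * cross u v.
Proof. by vring. Qed.

Lemma crossNr u v : cross u (- v) = - cross u v.
Proof. by vring. Qed.

Lemma crossNl u v : cross (- u) v = - cross u v.
Proof. by vring. Qed.

Lemma cross0r u : cross u 0 = 0.
Proof. by vring. Qed.

(** Cramer's rule. *)
Lemma cross_basis u v w :
  cross u v *: w = cross w v *: u + cross u w *: v.
Proof. by veq. Qed.

Lemma cross_le u w (e : R) : `|w| < e ->
  cross u w <= (`|u.1| + `|u.2|) * e.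
Proof.
move=> /vec_normP [h1 h2].
have := ler_norm (cross u w); rewrite /cross => /le_trans; apply.
apply: le_trans (ler_normB _ _) _.
rewrite !normrM mulrDl; apply: lerD; apply: ler_wpM2l => //; exact: ltW.
Qed.

End Vectors.

Section Points.
Variables (R : realType) (P : polygon_gluing R).
Local Notation V := (R * R)%type.
Local Notation I := 'I_(nsides P).
Implicit Types (d e : I) (x y : surface P) (z w v : V).

(** Points of the surface are handled through their representatives in the
    polygons, so that no term of the quotient has to be built; [rep x d z]
    says that the point z of the polygon of d represents x. *)
Definition rep x d z : Prop :=
  exists w : set_type (polygon d), point w = x /\ set_val w = z.

Lemma rep_polygon x d z : rep x d z -> polygon d z.
Proof. by move=> [w [_ <-]]; exact: set_valP. Qed.

Lemma polygon_rep d z : polygon d z -> exists x, rep x d z.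
Proof.
by move=> h; exists (point (SigSub (mem_set h) : set_type (polygon d))), (SigSub (mem_set h)).
Qed.

Lemma rep_fun x y d z : rep x d z -> rep y d z -> x = y.
Proof.
move=> [w [<- hw]] [w' [<- hw']]; congr point.
by apply: val_inj; rewrite [LHS]hw [RHS]hw'.
Qed.

Lemma rep_ex x : exists d z, rep x d z.
Proof.
rewrite -(reprK x); case: (generic_quotient.repr x) => d w; exists d, (set_val w), w; split=> //.
Qed.

Lemma point_glue d e (a : set_type (polygon d)) (b : set_type (polygon e)) :
  glue_step (existT _ d a : polygons P) (existT _ e b : polygons P) ->
  point a = point b.
Proof.
move=> h; rewrite /point; apply/eqmodP; rewrite /=; apply/asboolP; exact: rst_step.
Qed.

Lemma polygon_next d : polygon (next P d) = polygon d.
Proof.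
have e1 : porbit (next P) (next P d) = porbit (next P) d.
  by have := porbit_perm (next P) 1 d; rewrite expg1.
by rewrite /polygon e1.
Qed.

Lemma rep_next x d z : rep x (next P d) z <-> rep x d z.
Proof.
split=> [] h; have := rep_polygon h; first rewrite polygon_next;
  last rewrite -polygon_next.
- move=> /polygon_rep [y hy]; suff -> : x = y by [].
  case: h hy => [w [<- hw]] [w' [<- hw']]; apply/esym.
  by apply: point_glue; left; split => //=; rewrite hw hw'.
- move=> /polygon_rep [y hy]; suff -> : x = y by [].
  case: h hy => [w [<- hw]] [w' [<- hw']].
  by apply: point_glue; left; split => //=; rewrite hw hw'.
Qed.

Lemma porbit_next d e : e \in porbit (next P) d -> polygon e = polygon d.
Proof.
by case/porbitP => k ->; elim: k => [|k IH]; rewrite ?perm1 // expgSr permM polygon_next.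
Qed.

Lemma rep_porbit x d e z : e \in porbit (next P) d -> rep x e z <-> rep x d z.
Proof.
case/porbitP => k ->; elim: k => [|k IH]; first by rewrite perm1.
by rewrite expgSr permM rep_next.
Qed.

(** The translation that glues the side d to the opposite side. *)
Definition shift d : V := pos (next P (opp P d)) - pos d.

Definition on_side d z := exists2 t : R, 0 <= t <= 1 & z = pos d + t *: side d.

(** Elimination of the equivalence relation generated by the gluing: a
    predicate compatible with the elementary gluings depends only on the
    point of the surface. *)
Lemma rep_closed (C : I -> V -> Prop) :
  (forall d z, polygon d z -> C d z <-> C (next P d) z) ->
  (forall d z, on_side d z -> polygon d z -> polygon (opp P d) (z + shift d) ->
     C d z <-> C (opp P d) (z + shift d)) ->
  forall x d z e w, rep x d z -> rep x e w -> C d z -> C e w.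
Proof.
move=> h1 h2 x d z e w [a [<- <-]] [b [hb <-]].
suff : C d (set_val a) <-> C e (set_val b) by tauto.
move: hb => /eqmodP; rewrite /= => /asboolP.
rewrite -[C d _]/(C (tag (existT _ d a : polygons P)) (set_val (tagged (existT _ d a : polygons P)))).
rewrite -[C e _]/(C (tag (existT _ e b : polygons P)) (set_val (tagged (existT _ e b : polygons P)))).
elim=> {d e a b} [b a hs|a|a b _ ->|a b c _ -> _ ->] //.
case: hs => [[ht hv]|[ht [t ht01 [hb ha]]]].
- rewrite hv ht; apply: iff_sym; apply: h1.
  exact: set_valP (tagged b).
- have e1 : set_val (tagged a) = set_val (tagged b) + shift (tag b).
    by rewrite hb ha ht /shift; veq.
  rewrite e1 ht; apply: iff_sym; apply: h2.
  + by exists t.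
  + exact: set_valP (tagged b).
  + rewrite -e1 -ht; exact: set_valP (tagged a).
Qed.

Lemma rep_opp x d z : on_side d z -> polygon (opp P d) (z + shift d) ->
  rep x d z -> rep x (opp P d) (z + shift d).
Proof.
move=> [t t01 hz] /polygon_rep [y hy] hx; suff -> : x = y by [].
case: hx hy => [w [<- hw]] [w' [<- hw']].
apply: point_glue; right; split => //=.
exists t => //; rewrite hw hw' hz; split => //.
by rewrite /shift; veq.
Qed.

(** The topology of the surface in terms of the polygons. *)
Lemma surface_openP (U : set (surface P)) :
  open U <-> (forall x d z, U x -> rep x d z -> exists2 e : R, 0 < e &
     forall y w, `|w - z| < e -> rep y d w -> U y).
Proof.
have -> : open U <-> open (\pi_(surface P) @^-1` U) by [].
rewrite sigT_openP; split.
- move=> h x d z Ux [a [ha haz]].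
  have := h d; rewrite openE => /(_ a); rewrite /= -/(point a) ha => /(_ Ux).
  rewrite /interior /= => -[B [[C oC <-] /= Ca CU]].
  have : nbhs z C by rewrite -haz; exact: open_nbhs_nbhs.
  move=> /nbhs_normP [e /= e0 he]; exists e => // y w hw [b [<- hb]].
  apply: CU => /=; apply: he => /=; by rewrite hb distrC.
- move=> h d; rewrite openE => a Ua; rewrite /interior /=.
  have [e e0 he] := h (point a) d (set_val a) Ua (ex_intro _ a (conj erefl erefl)).
  exists (set_val @^-1` (ball (set_val a) e)); split=> /=.
  + by exists (ball (set_val a) e) => //; exact: ball_open.
  + exact: ballxx.
  + move=> b /= hb; apply: (he (point b) (set_val b)); last by exists b.
    by move: hb; rewrite -ball_normE /= distrC.
Qed.

(** Neighbourhoods in a closed polygon are taken in the subspace topology,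
    hence the quantification over representatives only. *)
Lemma chart_nearP d (a : set_type (polygon d)) (Q : surface P -> V -> Prop) :
  (\forall w \near a, Q (point w) (set_val w)) <->
  exists2 e : R, 0 < e & forall y w, `|w - set_val a| < e -> rep y d w -> Q y w.
Proof.
split.
- move=> [B [[C oC <-] /= Ca CU]].
  have /nbhs_normP [e /= e0 he] : nbhs (set_val a) C by exact: open_nbhs_nbhs.
  exists e => // y w hw [b [<- hb]]; rewrite -hb; apply: CU => /=; apply: he => /=.
  by rewrite hb distrC.
- move=> [e e0 he].
  exists (set_val @^-1` (ball (set_val a) e)); split=> /=.
  + by exists (ball (set_val a) e) => //; exact: ball_open.
  + exact: ballxx.
  + move=> b /= hb; apply: he; last by exists b.
    by move: hb; rewrite -ball_normE /= distrC.
Qed.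

End Points.

(** * Convex polygons *)

Section Polygons.
Variables (R : realType) (P : polygon_gluing R) (tsP : translation_surface P).
Local Notation V := (R * R)%type.
Local Notation I := 'I_(nsides P).
Implicit Types (d e f : I) (x y : surface P) (z w v : V).

Lemma oppK d : opp P (opp P d) = d.
Proof. by case: tsP => _ _ _ /(_ d) []. Qed.

Lemma side_opp d : side (opp P d) = - side d.
Proof. by case: tsP => _ _ _ /(_ d) []. Qed.

Lemma pos_next d : pos (next P d) = pos d + side d.
Proof. by rewrite /side; veq. Qed.

Lemma pos_opp d : pos (opp P d) = pos d + side d + shift d.
Proof.
by rewrite /shift -[next P (opp P d)]/(next P _) pos_next side_opp; veq.
Qed.

Lemma shift_opp d : shift (opp P d) = - shift d.
Proof. by rewrite {1}/shift oppK pos_next pos_opp; veq. Qed.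

Lemma next_neq d : next P d != d.
Proof. by case: tsP => _ /(_ d) []. Qed.

Lemma next2_neq d : next P (next P d) != d.
Proof. by case: tsP => _ /(_ d) []. Qed.

Lemma next_porbit d : next P d \in porbit (next P) d.
Proof. by have := mem_porbit (next P) 1 d; rewrite expg1. Qed.

Lemma next_porbitE d e : (next P e \in porbit (next P) d) = (e \in porbit (next P) d).
Proof.
rewrite -!eq_porbit_mem; congr (_ == _).
by have := porbit_perm (next P) 1 e; rewrite expg1.
Qed.

Lemma prev_porbit d : ((next P)^-1)%g d \in porbit (next P) d.
Proof. by rewrite -next_porbitE permKV porbit_id. Qed.

Lemma porbitS d e : e \in porbit (next P) d -> porbit (next P) e = porbit (next P) d.
Proof. by rewrite -eq_porbit_mem => /eqP. Qed.

Lemma porbit_symI d e : e \in porbit (next P) d -> d \in porbit (next P) e.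
Proof. by rewrite porbit_sym. Qed.

Lemma vertex_left d e : e \in porbit (next P) d -> e != d -> e != next P d ->
  0 < cross (side d) (pos e - pos d).
Proof. by case: tsP => _ _ /(_ d e). Qed.

Lemma pos_next_left d : cross (side d) (pos (next P d) - pos d) = 0.
Proof. by rewrite pos_next; vring. Qed.

Lemma vertex_left_eq0 d e : e \in porbit (next P) d ->
  cross (side d) (pos e - pos d) <= 0 -> e = d \/ e = next P d.
Proof.
move=> he h; have [->|n1] := eqVneq e d; first by left.
have [->|n2] := eqVneq e (next P d); first by right.
by have := vertex_left he n1 n2; rewrite ltNge h.
Qed.

Lemma pos_polygon d e : e \in porbit (next P) d -> polygon d (pos e).
Proof.
move=> he f hf; rewrite leNgt; apply/negP => h.
have hef : e \in porbit (next P) f by rewrite (porbitS hf).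
have := h; case: (vertex_left_eq0 hef (ltW h)) => ->.
  by rewrite subrr cross0r ltxx.
by rewrite pos_next_left ltxx.
Qed.

Lemma pos_polygon_id d : polygon d (pos d).
Proof. by apply: pos_polygon; exact: porbit_id. Qed.

Lemma polygon_convex d z w (t : R) : 0 <= t <= 1 -> polygon d z -> polygon d w ->
  polygon d (z + t *: (w - z)).
Proof.
move=> /andP[t0 t1] hz hw e he.
have -> : z + t *: (w - z) - pos e = (1 - t) *: (z - pos e) + t *: (w - pos e) by veq.
rewrite crossDr !crossZr; apply: addr_ge0; apply: mulr_ge0 => //.
- by rewrite subr_ge0.
- exact: hz.
- exact: hw.
Qed.

Lemma on_side_polygon d z : on_side d z -> polygon d z.
Proof.
move=> [t t01 ->].
have -> : pos d + t *: side d = pos d + t *: (pos (next P d) - pos d) by [].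
by apply: polygon_convex => //; [exact: pos_polygon_id | exact/pos_polygon/next_porbit].
Qed.

Lemma on_side_opp d z : on_side d z -> on_side (opp P d) (z + shift d).
Proof.
move=> [t /andP[t0 t1] ->]; exists (1 - t); first by apply/andP; split; lra.
by rewrite pos_opp side_opp; veq.
Qed.

Lemma rep_on_side x d z : on_side d z -> rep x d z -> rep x (opp P d) (z + shift d).
Proof. by move=> h; apply: rep_opp => //; exact/on_side_polygon/on_side_opp. Qed.

Lemma on_side_pos d : on_side d (pos d).
Proof. by exists 0; [rewrite lexx ler01 | veq]. Qed.

Lemma on_side_next d : on_side d (pos (next P d)).
Proof. by exists 1; [rewrite lexx ler01 | rewrite pos_next; veq]. Qed.

(** Implications are enough, because [next] has finite orbits and [opp] is
    an involution. *)
Lemma rep_closedW (C : I -> V -> Prop) :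
  (forall d z, C d z -> C (next P d) z) ->
  (forall d z, on_side d z -> C d z -> C (opp P d) (z + shift d)) ->
  forall x d z e w, rep x d z -> rep x e w -> C d z -> C e w.
Proof.
move=> h1 h2; apply: rep_closed => [d z _|d z hz _ _].
- split; first exact: h1.
  have /porbitP [k hk] : d \in porbit (next P) (next P d).
    by rewrite porbit_sym next_porbit.
  move=> hC; rewrite hk {hk}; elim: k => [|k IH]; first by rewrite perm1.
  by rewrite expgSr permM; exact: h1.
- split; first exact: h2.
  move=> /h2 - /(_ (on_side_opp hz)); rewrite oppK shift_opp.
  by have -> : z + shift d - shift d = z by veq.
Qed.

Lemma turn_left d : 0 < cross (side d) (side (next P d)).
Proof.
have := @vertex_left d (next P (next P d)).
rewrite next_porbitE next_porbit next2_neq next_neq !pos_next => /(_ isT isT isT).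
by congr (_ < _); vring.
Qed.

(** By convexity, the line of a side meets the polygon in that side only. *)
Lemma line_on_side d z : polygon d z -> cross (side d) (z - pos d) <= 0 -> on_side d z.
Proof.
move=> hz c0.
have {}c0 : cross (side d) (z - pos d) = 0.
  by apply/eqP; rewrite eq_le c0 /=; apply: hz; exact: porbit_id.
have c1 := turn_left d.
pose t := cross (z - pos d) (side (next P d)) / cross (side d) (side (next P d)).
have hw : z - pos d = t *: side d.
  have := cross_basis (side d) (side (next P d)) (z - pos d).
  rewrite c0 scale0r addr0 => e1; rewrite /t mulrC -scalerA -e1 scalerA mulVf ?scale1r //.
  by rewrite gt_eqF.
have ez : z = pos d + t *: side d by rewrite -hw; veq.
exists t => //; apply/andP; split.
- pose p := ((next P)^-1)%g d.
  have := hz p (prev_porbit d); have c2 := turn_left p.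
  have := pos_next p; rewrite permKV in c2 * => hp.
  have -> : z - pos p = side p + t *: side d by rewrite ez hp; veq.
  by rewrite crossDr crossvv add0r crossZr pmulr_lge0.
- have := hz _ (next_porbit d).
  have -> : z - pos (next P d) = (t - 1) *: side d by rewrite ez pos_next; veq.
  rewrite crossZr crossC mulrN -mulNr opprB pmulr_lge0 //; lra.
Qed.

Lemma two_sides d e z : e \in porbit (next P) d -> e != d ->
  on_side d z -> on_side e z -> z = pos d \/ z = pos (next P d).
Proof.
move=> he ned [s /andP[s0 s1] hs] [t /andP[t0 t1] ht].
have hde := porbit_symI he.
have : cross (side e) (z - pos e) = 0 by rewrite ht; vring.
have -> : z - pos e = (1 - s) *: (pos d - pos e) + s *: (pos (next P d) - pos e).
  by rewrite hs pos_next; veq.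
rewrite crossDr !crossZr.
have h1 := @pos_polygon_id d; have h2 := @pos_polygon _ _ (next_porbit d).
have {h1}p1 := h1 e he; have {h2}p2 := h2 e he.
move=> h0.
have [s00|s0'] := eqVneq s 0; first by left; rewrite hs s00; veq.
have [s11|s1'] := eqVneq s 1; first by right; rewrite hs pos_next s11; veq.
have sp : 0 < s by rewrite lt_neqAle eq_sym s0'.
have sp1 : s < 1 by rewrite lt_neqAle s1'.
have q1 : (1 - s) * cross (side e) (pos d - pos e) = 0.
  apply/eqP; rewrite eq_le; apply/andP; split; last by apply: mulr_ge0 => //; lra.
  by have := mulr_ge0 s0 p2; lra.
have q2 : s * cross (side e) (pos (next P d) - pos e) = 0 by rewrite q1 add0r in h0.
have r1 : cross (side e) (pos d - pos e) <= 0.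
  by move/eqP: q1; rewrite mulf_eq0 => /orP[/eqP|/eqP ->//]; lra.
have r2 : cross (side e) (pos (next P d) - pos e) <= 0.
  by move/eqP: q2; rewrite mulf_eq0 => /orP[/eqP|/eqP ->//]; lra.
case: (vertex_left_eq0 hde r1) => e1; first by rewrite e1 eqxx in ned.
have := vertex_left_eq0 (_ : next P d \in porbit (next P) e) r2.
rewrite next_porbitE => /(_ hde) [] e2.
- by have := next2_neq e; rewrite -e1 e2 eqxx.
- by rewrite -(perm_inj e2) eqxx in ned.
Qed.

Lemma vertex_on_side d e : e \in porbit (next P) d -> on_side d (pos e) ->
  e = d \/ e = next P d.
Proof.
move=> he [t _ ht]; apply: vertex_left_eq0 => //.
rewrite ht; have -> : pos d + t *: side d - pos d = t *: side d by veq.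
by rewrite crossZr crossvv mulr0.
Qed.

End Polygons.

(** * Small displacements on a surface *)

Section UniformRadius.
Variable R : realType.

Lemma seq_unif (T : eqType) (s : seq T) (Q : T -> R -> Prop) :
  (forall t (e e' : R), Q t e -> 0 < e' -> e' <= e -> Q t e') ->
  (forall t, t \in s -> exists2 e : R, 0 < e & Q t e) ->
  exists2 e : R, 0 < e & forall t, t \in s -> Q t e.
Proof.
move=> mon; elim: s => [|a s IH] h; first by exists 1.
have [e e0 he] : exists2 e : R, 0 < e & forall t, t \in s -> Q t e.
  by apply: IH => t ts; apply: h; rewrite inE ts orbT.
have [e' e'0 he'] := h a (mem_head _ _).
exists (Num.min e e') => [|t]; first by rewrite lt_min e0.
have m0 : 0 < Num.min e e' by rewrite lt_min e0.
rewrite inE => /orP[/eqP ->|/he hq]; first by apply: mon he' m0 _; rewrite ge_min lexx orbT.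
by apply: mon hq m0 _; rewrite ge_min lexx.
Qed.

Lemma fin_unif (T : finType) (Q : T -> R -> Prop) :
  (forall t (e e' : R), Q t e -> 0 < e' -> e' <= e -> Q t e') ->
  (forall t, exists2 e : R, 0 < e & Q t e) ->
  exists2 e : R, 0 < e & forall t, Q t e.
Proof.
move=> mon h; have [e e0 he] := seq_unif (s := enum T) mon (fun t _ => h t).
by exists e => // t; apply: he; rewrite mem_enum.
Qed.

End UniformRadius.

Section Steps.
Variables (R : realType) (P : polygon_gluing R) (tsP : translation_surface P).
Local Notation V := (R * R)%type.
Local Notation I := 'I_(nsides P).
Implicit Types (d f : I) (x y : surface P) (z w v u : V).

Definition vertex x := exists d, rep x d (pos d).

Lemma rotE d : rot P d = opp P (((next P)^-1)%g d).
Proof. by rewrite permM. Qed.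

Lemma rep_rot x d : rep x d (pos d) -> rep x (rot P d) (pos (rot P d)).
Proof.
move=> h; rewrite rotE; set p := ((next P)^-1)%g d.
have hp : next P p = d by rewrite permKV.
have := rep_on_side tsP (on_side_next p).
rewrite -hp rep_next in h => /(_ _ h).
by rewrite (pos_opp tsP) pos_next.
Qed.

Lemma rep_rot_porbit x d f : rep x d (pos d) -> f \in porbit (rot P) d -> rep x f (pos f).
Proof.
move=> h /porbitP [k ->]; elim: k => [|k IH]; first by rewrite perm1.
by rewrite expgSr permM; exact: rep_rot.
Qed.

Lemma rot_porbitE d e : (rot P e \in porbit (rot P) d) = (e \in porbit (rot P) d).
Proof.
rewrite -!eq_porbit_mem; congr (_ == _).
by have := porbit_perm (rot P) 1 e; rewrite expg1.
Qed.

(** A gluing across a side applies to a vertex only at an end of that side,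
    and then [rot] relates the sides leaving the vertex before and after
    it. *)
Lemma vertex_rep x d e w : rep x d (pos d) -> rep x e w ->
  exists f, [/\ f \in porbit (rot P) d, f \in porbit (next P) e & w = pos f].
Proof.
move=> hx; pose C e w := exists f, [/\ f \in porbit (rot P) d, f \in porbit (next P) e & w = pos f].
move=> /(rep_closedW (C := C) tsP _ _ hx); apply; last by exists d; rewrite !porbit_id.
- move=> g z [f [h1 h2 ->]]; exists f; split=> //.
  by rewrite porbit_sym next_porbitE porbit_sym.
- move=> g z hz [f [h1 h2 ez]]; rewrite ez in hz *.
  case: (vertex_on_side tsP h2 hz) => ef; rewrite ef in h1 *.
  + exists (next P (opp P g)); split.
    * by rewrite -rot_porbitE rotE permK oppK.
    * exact: next_porbit.
    * by rewrite /shift; veq.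
  + exists (opp P g); split; last by rewrite (pos_opp tsP) pos_next.
    * by have := rot_porbitE d (next P g); rewrite rotE permK h1 => ->.
    * exact: porbit_id.
Qed.

(** A point that is not a vertex lies on at most one side of its polygon,
    so that gluings lead to at most one other representative. *)
Lemma nonvertex_rep x d z e w : ~ vertex x -> rep x d z -> rep x e w ->
  (e \in porbit (next P) d /\ w = z) \/
  exists f, [/\ f \in porbit (next P) d, opp P f \in porbit (next P) e,
                on_side f z & w = z + shift f].
Proof.
move=> nvx hx.
pose C e w := (e \in porbit (next P) d /\ w = z) \/
  exists f, [/\ f \in porbit (next P) d, opp P f \in porbit (next P) e,
                on_side f z & w = z + shift f].
have nv f : f \in porbit (next P) d -> z <> pos f.
  by move=> hf ez; apply: nvx; exists f; apply/(rep_porbit _ _ hf); rewrite -ez.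
move=> /(rep_closedW (C := C) tsP _ _ hx); apply; last by left; rewrite porbit_id.
- move=> g u [[h1 ->]|[f [h1 h2 h3 ->]]]; [left|right].
    by rewrite next_porbitE.
  by exists f; split=> //; rewrite porbit_sym next_porbitE porbit_sym.
- move=> g u hu [[h1 eu]|[f [h1 h2 h3 eu]]].
    by right; exists g; rewrite -{1}eu -eu; split=> //; exact: porbit_id.
  have [eg|ng] := eqVneq (opp P f) g.
    left; rewrite -eg oppK // (shift_opp tsP) eu; split=> //; veq.
  have hg : on_side (opp P f) u by rewrite eu; exact: on_side_opp.
  exfalso; have [e1|e1] := two_sides tsP h2 ng hu hg.
  + have := vertex_on_side tsP (porbit_symI h2); rewrite -e1 => /(_ hg) [] eg.
      by rewrite eg eqxx in ng.
    apply: (nv f h1); move: eu; rewrite e1 eg; rewrite {1}/shift => /eqP.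
    rewrite -subr_eq => /eqP <-; veq.
  + have hn : next P g \in porbit (next P) (opp P f).
      by rewrite next_porbitE; exact: porbit_symI.
    have := vertex_on_side tsP hn; rewrite -e1 => /(_ hg) [] eg.
      apply: (nv (next P f)); first by rewrite next_porbitE.
      move: eu; rewrite e1 eg (pos_opp tsP) -pos_next => h; apply/esym.
      by move/addIr: h.
    by move/perm_inj: eg => eg; rewrite eg eqxx in ng.
Qed.

Lemma rep_finite x : exists s : seq (I * V), forall d z, rep x d z -> (d, z) \in s.
Proof.
have [[d hd]|nv] := pselect (vertex x).
  exists [seq (p.1, pos p.2) | p : I * I] => e w /(vertex_rep hd) [f [_ _ ->]].
  by apply/mapP; exists (e, f); rewrite ?mem_enum.
have [d [z hz]] := rep_ex x.
exists ([seq (e, z) | e : I] ++ [seq (p.1, z + shift p.2) | p : I * I]) => e w.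
move=> /(nonvertex_rep nv hz) [[_ ->]|[f [_ _ _ ->]]]; rewrite mem_cat; apply/orP.
- by left; apply/mapP; exists e; rewrite ?mem_enum.
- by right; apply/mapP; exists (e, f); rewrite ?mem_enum.
Qed.

(** A point has finitely many representatives, so radii chosen for each of
    them have a positive minimum. *)
Lemma rep_unif x (Q : I -> V -> R -> Prop) :
  (forall d z (e e' : R), Q d z e -> 0 < e' -> e' <= e -> Q d z e') ->
  (forall d z, rep x d z -> exists2 e : R, 0 < e & Q d z e) ->
  exists2 e : R, 0 < e & forall d z, rep x d z -> Q d z e.
Proof.
move=> mon h; have [s hs] := rep_finite x.
have [||e e0 he] := @seq_unif R _ s (fun p (e : R) => rep x p.1 p.2 -> Q p.1 p.2 e).
- by move=> t e e' hq e0 ee /hq /mon; apply.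
- move=> [d z] _ /=; have [hx|nx] := pselect (rep x d z); last by exists 1.
  by have [e e0 he] := h d z hx; exists e.
by exists e => // d z hx; exact: (he (d, z) (hs _ _ hx)).
Qed.

(** Translation structure without charts: y is reached from x by the
    displacement v inside a single polygon. At a point of the boundary of
    several polygons, small displacements exist in all directions, and
    there is more than one point y for a given v exactly at the cone points
    of larger angle. *)
Definition step x v y := exists d z, rep x d z /\ rep y d (z + v).

Lemma rep_step x y d z w : rep x d z -> rep y d w -> step x (w - z) y.
Proof. by move=> hx hy; exists d, z; split=> //; rewrite addrC subrK. Qed.

Lemma step0 x : step x 0 x.
Proof. by have [d [z h]] := rep_ex x; exists d, z; rewrite addr0. Qed.

Lemma off_side d z : polygon d z -> ~ on_side d z ->
  exists2 e : R, 0 < e & forall w, on_side d w -> e <= `|w - z|.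
Proof.
move=> hz nz.
have c0 : 0 < cross (side d) (z - pos d).
  by rewrite ltNge; apply/negP => /(line_on_side tsP hz).
set c := cross _ _ in c0.
have a0 : 0 < `|(side d).1| + `|(side d).2| + 1 by rewrite ltr_wpDl ?ltr01 // addr_ge0.
exists (c / (`|(side d).1| + `|(side d).2| + 1)); first by rewrite divr_gt0.
move=> w [t t01 hw]; rewrite leNgt; apply/negP => hlt.
have h := cross_le (- side d) hlt.
have e1 : cross (- side d) (w - z) = c by rewrite hw /c; vring.
move: h; rewrite e1 /= !normrN => h.
have : (`|(side d).1| + `|(side d).2| + 1) * (c / (`|(side d).1| + `|(side d).2| + 1)) = c.
  by rewrite mulrC divfK // gt_eqF.
have q0 : 0 < c / (`|(side d).1| + `|(side d).2| + 1) by rewrite divr_gt0.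
by lra.
Qed.

(** Near x, the gluing pattern is the one at x: a step opp moving a point
    w close to z also moves z, by the same translation. *)
Lemma star x : exists2 e : R, 0 < e & forall v y d w, `|v| < e ->
  step x v y -> rep y d w -> rep x d (w - v).
Proof.
have [||e e0 he] := @rep_unif x (fun d z (e : R) => on_side d z \/ forall w, on_side d w -> e <= `|w - z|).
- move=> d z e e' [h|h] _ le; [by left|right => w /h]; exact: le_trans.
- move=> d z hx; have [h|h] := pselect (on_side d z); first by exists 1 => //; left.
  by have [e e0 he] := off_side (rep_polygon hx) h; exists e => //; right.
exists e => // v y d w hv [d0 [z0 [hx hy]]] hw.
apply: (rep_closedW (C := fun d w => rep x d (w - v)) tsP _ _ hy hw); last by rewrite addrK.
- by move=> g z; rewrite rep_next.
- move=> g z hz hg; have [h|/(_ _ hz)] := he _ _ hg.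
    have -> : z + shift g - v = (z - v) + shift g by veq.
    exact: rep_on_side.
  have -> : z - (z - v) = v by veq.
  by rewrite leNgt hv.
Qed.

(** Distinct representatives of x in the same polygon are at a positive
    distance from each other. *)
Lemma disp_uniq x : exists2 e : R, 0 < e & forall v v' y, `|v| < e -> `|v'| < e ->
  step x v y -> step x v' y -> v = v'.
Proof.
have [e e0 he] := star x.
have [||e' e'0 he'] := @rep_unif x (fun d z (e : R) => forall z', rep x d z' -> `|z' - z| < e -> z' = z).
- by move=> d z e1 e2 h _ le z' hz' hlt; apply: h => //; exact: lt_le_trans le.
- move=> d z hz.
  have [||e1 e10 h1] := @rep_unif x (fun d' z' (e : R) => d' = d -> `|z' - z| < e -> z' = z).
  + by move=> d' z' e1 e2 h _ le ed hlt; apply: h => //; exact: lt_le_trans le.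
  + move=> d' z' _; have [ez|nz] := eqVneq z' z; first by exists 1.
    exists `|z' - z|; first by rewrite normr_gt0 subr_eq0.
    by move=> _; rewrite ltxx.
  by exists e1 => // z' hz' hlt; exact: (h1 d z').
exists (Num.min e (e' / 2)); first by rewrite lt_min e0 divr_gt0.
move=> v v' y; rewrite !lt_min => /andP[v1 v2] /andP[v3 v4] s1 s2.
have [d [w hw]] := rep_ex y.
have r1 := he _ _ _ _ v1 s1 hw; have r2 := he _ _ _ _ v3 s2 hw.
have h : w - v = w - v'.
  apply: (he' _ _ r2 _ r1); have -> : w - v - (w - v') = v' - v by veq.
  by apply: (le_lt_trans (ler_normB _ _)); lra.
by have := congr1 (fun a => w - a) h; rewrite !subKr.
Qed.

(** Points with a common small displacement to the same point are equal.
    This holds at singular points too, which is what makes limits unique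
    below. *)
Lemma step_coinj x x' : exists2 e : R, 0 < e & forall v y, `|v| < e ->
  step x v y -> step x' v y -> x = x'.
Proof.
have [e e0 he] := star x; have [e' e'0 he'] := star x'.
exists (Num.min e e'); first by rewrite lt_min e0.
move=> v y; rewrite lt_min => /andP[v1 v2] s1 s2.
have [d [w hw]] := rep_ex y.
exact: rep_fun (he _ _ _ _ v1 s1 hw) (he' _ _ _ _ v2 s2 hw).
Qed.

(** Small displacements add up, provided that the first one starts at the
    centre of the neighbourhood. *)
Lemma step_trans x : exists2 e : R, 0 < e & forall v u y y', `|v| < e ->
  step x v y -> step y u y' -> step x (v + u) y'.
Proof.
have [e e0 he] := star x; exists e => // v u y y' hv s1 [d [w [h1 h2]]].
exists d, (w - v); split; first exact: (he _ _ _ _ hv s1 h1).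
by have -> : w - v + (v + u) = w + u by veq.
Qed.

Lemma star_open x : exists2 e : R, 0 < e & forall e' : R, 0 < e' -> e' <= e ->
  open [set y | exists2 v, `|v| < e' & step x v y].
Proof.
have [e e0 he] := star x; exists e => // e' e'0 le.
apply/surface_openP => y d w [v hv s1] hw.
exists (e' - `|v|); first by rewrite subr_gt0.
move=> y' w' hlt hw'; exists (v + (w' - w)).
  by apply: le_lt_trans (ler_normD _ _) _; lra.
exists d, (w - v); split; first by apply: he s1 hw; exact: lt_le_trans le.
by have -> : w - v + (v + (w' - w)) = w' by veq.
Qed.

(** This fails at a cone point of angle larger than 2 pi, where several
    points are at the same small displacement. *)
Definition regular x := exists2 e : R, 0 < e & forall u y y', `|u| < e ->
  step x u y -> step x u y' -> y = y'.

(** If two displacements by u start in different polygons, they start on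
    their common side f, and u points along f since both polygons lie to
    the left of their sides. *)
Lemma nonvertex_regular x : ~ vertex x -> regular x.
Proof.
move=> nv; exists 1 => // u y y' _ [d [z [h1 h2]]] [d' [z' [h3 h4]]].
have [[hd ez]|[f [f1 f2 f3 ez]]] := nonvertex_rep nv h1 h3.
  by rewrite ez in h4; apply: rep_fun h2 _; apply/(rep_porbit _ _ hd).
have p1 := rep_polygon h2; have p2 := rep_polygon h4.
have := p2 _ f2; rewrite (side_opp tsP) crossNl oppr_ge0 => c2.
have hf : on_side f (z + u).
  apply: (line_on_side tsP); first by rewrite (porbit_next f1).
  case: f3 => t _ et.
  have -> : z + u - pos f = (z' + u - pos (opp P f)) + (pos (opp P f) - shift f - pos f).
    by rewrite ez; veq.
  rewrite crossDr [X in _ + X](_ : _ = 0) ?addr0 //.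
  by rewrite (pos_opp tsP); vring.
have h2' : rep y f (z + u) by apply/(rep_porbit _ _ f1).
have := rep_on_side tsP hf h2'; have -> : z + u + shift f = z' + u by rewrite ez; veq.
by move=> /(rep_porbit _ _ f2) h5; exact: rep_fun h5 h4.
Qed.

Lemma vertex_isolated x : exists2 e : R, 0 < e & forall v y, `|v| < e -> v != 0 ->
  step x v y -> ~ vertex y.
Proof.
have [||e e0 he] := @rep_unif x (fun d z (e : R) => forall f, `|pos f - z| < e -> pos f = z).
- by move=> d z e1 e2 h _ le f hlt; apply: h => //; exact: lt_le_trans le.
- move=> d z _; apply: fin_unif => [f e1 e2 h _ le hlt|f].
    by apply: h => //; exact: lt_le_trans le.
  have [ez|nz] := eqVneq (pos f) z; first by exists 1.
  exists `|pos f - z|; first by rewrite normr_gt0 subr_eq0.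
  by rewrite ltxx.
exists e => // v y hv v0 [d [z [hx hy]]] [g hg].
have [f [_ _ ef]] := vertex_rep hg hy.
have := he _ _ hx f; rewrite -ef.
have -> : z + v - z = v by veq.
move=> /(_ hv) h; move/eqP: v0; apply.
by apply: (addrI z); rewrite h addr0.
Qed.

End Steps.

(** * Translation charts and local isometries *)

Section IntervalConnected.
Variable R : realType.

(** Connectedness of a segment, for locally constant predicates. *)
Lemma interval_ind (a b : R) (Q : R -> Prop) : a <= b -> Q a ->
  (forall t, a <= t <= b -> exists2 e : R, 0 < e &
     forall s, a <= s <= b -> `|s - t| < e -> Q s <-> Q t) -> Q b.
Proof.
move=> ab Qa loc.
pose good (T : R -> Prop) (p : R * R) :=
  [/\ a <= p.1 <= b, T p.1, 0 < p.2 &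
   forall s, a <= s <= b -> `|s - p.1| < p.2 -> T s].
(* Open neighbourhoods of the points where T holds, on which T holds
   throughout: Q is clopen in the segment. *)
pose C T := \bigcup_(p in good T) ball p.1 p.2.
have oC T : open (C T) by apply: bigcup_open => p _; exact: ball_open.
have inC (T : R -> Prop) t : (T = Q \/ T = (fun s => ~ Q s)) -> a <= t <= b -> T t -> C T t.
  move=> hT tab Tt; have [e e0 he] := loc t tab; exists (t, e); last exact: ballxx.
  split=> //= s sab st; have := he s sab st.
  by case: hT Tt => ->; tauto.
have outC (T : R -> Prop) t : a <= t <= b -> C T t -> T t.
  move=> tab [[u e] [_ _ _ h]]; rewrite -ball_normE /= => hu.
  by apply: h => //=; rewrite distrC.
pose B := [set t | a <= t <= b /\ Q t].
suff : B = `[a, b]%classic.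
  by move=> /predeqP /(_ b) [_]; rewrite /= in_itv /= ab lexx => /(_ isT) [].
apply: (@segment_connected R a b B).
- by exists a; split => //; rewrite lexx ab.
- exists (C Q) => //; apply/predeqP => t; rewrite /B /= in_itv /=; split.
    by move=> [h1 h2]; split => //; apply: inC => //; left.
  by move=> [h1 h2]; split => //; exact: outC h2.
- exists (~` C (fun s => ~ Q s)); first by apply: open_closedC.
  apply/predeqP => t; rewrite /B /= in_itv /=; split.
    by move=> [h1 h2]; split => // h3; exact: (outC _ _ h1 h3).
  by move=> [h1 h2]; split => //; apply: contrapT => h3; apply: h2; apply: inC => //; right.
Qed.

End IntervalConnected.

Section Charts.
Variables (R : realType) (P : polygon_gluing R) (tsP : translation_surface P).
Local Notation V := (R * R)%type.
Implicit Types (x y : surface P) (z w v u : V).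

Lemma open_stepP (U : set (surface P)) : open U <->
  forall x, U x -> exists2 e : R, 0 < e & forall v y, `|v| < e -> step x v y -> U y.
Proof.
rewrite surface_openP; split=> h.
- move=> x Ux.
  have [||e e0 he] := @rep_unif _ _ tsP x (fun d z (e : R) => forall y w, `|w - z| < e -> rep y d w -> U y).
  + by move=> d z e e' h1 _ le y w hw; apply: h1; exact: lt_le_trans le.
  + by move=> d z hx; exact: h hx.
  exists e => // v y hv [d [z [hx hy]]]; apply: (he _ _ hx) hy.
  by have -> : z + v - z = v by veq.
- move=> x d z Ux hx; have [e e0 he] := h x Ux; exists e => // y w hw hy.
  exact: he hw (rep_step hx hy).
Qed.

(** A chart is affine for displacements across sides as well as inside a
    polygon. *)
Definition affine_at (h : surface P -> V) x :=
  exists2 e : R, 0 < e & forall v y, `|v| < e -> step x v y -> h y = h x + v.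

Lemma chart_stepP U h : translation_chart U h <->
  [/\ open U, {in U &, injective h} & forall x, U x -> affine_at h x].
Proof.
have E (a b c e : V) : a - b = c - e <-> a = c + (b - e).
  split=> [h1|->]; last by veq.
  rewrite -[a](subrK b) h1; veq.
split=> -[h1 h2 h3]; split => //.
- move=> x Ux.
  have [||e e0 he] := @rep_unif _ _ tsP x (fun d z (e : R) => forall y w, `|w - z| < e -> rep y d w -> h y = h x + (w - z)).
  + by move=> d z e e' h4 _ le y w hw; apply: h4; exact: lt_le_trans le.
  + move=> d z [a [ha hz]]; have := h3 d a; rewrite ha => /(_ Ux).
    move/(chart_nearP a (fun y w => h y - w = h x - set_val a)) => [e e0 he].
    by exists e => // y w; rewrite -hz => hw hy; apply/E; exact: he hy.
  exists e => // v y hv [d [z [hx hy]]].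
  by rewrite (he _ _ hx _ _ _ hy); have -> : z + v - z = v by veq.
- move=> d a Ua; have [e e0 he] := h3 _ Ua.
  apply/(chart_nearP a (fun y w => h y - w = h (point a) - set_val a)).
  exists e => // y w hw hy; apply/E; apply: he => //.
  by apply: rep_step hy; exists a.
Qed.

(** A small disc around x, with the displacement from x as coordinate. *)
Lemma regular_chart x : regular x -> exists U h, translation_chart U h /\ U x.
Proof.
move=> [e1 e10 h1]; have [e2 e20 h2] := star_open tsP x.
have [e3 e30 h3] := disp_uniq tsP x; have [e4 e40 h4] := step_trans tsP x.
pose e := Num.min (Num.min e1 e2) (Num.min e3 e4).
have e0 : 0 < e by rewrite !lt_min e10 e20 e30 e40.
have ee1 : e <= e1 by rewrite !ge_min lexx.
have ee2 : e <= e2 by rewrite !ge_min lexx orbT.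
have ee3 : e <= e3 by rewrite !ge_min lexx !orbT.
have ee4 : e <= e4 by rewrite !ge_min lexx !orbT.
pose U := [set y | exists2 v, `|v| < e & step x v y].
pose h y := xget 0 [set v | `|v| < e /\ step x v y].
have hP y : U y -> `|h y| < e /\ step x (h y) y.
  by move=> [v v0 v1]; rewrite /h; case: xgetP => [u -> //|/(_ v)] [].
have hE v y : `|v| < e -> step x v y -> h y = v.
  move=> hv sv; have [|a b] := hP y; first by exists v.
  by apply: (h3 _ _ y) => //; exact: lt_le_trans ee3.
exists U, h; split; last by exists 0; [rewrite normr0 | exact: step0].
apply/chart_stepP; split.
- exact: h2.
- move=> y y'; rewrite !inE => /hP [a1 a2] /hP [b1 b2] hh.
  by apply: (h1 (h y)) => //; [exact: lt_le_trans ee1 | rewrite hh].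
- move=> y Uy; have [a1 a2] := hP y Uy.
  exists (e - `|h y|); first by rewrite subr_gt0.
  move=> u y' hu sy; apply: hE; last by apply: h4 a2 sy; exact: lt_le_trans ee4.
  by apply: (le_lt_trans (ler_normD _ _)); lra.
Qed.

Lemma step_0_eq x y : step x 0 y -> y = x.
Proof. by move=> [d [z [h1]]]; rewrite addr0 => h2; exact: rep_fun h2 h1. Qed.

Lemma pt_default (d : 'I_(nsides P)) : exists x, rep x d (pos d).
Proof. by apply: polygon_rep; exact: pos_polygon_id. Qed.

(** The point represented by z in the polygon of d, as a total function:
    outside of the polygon the value is irrelevant. *)
Definition pt d z : surface P := xget (projT1 (cid (pt_default d))) [set x | rep x d z].

Lemma pt_rep d z : polygon d z -> rep (pt d z) d z.
Proof. by move=> /polygon_rep [x hx]; rewrite /pt; case: xgetP => [y -> //|/(_ x)]. Qed.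

Lemma rep_pt x d z : rep x d z -> x = pt d z.
Proof. by move=> h; apply: rep_fun h (pt_rep (rep_polygon h)). Qed.

Lemma pt_next d z : polygon d z -> pt (next P d) z = pt d z.
Proof. by move=> /pt_rep h; apply/esym/rep_pt/rep_next. Qed.

Lemma pt_porbit d e z : e \in porbit (next P) d -> polygon d z -> pt e z = pt d z.
Proof. by move=> he /pt_rep h; apply/esym/rep_pt/rep_porbit; [exact: he|]. Qed.

Lemma pt_opp d z : on_side d z -> pt (opp P d) (z + shift d) = pt d z.
Proof.
move=> h; apply/esym/rep_pt; apply: rep_on_side => //.
exact/pt_rep/on_side_polygon.
Qed.

End Charts.

Section LocalIsometries.
Variable R : realType.
Local Notation V := (R * R)%type.
Implicit Types P Q S : polygon_gluing R.

(** The condition satisfied by translation isomorphisms, at all points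
    including the singular ones. *)
Definition local_iso P Q (f : surface P -> surface Q) := forall x,
  exists2 e : R, 0 < e & forall v y, `|v| < e -> step x v y -> step (f x) v (f y).

Lemma local_iso_comp P Q S (f : surface P -> surface Q) (g : surface Q -> surface S) :
  local_iso f -> local_iso g -> local_iso (g \o f).
Proof.
move=> hf hg x; have [e e0 he] := hf x; have [e' e'0 he'] := hg (f x).
exists (Num.min e e'); first by rewrite lt_min e0.
by move=> v y; rewrite lt_min => /andP[v1 v2] /(he _ _ v1) /(he' _ _ v2).
Qed.

Lemma local_iso_continuous P Q (f : surface P -> surface Q) :
  translation_surface P -> translation_surface Q -> local_iso f -> continuous f.
Proof.
move=> tsP tsQ hf; apply/continuousP => U /(open_stepP tsQ) oU; apply/(open_stepP tsP).
move=> x Ux; have [e e0 he] := hf x; have [e' e'0 he'] := oU _ Ux.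
exists (Num.min e e'); first by rewrite lt_min e0.
by move=> v y; rewrite lt_min => /andP[v1 v2] /(he _ _ v1) /(he' _ _ v2).
Qed.

Lemma local_iso_chart P Q (f : surface P -> surface Q) :
  translation_surface P -> translation_surface Q -> injective f -> local_iso f ->
  forall U h, translation_chart U h -> translation_chart (f @^-1` U) (h \o f).
Proof.
move=> tsP tsQ injf hf U h /(chart_stepP tsQ) [oU injh aff]; apply/(chart_stepP tsP); split.
- by move/continuousP: (local_iso_continuous tsP tsQ hf); exact.
- by move=> x y; rewrite !inE => h1 h2 /= h3; apply: injf; apply: injh; rewrite ?inE.
- move=> x Ux; have [e e0 he] := hf x; have [e' e'0 he'] := aff _ Ux.
  exists (Num.min e e'); first by rewrite lt_min e0.
  by move=> v y; rewrite lt_min => /andP[v1 v2] /(he _ _ v1) /(he' _ _ v2).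
Qed.

(** This and the next lemma show that isomorphisms are the bijective local
    isometries. *)
Lemma local_iso_isomorphic P Q (f : surface P -> surface Q) (g : surface Q -> surface P) :
  translation_surface P -> translation_surface Q ->
  local_iso f -> local_iso g -> cancel f g -> cancel g f -> isomorphic P Q.
Proof.
move=> tsP tsQ hf hg fK gK; exists f, g; split => //.
- by split; apply: local_iso_continuous.
- by apply: local_iso_chart => //; exact: can_inj fK.
- by apply: local_iso_chart => //; exact: can_inj gK.
Qed.

(** At a regular image point, charts show that f is a translation. Other
    image points are reached along the segments that end there: the error
    of the displacement from f x is constant on the open segment, and it
    tends to 0 at x. *)
Lemma isomorphic_local_iso P Q (f : surface P -> surface Q) :
  translation_surface P -> translation_surface Q -> injective f -> continuous f ->
  (forall U h, translation_chart U h -> translation_chart (f @^-1` U) (h \o f)) ->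
  local_iso f.
Proof.
move=> tsP tsQ injf /continuousP cf hf x.
have [e1 e10 so] := star_open tsQ (f x); have [e2 e20 du] := disp_uniq tsQ (f x).
have [e3 e30 vi] := vertex_isolated tsQ (f x); have [e4 e40 st] := step_trans tsQ (f x).
pose e := Num.min (Num.min e1 e2) (Num.min e3 e4).
have e0 : 0 < e by rewrite !lt_min e10 e20 e30 e40.
have ee1 : e <= e1 by rewrite !ge_min lexx.
have ee2 : e <= e2 by rewrite !ge_min lexx orbT.
have ee3 : e <= e3 by rewrite !ge_min lexx !orbT.
have ee4 : e <= e4 by rewrite !ge_min lexx !orbT.
have pre (a : R) : 0 < a -> a <= e -> exists2 b : R, 0 < b & forall v y, `|v| < b -> step x v y ->
    exists2 v', `|v'| < a & step (f x) v' (f y).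
  move=> a0 ae; have := cf _ (so a a0 (le_trans ae ee1)).
  move/(open_stepP tsP) => /(_ x); apply; exists 0; first by rewrite normr0.
  exact: step0.
have [d1 d10 hd1] := pre e e0 (lexx _); have [d2 d20 hd2] := disp_uniq tsP x.
exists (Num.min d1 d2); first by rewrite lt_min d10.
move=> v y; rewrite lt_min => /andP[v1 v2] sxy.
have [vz|v0] := eqVneq v 0.
  by rewrite vz in sxy *; rewrite (step_0_eq sxy); exact: step0.
have [d [z [hx hy]]] := sxy.
pose yy (r : R) := pt tsP d (z + r *: v).
have ryy r : 0 <= r <= 1 -> rep (yy r) d (z + r *: v).
  move=> r01; apply: pt_rep.
  have := polygon_convex r01 (rep_polygon hx) (rep_polygon hy).
  by have -> : z + r *: (z + v - z) = z + r *: v by veq.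
have sxr r : 0 <= r <= 1 -> step x (r *: v) (yy r).
  by move=> r01; exists d, z; split => //; exact: ryy.
have nrv r : 0 <= r <= 1 -> `|r *: v| <= `|v|.
  move=> /andP[r0 r1]; rewrite normrZ ger0_norm //.
  by have := normr_ge0 v; nra.
(* Displacement from f x to the image of the point at r on the segment from
   x to y. *)
pose D r := xget 0 [set u | `|u| < e /\ step (f x) u (f (yy r))].
have DP r : 0 <= r <= 1 -> `|D r| < e /\ step (f x) (D r) (f (yy r)).
  move=> r01; have [|u u1 u2] := hd1 _ _ _ (sxr _ r01); first exact: le_lt_trans (nrv r r01) v1.
  by rewrite /D; case: xgetP => [? -> //|/(_ u)] [].
have DE r u : 0 <= r <= 1 -> `|u| < e -> step (f x) u (f (yy r)) -> D r = u.
  move=> /DP [a b] u1 u2; apply: (du _ _ (f (yy r))) => //; exact: lt_le_trans ee2.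
pose E r := D r - r *: v.
(* The image point is regular for 0 < t, being a small nonzero displacement
   away from f x. *)
have loc t : 0 < t <= 1 -> exists2 a : R, 0 < a & forall s, 0 <= s <= 1 -> `|s - t| < a -> E s = E t.
  move=> /andP[t0 t1]; have t01 : 0 <= t <= 1 by rewrite ltW.
  have [n1 n2] := DP t t01.
  have Dn0 : D t != 0.
    apply/eqP => D0; rewrite D0 in n2; have /injf ex := step_0_eq n2.
    have := sxr t t01; rewrite ex => h.
    have := hd2 (t *: v) 0 x _ _ h (step0 x); rewrite normr0 => /(_ _ d20) h2.
    have /eqP := h2 (le_lt_trans (nrv t t01) v2).
    by rewrite scaler_eq0 (negPf v0) orbF gt_eqF.
  have nv := vi _ _ (lt_le_trans n1 ee3) Dn0 n2.
  have [U [h [hU Uq]]] := regular_chart tsQ (nonvertex_regular tsQ nv).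
  have [oU _ aff] : [/\ open U, {in U &, injective h} & forall x, U x -> affine_at h x].
    exact/(chart_stepP tsQ).
  have [a1 a10 h1] := aff _ Uq.
  have := hf _ _ hU => /(chart_stepP tsP) [_ _ /(_ (yy t) Uq) [a2 a20 h2]].
  have [a3 a30 h3] := star_open tsQ (f (yy t)).
  pose c := Num.min (Num.min a1 a3) (e - `|D t|).
  have c0 : 0 < c by rewrite !lt_min a10 a30 subr_gt0.
  have := cf _ (h3 c c0 _); rewrite !ge_min lexx orbT => /(_ isT).
  move/(open_stepP tsP) => /(_ (yy t)) [|a4 a40 h4].
    by exists 0; [rewrite normr0 | exact: step0].
  have nv0 : 0 < `|v| by rewrite normr_gt0.
  exists (Num.min a2 a4 / `|v|); first by rewrite divr_gt0 // lt_min a20.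
  move=> s s01; rewrite ltr_pdivlMr // lt_min => /andP[s2 s4].
  have sst : step (yy t) ((s - t) *: v) (yy s).
    have := rep_step (ryy t t01) (ryy s s01).
    by congr step; veq.
  rewrite -normrZ in s2 s4.
  have [u' u'1 su'] := h4 _ _ s4 sst.
  move: u'1; rewrite !lt_min => /andP[/andP[u1 u3] uD].
  have eu : u' = (s - t) *: v.
    by have := h2 _ _ s2 sst; rewrite /= (h1 _ _ u1 su') => /addrI.
  have lt1 : `|D t + u'| < e by apply: (le_lt_trans (ler_normD _ _)); lra.
  have := st _ _ _ _ (lt_le_trans n1 ee4) n2 su' => /(DE _ _ s01 lt1) Ds.
  by rewrite /E Ds eu; veq.
have Ec c : 0 < c <= 1 -> E 1 = E c.
  move=> /andP[c0 c1]; apply: (@interval_ind _ c 1 (fun t => E t = E c)) => // t /andP[ct t1].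
  have [|a a0 ha] := loc t; first by rewrite t1 andbT (lt_le_trans c0).
  exists a => // s /andP[cs s1] hst; rewrite (ha s) // s1 andbT.
  by apply: le_trans cs; exact: ltW.
have r11 : 0 <= (1 : R) <= 1 by rewrite lexx ler01.
(* By continuity of f at x the constant error is arbitrarily small. *)
have E1 : E 1 = 0.
  apply/eqP/negPn/negP; rewrite -normr_gt0; set n := `|E 1| => n0.
  have nv0 : 0 < `|v| by rewrite normr_gt0.
  have [||b b0 hb] := pre (Num.min e (n / 2)); first by rewrite lt_min e0 divr_gt0.
    by rewrite ge_min lexx.
  pose r := Num.min 1 (Num.min b (n / 2) / (2 * `|v|)).
  have r0 : 0 < r by rewrite lt_min ltr01 divr_gt0 // ?lt_min ?b0 ?divr_gt0 // mulr_gt0.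
  have r1 : r <= 1 by rewrite ge_min lexx.
  have r01 : 0 <= r <= 1 by rewrite r1 ltW.
  have hrv : `|r *: v| < Num.min b (n / 2).
    have m0 : 0 < Num.min b (n / 2) by rewrite lt_min b0 divr_gt0.
    have : r <= Num.min b (n / 2) / (2 * `|v|) by rewrite ge_min lexx orbT.
    rewrite ler_pdivlMr ?mulr_gt0 // normrZ gtr0_norm // => h; nra.
  move: hrv; rewrite lt_min => /andP[hr1 hr2].
  have [u] := hb _ _ hr1 (sxr r r01).
  rewrite lt_min => /andP[ue un] su.
  have := Ec r; rewrite r0 r1 => /(_ isT); rewrite /E (DE r u r01 ue su).
  rewrite -/(E 1) => h; have : n <= `|u| + `|r *: v| by rewrite /n h ler_normB.
  by lra.
have [_] := DP 1 r11.
have -> : D 1 = v.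
  by have /eqP := E1; rewrite /E subr_eq0 scale1r => /eqP.
have -> // : yy 1 = y.
by have := ryy 1 r11; rewrite scale1r => h; exact: rep_fun h hy.
Qed.

End LocalIsometries.

(** * Immersions of planar sets *)

Section Immersions.
Variables (R : realType) (P : polygon_gluing R) (tsP : translation_surface P).
Local Notation V := (R * R)%type.
Implicit Types (K : set V) (phi psi : V -> surface P) (z w v : V).

(** A map from a part of the plane that is locally a translation. *)
Definition immersion K phi := forall z, K z -> exists2 e : R, 0 < e &
  forall w, K w -> `|w - z| < e -> step (phi z) (w - z) (phi w).

Lemma immersionS K K' phi : K' `<=` K -> immersion K phi -> immersion K' phi.
Proof.
move=> s h z /s /h [e e0 he]; exists e => // w /s; exact: he.
Qed.

Lemma immersion_shift K (c : V) phi :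
  immersion K phi -> immersion [set z | K (z + c)] (fun z => phi (z + c)).
Proof.
move=> h z /h [e e0 he]; exists e => // w hw hlt.
have -> : w - z = w + c - (z + c) by veq.
by apply: he => //; have -> : w + c - (z + c) = w - z by veq.
Qed.

Lemma pt_immersion (d : 'I_(nsides P)) : immersion (polygon d) (pt tsP d).
Proof.
move=> z hz; exists 1 => // w hw _; apply: rep_step; exact: pt_rep.
Qed.

Lemma immersion_eq_in K phi psi :
  (forall z, K z -> phi z = psi z) -> immersion K phi -> immersion K psi.
Proof.
move=> h hp z Kz; have [e e0 he] := hp z Kz; exists e => // w Kw hw.
by rewrite -!h //; exact: he.
Qed.

(** Two immersions that agree along a line can be glued: near a point of
    the line, each of the two halves is already a translation by
    displacements from that point. *)
Lemma immersion_split K (l c : V) phi psi :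
  immersion [set z | K z /\ 0 <= cross l (z - c)] phi ->
  immersion [set z | K z /\ cross l (z - c) <= 0] psi ->
  (forall z, K z -> cross l (z - c) = 0 -> phi z = psi z) ->
  immersion K (fun z => if 0 <= cross l (z - c) then phi z else psi z).
Proof.
move=> h1 h2 hE z Kz.
have cont (a : R) : 0 < a -> exists2 e : R, 0 < e & forall u v : V, `|v - u| < e ->
    cross l (v - c) - cross l (u - c) <= a / 2.
  move=> a0; have b0 : 0 < `|l.1| + `|l.2| + 1 by rewrite ltr_wpDl ?ltr01 // addr_ge0.
  exists (a / 2 / (`|l.1| + `|l.2| + 1)); first by rewrite !divr_gt0.
  move=> u v /(cross_le l) h; have -> : cross l (v - c) - cross l (u - c) = cross l (v - u) by vring.
  apply: (le_trans h).
  have e1 : (`|l.1| + `|l.2| + 1) * (a / 2 / (`|l.1| + `|l.2| + 1)) = a / 2.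
    by rewrite mulrC divfK // gt_eqF.
  have : 0 < a / 2 / (`|l.1| + `|l.2| + 1) by rewrite !divr_gt0.
  by lra.
have [hlt|hgt|heq] := ltgtP 0 (cross l (z - c)).
- have [e e0 he] := h1 z (conj Kz (ltW hlt)); have [e' e'0 he'] := cont _ hlt.
  exists (Num.min e e'); first by rewrite lt_min e0.
  move=> w Kw; rewrite lt_min => /andP[w1 w2].
  have := he' w z; rewrite distrC => /(_ w2) h.
  have hw : 0 <= cross l (w - c) by lra.
  by rewrite hw; apply: he.
- have [e e0 he] := h2 z (conj Kz (ltW hgt)).
  have [|e' e'0 he'] := cont (- cross l (z - c)); first by rewrite oppr_gt0.
  exists (Num.min e e'); first by rewrite lt_min e0.
  move=> w Kw; rewrite lt_min => /andP[w1 w2].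
  have h := he' z w w2.
  have hw : cross l (w - c) < 0 by lra.
  by rewrite leNgt hw /=; apply: he => //; split => //; exact: ltW.
- have z0 : 0 <= cross l (z - c) by rewrite -heq.
  have z1 : cross l (z - c) <= 0 by rewrite -heq.
  have [e e0 he] := h1 z (conj Kz z0); have [e' e'0 he'] := h2 z (conj Kz z1).
  exists (Num.min e e'); first by rewrite lt_min e0.
  move=> w Kw; rewrite lt_min => /andP[w1 w2].
  case: ifPn => hw; first by apply: he.
  rewrite hE //; apply: he' => //; split => //.
  by rewrite ltW // ltNge.
Qed.

(** Unique continuation: two immersions that agree at an end of a segment agree
    along it as long as they stay at regular points. *)
Lemma immersion_unique phi psi (a b : V) K :
  (forall t : R, 0 <= t <= 1 -> K (a + t *: (b - a))) ->
  immersion K phi -> immersion K psi -> phi a = psi a ->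
  (forall t : R, 0 <= t < 1 -> regular (phi (a + t *: (b - a)))) ->
  phi b = psi b.
Proof.
move=> hK hp hq hab reg.
pose g (t : R) := a + t *: (b - a).
have n0 : 0 < `|b - a| + 1 by rewrite ltr_wpDl ?ltr01.
have gst s t : g s - g t = (s - t) *: (b - a) by rewrite /g; veq.
have near t (e : R) : 0 < e -> forall s, `|s - t| < e / (`|b - a| + 1) -> `|g s - g t| < e.
  move=> e0 s; rewrite ltr_pdivlMr // gst normrZ => h.
  by have := normr_ge0 (s - t); nra.
(* The set of agreement is open by regularity and closed by [step_coinj];
   [step_coinj] alone carries the agreement to the end b, which may be
   singular. *)
have agree c : 0 <= c < 1 -> phi (g c) = psi (g c).
  move=> /andP[c0 c1]; apply: (@interval_ind _ 0 c (fun t => phi (g t) = psi (g t))) => //.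
    by rewrite /g; have -> : a + 0 *: (b - a) = a by veq.
  move=> t /andP[t0 tc].
  have tK : 0 <= t <= 1 by rewrite t0 (le_trans tc) // ltW.
  have [e e0 he] := hp _ (hK t tK); have [e' e'0 he'] := hq _ (hK t tK).
  have [eq|neq] := pselect (phi (g t) = psi (g t)).
    have [|r r0 hr] := reg t; first by rewrite t0 (le_lt_trans tc).
    exists (Num.min r (Num.min e e') / (`|b - a| + 1)).
      by rewrite divr_gt0 // !lt_min r0 e0.
    move=> s /andP[s0 sc] /near; rewrite !lt_min r0 e0 e'0 => /(_ isT) /andP[l1 /andP[l2 l3]].
    have sK : 0 <= s <= 1 by rewrite s0 (le_trans sc) // ltW.
    split=> _ //; apply: hr l1 (he _ (hK s sK) l2) _.
    by move: (he' _ (hK s sK) l3); rewrite -/(g t) eq.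
  have [r r0 hr] := step_coinj tsP (phi (g t)) (psi (g t)).
  exists (Num.min r (Num.min e e') / (`|b - a| + 1)).
    by rewrite divr_gt0 // !lt_min r0 e0.
  move=> s /andP[s0 sc] /near; rewrite !lt_min r0 e0 e'0 => /(_ isT) /andP[l1 /andP[l2 l3]].
  have sK : 0 <= s <= 1 by rewrite s0 (le_trans sc) // ltW.
  split=> // eqs; apply: hr l1 (he _ (hK s sK) l2) _.
  by have := he' _ (hK s sK) l3; rewrite -/(g s) -eqs.
have g1 : g 1 = b by rewrite /g; veq.
have K1 : 0 <= (1 : R) <= 1 by rewrite lexx ler01.
have [r r0 hr] := step_coinj tsP (phi b) (psi b).
have [e e0 he] := hp _ (hK 1 K1); have [e' e'0 he'] := hq _ (hK 1 K1).
set m := Num.min r (Num.min e e').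
have m0 : 0 < m by rewrite !lt_min r0 e0.
pose k := Num.min 1 (m / (`|b - a| + 1) / 2).
have k0 : 0 < k by rewrite lt_min ltr01 !divr_gt0.
have k1 : k <= 1 by rewrite ge_min lexx.
have km : k < m / (`|b - a| + 1).
  have : k <= m / (`|b - a| + 1) / 2 by rewrite ge_min lexx orbT.
  by have : 0 < m / (`|b - a| + 1) by [rewrite divr_gt0|]; lra.
pose s := 1 - k.
have := near 1 m m0 s; have -> : `|s - 1| = k.
  by rewrite /s (_ : 1 - k - 1 = - k) ?normrN ?gtr0_norm //; ring.
move=> /(_ km); rewrite !lt_min g1 => /andP[l1 /andP[l2 l3]].
have sK : 0 <= s <= 1 by rewrite /s; lra.
have s1 : 0 <= s < 1 by rewrite /s; lra.
have h1 := he _ (hK s sK); have h2 := he' _ (hK s sK).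
rewrite -/(g 1) -/(g s) g1 in h1 h2.
by apply: hr l1 (h1 l2) _; rewrite agree //; exact: h2.
Qed.

End Immersions.

Section Maps.
Variable R : realType.
Local Notation V := (R * R)%type.
Implicit Types P Q : polygon_gluing R.

Lemma immersion_comp P Q (f : surface P -> surface Q) K phi :
  local_iso f -> immersion K phi -> immersion K (f \o phi).
Proof.
move=> hf hp z Kz; have [e e0 he] := hp z Kz; have [e' e'0 he'] := hf (phi z).
exists (Num.min e e'); first by rewrite lt_min e0.
move=> w Kw; rewrite lt_min => /andP[w1 w2].
exact: he' w2 (he _ Kw w1).
Qed.

(** Compatible immersions of the polygons define a local isometry: a small
    displacement stays in one polygon. *)
Lemma map_surface P Q (phi : 'I_(nsides P) -> V -> surface Q) :
  translation_surface P ->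
  (forall d z, polygon d z -> phi (next P d) z = phi d z) ->
  (forall d z, on_side d z -> phi (opp P d) (z + shift d) = phi d z) ->
  (forall d, immersion (polygon d) (phi d)) ->
  exists f : surface P -> surface Q, local_iso f /\ forall x d z, rep x d z -> f x = phi d z.
Proof.
move=> tsP h1 h2 h3.
have ex (x : surface P) : exists p : 'I_(nsides P) * V, rep x p.1 p.2.
  by have [d [z h]] := rep_ex x; exists (d, z).
pose f x := phi (projT1 (cid (ex x))).1 (projT1 (cid (ex x))).2.
have fE x d z : rep x d z -> f x = phi d z.
  rewrite /f; case: cid => -[d0 z0] /= h0 h; apply/esym.
  apply: (rep_closed (C := fun d z => phi d z = phi d0 z0) _ _ h0 h) => //.
  - by move=> e w hw; rewrite h1.
  - by move=> e w hw _ _; rewrite h2.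
exists f; split => // x.
have [||e e0 he] := @rep_unif _ _ tsP x (fun d z (e : R) => forall w, polygon d w -> `|w - z| < e ->
  step (phi d z) (w - z) (phi d w)).
- by move=> d z e e' h _ le w hw hlt; apply: h => //; exact: lt_le_trans le.
- move=> d z hx; exact: h3 (rep_polygon hx).
exists e => // v y hv [d [z [hx hy]]].
have := he d z hx (z + v) (rep_polygon hy); have -> : z + v - z = v by veq.
by rewrite (fE _ _ _ hx) (fE _ _ _ hy); exact.
Qed.

Definition midpoint P (d : 'I_(nsides P)) : V := pos d + 2^-1 *: side d.

Lemma on_side_midpoint P (d : 'I_(nsides P)) : on_side d (midpoint d).
Proof. by exists 2^-1 => //; apply/andP; split; lra. Qed.

Lemma off_vertex P (tsP : translation_surface P) (x : surface P) d z :
  rep x d z -> (forall f, f \in porbit (next P) d -> z <> pos f) -> ~ vertex x.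
Proof. by move=> hx h [e he]; have [f [_ f1 f2]] := vertex_rep tsP he hx; exact: h f1 f2. Qed.

Lemma midpoint_left P (tsP : translation_surface P) (d e : 'I_(nsides P)) :
  e \in porbit (next P) d -> e != d -> 0 < cross (side d) (midpoint e - pos d).
Proof.
move=> he ned; rewrite ltNge; apply/negP => h.
have hne : next P e \in porbit (next P) d by rewrite next_porbitE.
have p1 := pos_polygon tsP he (porbit_id _ d).
have p2 := pos_polygon tsP hne (porbit_id _ d).
have E : cross (side d) (midpoint e - pos d) = 2^-1 * cross (side d) (pos e - pos d) +
    2^-1 * cross (side d) (pos (next P e) - pos d).
  by rewrite /midpoint pos_next /cross /= !scale_mul; field.
have z1 : cross (side d) (pos e - pos d) <= 0 by lra.
have z2 : cross (side d) (pos (next P e) - pos d) <= 0 by lra.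
case: (vertex_left_eq0 tsP he z1) => e1; first by rewrite e1 eqxx in ned.
case: (vertex_left_eq0 tsP hne z2) => [e2|/perm_inj e2]; last by rewrite e2 eqxx in ned.
by have := next2_neq tsP d; rewrite -e1 e2 eqxx.
Qed.

(** A vertex is an extreme point of its polygon. *)
Lemma segment_off_vertex P (tsP : translation_surface P) (d e f : 'I_(nsides P)) w (t : R) :
  e \in porbit (next P) d -> f \in porbit (next P) d -> polygon d w -> 0 <= t < 1 ->
  midpoint e + t *: (w - midpoint e) <> pos f.
Proof.
move=> he hf hw /andP[t0 t1] h.
have key g : g \in porbit (next P) d -> cross (side g) (pos f - pos g) = 0 -> e = g.
  move=> hg c0; apply/eqP/negPn/negP => neg.
  have eg : e \in porbit (next P) g by rewrite (porbitS hg).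
  have p1 := midpoint_left tsP eg neg; have p3 := mulr_ge0 t0 (hw g hg).
  have : cross (side g) (pos f - pos g) =
    (1 - t) * cross (side g) (midpoint e - pos g) + t * cross (side g) (w - pos g).
    by rewrite -h; vring.
  by have := mulr_gt0 (_ : 0 < 1 - t) p1; rewrite subr_gt0 => /(_ t1); lra.
have e1 : e = f by apply: key => //; rewrite subrr cross0r.
have hp : ((next P)^-1)%g f \in porbit (next P) d.
  by rewrite -next_porbitE permKV.
have e2 : e = ((next P)^-1)%g f.
  by apply: key => //; have := pos_next_left (((next P)^-1)%g f); rewrite permKV.
by have := next_neq tsP e; rewrite {1}e2 permKV e1 eqxx.
Qed.

Definition inner P (d : 'I_(nsides P)) w :=
  forall e, e \in porbit (next P) d -> 0 < cross (side e) (w - pos e).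

Lemma inner_polygon P (d : 'I_(nsides P)) w : inner d w -> polygon d w.
Proof. by move=> h e /h /ltW. Qed.

Lemma inner_next P (d : 'I_(nsides P)) : inner (next P d) = inner d.
Proof.
have e1 : porbit (next P) (next P d) = porbit (next P) d.
  by have := porbit_perm (next P) 1 d; rewrite expg1.
by rewrite /inner e1.
Qed.

Lemma inner_convex P (d : 'I_(nsides P)) z w (t : R) : 0 < t <= 1 ->
  polygon d z -> inner d w -> inner d (z + t *: (w - z)).
Proof.
move=> /andP[t0 t1] hz hw e he.
have -> : cross (side e) (z + t *: (w - z) - pos e) =
  (1 - t) * cross (side e) (z - pos e) + t * cross (side e) (w - pos e) by vring.
have h1 : 0 <= 1 - t by rewrite subr_ge0.
have := mulr_ge0 h1 (hz e he); have := mulr_gt0 t0 (hw e he); lra.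
Qed.

Lemma inner_ex P (tsP : translation_surface P) (d : 'I_(nsides P)) : exists w, inner d w.
Proof.
exists (2^-1 *: (midpoint d + midpoint (next P d))) => e he.
have mp f : f \in porbit (next P) d -> 0 <= cross (side e) (midpoint f - pos e).
  move=> hf; have := on_side_polygon tsP (on_side_midpoint f); apply.
  by rewrite (porbitS hf).
have E : cross (side e) (2^-1 *: (midpoint d + midpoint (next P d)) - pos e) =
  2^-1 * cross (side e) (midpoint d - pos e) + 2^-1 * cross (side e) (midpoint (next P d) - pos e).
  by rewrite /cross /= !scale_mul; field.
have m1 := mp d (porbit_id _ _); have m2 := mp _ (next_porbit d).
have [ed|ne] := eqVneq d e.
  have := @midpoint_left _ tsP e (next P d).
  by rewrite next_porbitE porbit_sym he -{1}ed next_neq // => /(_ isT isT); lra.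
by have := @midpoint_left _ tsP e d; rewrite porbit_sym he ne => /(_ isT isT); lra.
Qed.

Lemma inner_near P (tsP : translation_surface P) (d : 'I_(nsides P)) z (e : R) :
  polygon d z -> 0 < e -> exists2 w, inner d w & `|w - z| < e.
Proof.
move=> hz e0; have [b hb] := inner_ex tsP d.
have n0 : 0 < `|b - z| + 1 by rewrite ltr_wpDl ?ltr01.
pose t := Num.min 1 (e / (`|b - z| + 1)).
have t0 : 0 < t by rewrite lt_min ltr01 divr_gt0.
exists (z + t *: (b - z)); first by apply: inner_convex; rewrite ?t0 ?ge_min ?lexx.
have -> : z + t *: (b - z) - z = t *: (b - z) by veq.
have : t <= e / (`|b - z| + 1) by rewrite ge_min lexx orbT.
by rewrite ler_pdivlMr // normrZ gtr0_norm // => h; lra.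
Qed.

(** Gluings across sides only affect the points of the sides. *)
Lemma inner_rep P (tsP : translation_surface P) (d e : 'I_(nsides P)) x z w :
  inner d z -> rep x d z -> rep x e w -> e \in porbit (next P) d /\ w = z.
Proof.
move=> hz hx hw.
apply: (rep_closedW (C := fun e w => e \in porbit (next P) d /\ w = z) tsP _ _ hx hw) => //.
- by move=> f u [h1 ->]; rewrite next_porbitE.
- move=> f u [t _ hu] [h1 h2]; have := hz f h1.
  by rewrite -h2 hu (_ : cross _ _ = 0) ?ltxx //; vring.
- by rewrite porbit_id.
Qed.

(** The segment from a fixed point inside a side to any other point of the
    polygon avoids the vertices, so that unique continuation applies.
    Midpoints are fixed points which are easy to follow through the
    constructions below. *)
Lemma local_iso_rigid P (tsP : translation_surface P) (f : surface P -> surface P) :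
  local_iso f ->
  (forall d, exists e x, [/\ e \in porbit (next P) d, rep x e (midpoint e) & f x = x]) ->
  forall x, f x = x.
Proof.
move=> hf hfix x; have [d [w hw]] := rep_ex x.
have [e [y [he hy fy]]] := hfix d.
have pw := rep_polygon hw.
have pe : polygon d (midpoint e).
  by rewrite -(porbit_next he); apply: on_side_polygon => //; exact: on_side_midpoint.
have -> : x = pt tsP d w by exact: rep_pt.
apply/esym/(@immersion_unique _ _ tsP (pt tsP d) (f \o pt tsP d) (midpoint e) w (polygon d)).
- by move=> t t01; apply: polygon_convex.
- exact: pt_immersion.
- by apply: immersion_comp => //; exact: pt_immersion.
- have ey : y = pt tsP d (midpoint e) by apply: rep_pt; apply/(rep_porbit _ _ he).
  by rewrite /= -ey fy.
- move=> t t01; apply: (nonvertex_regular tsP).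
  have t01' : 0 <= t <= 1 by case/andP: t01 => -> /ltW.
  apply: (off_vertex tsP (pt_rep tsP (polygon_convex t01' pe pw))) => g hg.
  exact: (segment_off_vertex tsP he hg pw t01).
Qed.

End Maps.

(** * Surgeries under isomorphisms *)

Section Resew.
Variables (R : realType) (P : polygon_gluing R) (tsP : translation_surface P).
Variables (g h : 'I_(nsides P)).
Hypothesis sgh : side h = side g.
Hypothesis tsR : translation_surface (resew g h).
Local Notation V := (R * R)%type.
Local Notation I := 'I_(nsides P).
Local Notation RP := (resew g h).
Implicit Types (d e f : I) (x y : surface P) (z w v u : V).

Lemma side_neq0 d : side d != 0.
Proof.
by apply/eqP => h0; have := turn_left tsP d; rewrite h0 crossC cross0r oppr0 ltxx.
Qed.

Lemma side_opp_neq d e : side d = side e -> opp P d != e.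
Proof.
move=> hde; apply/eqP => h1; have := side_opp tsP d; rewrite h1 hde => h2.
move/eqP: (side_neq0 e); apply.
by apply: vec_eq; [have := congr1 fst h2 | have := congr1 snd h2] => /=; lra.
Qed.

Lemma resew_oppE d : opp RP d = tperm g h (opp P (tperm g h d)).
Proof. by rewrite /= -{1}(tpermK g h d) permJ. Qed.

Lemma resew_opp_g : opp RP g = opp P h.
Proof.
by rewrite resew_oppE tpermL tpermD // eq_sym; apply: side_opp_neq.
Qed.

Lemma resew_opp_h : opp RP h = opp P g.
Proof.
by rewrite resew_oppE tpermR tpermD // eq_sym; apply: side_opp_neq.
Qed.

Lemma resew_opp_off d : d != g -> d != h -> opp P d != g -> opp P d != h ->
  opp RP d = opp P d.
Proof. by move=> n1 n2 n3 n4; rewrite resew_oppE !tpermD // eq_sym. Qed.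

(** The segments along which the surface is cut. *)
Definition slit x := exists k z, [/\ k = g \/ k = h, on_side k z & rep x k z].

Lemma slit_side x d z : (d == g) || (d == h) || (opp P d == g) || (opp P d == h) ->
  on_side d z -> rep x d z -> slit x.
Proof.
move=> hd hz hx.
have h1 k : (d == k) || (opp P d == k) -> k = g \/ k = h -> slit x.
  move=> /orP[/eqP <-|/eqP <-] hk; first by exists d, z.
  exists (opp P d), (z + shift d); split => //; first exact: on_side_opp.
  exact: rep_on_side.
move: hd; rewrite -!orbA => /or4P[] hd; [apply: (h1 g)|apply: (h1 h)|apply: (h1 g)|apply: (h1 h)];
  rewrite ?hd ?orbT //; by [left|right].
Qed.

(** The polygons of P and of [resew g h] are the same, so that points off
    the slits can be identified when they have a common representative. *)
Definition lift x (xt : surface RP) := exists d z, rep x d z /\ rep xt d z.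

(** Off the slits, both gluings identify the same representatives. *)
Lemma lift_rep x (xt : surface RP) d z : ~ slit x -> lift x xt -> rep x d z -> rep xt d z.
Proof.
move=> ns [d0 [z0 [h0 h1]]] h2.
suff [//] : rep xt d z /\ rep x d z.
apply: (rep_closedW (C := fun d z => rep xt d z /\ rep x d z) tsP _ _ h0 h2) => //.
- by move=> e w [a b]; split; apply/rep_next.
- move=> e w he [a b]; split; last exact: rep_on_side.
  have hn : ~~ ((e == g) || (e == h) || (opp P e == g) || (opp P e == h)).
    by apply/negP => hn; apply: ns; apply: slit_side hn he b.
  move: hn; rewrite !negb_or -!andbA => /and4P[n1 n2 n3 n4].
  have := @rep_on_side _ RP tsR xt e w he a.
  by rewrite /shift resew_opp_off.
Qed.

Lemma lift_ex x : exists xt, lift x xt.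
Proof.
have [d [z hx]] := rep_ex x.
have hz : @polygon R RP d z by exact: rep_polygon hx.
by have [xt hxt] := polygon_rep hz; exists xt, d, z.
Qed.

Lemma lift_uniq x (xt yt : surface RP) : ~ slit x -> lift x xt -> lift x yt -> xt = yt.
Proof.
move=> ns [d [z [h1 h2]]] h3; exact: rep_fun h2 (lift_rep ns h3 h1).
Qed.

Lemma lift_step x y (xt yt : surface RP) v : ~ slit x -> ~ slit y ->
  lift x xt -> lift y yt -> step x v y -> step xt v yt.
Proof.
move=> nx ny lx ly [d [z [h1 h2]]]; exists d, z.
by split; [exact: lift_rep nx lx h1 | exact: lift_rep ny ly h2].
Qed.

Lemma inner_slit x d w : inner d w -> rep x d w -> ~ slit x.
Proof.
move=> hw hx [k [z [_ [t _ hz] hxk]]].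
have [hk ez] := inner_rep tsP hw hx hxk; have := hw k hk.
by rewrite -ez hz (_ : cross _ _ = 0) ?ltxx //; vring.
Qed.

End Resew.

Section ResewMap.
Variables (R : realType) (P P' : polygon_gluing R).
Hypotheses (tsP : translation_surface P) (tsP' : translation_surface P').
Variables (g h : 'I_(nsides P)) (g' h' : 'I_(nsides P')).
Hypothesis sgh : side h = side g.
Hypotheses (sgh' : side h' = side g') (sgg : side g' = side g).
Local Notation RP := (resew g h).
Local Notation RP' := (resew g' h').
Hypotheses (tsR : translation_surface RP) (tsR' : translation_surface RP').
Variables (F : surface P -> surface P') (G : surface P' -> surface P).
Hypotheses (hF : local_iso F) (FK : cancel F G).
Hypothesis Fg : forall (t : R) x, 0 <= t <= 1 -> rep x g (pos g + t *: side g) ->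
  rep (F x) g' (pos g' + t *: side g').
Hypothesis Fh : forall (t : R) x, 0 <= t <= 1 -> rep x h (pos h + t *: side h) ->
  rep (F x) h' (pos h' + t *: side h').
Local Notation V := (R * R)%type.
Implicit Types (d : 'I_(nsides P)) (x y : surface P) (z w v u : V).
Implicit Types (xt yt qt : surface RP').

(** By injectivity F takes the complement of the slits to the complement of
    the slits. *)
Lemma slit_map x : ~ slit g h x -> ~ slit g' h' (F x).
Proof.
move=> ns [k [z [hk [t t01 ->] hFx]]]; apply: ns.
have key (a : 'I_(nsides P)) (a' : 'I_(nsides P')) : a = g \/ a = h ->
    (forall (t : R) x, 0 <= t <= 1 -> rep x a (pos a + t *: side a) ->
       rep (F x) a' (pos a' + t *: side a')) ->
    rep (F x) a' (pos a' + t *: side a') -> slit g h x.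
  move=> ha hFa hx.
  have os : on_side a (pos a + t *: side a) by exists t.
  have [y hy] := polygon_rep (on_side_polygon tsP os).
  have eF : F x = F y by exact: rep_fun hx (hFa _ _ t01 hy).
  have -> : x = y by exact: can_inj FK _ _ eF.
  by exists a, (pos a + t *: side a).
case: hk hFx => -> hFx; [apply: (key g g')|apply: (key h h')] => //; by [left|right].
Qed.

(** The map between the resewn surfaces is F off the slits; on the polygon
    of d it is extended by continuity: yt is the limit at z of the images
    of the interior points. *)
Definition limit d z yt := exists2 r : R, 0 < r & forall w y qt, inner d w ->
  `|w - z| < r -> rep y d w -> lift (g := g') (h := h') (F y) qt -> step yt (w - z) qt.

(** Two limits have a common small displacement to the same point. *)
Lemma limit_uniq d z yt yt' : polygon d z -> limit d z yt -> limit d z yt' -> yt = yt'.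
Proof.
move=> hz [r r0 hr] [r' r'0 hr']; have [e e0 he] := step_coinj tsR' yt yt'.
have [|w hw] := inner_near tsP hz (e := Num.min e (Num.min r r')).
  by rewrite !lt_min e0 r0.
rewrite !lt_min => /andP[w1 /andP[w2 w3]].
have [y hy] := polygon_rep (inner_polygon hw).
have [qt hq] := lift_ex g' h' (F y).
exact: he w1 (hr _ _ _ hw w2 hy hq) (hr' _ _ _ hw w3 hy hq).
Qed.

Lemma limit_unslit d z x yt : rep x d z -> ~ slit g h x -> lift (F x) yt -> limit d z yt.
Proof.
move=> hx ns hl; have [e e0 he] := hF x; exists e => // w y qt hw hlt hy hq.
apply: (lift_step tsP' tsR' _ _ hl hq); first exact: slit_map.
  by apply: slit_map; apply: inner_slit hw hy.
exact: he hlt (rep_step hx hy).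
Qed.

(** The image under F of a slit seen from the left of k is the slit seen
    from the left of k'. A point of the polygon of k near z stays to the
    left of k', since F is a translation near x. *)
Lemma limit_side (k : 'I_(nsides P)) (k' : 'I_(nsides P')) x (t : R) yt :
  side k' = side k -> 0 < t < 1 -> rep x k (pos k + t *: side k) ->
  rep (F x) k' (pos k' + t *: side k') -> rep yt k' (pos k' + t *: side k') ->
  limit k (pos k + t *: side k) yt.
Proof.
move=> sk /andP[t0 t1] hx hFx hyt; have [e e0 he] := hF x.
exists e => // w y qt hw hlt hy hq; set z := pos k + _ in hx hlt *; set z' := pos k' + _ in hFx hyt.
have os : on_side k' z' by exists t => //; rewrite !ltW.
have nvz f : f \in porbit (next P') k' -> z' <> pos f.
  move=> hf ez; have := vertex_on_side tsP' hf; rewrite -ez => /(_ os) hh.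
  have : t *: side k' = 0 \/ (t - 1) *: side k' = 0.
    case: hh => ef; [left|right]; move: ez; rewrite ef /z' ?pos_next => ez.
      by apply: (addrI (pos k')); rewrite ez addr0.
    by apply: (addrI (pos k' + side k')); rewrite addr0 -{2}ez; veq.
  by case=> /eqP; rewrite scaler_eq0 (negPf (side_neq0 tsP' k')) orbF => /eqP; lra.
have nv : ~ vertex (F x) by apply: off_vertex hFx nvz.
have hns : ~ slit g' h' (F y) by apply: slit_map; apply: inner_slit hw hy.
have [a [z1 [h1 h2]]] := he _ _ hlt (rep_step hx hy).
suff : rep (F y) k' (z' + (w - z)).
  by move=> hr; have := rep_step hyt (lift_rep tsP' tsR' hns hq hr); congr step; veq.
have [[ha ez]|[f [f1 f2 f3 ez]]] := nonvertex_rep tsP' nv hFx h1.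
  by rewrite -ez; apply/(rep_porbit _ _ ha).
have fk : f = k'.
  apply/eqP/negPn/negP => nf; have := two_sides tsP' f1 nf os f3.
  by case; apply: nvz; rewrite ?next_porbitE porbit_id.
rewrite fk in f2 ez.
have := rep_polygon h2 f2; rewrite (side_opp tsP') crossNl sk oppr_ge0.
have -> : z1 + (w - z) - pos (opp P' k') = (w - pos k) + - side k'.
  by rewrite ez (pos_opp tsP') /z /z' sk; veq.
rewrite sk crossDr crossNr crossvv oppr0 addr0 => h3.
by have := hw k (porbit_id _ _); rewrite ltNge h3.
Qed.

(** The candidates are the points of the new surface having a
    representative in common with F x. An interior point near z is at a
    small displacement from one of them, which does not depend on the
    interior point because the interior of the polygon near z is convex. *)
Lemma limit_ex d z : polygon d z -> exists yt, limit d z yt.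
Proof.
move=> hz; have [x hx] := polygon_rep hz.
pose cand c := exists e z', rep (F x) e z' /\ rep (c : surface RP') e z'.
have [||e0 e00 he0] := @rep_unif _ _ tsP' (F x) (fun a z' (r : R) => forall c : surface RP', rep c a z' ->
   forall v (q : surface RP') b w, `|v| < r -> step c v q -> rep q b w -> rep c b (w - v)).
- by move=> a z' r r' h1 _ le c hc v q f w hv; apply: (h1 c hc); exact: lt_le_trans le.
- move=> a z' hz'; have hp : @polygon R RP' a z' by exact: rep_polygon hz'.
  have [c hc] := polygon_rep hp; have [r r0 hr] := star tsR' c; exists r => // c' hc'.
  by rewrite (rep_fun hc' hc).
(* All the small displacements to a point near a candidate come from it,
   whence the uniqueness of the candidate. *)
have st c : cand c -> forall v (q : surface RP') b w, `|v| < e0 -> step c v q -> rep q b w -> rep c b (w - v).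
  by move=> [a [z' [h1 h2]]]; exact: (he0 _ _ h1 _ h2).
have [e1 e10 he1] := hF x.
pose e := Num.min e0 e1; have ep : 0 < e by rewrite lt_min e00.
have getc w y qt : inner d w -> `|w - z| < e -> rep y d w -> lift (F y) qt ->
    exists2 c, cand c & step c (w - z) qt.
  rewrite lt_min => hw /andP[_ hlt] hy hq.
  have [a [z' [h1 h2]]] := he1 _ _ hlt (rep_step hx hy).
  have hp : @polygon R RP' a z' by exact: rep_polygon h1.
  have [c hc] := polygon_rep hp; exists c; first by exists a, z'.
  exists a, z'; split => //; apply: (lift_rep tsP' tsR' _ hq h2).
  by apply: slit_map; apply: inner_slit hw hy.
have cinj c c' v qt : cand c -> cand c' -> `|v| < e -> step c v qt -> step c' v qt -> c = c'.
  rewrite lt_min => hc hc' /andP[hv _] s1 s2; have [a [w hw]] := rep_ex qt.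
  exact: rep_fun (st _ hc _ _ _ _ hv s1 hw) (st _ hc' _ _ _ _ hv s2 hw).
have [w0 hw0 lt0] := inner_near tsP hz ep.
have [y0 hy0] := polygon_rep (inner_polygon hw0); have [q0 hq0] := lift_ex g' h' (F y0).
have [c0 cc0 sc0] := getc _ _ _ hw0 lt0 hy0 hq0.
exists c0, e => // w y qt hw hlt hy hq.
pose p t := w0 + t *: (w - w0).
have pin t : 0 <= t <= 1 -> inner d (p t).
  move=> /andP[]; rewrite le_eqVlt => /orP[/eqP <-|t0] t1.
    by rewrite /p; have -> : w0 + 0 *: (w - w0) = w0 by veq.
  by apply: inner_convex => //; [rewrite t0 | exact: inner_polygon].
have pe t : 0 <= t <= 1 -> `|p t - z| < e.
  move=> /andP[t0 t1].
  have -> : p t - z = (1 - t) *: (w0 - z) + t *: (w - z) by rewrite /p; veq.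
  apply: (le_lt_trans (ler_normD _ _)); rewrite !normrZ !ger0_norm ?subr_ge0 //.
  have : 0 < t \/ t < 1 by have [->|] := eqVneq t 0; [right; rewrite ltr01 | move=> n; left; rewrite lt_neqAle eq_sym n].
  by case=> ?; nra.
(* Image of the point at t of the segment from w0 to w. *)
pose L t := xget q0 [set qt | exists y, rep y d (p t) /\ lift (F y) qt].
have LP t : 0 <= t <= 1 -> exists y, rep y d (p t) /\ lift (F y) (L t).
  move=> t01; have [a ha] := polygon_rep (inner_polygon (pin t t01)).
  have [b hb] := lift_ex g' h' (F a).
  by rewrite /L; case: xgetP => [? -> //|/(_ b)] []; exists a.
have loc c t : cand c -> 0 <= t <= 1 -> step c (p t - z) (L t) -> exists2 r : R, 0 < r &
    forall s, 0 <= s <= 1 -> `|s - t| < r -> step c (p s - z) (L s).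
  move=> hc t01 hs; have [a [ha hla]] := LP t t01.
  have [r r0 hr] := hF a; have n0 : 0 < `|w - w0| + 1 by rewrite ltr_wpDl ?ltr01.
  exists (r / (`|w - w0| + 1)); first by rewrite divr_gt0.
  move=> s s01; rewrite ltr_pdivlMr // => h1; have [b [hb hlb]] := LP s s01.
  have dlt : `|p s - p t| < r.
    have -> : p s - p t = (s - t) *: (w - w0) by rewrite /p; veq.
    by rewrite normrZ; have := normr_ge0 (s - t); nra.
  have na : ~ slit g' h' (F a) by apply: slit_map; apply: inner_slit (pin t t01) ha.
  have nb : ~ slit g' h' (F b) by apply: slit_map; apply: inner_slit (pin s s01) hb.
  have [f [u [h2 h3]]] := lift_step tsP' tsR' na nb hla hlb (hr _ _ dlt (rep_step ha hb)).
  have := pe t t01; rewrite lt_min => /andP[pt0 _].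
  exists f, (u - (p t - z)); split; first exact: st hc _ _ _ _ pt0 hs h2.
  by have -> : u - (p t - z) + (p s - z) = u + (p s - p t) by veq.
(* The candidate is locally constant along the segment. *)
have key : step c0 (p 1 - z) (L 1).
  apply: (@interval_ind _ 0 1 (fun t => step c0 (p t - z) (L t))) => //.
  - have [|a [ha hla]] := LP 0; first by rewrite lexx ler01.
    have p0 : p 0 = w0 by rewrite /p; veq.
    rewrite p0 in ha *; have ea := rep_fun ha hy0; rewrite ea in hla.
    by rewrite (lift_uniq tsP' tsR' _ hla hq0) //; apply: slit_map; apply: inner_slit hw0 hy0.
  - move=> t t01; have [a [ha hla]] := LP t t01.
    have [c hc sc] := getc _ _ _ (pin t t01) (pe t t01) ha hla.
    have [r r0 hr] := loc c t hc t01 sc; exists r => // s s01 hst.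
    have s1 := hr s s01 hst.
    have E1 : step c0 (p s - z) (L s) -> c0 = c.
      by move=> h1; apply: cinj h1 s1 => //; exact: pe.
    have E2 : step c0 (p t - z) (L t) -> c0 = c.
      by move=> h1; apply: cinj h1 sc => //; exact: pe.
    by split=> h1; [rewrite (E1 h1) | rewrite (E2 h1)].
have p1 : p 1 = w by rewrite /p; veq.
have [|a [ha hla]] := LP 1; first by rewrite lexx ler01.
rewrite p1 in ha key; have ea := rep_fun ha hy; rewrite ea in hla.
suff <- : L 1 = qt by [].
by apply: (lift_uniq tsP' tsR' _ hla hq); apply: slit_map; apply: inner_slit hw hy.
Qed.

(** A common interior point close to both z and w relates the two limits. *)
Lemma limit_step d z yt : polygon d z -> limit d z yt -> exists2 r : R, 0 < r &
  forall w qt, polygon d w -> `|w - z| < r -> limit d w qt -> step yt (w - z) qt.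
Proof.
move=> hz [r r0 hr]; have [e e0 he] := star tsR' yt.
exists (Num.min r e / 2); first by rewrite divr_gt0 // lt_min r0.
move=> w qt hw; rewrite ltr_pdivlMr // => hlt [r' r'0 hr'].
have [e' e'0 he'] := star tsR' qt.
have [|u hu] := inner_near tsP hw (e := Num.min (Num.min r' e') (Num.min r e / 2)).
  by rewrite !lt_min r'0 e'0 divr_gt0 // lt_min r0.
rewrite !lt_min => /andP[/andP[u1 u2] u3].
have uz : `|u - z| < Num.min r e.
  have -> : u - z = (u - w) + (w - z) by veq.
  by apply: (le_lt_trans (ler_normD _ _)); lra.
move: uz; rewrite lt_min => /andP[u4 u5].
have [y hy] := polygon_rep (inner_polygon hu); have [q hq] := lift_ex g' h' (F y).
have s1 := hr _ _ _ hu u4 hy hq; have s2 := hr' _ _ _ hu u1 hy hq.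
have [a [b hb]] := rep_ex q.
exists a, (b - (u - z)); split; first exact: he u5 s1 hb.
have -> : b - (u - z) + (w - z) = b - (u - w) by veq.
exact: he' u2 s2 hb.
Qed.

Lemma limit_next d z yt : limit (next P d) z yt <-> limit d z yt.
Proof.
rewrite /limit inner_next.
by split=> -[r r0 hr]; exists r => // w y qt hw hlt hy; apply: hr => //; apply/rep_next.
Qed.

(** The extensions on the two sides of the edge d of the new surface agree
    at z. *)
Let matched d z := exists yt, limit d z yt /\ limit (opp RP d) (z + @shift R RP d) yt.

(** The new neighbour of k is the former neighbour opp m of m. From both
    sides the limit is the point of the slit k' at the same parameter t,
    once the second one is followed from m to opp m before the surgery and
    from opp m to k after it. *)
Lemma matched_cut (k m : 'I_(nsides P)) (k' m' : 'I_(nsides P')) (t : R) :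
  opp RP k = opp P m -> opp RP' k' = opp P' m' ->
  side k' = side k -> side m' = side m -> side m = side k ->
  (forall (t : R) x, 0 <= t <= 1 -> rep x k (pos k + t *: side k) ->
     rep (F x) k' (pos k' + t *: side k')) ->
  (forall (t : R) x, 0 <= t <= 1 -> rep x m (pos m + t *: side m) ->
     rep (F x) m' (pos m' + t *: side m')) ->
  0 < t < 1 -> matched k (pos k + t *: side k).
Proof.
move=> ok ok' sk sm smk Fk Fm t01.
have t01' : 0 <= t <= 1 by case/andP: t01 => /ltW -> /ltW.
have os' : on_side k' (pos k' + t *: side k') by exists t.
have hp' : @polygon R RP' k' (pos k' + t *: side k') by exact: (on_side_polygon tsP' os').
have [yt hyt] := polygon_rep hp'; exists yt.
have os : on_side k (pos k + t *: side k) by exists t.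
have [x hx] := polygon_rep (on_side_polygon tsP os); split.
  exact: limit_side sk t01 hx (Fk _ _ t01' hx) hyt.
have osm : on_side m (pos m + t *: side m) by exists t.
have [x2 hx2] := polygon_rep (on_side_polygon tsP osm).
have osm' : on_side m' (pos m' + t *: side m') by exists t.
have E : pos k + t *: side k + @shift R RP k = pos (opp P m) + (1 - t) *: side (opp P m).
  have E0 : @pos R RP (next RP (opp P m)) = pos (opp P m) + side (opp P m) := pos_next (opp P m).
  by rewrite /shift ok E0 (side_opp tsP) -smk; veq.
have E' : pos k' + t *: side k' + @shift R RP' k' = pos (opp P' m') + (1 - t) *: side (opp P' m').
  have E0 : @pos R RP' (next RP' (opp P' m')) = pos (opp P' m') + side (opp P' m') := pos_next (opp P' m').
  by rewrite /shift ok' E0 (side_opp tsP') sk sm smk; veq.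
have Em : pos m + t *: side m + shift m = pos (opp P m) + (1 - t) *: side (opp P m).
  by rewrite (pos_opp tsP) (side_opp tsP); veq.
have Em' : pos m' + t *: side m' + shift m' = pos (opp P' m') + (1 - t) *: side (opp P' m').
  by rewrite (pos_opp tsP') (side_opp tsP'); veq.
rewrite E ok; apply: (limit_side (k' := opp P' m') (x := x2)).
- by rewrite (side_opp tsP) (side_opp tsP') sm.
- by case/andP: t01 => ? ?; apply/andP; split; lra.
- by rewrite -Em; exact: rep_on_side.
- by rewrite -Em'; apply: rep_on_side => //; exact: Fm.
- rewrite -E' -ok'; exact: (@rep_on_side _ RP' tsR' yt k' _ os' hyt).
Qed.

Lemma matched_opp d z : on_side d z -> matched d z ->
  matched (opp RP d) (z + @shift R RP d).
Proof.
move=> hz [yt [h1 h2]]; exists yt; split => //.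
by rewrite (oppK tsR) (shift_opp tsR) addrK.
Qed.

(** The interior of an uncut side is off the slits. *)
Lemma matched_uncut d (t : R) : ~~ [|| d == g, d == h, opp P d == g | opp P d == h] ->
  0 < t < 1 -> matched d (pos d + t *: side d).
Proof.
rewrite !negb_or => /and4P[n1 n2 n3 n4] /andP[t0 t1].
have os : on_side d (pos d + t *: side d) by exists t => //; rewrite !ltW.
have [x hx] := polygon_rep (on_side_polygon tsP os).
have [yt hyt] := lift_ex g' h' (F x).
have ne (z : V) : z = pos d + t *: side d -> z <> pos d /\ z <> pos (next P d).
  move=> ->; split=> ez.
    have /eqP : t *: side d = 0 by apply: (addrI (pos d)); rewrite ez addr0.
    by rewrite scaler_eq0 (negPf (side_neq0 tsP d)) orbF gt_eqF.
  have /eqP : (1 - t) *: side d = 0.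
    by rewrite pos_next in ez; apply: (addrI (pos d + t *: side d)); rewrite addr0 {2}ez; veq.
  by rewrite scaler_eq0 (negPf (side_neq0 tsP d)) orbF subr_eq0 gt_eqF.
have [ne1 ne2] := ne _ erefl.
have nvz f : f \in porbit (next P) d -> pos d + t *: side d <> pos f.
  move=> hf ez; have := vertex_on_side tsP hf; rewrite -ez => /(_ os) [] ef; rewrite ef in ez.
  - exact: ne1.
  - exact: ne2.
have nv : ~ vertex x by apply: off_vertex hx nvz.
have ns : ~ slit g h x.
  move=> [k [z [hk osk hxk]]].
  have nkd : k != d by apply/eqP => e; case: hk => e'; [rewrite -e e' eqxx in n1|rewrite -e e' eqxx in n2].
  have nkod : k != opp P d by apply/eqP => e; case: hk => e'; [rewrite -e e' eqxx in n3|rewrite -e e' eqxx in n4].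
  have [[ha ez]|[f [f1 f2 f3 ez]]] := nonvertex_rep tsP nv hx hxk.
    by rewrite ez in osk; case: (two_sides tsP ha nkd os osk).
  have fd : f = d by apply/eqP/negPn/negP => nf; case: (two_sides tsP f1 nf os f3).
  rewrite fd in f2 ez.
  have os2 : on_side (opp P d) z by rewrite ez; exact: on_side_opp.
  case: (two_sides tsP (porbit_symI f2) nkod os2 osk); rewrite ez => e1.
    by apply: ne2; apply: (addIr (shift d)); rewrite e1 (pos_opp tsP) pos_next.
  by apply: ne1; apply: (addIr (shift d)); rewrite e1 /shift; veq.
have eo : opp RP d = opp P d by apply: resew_opp_off.
have es : @shift R RP d = shift d by rewrite /shift eo.
exists yt; rewrite eo es; split; first exact: limit_unslit hx ns hyt.
exact: limit_unslit (rep_on_side tsP os hx) ns hyt.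
Qed.

Lemma matched_inside d (t : R) : 0 < t < 1 -> matched d (pos d + t *: side d).
Proof.
move=> t01.
have sgh2 : side h' = side h by rewrite sgh' sgg.
have [og oh] := (resew_opp_g tsP sgh, resew_opp_h tsP sgh).
have [og' oh'] := (resew_opp_g tsP' sgh', resew_opp_h tsP' sgh').
have M k : (k = g \/ k = h) -> forall s : R, 0 < s < 1 -> matched k (pos k + s *: side k).
  case=> -> s s01.
    by apply: (@matched_cut g h g' h') => //.
  by apply: (@matched_cut h g h' g') => //.
have Mo k : (k = g \/ k = h) -> d = opp RP k -> matched d (pos d + t *: side d).
  move=> hk ->; have s01 : 0 < 1 - t < 1 by case/andP: t01 => ? ?; apply/andP; split; lra.
  have e1 : @side R P (opp RP k) = - side k := side_opp tsR k.
  have e2 : @pos R P (opp RP k) = pos k + side k + @shift R RP k := pos_opp tsR k.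
  rewrite e1 e2 (_ : _ + t *: - side k = pos k + (1 - t) *: side k + @shift R RP k); last by veq.
  apply: matched_opp; last exact: M.
  by exists (1 - t) => //; case/andP: s01 => /ltW -> /ltW.
have [|hn] := boolP [|| d == g, d == h, opp P d == g | opp P d == h]; last exact: matched_uncut.
case/or4P => /eqP e; [by rewrite e; apply: M => //; left|by rewrite e; apply: M => //; right| |].
- by apply: (Mo h); [right | rewrite oh -e (oppK tsP)].
- by apply: (Mo g); [left | rewrite og -e (oppK tsP)].
Qed.

(** The ends of a side, which may be cone points, are reached from its
    interior. *)
Lemma matched_on_side d z yt qt : on_side d z -> limit d z yt ->
  limit (opp RP d) (z + @shift R RP d) qt -> yt = qt.
Proof.
move=> os l1 l2; have [t /andP[t0 t1] ez] := os.
have pz := on_side_polygon tsP os.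
have pz' : polygon (opp RP d) (z + @shift R RP d).
  exact: (on_side_polygon tsR (@on_side_opp _ RP tsR d z os)).
have [r r0 hr] := limit_step pz l1; have [r' r'0 hr'] := limit_step pz' l2.
have [e e0 he] := step_coinj tsR' yt qt.
pose m := Num.min e (Num.min r r'); have m0 : 0 < m by rewrite !lt_min e0 r0.
have n0 : 0 < `|side d| by rewrite normr_gt0 (side_neq0 tsP).
(* a parameter in the open interval, close to t *)
have [s s01 hs] : exists2 s : R, 0 < s < 1 & `|s - t| * `|side d| < m.
  pose a := Num.min (1 / 2) (m / `|side d| / 2).
  have a0 : 0 < a by rewrite lt_min divr_gt0 // !divr_gt0.
  have a1 : a <= 1 / 2 by rewrite ge_min lexx.
  have a2 : a * `|side d| < m.
    have : a <= m / `|side d| / 2 by rewrite ge_min lexx orbT.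
    have : 0 < m / `|side d| by rewrite divr_gt0.
    by rewrite -ltr_pdivlMr //; lra.
  have [th|th] := leP t (1 / 2).
    exists (t + a / 2); first by apply/andP; split; lra.
    have -> : t + a / 2 - t = a / 2 by ring.
    by rewrite gtr0_norm ?divr_gt0 //; nra.
  exists (t - a / 2); first by apply/andP; split; lra.
  have -> : t - a / 2 - t = - (a / 2) by ring.
  by rewrite normrN gtr0_norm ?divr_gt0 //; nra.
have [q [m1 m2]] := matched_inside d s01.
set w := pos d + s *: side d in m1 m2.
have osw : on_side d w by exists s => //; case/andP: s01 => /ltW -> /ltW.
have wz : w - z = (s - t) *: side d by rewrite ez /w; veq.
have : `|w - z| < m by rewrite wz normrZ.
rewrite !lt_min => /andP[w1 /andP[w2 w3]].
have s1 := hr _ _ (on_side_polygon tsP osw) w2 m1.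
have pw' : polygon (opp RP d) (w + @shift R RP d).
  exact: (on_side_polygon tsR (@on_side_opp _ RP tsR d w osw)).
have E : w + @shift R RP d - (z + @shift R RP d) = w - z by veq.
have := hr' _ _ pw' _ m2; rewrite E => /(_ w3) s2.
exact: he w1 s1 s2.
Qed.

(** The extension is characterized by its values off the slits, which are
    those of F; this is what shows that the extensions of F and of its
    inverse are inverse to each other. *)
Lemma resew_map : exists f : surface RP -> surface RP', local_iso f /\
  forall x d z e w (xt : surface RP) yt, ~ slit g h x -> rep x d z -> rep xt d z ->
    rep (F x) e w -> rep yt e w -> f xt = yt.
Proof.
have [n0 _ _ _ _] := tsP; pose d0 := Ordinal n0; have [x0 _] := pt_default tsP d0.
have [q0 _] := lift_ex g' h' (F x0).
pose phi d z := xget q0 [set yt | limit d z yt].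
have phiP d z : polygon d z -> limit d z (phi d z).
  by move=> /limit_ex [yt hyt]; rewrite /phi; case: xgetP => [? -> //|/(_ yt)].
have [|||f [lf fE]] := @map_surface _ RP RP' phi tsR.
- move=> d z hz; have hz' : polygon (next P d) z by rewrite polygon_next.
  by apply: limit_uniq hz (proj1 (limit_next d z _) (phiP _ _ hz')) (phiP _ _ hz).
- move=> d z os; apply/esym/(matched_on_side os); apply: phiP.
    exact: (on_side_polygon tsP os).
  exact: (on_side_polygon tsR (@on_side_opp _ RP tsR d z os)).
- move=> d z hz; have [r r0 hr] := limit_step hz (phiP _ _ hz).
  by exists r => // w hw hlt; exact: hr hw hlt (phiP _ _ hw).
exists f; split=> // x d z e w xt yt ns h1 h2 h3 h4.
rewrite (fE _ _ _ h2); have hz := rep_polygon h1.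
apply: limit_uniq hz (phiP _ _ hz) _.
by apply: limit_unslit h1 ns _; exists e, w.
Qed.

End ResewMap.

(** Surgeries along sides that correspond to each other under an
    isomorphism give isomorphic surfaces: the isomorphism extends
    continuously from the complement of the slits. *)
Theorem resew_isomorphic (R : realType) (P P' : polygon_gluing R)
    (g h : 'I_(nsides P)) (g' h' : 'I_(nsides P'))
    (F : surface P -> surface P') (G : surface P' -> surface P) :
  translation_surface P -> translation_surface P' ->
  translation_surface (resew g h) -> translation_surface (resew g' h') ->
  side h = side g -> side h' = side g' -> side g' = side g ->
  local_iso F -> local_iso G -> cancel F G -> cancel G F ->
  (forall (t : R) x, 0 <= t <= 1 -> rep x g (pos g + t *: side g) ->
     rep (F x) g' (pos g' + t *: side g')) ->
  (forall (t : R) x, 0 <= t <= 1 -> rep x h (pos h + t *: side h) ->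
     rep (F x) h' (pos h' + t *: side h')) ->
  isomorphic (resew g h) (resew g' h').
Proof.
move=> tsP tsP' tsR tsR' sgh sgh' sgg lF lG FK GK Fg Fh.
have back (k : 'I_(nsides P)) (k' : 'I_(nsides P')) :
    (forall (t : R) x, 0 <= t <= 1 -> rep x k (pos k + t *: side k) ->
     rep (F x) k' (pos k' + t *: side k')) ->
    forall (t : R) y, 0 <= t <= 1 -> rep y k' (pos k' + t *: side k') ->
     rep (G y) k (pos k + t *: side k).
  move=> Fk t y t01 hy.
  have os : on_side k (pos k + t *: side k) by exists t.
  have [x hx] := polygon_rep (on_side_polygon tsP os).
  by rewrite (rep_fun hy (Fk _ _ t01 hx)) FK.
have Gg := back _ _ Fg; have Gh := back _ _ Fh.
have [f [lf fE]] := resew_map tsP tsP' sgh sgh' sgg tsR tsR' lF FK Fg Fh.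
have [f' [lf' fE']] := resew_map tsP' tsP sgh' sgh (esym sgg) tsR' tsR lG GK Gg Gh.
(* Both composites are the identity at interior points, and every point is
   a limit of such points. *)
have comp (Q Q' : polygon_gluing R) (a b : 'I_(nsides Q)) (a' b' : 'I_(nsides Q'))
   (H : surface Q -> surface Q') (H' : surface Q' -> surface Q)
   (f1 : surface (resew a b) -> surface (resew a' b')) (f2 : surface (resew a' b') -> surface (resew a b)) :
   translation_surface Q -> translation_surface (resew a b) -> cancel H H' -> cancel H' H ->
   local_iso f1 -> local_iso f2 ->
   (forall x, ~ slit a b x -> ~ slit a' b' (H x)) ->
   (forall x d z e w (xt : surface (resew a b)) (yt : surface (resew a' b')), ~ slit a b x -> rep x d z -> rep xt d z ->
      rep (H x) e w -> rep yt e w -> f1 xt = yt) ->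
   (forall x d z e w (xt : surface (resew a' b')) (yt : surface (resew a b)), ~ slit a' b' x -> rep x d z -> rep xt d z ->
      rep (H' x) e w -> rep yt e w -> f2 xt = yt) -> cancel f1 f2.
  move=> tsQ tsQR HK HK' l1 l2 hs E1 E2 xt; have [d [z hx]] := rep_ex xt.
  have [e e0 he] := local_iso_comp l1 l2 xt.
  have [r r0 hr] := step_coinj tsQR (f2 (f1 xt)) xt.
  have hz : @polygon _ Q d z := rep_polygon hx.
  have [|w hw] := inner_near tsQ hz (e := Num.min e r); first by rewrite lt_min e0.
  rewrite lt_min => /andP[w1 w2].
  have [y hy] := polygon_rep (inner_polygon hw).
  have [yt hyt] : exists yt : surface (resew a b), rep yt d w by exact: polygon_rep (inner_polygon hw : @polygon _ (resew a b) d w).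
  have ns : ~ slit a b y by exact: inner_slit hw hy.
  have [c [u hu]] := rep_ex (H y).
  have [qt hq] : exists qt : surface (resew a' b'), rep qt c u by exact: polygon_rep (rep_polygon hu : @polygon _ (resew a' b') c u).
  have e1 : f1 yt = qt by exact: E1 ns hy hyt hu hq.
  have e2 : f2 qt = yt by apply: E2 (hs _ ns) hu hq _ hyt; rewrite HK.
  have s1 := rep_step hx hyt.
  have := he _ _ w1 s1; rewrite /= e1 e2 => s2.
  exact: hr w2 s2 s1.
apply: (local_iso_isomorphic tsR tsR' lf lf').
- by apply: (comp _ _ _ _ _ _ F G) => // x ns; exact: (slit_map tsP FK Fg Fh ns).
- by apply: (comp _ _ _ _ _ _ G F) => // x ns; exact: (slit_map tsP' GK Gg Gh ns).
Qed.

(** * Angles and fans of corners *)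

Section Angles.
Variable R : realType.
Local Notation V := (R * R)%type.
Implicit Types (u v w p q : V) (a b : R).

(** The rotation of angle a. *)
Definition rt a u : V := (cos a * u.1 - sin a * u.2, sin a * u.1 + cos a * u.2).

Lemma rt0 u : rt 0 u = u.
Proof. by apply: vec_eq; rewrite /rt /= cos0 sin0; ring. Qed.

Lemma rtD a b u : rt a (rt b u) = rt (a + b) u.
Proof. by apply: vec_eq; rewrite /rt /= cosD sinD; ring. Qed.

Lemma rtZ a (t : R) u : rt a (t *: u) = t *: rt a u.
Proof. by apply: vec_eq; rewrite /rt /= ?scale_mul; ring. Qed.

Lemma rtpi u : rt pi u = - u.
Proof. by apply: vec_eq; rewrite /rt /= cospi sinpi; ring. Qed.

Lemma cs a : cos a * cos a + sin a * sin a = 1 :> R.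
Proof. by have := cos2Dsin2 a; rewrite !expr2. Qed.

Lemma cross_rt a b u : cross (rt a u) (rt b u) = sin (b - a) * dot u u.
Proof. by rewrite /cross /rt /dot /= sinB; ring. Qed.

Lemma dot_rt a b u : dot (rt a u) (rt b u) = cos (b - a) * dot u u.
Proof. by rewrite /rt /dot /= cosB; ring. Qed.

Lemma dot_gt0 u : u != 0 -> 0 < dot u u.
Proof.
move=> u0; rewrite /dot lt_neqAle; apply/andP; split; last by nra.
apply/eqP => h; move/eqP: u0; apply.
have h1 : u.1 * u.1 = 0 by nra.
have h2 : u.2 * u.2 = 0 by nra.
by apply: vec_eq => /=; [move/eqP: h1|move/eqP: h2]; rewrite mulf_eq0 orbb => /eqP.
Qed.

Lemma enorm_gt0 u : u != 0 -> 0 < enorm u.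
Proof. by move=> /dot_gt0 h; rewrite sqrtr_gt0. Qed.

Lemma enorm_sqr u : enorm u * enorm u = dot u u.
Proof. by rewrite -expr2 sqr_sqrtr // /dot; nra. Qed.

Lemma angle_arg u v : u != 0 -> v != 0 -> -1 <= dot u v / (enorm u * enorm v) <= 1.
Proof.
move=> u0 v0; have n1 := enorm_gt0 u0; have n2 := enorm_gt0 v0.
have m0 : 0 < enorm u * enorm v by rewrite mulr_gt0.
have h : dot u v * dot u v <= (enorm u * enorm v) * (enorm u * enorm v).
  have -> : (enorm u * enorm v) * (enorm u * enorm v) = (enorm u * enorm u) * (enorm v * enorm v) by ring.
  by rewrite !enorm_sqr /dot; have := sqr_ge0 (cross u v); rewrite /cross expr2; nra.
rewrite -ler_norml normrM normfV (gtr0_norm m0) ler_pdivrMr // mul1r.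
by rewrite ler_norml; apply/andP; split; rewrite leNgt; apply/negP => hh; nra.
Qed.

Lemma angle_ge0 u v : u != 0 -> v != 0 -> 0 <= angle u v.
Proof. by move=> u0 v0; apply: acos_ge0; exact: angle_arg. Qed.

Lemma angle_lepi u v : u != 0 -> v != 0 -> angle u v <= pi.
Proof. by move=> u0 v0; apply: acos_lepi; exact: angle_arg. Qed.

Lemma angle_polar u v : u != 0 -> v != 0 -> 0 <= cross u v ->
  exists2 l : R, 0 < l & v = l *: rt (angle u v) u.
Proof.
move=> u0 v0 c0; have n1 := enorm_gt0 u0; have n2 := enorm_gt0 v0.
have m0 : 0 < enorm u * enorm v by rewrite mulr_gt0.
have d0 := dot_gt0 u0.
have ha := angle_arg u0 v0.
have hc : cos (angle u v) = dot u v / (enorm u * enorm v).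
  by rewrite /angle acosK // in_itv.
have hs : sin (angle u v) = cross u v / (enorm u * enorm v).
  rewrite /angle sin_acos //.
  have -> : 1 - (dot u v / (enorm u * enorm v)) ^+ 2 = (cross u v / (enorm u * enorm v)) ^+ 2.
    have E : dot u v ^+ 2 + cross u v ^+ 2 = (enorm u * enorm v) ^+ 2.
      by rewrite exprMn !(expr2 (enorm _)) !enorm_sqr /dot /cross; ring.
    by rewrite !expr_div_n -E; field; rewrite E expf_neq0 // gt_eqF.
  by rewrite sqrtr_sqr ger0_norm // divr_ge0 // ltW.
exists (enorm v / enorm u); first by rewrite divr_gt0.
have m1 : enorm u != 0 by rewrite gt_eqF.
have m2 : enorm v != 0 by rewrite gt_eqF.
have es : enorm u ^+ 2 = dot u u by rewrite expr2 enorm_sqr.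
apply: vec_eq; rewrite /rt /= hc hs ?scale_mul.
  have -> : enorm v / enorm u * (dot u v / (enorm u * enorm v) * u.1 - cross u v / (enorm u * enorm v) * u.2)
    = (dot u v * u.1 - cross u v * u.2) / enorm u ^+ 2 by field; rewrite m1 m2.
  apply: (mulIf (_ : enorm u ^+ 2 != 0)); first by rewrite expf_neq0.
  by rewrite divfK ?expf_neq0 // es /dot /cross; ring.
have -> : enorm v / enorm u * (cross u v / (enorm u * enorm v) * u.1 + dot u v / (enorm u * enorm v) * u.2)
    = (cross u v * u.1 + dot u v * u.2) / enorm u ^+ 2 by field; rewrite m1 m2.
apply: (mulIf (_ : enorm u ^+ 2 != 0)); first by rewrite expf_neq0.
by rewrite divfK ?expf_neq0 // es /dot /cross; ring.
Qed.

Lemma angle_rt u a (l : R) : u != 0 -> 0 < l -> 0 <= a <= pi -> angle u (l *: rt a u) = a.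
Proof.
move=> u0 l0 ha; have d0 := dot_gt0 u0; have n1 := enorm_gt0 u0.
have dl w : dot (l *: w) (l *: w) = l * l * dot w w by rewrite /dot /= !scale_mul; ring.
have en : enorm (l *: rt a u) = l * enorm u.
  rewrite /enorm dl dot_rt subrr cos0 mul1r sqrtrM; last by nra.
  by rewrite -expr2 sqrtr_sqr gtr0_norm.
have du : dot u (l *: rt a u) = l * cos a * dot u u.
  by rewrite /dot /rt /= !scale_mul; ring.
rewrite /angle en du -enorm_sqr.
have -> : l * cos a * (enorm u * enorm u) / (enorm u * (l * enorm u)) = cos a.
  by field; rewrite !gt_eqF.
by rewrite cosK // in_itv.
Qed.

Lemma sin_lt0_pi2 a : pi < a < pi + pi -> sin a < 0 :> R.
Proof.
move=> /andP[a1 a2]; have : 0 < sin (a - pi).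
  by apply: sin_gt0_pi; apply/andP; split; lra.
by rewrite sinB cospi sinpi; lra.
Qed.

Lemma cross_neq0 u v : 0 < cross u v -> u != 0 /\ v != 0.
Proof.
move=> h; split; apply/eqP => h0; move: h; rewrite h0 ?cross0r ?ltxx //.
by rewrite crossC cross0r oppr0 ltxx.
Qed.

Lemma cross_Zrt u (l m : R) a b :
  cross (l *: rt a u) (m *: rt b u) = l * m * (sin (b - a) * dot u u).
Proof. by rewrite -cross_rt; vring. Qed.

Lemma angle_gt0_ltpi u v : 0 < cross u v -> 0 < angle u v < pi.
Proof.
move=> c0; have [u0 v0] := cross_neq0 c0.
have a0 := angle_ge0 u0 v0; have a1 := angle_lepi u0 v0.
have [l l0 hl] := angle_polar u0 v0 (ltW c0).
have : cross u v = l * (sin (angle u v) * dot u u).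
  by rewrite {1}hl -{1}(rt0 u) -(scale1r (rt 0 u)) cross_Zrt subr0 mul1r.
rewrite !lt_neqAle a0 a1 !andbT => E; apply/andP; split; apply/eqP => h; move: E.
  by rewrite -h sin0 mul0r mulr0 => h2; move: c0; rewrite h2 ltxx.
by rewrite h sinpi mul0r mulr0 => h2; move: c0; rewrite h2 ltxx.
Qed.

Lemma angle_add u v w : 0 < cross u v -> 0 < cross v w -> 0 <= cross u w ->
  angle u v + angle v w = angle u w.
Proof.
move=> c1 c2 c3; have [u0 v0] := cross_neq0 c1; have [_ w0] := cross_neq0 c2.
have [l l0 hl] := angle_polar u0 v0 (ltW c1).
have [m m0 hm] := angle_polar v0 w0 (ltW c2).
have /andP[a1 a2] := angle_gt0_ltpi c1; have /andP[b1 b2] := angle_gt0_ltpi c2.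
have hw : w = (m * l) *: rt (angle u v + angle v w) u.
  by rewrite {1}hm {2}hl rtZ rtD scalerA [angle v w + _]addrC.
apply/esym; rewrite {1}hw angle_rt ?mulr_gt0 //; apply/andP; split; first lra.
rewrite leNgt; apply/negP => h.
have hs : sin (angle u v + angle v w) < 0 by apply: sin_lt0_pi2; apply/andP; split; lra.
move: c3; rewrite {1}hw -{1}(rt0 u) -{1}(scale1r (rt 0 u)) cross_Zrt subr0 mul1r.
have d0 := dot_gt0 u0; have ml : 0 < m * l by rewrite mulr_gt0.
by rewrite pmulr_rge0 // pmulr_lge0 //; lra.
Qed.

Lemma angle_opp u (l : R) : u != 0 -> 0 < l -> angle u (- (l *: u)) = pi.
Proof.
move=> u0 l0; have -> : - (l *: u) = l *: rt pi u by rewrite rtpi scalerN.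
by apply: angle_rt => //; rewrite pi_ge0 lexx.
Qed.

(** Angles of consecutive vectors of a fan add up to pi when the last
    vector is opposite to the first. The angles at the vertices of the
    two-cylinder surfaces are sums of such half-turns between horizontal
    rays. *)
Lemma half_turn2 u v (l : R) : 0 < cross u v -> 0 < l ->
  angle u v + angle v (- (l *: u)) = pi.
Proof.
move=> c l0; have [u0 _] := cross_neq0 c; rewrite -(angle_opp u0 l0).
apply: angle_add => //; rewrite crossNr crossZr ?crossvv ?mulr0 ?oppr0 //.
by rewrite -mulrN -crossC mulr_gt0.
Qed.

Lemma half_turn3 u v w (l : R) : 0 < cross u v -> 0 < cross v w -> 0 < cross u w -> 0 < l ->
  angle u v + angle v w + angle w (- (l *: u)) = pi.
Proof. by move=> c1 c2 c3 l0; rewrite (angle_add c1 c2 (ltW c3)) half_turn2. Qed.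

Lemma angleN u v : angle (- u) (- v) = angle u v.
Proof.
rewrite /angle; have -> : dot (- u) (- v) = dot u v by rewrite /dot /=; ring.
have E z : enorm (- z) = enorm z by rewrite /enorm; congr Num.sqrt; rewrite /dot /=; ring.
by rewrite !E.
Qed.

(** The angles of a triangle. *)
Lemma triangle_angles u v w : u + v + w = 0 -> 0 < cross u v ->
  angle u (- w) + angle v (- u) + angle w (- v) = pi.
Proof.
move=> h c.
have hw : w = - (u + v) by apply/eqP; rewrite -addr_eq0 addrC h.
have c1 : 0 < cross u (- w) by rewrite hw opprK crossDr crossvv add0r.
have c2 : 0 < cross (- w) v.
  by rewrite hw opprK (_ : cross (u + v) v = cross u v) //; vring.
have := half_turn3 c1 c2 c ltr01; rewrite scale1r => <-.
by rewrite -(angleN w (- v)) opprK; ring.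
Qed.

Lemma sector_angle p q u : 0 < cross p q -> u != 0 -> 0 <= cross p u -> 0 <= cross u q ->
  exists (l a : R), [/\ 0 < l, 0 <= a <= angle p q, u = l *: rt a p &
    a = angle p q -> cross u q = 0].
Proof.
move=> c u0 c1 c2; have [p0 q0] := cross_neq0 c.
have [l l0 hl] := angle_polar p0 u0 c1; have [m m0 hm] := angle_polar p0 q0 (ltW c).
have a0 := angle_ge0 p0 u0; have a1 := angle_lepi p0 u0.
have /andP[b0 b1] := angle_gt0_ltpi c.
have E : cross u q = l * m * (sin (angle p q - angle p u) * dot p p).
  by rewrite {1}hl {1}hm cross_Zrt.
exists l, (angle p u); split => //; last by move=> ea; rewrite E ea subrr sin0 mul0r mulr0.
rewrite a0 leNgt; apply/negP => h; move: c2; rewrite E.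
have lm : 0 < l * m by rewrite mulr_gt0.
have d0 := dot_gt0 p0.
rewrite pmulr_rge0 // pmulr_lge0 // -opprB sinN oppr_ge0 leNgt.
by rewrite sin_gt0_pi //; apply/andP; split; lra.
Qed.

End Angles.

Section Fans.
Variables (R : realType) (P : polygon_gluing R) (tsP : translation_surface P).
Local Notation V := (R * R)%type.
Local Notation I := 'I_(nsides P).
Implicit Types (d e : I) (x y : surface P) (u v : V) (i j k : nat).

Lemma side_rot d : side (rot P d) = - side (((next P)^-1)%g d).
Proof. by rewrite rotE (side_opp tsP). Qed.

Lemma cross_side_rot d : 0 < cross (side d) (side (rot P d)).
Proof.
by rewrite side_rot crossNr -crossC; have := turn_left tsP (((next P)^-1)%g d); rewrite permKV.
Qed.

Lemma cornerE d : corner d = angle (side d) (side (rot P d)).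
Proof. by rewrite side_rot. Qed.

Lemma corner_bounds d : 0 < corner d < pi.
Proof. by rewrite cornerE; apply: angle_gt0_ltpi; exact: cross_side_rot. Qed.

Definition sweep k d : R := \sum_(i < k) corner (iter i (rot P) d).

Lemma sweepS k d : sweep k.+1 d = sweep k d + corner (iter k (rot P) d).
Proof. by rewrite /sweep big_ord_recr. Qed.

Lemma sweep0 d : sweep 0 d = 0.
Proof. by rewrite /sweep big_ord0. Qed.

Lemma sweep_lt i j d : (i < j)%N -> sweep i d < sweep j d.
Proof.
elim: j => // j IH; rewrite ltnS leq_eqVlt sweepS => /orP[/eqP ->|/IH h].
  by rewrite ltrDl; case/andP: (corner_bounds (iter j (rot P) d)).
by have /andP[h1 _] := corner_bounds (iter j (rot P) d); lra.
Qed.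

Lemma sweep_le i j d : (i <= j)%N -> sweep i d <= sweep j d.
Proof. by rewrite leq_eqVlt => /orP[/eqP ->//|/(sweep_lt d) /ltW]. Qed.

(** The directions of the sides met around a vertex are obtained by adding
    up the corners. *)
Lemma side_sweep k d : exists2 l : R, 0 < l & side (iter k (rot P) d) = l *: rt (sweep k d) (side d).
Proof.
elim: k => [|k [l l0 hl]]; first by exists 1; rewrite ?ltr01 // scale1r sweep0 rt0.
have c := cross_side_rot (iter k (rot P) d); have [n1 n2] := cross_neq0 c.
have [m m0 hm] := angle_polar n1 n2 (ltW c).
exists (m * l); first exact: mulr_gt0.
by rewrite -cornerE in hm; rewrite iterS hm hl rtZ rtD scalerA sweepS [corner _ + _]addrC.
Qed.

Lemma cross_corner d u : polygon d (pos d + u) ->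
  0 <= cross (side d) u /\ 0 <= cross u (side (rot P d)).
Proof.
move=> h; split.
  by have := h d (porbit_id _ _); rewrite (_ : pos d + u - pos d = u) //; veq.
have := h _ (prev_porbit d); have := pos_next (((next P)^-1)%g d); rewrite permKV => e1.
have -> : pos d + u - pos (((next P)^-1)%g d) = u + side (((next P)^-1)%g d) by rewrite e1; veq.
by rewrite side_rot crossNr -crossC crossDr crossvv addr0.
Qed.

(** A point of the corner of d which is not to the right of the last ray is
    on that ray, hence in the next corner too. *)
Lemma rep_ray x d u : rep x d (pos d + u) -> cross u (side (rot P d)) <= 0 ->
  rep x (rot P d) (pos (rot P d) + u).
Proof.
move=> hx; rewrite side_rot crossNr -crossC => c.
set p := ((next P)^-1)%g d in c; have hp : next P p = d by rewrite permKV.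
have ep : pos d = pos p + side p by rewrite -hp pos_next.
have hx' : rep x p (pos d + u) by apply/rep_next; rewrite hp.
have os : on_side p (pos d + u).
  apply: (line_on_side tsP); first exact: rep_polygon hx'.
  have -> : pos d + u - pos p = side p + u by rewrite ep; veq.
  by rewrite crossDr crossvv add0r.
have := rep_on_side tsP os hx'.
by rewrite rotE -/p (pos_opp tsP); congr rep; rewrite ep; veq.
Qed.

Lemma porbit_iter d e : e \in porbit (rot P) d ->
  exists2 i, (i < #|porbit (rot P) d|)%N & e = iter i (rot P) d.
Proof. by rewrite porbit_traject => /trajectP. Qed.

Lemma cone_angle_sweep d : cone_angle d = sweep #|porbit (rot P) d| d.
Proof.
have E k e : \sum_(f <- traject (rot P) e k) corner f = sweep k e.
  elim: k e => [|k IH] e; first by rewrite big_nil sweep0.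
  rewrite /= big_cons IH /sweep big_ord_recl /=; congr (_ + _).
  by apply: eq_bigr => i _; rewrite -iterSr.
rewrite -E /cone_angle big_uniq ?uniq_traject_porbit //=.
by apply: eq_bigl => f; rewrite porbit_traject.
Qed.

Lemma iter_card_porbit d : iter #|porbit (rot P) d| (rot P) d = d.
Proof. by rewrite -permX permX iter_porbit. Qed.

(** When the corners at a vertex add up to a full turn they are the sectors
    of a disc, which only meet along the rays glued together. *)
Lemma full_turn_regular x d : rep x d (pos d) -> cone_angle d = 2 * pi -> regular x.
Proof.
move=> hx; rewrite cone_angle_sweep; set n := #|_| => hn.
have d0 := side_neq0 tsP d.
exists 1 => // u y y' _ s1 s2.
have [u0|u0] := eqVneq u 0.
  by rewrite u0 in s1 s2; rewrite (step_0_eq s1) (step_0_eq s2).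
(* Polar coordinates of u, the angle being the sum of the corners before
   the one that contains u and of an angle in it. *)
have sector z : step x u z -> exists i (l a : R),
    [/\ (i < n)%N, rep z (iter i (rot P) d) (pos (iter i (rot P) d) + u),
        0 <= a <= corner (iter i (rot P) d),
        0 < l /\ u = l *: rt (sweep i d + a) (side d) &
        a = corner (iter i (rot P) d) ->
          rep z (iter i.+1 (rot P) d) (pos (iter i.+1 (rot P) d) + u)].
  move=> [e [w [h1 h2]]]; have [f [f1 f2 ew]] := vertex_rep tsP hx h1.
  have [i hi ef] := porbit_iter f1; exists i.
  have hz : rep z f (pos f + u) by rewrite -ew; apply/(rep_porbit _ _ f2).
  have [c1 c2] := cross_corner (rep_polygon hz).
  have [l [a [l0 ha hu hc]]] := sector_angle (cross_side_rot f) u0 c1 c2.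
  have [m m0 hm] := side_sweep i d.
  exists (l * m), a; rewrite -ef; split => //; first by rewrite cornerE.
    split; first exact: mulr_gt0.
    by rewrite hu ef hm rtZ rtD scalerA addrC.
  rewrite cornerE => /hc c0; rewrite iterS -ef; apply: rep_ray => //.
  by rewrite c0.
have [i [l [a [i1 i2 i3 [i4 i5] i6]]]] := sector y s1.
have [j [m [b [j1 j2 j3 [j4 j5] j6]]]] := sector y' s2.
wlog ij : y y' s1 s2 i l a j m b i1 i2 i3 i4 i5 i6 j1 j2 j3 j4 j5 j6 / (i <= j)%N => [W|].
  have [h|h] := leqP i j; first exact: (W y y' s1 s2 i l a j m b).
  by apply/esym; apply: (W y' y s2 s1 j m b i l a) => //; exact: ltnW.
move: ij; rewrite leq_eqVlt => /orP[/eqP ij|ij].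
  by rewrite ij in i2; exact: rep_fun i2 j2.
set A := sweep i d + a in i5; set B := sweep j d + b in j5.
have A0 : 0 <= A.
  have := sweep_le d (leq0n i); rewrite sweep0 /A; case/andP: i3; lra.
have Ai : A <= sweep i.+1 d by rewrite sweepS /A; case/andP: i3; lra.
have ij' := sweep_le d ij.
have Bj : sweep j d <= B by rewrite /B; case/andP: j3; lra.
have Bj' : B <= sweep j.+1 d by rewrite sweepS /B; case/andP: j3; lra.
have jn := sweep_le d j1; rewrite hn in jn.
have dd := dot_gt0 d0.
have lm : 0 < l * m by rewrite mulr_gt0.
have hs : sin (B - A) = 0.
  have : cross u u = l * m * (sin (B - A) * dot (side d) (side d)).
    by rewrite {1}i5 j5 cross_Zrt.
  rewrite crossvv => E; apply: (mulfI (lt0r_neq0 lm)); apply: (mulIf (lt0r_neq0 dd)).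
  by rewrite mulr0 mul0r -mulrA.
have hc : 0 < cos (B - A).
  have : dot u u = l * m * (cos (B - A) * dot (side d) (side d)).
    by rewrite {1}i5 {1}j5 -dot_rt /dot /= !scale_mul; ring.
  have := dot_gt0 u0 => /[swap] ->.
  by rewrite pmulr_rgt0 // pmulr_lgt0.
(* Two polar angles of the same vector in a full turn: equal, or at its two
   ends. *)
have [BA|BA] : B = A \/ B - A = 2 * pi.
  have [h|h] := eqVneq B A; [by left | right].
  have BA0 : 0 < B - A by rewrite subr_gt0 lt_neqAle eq_sym h; lra.
  have [h1|h1|h1] := ltgtP (B - A) pi.
  - by have := @sin_gt0_pi R (B - A); rewrite BA0 h1 hs ltxx => /(_ isT).
  - apply/eqP; rewrite eq_le; apply/andP; split; first lra.
    rewrite leNgt; apply/negP => h2.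
    have h3 : B - A < pi + pi by lra.
    by have := @sin_lt0_pi2 R (B - A); rewrite h1 h3 hs ltxx => /(_ isT).
  - by move: hc; rewrite h1 cospi ltr0N1.
- have ji : j = i.+1.
    apply/eqP; rewrite eqn_leq ij andbT leqNgt; apply/negP => h.
    by have := sweep_lt d h; lra.
  have ea : a = corner (iter i (rot P) d) by move: Ai Bj ij' BA i3; rewrite sweepS /A => ? ? ? ? /andP[]; lra.
  by have := i6 ea; rewrite -ji => h; exact: rep_fun h j2.
- have si := sweep_le d (leq0n i); rewrite sweep0 in si.
  have /andP[a0 _] := i3; have /andP[b0 bc] := j3.
  have i0 : i = 0%N.
    apply/eqP; rewrite -leqn0 leqNgt; apply/negP => /(sweep_lt d); rewrite sweep0.
    by move: BA Bj' jn; rewrite /A; lra.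
  have jS : j.+1 = n.
    apply/eqP; rewrite eqn_leq j1 leqNgt /=; apply/negP => /(sweep_lt d).
    by move: BA A0 Bj' jn; rewrite hn; lra.
  have eb : b = corner (iter j (rot P) d).
    by move: BA A0 Bj' jn; rewrite sweepS /B; lra.
  have := j6 eb; rewrite jS iter_card_porbit => h.
  by rewrite i0 in i2; exact: rep_fun i2 h.
Qed.

(** Near its vertex a polygon is the sector between its two sides. *)
Lemma sector_polygon d : exists2 r : R, 0 < r & forall u, `|u| < r ->
  0 <= cross (side d) u -> 0 <= cross u (side (rot P d)) -> polygon d (pos d + u).
Proof.
have [||r r0 hr] := @fin_unif R I (fun e r => e \in porbit (next P) d -> e != d -> next P e != d ->
   forall u, `|u| < r -> 0 <= cross (side e) (pos d + u - pos e)).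
- by move=> e r r' h _ le h1 h2 h3 u hu; apply: h => //; exact: lt_le_trans le.
- move=> e; have [|] := boolP [&& e \in porbit (next P) d, e != d & next P e != d]; last first.
    by move=> /negP h; exists 1 => // h1 h2 h3; case: h; rewrite h1 h2.
  move=> /and3P[h1 h2 h3].
  have c : 0 < cross (side e) (pos d - pos e).
    by apply: vertex_left => //; rewrite 1?porbit_sym // eq_sym.
  have b0 : 0 < `|(side e).1| + `|(side e).2| + 1 by rewrite ltr_wpDl ?ltr01 // addr_ge0.
  exists (cross (side e) (pos d - pos e) / (`|(side e).1| + `|(side e).2| + 1)); first by rewrite divr_gt0.
  move=> _ _ _ u hu; have := cross_le (side e) (_ : `|- u| < _); rewrite normrN => /(_ _ hu).
  set c' := cross _ _ in c hu *; rewrite crossNr => h.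
  have -> : cross (side e) (pos d + u - pos e) = c' + cross (side e) u by rewrite /c'; vring.
  have e1 : (`|(side e).1| + `|(side e).2| + 1) * (c' / (`|(side e).1| + `|(side e).2| + 1)) = c'.
    by rewrite mulrC divfK // gt_eqF.
  have : 0 < c' / (`|(side e).1| + `|(side e).2| + 1) by rewrite divr_gt0.
  by lra.
exists r => // u hu c1 c2 e he.
have [->|n1] := eqVneq e d; first by have -> : pos d + u - pos d = u by veq.
have [n2|n2] := eqVneq (next P e) d; last exact: hr.
have ep : ((next P)^-1)%g d = e by rewrite -n2 permK.
move: c2; rewrite side_rot ep crossNr -crossC.
have -> : pos d + u - pos e = side e + u by rewrite -n2 pos_next; veq.
by rewrite crossDr crossvv add0r.
Qed.

(** The fan of three corners from q, developed in the plane as a map from a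
    half-disc. Three corners suffice for the half-turns of the two-cylinder
    surfaces. *)
Definition half_disc q u := let q2 := rot P q in let q3 := rot P q2 in
  if 0 <= cross (- side q2) (u - 0) then pt tsP q (pos q + u)
  else if 0 <= cross (- side q3) (u - 0) then pt tsP q2 (pos q2 + u)
  else pt tsP q3 (pos q3 + u).

Lemma half_disc_immersion q (l : R) : 0 < l ->
  side (rot P (rot P (rot P q))) = - (l *: side q) ->
  exists2 r : R, 0 < r &
    immersion [set u | `|u| < r /\ 0 <= cross (side q) u] (half_disc q).
Proof.
move=> l0; set q2 := rot P q; set q3 := rot P q2 => hq4.
have [r1 r10 h1] := sector_polygon q; have [r2 r20 h2] := sector_polygon q2.
have [r3 r30 h3] := sector_polygon q3.
pose r := Num.min r1 (Num.min r2 r3).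
have rr1 : r <= r1 by rewrite ge_min lexx.
have rr2 : r <= r2 by rewrite !ge_min lexx orbT.
have rr3 : r <= r3 by rewrite !ge_min lexx !orbT.
have s2 : side q2 = side (rot P q) by []. have s3 : side q3 = side (rot P q2) by [].
exists r; first by rewrite !lt_min r10 r20.
set K := [set u | _].
have c12 := cross_side_rot q; have c23 := cross_side_rot q2.
have mem1 u : K u -> cross (side q2) u <= 0 -> polygon q (pos q + u).
  by move=> [hu c] c2; apply: h1 => //; [exact: lt_le_trans rr1 | rewrite crossC oppr_ge0].
have mem2 u : K u -> 0 <= cross (side q2) u -> cross (side q3) u <= 0 -> polygon q2 (pos q2 + u).
  by move=> [hu c] c2 c3; apply: h2 => //; [exact: lt_le_trans rr2 | rewrite crossC oppr_ge0].
have mem3 u : K u -> 0 <= cross (side q3) u -> polygon q3 (pos q3 + u).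
  move=> [hu c] c3; apply: h3 => //; first exact: lt_le_trans rr3.
  rewrite hq4 crossNr -crossC (_ : cross (l *: side q) u = l * cross (side q) u); last by vring.
  by rewrite mulr_ge0 // ltW.
have imm (d : I) K' : (forall u, K' u -> polygon d (pos d + u)) -> immersion K' (fun u => pt tsP d (pos d + u)).
  move=> h; have h' := immersion_shift (c := pos d) (@pt_immersion _ _ tsP d).
  apply: (immersion_eq_in (phi := fun u => pt tsP d (u + pos d))); first by move=> u _; rewrite addrC.
  by apply: immersionS h' => u /h; rewrite addrC.
have E d u : cross (- side d) (u - 0) = - cross (side d) u by rewrite subr0 crossNl.
apply: immersion_split.
- by apply: imm => u [Ku]; rewrite E oppr_ge0; exact: mem1.
- apply: immersion_split.
  + by apply: imm => u [[Ku]]; rewrite !E oppr_le0 oppr_ge0; exact: mem2.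
  + by apply: imm => u [[Ku _]]; rewrite E oppr_le0; exact: mem3.
  + move=> u [Ku]; rewrite !E oppr_le0 => c2 /eqP; rewrite oppr_eq0 => /eqP c3.
    have hp : polygon q2 (pos q2 + u) by apply: mem2; rewrite ?c3.
    apply: rep_pt; apply: rep_ray; first exact: pt_rep.
    by rewrite crossC c3 oppr0.
- move=> u Ku; rewrite !E => /eqP; rewrite oppr_eq0 => /eqP c2.
  have hp : polygon q (pos q + u) by apply: mem1; rewrite ?c2.
  have c3 : cross (side q3) u <= 0.
    have := cross_basis (side q) (side q2) u.
    rewrite [cross u _]crossC c2 oppr0 scale0r add0r => hu.
    have := crossZr (side q3) (cross (side q) (side q2)) u; rewrite hu crossZr => e1.
    have : cross (side q) (side q2) * cross (side q3) u <= 0.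
      rewrite -e1 [cross (side q3) _]crossC mulrN oppr_le0 mulr_ge0 //; last exact: ltW.
      by case: Ku.
    by rewrite pmulr_rle0.
  rewrite oppr_ge0 c3; apply: rep_pt; apply: rep_ray; first exact: pt_rep.
  by rewrite crossC c2 oppr0.
Qed.

End Fans.

Section Turn.
Variables (R : realType) (P Q : polygon_gluing R).
Hypotheses (tsP : translation_surface P) (tsQ : translation_surface Q).
Variables (F : surface P -> surface Q) (lF : local_iso F).
Local Notation V := (R * R)%type.

(** A local isometry maps half-turns to half-turns: F restricted to the
    successive corners of the first fan agrees with [half_disc] by unique
    continuation, ray after ray. The first fan may consist of any number of
    corners, since the surface P is arbitrary. *)
Lemma local_iso_half_turn (e : 'I_(nsides P)) (q : 'I_(nsides Q)) k (c l : R) :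
  sweep k e = pi -> 0 < c -> side q = c *: side e ->
  0 < cross (side q) (side (rot Q (rot Q q))) -> 0 < l ->
  side (rot Q (rot Q (rot Q q))) = - (l *: side q) ->
  (exists2 r : R, 0 < r & forall (t : R) x, 0 < t < r -> rep x e (pos e + t *: side e) ->
     rep (F x) q (pos q + t *: side e)) ->
  exists2 r : R, 0 < r & forall (t : R) x, 0 < t < r ->
     rep x (iter k (rot P) e) (pos (iter k (rot P) e) - t *: side e) ->
     rep (F x) (rot Q (rot Q (rot Q q))) (pos (rot Q (rot Q (rot Q q))) - t *: side e).
Proof.
move=> hk c0 hq c13 l0 hq4 start.
pose u i := side (iter i (rot P) e).
have e0 := side_neq0 tsP e.
have dir i : (i <= k)%N -> 0 <= cross (side e) (u i).
  move=> ik; have [m m0 hm] := side_sweep tsP i e.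
  rewrite /u hm -{1}(scale1r (side e)) -{1}(rt0 (side e)) cross_Zrt subr0 mul1r.
  have d0 := dot_gt0 e0; rewrite pmulr_rge0 // pmulr_lge0 //.
  have h1 := sweep_le tsP e ik; rewrite hk in h1.
  have h2 := sweep_le tsP e (leq0n i); rewrite sweep0 in h2.
  by apply: sin_ge0_pi; rewrite h1 h2.
have hqd v : (0 <= cross (side q) v) = (0 <= cross (side e) v).
  by rewrite hq (_ : cross (c *: side e) v = c * cross (side e) v) ?pmulr_rge0 //; vring.
have [r r0 hr] := half_disc_immersion tsQ l0 hq4.
have [x0 hx0] := polygon_rep (pos_polygon_id tsQ (d := q)).
have [r' r'0 hr'] := vertex_isolated tsQ x0.
have [r1 r10 st1] := disp_uniq tsQ x0.
have hd0 : half_disc tsQ q 0 = x0.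
  rewrite /half_disc !subr0 !cross0r lexx addr0; apply/esym; exact: rep_pt.
have K0 : `|0 : V| < r /\ 0 <= cross (side q) 0 by rewrite normr0 cross0r.
have [r2 r20 hr2] := hr 0 K0; rewrite hd0 in hr2.
pose m := Num.min (Num.min r r') r2.
have m0 : 0 < m by rewrite !lt_min r0 r'0.
have reg v : `|v| < m -> v != 0 -> 0 <= cross (side q) v -> regular (half_disc tsQ q v).
  rewrite !lt_min => /andP[/andP[v1 v2] v3] vn0 cv; apply: (nonvertex_regular tsQ).
  by apply: (hr' v) => //; have := hr2 v (conj v1 cv); rewrite subr0; exact.
(* F agrees with the developed fan of Q along the i-th ray of the fan of P. *)
have claim i : (i <= k)%N -> exists2 a : R, 0 < a & forall (t : R) x, 0 < t < a ->
    rep x (iter i (rot P) e) (pos (iter i (rot P) e) + t *: u i) -> F x = half_disc tsQ q (t *: u i).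
  elim: i => [_|i IH ik].
    have [a a0 ha] := start; have [a' a'0 ha'] := sector_polygon tsQ q.
    exists a => // t x t0 hx.
    have h1 := ha t x t0 hx; rewrite /half_disc subr0 crossNl oppr_ge0.
    have -> : cross (side (rot Q q)) (t *: u 0%N) <= 0.
      have := cross_side_rot tsQ q; rewrite hq crossZr /u /= => h2.
      have : 0 < c * cross (side e) (side (rot Q q)) by move: h2; congr (_ < _); vring.
      rewrite pmulr_rgt0 // => h3; rewrite crossC mulrN oppr_le0.
      by case/andP: t0 => t0 _; rewrite mulr_ge0 // ltW.
    exact: rep_pt.
  have [a a0 ha] := IH (ltnW ik).
  set d := iter i (rot P) e in ha *.
  have ui : u i = side d by []. have ui1 : u i.+1 = side (rot P d) by [].
  have cd := cross_side_rot tsP d; rewrite -ui -ui1 in cd.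
  pose N := `|u i| + `|u i.+1| + 1.
  have N0 : 0 < N by rewrite ltr_wpDl ?ltr01 // addr_ge0.
  exists (Num.min (Num.min a 1) (m / N)); first by rewrite !lt_min a0 ltr01 divr_gt0.
  move=> t x /andP[t0]; rewrite !lt_min => /andP[/andP[ta t1]]; rewrite ltr_pdivlMr // => tm hx.
  have os1 : on_side d (pos d + t *: u i) by exists t => //; rewrite !ltW.
  have p1 := on_side_polygon tsP os1.
  have pd : next P (((next P)^-1)%g d) = d by rewrite permKV.
  have ep : pos d = pos (((next P)^-1)%g d) + side (((next P)^-1)%g d) by rewrite -{1}pd pos_next.
  have os2 : on_side (((next P)^-1)%g d) (pos d + t *: u i.+1).
    exists (1 - t); first by apply/andP; split; lra.
    by rewrite ui1 (side_rot tsP) ep; veq.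
  have p2 : polygon d (pos d + t *: u i.+1).
    by rewrite -(porbit_next (prev_porbit d)); exact: (on_side_polygon tsP os2).
  have hx2 : x = pt tsP d (pos d + t *: u i.+1).
    apply: rep_fun hx _; rewrite iterS -/d; apply: rep_ray => //; first exact: pt_rep.
    by rewrite ui1 (_ : cross _ _ = 0) //; vring.
  have [x1 hx1] := polygon_rep p1.
  have s0 (s : R) : 0 <= s <= 1 -> let v := t *: u i + s *: (t *: u i.+1 - t *: u i) in
      [/\ `|v| < m, v != 0, 0 <= cross (side q) v & polygon d (pos d + v)].
    move=> /andP[s0 s1] v.
    have ev : v = (t * (1 - s)) *: u i + (t * s) *: u i.+1 by rewrite /v; veq.
    have t1s : 0 <= t * (1 - s) by rewrite mulr_ge0 ?subr_ge0 // ltW.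
    have ts0 : 0 <= t * s by rewrite mulr_ge0 // ltW.
    split.
    - rewrite ev; apply: (le_lt_trans (ler_normD _ _)); rewrite (normrZ (t * (1 - s)) (u i)) (normrZ (t * s) (u i.+1)) (ger0_norm t1s) (ger0_norm ts0).
      have := normr_ge0 (u i); have := normr_ge0 (u i.+1); move: tm; rewrite /N => tm ? ?.
      by nra.
    - apply/eqP => v0.
      have z1 : t * s * cross (u i) (u i.+1) = 0.
        by rewrite -(cross0r (u i)) -v0 ev; vring.
      have z2 : t * (1 - s) * cross (u i) (u i.+1) = 0.
        by apply: oppr_inj; rewrite oppr0 -(cross0r (u i.+1)) -v0 ev; vring.
      have : t * cross (u i) (u i.+1) = 0 by rewrite -[RHS](addr0 0) -{1}z1 -z2; ring.
      by apply/eqP; rewrite gt_eqF // mulr_gt0.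
    - rewrite hqd ev crossDr !crossZr addr_ge0 // mulr_ge0 //; apply: dir => //.
      exact: ltnW.
    - have -> : pos d + v = pos d + t *: u i + s *: (pos d + t *: u i.+1 - (pos d + t *: u i)).
        by rewrite /v; veq.
      by apply: polygon_convex => //; apply/andP.
  rewrite hx2; apply/esym.
  pose K := [set v | (`|v| < r /\ 0 <= cross (side q) v) /\ polygon d (pos d + v)].
  have mr v : `|v| < m -> `|v| < r by rewrite !lt_min => /andP[/andP[]].
  apply: (@immersion_unique _ _ tsQ (half_disc tsQ q) (fun v => F (pt tsP d (pos d + v)))
    (t *: u i) (t *: u i.+1) K).
  - by move=> s /s0 [h1 _ h2 h3]; split => //; split => //; exact: mr.
  - by apply: immersionS hr => v [].
  - have h' := immersion_shift (c := pos d) (@pt_immersion _ _ tsP d).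
    apply: (immersion_eq_in (phi := F \o (fun v => pt tsP d (v + pos d)))).
      by move=> v _ /=; rewrite addrC.
    by apply: immersion_comp lF _; apply: immersionS h' => v [_]; rewrite addrC.
  - rewrite -(rep_pt tsP hx1); apply/esym; apply: ha => //; exact/andP.
  - move=> s s01; have s01' : 0 <= s <= 1 by case/andP: s01 => -> /ltW.
    by have [h1 h2 h3 _] := s0 s s01'; exact: reg.
have [a a0 ha] := claim k (leqnn k).
have [b b0 hb] := side_sweep tsP k e.
rewrite hk rtpi scalerN in hb.
set q3 := rot Q (rot Q q) in c13 hq4 *.
have [b3 b30 hb3] := sector_polygon tsQ q3.
have n0 : 0 < `|side e| by rewrite normr_gt0.
exists (Num.min (a * b) (b3 / `|side e|)).
  by rewrite lt_min mulr_gt0 // divr_gt0.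
move=> t x /andP[t0]; rewrite lt_min ltr_pdivlMr // => /andP[ta tb] hx.
have e1 : (t / b) *: u k = - (t *: side e).
  by rewrite /u hb scalerN scalerA divfK // gt_eqF.
have := ha (t / b) x; rewrite divr_gt0 // ltr_pdivrMr // ta => /(_ isT).
rewrite e1 => /(_ hx) ->.
have cqe d : 0 < cross (side q) (side d) -> 0 < cross (side e) (side d).
  rewrite hq (_ : cross (c *: side e) (side d) = c * cross (side e) (side d)); last by vring.
  by rewrite pmulr_rgt0.
have sgn d : 0 < cross (side q) (side d) -> (0 <= cross (- side d) (- (t *: side e) - 0)) = false.
  move=> /cqe h; apply/negbTE; rewrite -ltNge.
  have -> : cross (- side d) (- (t *: side e) - 0) = - (t * cross (side e) (side d)) by vring.
  by rewrite oppr_lt0 mulr_gt0.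
rewrite /half_disc (sgn _ _ (cross_side_rot tsQ q)) (sgn _ _ c13) -/q3.
have hp : polygon q3 (pos q3 - t *: side e).
  apply: hb3; first by rewrite normrN normrZ gtr0_norm.
    rewrite crossNr crossZr -mulrN -crossC mulr_ge0 ?ltW //.
    exact: cqe.
  by rewrite hq4 hq (_ : cross _ _ = 0) //; vring.
apply: rep_ray => //; first exact: pt_rep.
by rewrite hq4 hq (_ : cross _ _ = 0) //; vring.
Qed.

End Turn.

(** * Flips of diagonals *)

Section Triangles.
Variables (R : realType) (P : polygon_gluing R) (tsP : translation_surface P).
Local Notation V := (R * R)%type.
Local Notation I := 'I_(nsides P).
Implicit Types (d e : I) (z w : V).

Definition triangulated := forall d, next P (next P (next P d)) = d.

Hypothesis tri : triangulated.

Lemma tri_porbit d e : e \in porbit (next P) d ->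
  [\/ e = d, e = next P d | e = next P (next P d)].
Proof.
case/porbitP => k ->; elim: k => [|k]; first by rewrite perm1; constructor 1.
by rewrite expgSr permM => -[] ->; [constructor 2|constructor 3|constructor 1; rewrite tri].
Qed.

Lemma tri_sides d : side d + side (next P d) + side (next P (next P d)) = 0.
Proof. by rewrite /side tri; veq. Qed.

Lemma tri_polygonP d z : [/\ 0 <= cross (side d) (z - pos d),
    0 <= cross (side (next P d)) (z - pos (next P d)) &
    0 <= cross (side (next P (next P d))) (z - pos (next P (next P d)))] <-> polygon d z.
Proof.
split=> [[h1 h2 h3] e /tri_porbit [] -> //|h].
by split; apply: h; rewrite ?next_porbitE ?porbit_id.
Qed.

Lemma tri_in d : [/\ d \in porbit (next P) d, next P d \in porbit (next P) d &
  next P (next P d) \in porbit (next P) d].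
Proof. by split; rewrite ?next_porbitE porbit_id. Qed.

End Triangles.

(** A vector in the cone of u and v is to the left of c if u and v are. *)
Lemma cross_cone (R : realType) (u v w c : R * R) : 0 < cross u v ->
  0 <= cross u w -> 0 <= cross w v -> 0 <= cross c u -> 0 <= cross c v -> 0 <= cross c w.
Proof.
move=> d h1 h2 h3 h4; rewrite -(pmulr_rge0 _ d) -crossZr cross_basis crossDr !crossZr.
by rewrite addr_ge0 // mulr_ge0.
Qed.

Section PiecewiseMaps.
Variables (R : realType) (P Q : polygon_gluing R).
Hypotheses (tsP : translation_surface P) (tsQ : translation_surface Q).
Local Notation V := (R * R)%type.

Lemma pt_shift_immersion (K : set V) d (c : V) :
  (forall z, K z -> polygon d (z + c)) -> immersion K (fun z => pt tsQ d (z + c)).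
Proof.
by move=> h; apply: immersionS (immersion_shift (c := c) (@pt_immersion _ _ tsQ d)).
Qed.

(** The flips are disjoint by [flip_sep], so that each triangle has at most
    one side in A; it determines how the triangle is mapped. *)
Definition key (A : pred 'I_(nsides P)) d : option 'I_(nsides P) :=
  if A d then Some d else if A (next P d) then Some (next P d)
  else if A (next P (next P d)) then Some (next P (next P d)) else None.

Lemma key_next (A : pred 'I_(nsides P)) d : triangulated P ->
  (forall a, A a -> ~~ A (next P a) /\ ~~ A (next P (next P a))) ->
  key A (next P d) = key A d.
Proof.
move=> tri sep; rewrite /key tri.
have := sep d; have := sep (next P d); rewrite tri.
have := sep (next P (next P d)); rewrite !tri.
by case: (A d); case: (A (next P d)); case: (A (next P (next P d))) => // h1 h2 h3;
  do [case: (h1 isT) => //|case: (h2 isT) => //|case: (h3 isT) => //].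
Qed.

End PiecewiseMaps.

Section Flip.
Variables (R : realType).
Local Notation V := (R * R)%type.

(** Q is obtained from P by exchanging, in the quadrilateral around each
    edge of A, one diagonal for the other; rho names the sides of Q after
    those of P, the new diagonal being turned counterclockwise from the old
    one. *)
Record flip (P Q : polygon_gluing R) (rho : 'I_(nsides P) -> 'I_(nsides Q))
    (A : pred 'I_(nsides P)) : Prop := Flip {
  flip_triP : triangulated P;
  flip_triQ : triangulated Q;
  flip_opp : forall x, opp Q (rho x) = rho (opp P x);
  flip_side : forall x, ~~ A x -> side (rho x) = side x;
  flip_A : forall x, A (opp P x) = A x;
  flip_sep : forall a, A a -> ~~ A (next P a) /\ ~~ A (next P (next P a));
  flip_keep : forall x, ~~ A x -> ~~ A (next P x) -> ~~ A (next P (next P x)) ->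
    next Q (rho x) = rho (next P x);
  flip_next : forall a, A a -> [/\ next Q (rho a) = rho (next P (next P a)),
    next Q (rho (next P (next P a))) = rho (next P (opp P a)) &
    next Q (rho (next P (opp P a))) = rho a] }.

Variables (P Q : polygon_gluing R).
Hypotheses (tsP : translation_surface P) (tsQ : translation_surface Q).
Variables (rho : 'I_(nsides P) -> 'I_(nsides Q)) (A : pred 'I_(nsides P)).
Hypothesis fl : flip rho A.
Let triP := flip_triP fl.
Let triQ := flip_triQ fl.

Local Notation nP := (next P).
Local Notation nQ := (next Q).

(** Coordinates in Q of a point of P, for the translation that takes the
    side x to rho x. *)
Let move x z : V := z + (pos (rho x) - pos x).

(** The triangle of a is cut by the new diagonal into two parts, that
    belong to the triangles of Q having the other two sides of that
    triangle. *)
Let piece a z := if 0 <= cross (side (rho a)) (z - pos (nP (nP a)))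
  then pt tsQ (rho (nP (nP a))) (move (nP (nP a)) z) else pt tsQ (rho (nP a)) (move (nP a) z).

Section Piece.
Variables (a : 'I_(nsides P)) (Aa : A a).
Let a1 := nP a. Let a2 := nP a1. Let b := opp P a. Let b1 := nP b. Let b2 := nP b1.

Let na2 : nP a2 = a. Proof. exact: triP. Qed.
Let Ab : A b. Proof. by rewrite /b (flip_A fl). Qed.
Let ob : opp P b = a. Proof. exact: oppK. Qed.
Let nb2 : nP b2 = b. Proof. exact: triP. Qed.
Let qa : nQ (rho a) = rho a2. Proof. by case: (flip_next fl Aa). Qed.
Let qa2 : nQ (rho a2) = rho b1. Proof. by case: (flip_next fl Aa). Qed.
Let qb1 : nQ (rho b1) = rho a. Proof. by case: (flip_next fl Aa). Qed.
Let qb : nQ (rho b) = rho b2. Proof. by case: (flip_next fl Ab). Qed.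
Let qb2 : nQ (rho b2) = rho a1. Proof. by case: (flip_next fl Ab); rewrite ob. Qed.
Let qa1 : nQ (rho a1) = rho b. Proof. by case: (flip_next fl Ab); rewrite ob. Qed.
Let s1 : side (rho a1) = side a1. Proof. by apply: (flip_side fl); case: (flip_sep fl Aa). Qed.
Let s2 : side (rho a2) = side a2. Proof. by apply: (flip_side fl); case: (flip_sep fl Aa). Qed.
Let t1 : side (rho b1) = side b1. Proof. by apply: (flip_side fl); case: (flip_sep fl Ab). Qed.
Let t2 : side (rho b2) = side b2. Proof. by apply: (flip_side fl); case: (flip_sep fl Ab). Qed.
Let oa : opp Q (rho a) = rho b. Proof. exact: flip_opp fl _. Qed.
Let sb : side b = - side a. Proof. exact: side_opp. Qed.
Let srb : side (rho b) = - side (rho a). Proof. by rewrite -oa (side_opp tsQ). Qed.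
Let sra : side (rho a) = - (side a2 + side b1).
Proof.
have := tri_sides triQ (rho a); rewrite qa qa2 s2 t1 -addrA => h.
by apply/eqP; rewrite -addr_eq0 h.
Qed.
Let p1 : pos a1 = pos a + side a. Proof. exact: pos_next. Qed.
Let p2 : pos a2 = pos a1 + side a1. Proof. exact: pos_next. Qed.
Let p3 : pos a = pos a2 + side a2. Proof. by rewrite -{1}na2 pos_next. Qed.
Let r1 : pos (rho a2) = pos (rho a) + side (rho a). Proof. by rewrite -qa pos_next. Qed.
Let r2 : pos (rho b1) = pos (rho a2) + side a2. Proof. by rewrite -qa2 pos_next s2. Qed.
Let r3 : pos (rho b) = pos (rho a1) + side a1. Proof. by rewrite -qa1 pos_next s1. Qed.
Let r4 : pos (rho a1) = pos (rho b2) + side b2. Proof. by rewrite -qb2 pos_next t2. Qed.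
Let r5 : pos (rho b) = pos (rho a2) + shift (rho a).
Proof. by rewrite r1 -oa (pos_opp tsQ). Qed.

Let near z : polygon a z -> 0 <= cross (side (rho a)) (z - pos a2) ->
  polygon (rho a2) (move a2 z).
Proof.
move=> /(tri_polygonP triP) [h1 h2 h3] c.
apply/(tri_polygonP triQ); rewrite /move qa2 qb1 s2 t1; split.
- by have -> : z + (pos (rho a2) - pos a2) - pos (rho a2) = z - pos a2 by veq.
- have -> : z + (pos (rho a2) - pos a2) - pos (rho b1) = z - pos a by rewrite r2 p3; veq.
  have c1 := turn_left tsP a2; rewrite na2 in c1.
  have c2 := turn_left tsP b; have c3 := turn_left tsQ (rho a2).
  rewrite -/b1 in c2; rewrite qa2 s2 t1 in c3.
  apply: (@cross_cone _ (side a) (- side a2)) => //.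
  + by rewrite crossNr -crossC.
  + rewrite crossNr -crossC; have -> : z - pos a = (z - pos a2) - side a2 by rewrite p3; veq.
    by rewrite crossDr crossNr crossvv oppr0 addr0.
  + have -> : side a = - side b by rewrite sb opprK.
    by rewrite crossNr -crossC ltW.
  + by rewrite crossNr -crossC ltW.
- have -> : z + (pos (rho a2) - pos a2) - pos (rho a) = side (rho a) + (z - pos a2) by rewrite r1; veq.
  by rewrite crossDr crossvv add0r.
Qed.

Let far z : polygon a z -> cross (side (rho a)) (z - pos a2) <= 0 ->
  polygon (rho a1) (move a1 z).
Proof.
move=> /(tri_polygonP triP) [h1 h2 h3] c.
apply/(tri_polygonP triQ); rewrite /move qa1 qb s1 t2; split.
- by have -> : z + (pos (rho a1) - pos a1) - pos (rho a1) = z - pos a1 by veq.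
- have -> : z + (pos (rho a1) - pos a1) - pos (rho b) = z - pos a2 by rewrite r3 p2; veq.
  by rewrite srb crossNl oppr_ge0.
- have -> : z + (pos (rho a1) - pos a1) - pos (rho b2) = side b2 + (z - pos a1) by rewrite r4; veq.
  rewrite crossDr crossvv add0r.
  have c1 := turn_left tsP a; rewrite -/a1 in c1.
  have c2 := turn_left tsP b2; have c3 := turn_left tsQ (rho b2).
  rewrite nb2 in c2; rewrite qb2 s1 t2 in c3.
  apply: (@cross_cone _ (side a1) (- side a)) => //.
  + by rewrite crossNr -crossC.
  + rewrite crossNr -crossC; have -> : z - pos a1 = (z - pos a) - side a by rewrite p1; veq.
    by rewrite crossDr crossNr crossvv oppr0 addr0.
  + exact: ltW.
  + by rewrite -sb ltW.
Qed.

Let agree z : polygon a z -> cross (side (rho a)) (z - pos a2) = 0 ->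
  pt tsQ (rho a2) (move a2 z) = pt tsQ (rho a1) (move a1 z).
Proof.
move=> hz c; have c0 : 0 <= cross (side (rho a)) (z - pos a2) by rewrite c.
have c0' : cross (side (rho a)) (z - pos a2) <= 0 by rewrite c.
have h1 := near hz c0; have h2 := far hz c0'.
have h1' : polygon (rho a) (move a2 z) by rewrite -polygon_next qa.
have os : on_side (rho a) (move a2 z).
  apply: (line_on_side tsQ h1').
  have -> : move a2 z - pos (rho a) = side (rho a) + (z - pos a2) by rewrite /move r1; veq.
  by rewrite crossDr crossvv add0r.
rewrite -qa (pt_next tsQ h1') -(pt_opp tsQ os) oa -qa1.
have E : pos (rho a1) = pos (rho a2) + shift (rho a) - side a1 by rewrite -r5 r3; veq.
have -> : move a2 z + shift (rho a) = move a1 z by rewrite /move E p2; veq.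
by rewrite (pt_next tsQ).
Qed.

Lemma piece_immersion : immersion (polygon a) (piece a).
Proof.
apply: immersion_split.
- by apply: pt_shift_immersion => z [h1 h2]; exact: near.
- by apply: pt_shift_immersion => z [h1 h2]; exact: far.
- by move=> z hz c; exact: agree.
Qed.

Lemma piece_side1 z : on_side a1 z -> piece a z = pt tsQ (rho a1) (move a1 z).
Proof.
move=> os; have hz : polygon a z by rewrite -polygon_next; exact: (on_side_polygon tsP os).
case: os => t /andP[t0 t1'] ez; rewrite /piece -/a1 -/a2; case: ifPn => // c.
apply: agree => //; apply/eqP; rewrite eq_le c andbT.
have -> : z - pos a2 = (1 - t) *: - side a1 by rewrite ez p2; veq.
rewrite crossZr crossNr mulrN oppr_le0; apply: mulr_ge0; first by rewrite subr_ge0.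
by have := turn_left tsQ (rho a1); rewrite qa1 srb s1 crossNr crossC opprK => /ltW.
Qed.

Lemma piece_side2 z : on_side a2 z -> piece a z = pt tsQ (rho a2) (move a2 z).
Proof.
move=> [t /andP[t0 t1'] ez]; rewrite /piece -/a1 -/a2.
have -> : z - pos a2 = t *: side a2 by rewrite ez; veq.
rewrite crossZr mulr_ge0 //; have := turn_left tsQ (rho a); rewrite qa s2; exact: ltW.
Qed.

Lemma piece_opp z : on_side a z -> piece (opp P a) (z + shift a) = piece a z.
Proof.
move=> os; have hz : polygon a z by exact: (on_side_polygon tsP os).
have pb : pos b = pos a1 + shift a by rewrite p1 -(pos_opp tsP).
have pb1 : pos b1 = pos a + shift a by rewrite /b1 pos_next pb sb p1; veq.
have pb2 : pos b2 = pos a + shift a + side b1 by rewrite /b2 pos_next pb1.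
rewrite /piece -/b -/b1 -/b2 -/a1 -/a2 srb.
have -> : cross (- side (rho a)) (z + shift a - pos b2) = - cross (side (rho a)) (z - pos a2).
  have -> : z + shift a - pos b2 = (z - pos a2) + side (rho a) by rewrite pb2 sra p3; veq.
  by rewrite crossNl crossDr crossvv addr0.
have e1 : move b1 (z + shift a) = move a2 z by rewrite /move pb1 r2 p3; veq.
have e2 : move b2 (z + shift a) = move a1 z.
  rewrite /move r4; have -> : pos b2 = pos a1 + shift a - side b2.
    by rewrite -pb -nb2 pos_next; veq.
  by veq.
rewrite oppr_ge0 e1 e2; have [c|c|c] := ltgtP 0 (cross (side (rho a)) (z - pos a2)).
- have hn := near hz (ltW c).
  by rewrite -qa2 (pt_next tsQ hn).
- have hf := far hz (ltW c).
  have hf' : polygon (rho b2) (move a1 z) by rewrite -polygon_next qb2.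
  by rewrite -qb2 (pt_next tsQ hf').
- have hf : polygon (rho a1) (move a1 z) by apply: far => //; rewrite -c.
  have hf' : polygon (rho b2) (move a1 z) by rewrite -polygon_next qb2.
  by rewrite agree // -qb2 (pt_next tsQ hf').
Qed.

End Piece.

Lemma flip_map : exists f : surface P -> surface Q, local_iso f /\
  forall x y z, ~~ A x -> on_side x z -> rep y x z ->
    rep (f y) (rho x) (z + (pos (rho x) - pos x)).
Proof.
pose phi x := if key A x is Some a then piece a else fun z => pt tsQ (rho x) (move x z).
have keyP x a : key A x = Some a -> A a /\ [\/ x = a, x = nP a | x = nP (nP a)].
  rewrite /key; case: ifP => [h [<-]|_]; first by split => //; constructor 1.
  case: ifP => [h [<-]|_]; first by split => //; constructor 3; rewrite triP.
  by case: ifP => // h [<-]; split => //; constructor 2; rewrite triP.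
have keyN x : key A x = None -> [/\ ~~ A x, ~~ A (nP x) & ~~ A (nP (nP x))].
  by rewrite /key; case: ifP => // _; case: ifP => // _; case: ifP.
have keyA x : A x -> key A x = Some x by rewrite /key => ->.
have knext x : key A (nP x) = key A x by apply: key_next triP (flip_sep fl).
have qx x : key A x = None -> nQ (rho x) = rho (nP x).
  by move=> /keyN [h1 h2 h3]; exact: flip_keep fl _ h1 h2 h3.
have mem x z : key A x = None -> polygon x z -> polygon (rho x) (move x z).
  move=> k /(tri_polygonP triP) [h1 h2 h3]; have [n1 n2 n3] := keyN x k.
  have k1 : key A (nP x) = None by rewrite knext.
  have e1 := qx x k; have e2 := qx _ k1.
  have s1 := flip_side fl n1; have s2 := flip_side fl n2; have s3 := flip_side fl n3.
  have q1 : pos (rho (nP x)) = pos (rho x) + side x by rewrite -e1 pos_next s1.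
  have q2 : pos (rho (nP (nP x))) = pos (rho x) + side x + side (nP x) by rewrite -e2 pos_next s2 q1.
  apply/(tri_polygonP triQ); rewrite e1 e2 s1 s2 s3 q1 q2 /move; split.
  - by have -> : z + (pos (rho x) - pos x) - pos (rho x) = z - pos x by veq.
  - by move: h2; rewrite pos_next; congr (0 <= cross _ _); veq.
  - by move: h3; rewrite !pos_next; congr (0 <= cross _ _); veq.
have onside x z : ~~ A x -> on_side x z -> phi x z = pt tsQ (rho x) (move x z).
  move=> nA os; rewrite /phi; case E : (key A x) => [a|//].
  have [Aa [ex|ex|ex]] := keyP _ _ E; rewrite ex in nA os *.
  - by rewrite Aa in nA.
  - exact: piece_side1.
  - exact: piece_side2.
have [|||f [lf fE]] := @map_surface _ P Q phi tsP.
- move=> x z hz; rewrite /phi knext; case E : (key A x) => [//|].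
  have hm := mem x z E hz; rewrite -(qx x E) -(pt_next tsQ hm); congr pt.
  have [n1 _ _] := keyN x E.
  by rewrite /move -(qx x E) !pos_next (flip_side fl n1); veq.
- move=> x z os; have [Ax|nA] := boolP (A x).
    have Ao : A (opp P x) by rewrite (flip_A fl).
    by rewrite /phi (keyA _ Ax) (keyA _ Ao) piece_opp.
  have nAo : ~~ A (opp P x) by rewrite (flip_A fl).
  have os' := on_side_opp tsP os; rewrite (onside _ _ nA os) (onside _ _ nAo os').
  have osq : on_side (rho x) (move x z).
    case: os => t t01 ->; exists t => //.
    by rewrite /move (flip_side fl nA); veq.
  rewrite -(pt_opp tsQ osq) (flip_opp fl); congr pt.
  by rewrite /move -(flip_opp fl) (pos_opp tsP) (pos_opp tsQ) (flip_side fl nA); veq.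
- move=> x; rewrite /phi; case E : (key A x) => [a|].
    have [Aa hx] := keyP _ _ E; have -> : polygon x = polygon a.
      by case: hx => ->; rewrite ?polygon_next.
    exact: piece_immersion.
  by apply: pt_shift_immersion => z; exact: mem.
exists f; split => // x y z nA os hy; rewrite (fE _ _ _ hy) (onside _ _ nA os).
apply: pt_rep; apply: on_side_polygon tsQ _ _ _; case: os => t t01 ->; exists t => //.
by rewrite /move (flip_side fl nA); veq.
Qed.

End Flip.

Section FlipIso.
Variables (R : realType) (P Q : polygon_gluing R).
Hypotheses (tsP : translation_surface P) (tsQ : translation_surface Q).

(** Flipping back gives a map in the other direction. Both composites fix
    the midpoints of the sides which are not flipped. *)
Lemma flip_isomorphic rho A rho' A' :
  @flip R P Q rho A -> @flip R Q P rho' A' ->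
  (forall x, ~~ A x -> ~~ A' (rho x) /\ rho' (rho x) = x) ->
  (forall y, ~~ A' y -> ~~ A (rho' y) /\ rho (rho' y) = y) ->
  isomorphic P Q.
Proof.
move=> fl fl' h h'.
have rig (P1 Q1 : polygon_gluing R) (t1 : translation_surface P1) (t2 : translation_surface Q1)
   r1 A1 r2 A2 (f1 : surface P1 -> surface Q1) (f2 : surface Q1 -> surface P1) :
   @flip R P1 Q1 r1 A1 -> @flip R Q1 P1 r2 A2 ->
   (forall x, ~~ A1 x -> ~~ A2 (r1 x) /\ r2 (r1 x) = x) ->
   local_iso f1 -> local_iso f2 ->
   (forall x y z, ~~ A1 x -> on_side x z -> rep y x z -> rep (f1 y) (r1 x) (z + (pos (r1 x) - pos x))) ->
   (forall x y z, ~~ A2 x -> on_side x z -> rep y x z -> rep (f2 y) (r2 x) (z + (pos (r2 x) - pos x))) ->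
   cancel f1 f2.
  move=> g1 g2 hh l1 l2 e1 e2; apply: (local_iso_rigid t1 (local_iso_comp l1 l2)) => d.
  have [e he nA] : exists2 e, e \in porbit (next P1) d & ~~ A1 e.
    have [Ad|nA] := boolP (A1 d); last by exists d => //; exact: porbit_id.
    by exists (next P1 d); [exact: next_porbit | case: (flip_sep g1 Ad)].
  have os := on_side_midpoint e.
  have [y hy] := polygon_rep (on_side_polygon t1 os).
  exists e, y; split => //=.
  have [nA2 r21] := hh e nA.
  have hf := e1 _ _ _ nA os hy.
  have em : midpoint e + (pos (r1 e) - pos e) = midpoint (r1 e).
    by rewrite /midpoint (flip_side g1 nA); veq.
  rewrite em in hf.
  have := e2 _ _ _ nA2 (on_side_midpoint _) hf.
  have -> : midpoint (r1 e) + (pos (r2 (r1 e)) - pos (r1 e)) = midpoint e.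
    by rewrite -em r21; veq.
  by rewrite r21 => h2; exact: rep_fun h2 hy.
have [f [lf fE]] := flip_map tsP tsQ fl.
have [f' [lf' fE']] := flip_map tsQ tsP fl'.
apply: (local_iso_isomorphic tsP tsQ lf lf').
- exact: (rig _ _ tsP tsQ _ _ _ _ _ _ fl fl').
- exact: (rig _ _ tsQ tsP _ _ _ _ _ _ fl' fl).
Qed.

End FlipIso.

(** * Subdivisions of triangulations *)

Section Inclusion.
Variables (R : realType) (S P : polygon_gluing R).
Hypotheses (tsS : translation_surface S) (tsP : translation_surface P) (triS : triangulated S).
Local Notation V := (R * R)%type.

(** A triangulated surface whose triangles are placed in the polygons of P,
    the origin of the side j at o j, so that glued points remain glued,
    maps to that of P. Opposite sides either coincide inside a polygon or
    are carried to each other by the gluing of two sides of P. *)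
Lemma inclusion_map (e : 'I_(nsides S) -> 'I_(nsides P)) (o : 'I_(nsides S) -> V) :
  (forall j, polygon (e j) (o j)) ->
  (forall j, e (next S j) \in porbit (next P) (e j) /\ o (next S j) = o j + side j) ->
  (forall j, (e (opp S j) \in porbit (next P) (e j) /\ o (opp S j) = o j + side j) \/
     exists d, [/\ d \in porbit (next P) (e j), opp P d \in porbit (next P) (e (opp S j)),
       on_side d (o j), on_side d (o j + side j) & o (opp S j) = o j + side j + shift d]) ->
  exists f : surface S -> surface P, local_iso f /\
    forall y j z, rep y j z -> rep (f y) (e j) (z + (o j - pos j)).
Proof.
move=> h0 h1 h2.
have mem j z : polygon j z -> polygon (e j) (z + (o j - pos j)).
  move=> /(tri_polygonP triS) [c1 c2 c3] f hf.
  have [e1 o1] := h1 j; have [e2 o2] := h1 (next S j).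
  have m0 := h0 j f hf.
  have m1 : 0 <= cross (side f) (o j + side j - pos f).
    by rewrite -o1; apply: h0; rewrite (porbitS e1).
  have m2 : 0 <= cross (side f) (o j + side j + side (next S j) - pos f).
    by rewrite -o1 -o2; apply: h0; rewrite (porbitS e2) (porbitS e1).
  have D := turn_left tsS j.
  have E : cross (side j) (side (next S j)) * cross (side f) (z + (o j - pos j) - pos f) =
     cross (side (next S j)) (z - pos (next S j)) * cross (side f) (o j - pos f) +
     cross (side (next S (next S j))) (z - pos (next S (next S j))) * cross (side f) (o j + side j - pos f) +
     cross (side j) (z - pos j) * cross (side f) (o j + side j + side (next S j) - pos f).
    have -> : side (next S (next S j)) = - (side j + side (next S j)).
      by apply/eqP; rewrite -addr_eq0 addrC tri_sides.
    by rewrite !pos_next; vring.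
  rewrite -(pmulr_rge0 _ D) E.
  by apply: addr_ge0; [apply: addr_ge0|]; apply: mulr_ge0.
pose phi j z := pt tsP (e j) (z + (o j - pos j)).
have [|||f [lf fE]] := @map_surface _ S P phi tsS.
- move=> j z hz; have [e1 o1] := h1 j; rewrite /phi o1 pos_next.
  have -> : z + (o j + side j - (pos j + side j)) = z + (o j - pos j) by veq.
  by apply: pt_porbit => //; exact: mem.
- move=> j z os; rewrite /phi; have hm := mem j z (on_side_polygon tsS os).
  have -> : z + shift j + (o (opp S j) - pos (opp S j)) = z + (o j - pos j) + (o (opp S j) - o j - side j).
    by rewrite (pos_opp tsS); veq.
  case: (h2 j) => [[e1 ->]|[d [d1 d2 os1 os2 ->]]].
    have -> : z + (o j - pos j) + (o j + side j - o j - side j) = z + (o j - pos j) by veq.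
    exact: pt_porbit.
  have osd : on_side d (z + (o j - pos j)).
    case: os os1 os2 => t /andP[t0 t1] -> [a /andP[a0 a1] ea] [b /andP[b0 b1] eb].
    exists ((1 - t) * a + t * b).
      by apply/andP; split; nra.
    have -> : pos j + t *: side j + (o j - pos j) = (1 - t) *: o j + t *: (o j + side j) by veq.
    by rewrite eb ea; veq.
  have -> : z + (o j - pos j) + (o j + side j + shift d - o j - side j) = z + (o j - pos j) + shift d by veq.
  have p3 : polygon (opp P d) (z + (o j - pos j) + shift d).
    by apply: (on_side_polygon tsP); apply: (on_side_opp tsP).
  rewrite -(pt_porbit tsP d2); last by rewrite -(porbit_next d2).
  by rewrite (pt_opp tsP osd); apply: pt_porbit.
- by move=> j; apply: pt_shift_immersion; exact: mem.
by exists f; split => // y j z hy; rewrite (fE _ _ _ hy); apply: pt_rep; apply: mem; exact: rep_polygon hy.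
Qed.

End Inclusion.

Section Split.
Variable R : realType.
Local Notation V := (R * R)%type.

(** S is obtained from P by marking the point at proportion lam a on each
    side a of A and joining it to the opposite vertex of the triangle of a.
    The halves of a are iota a and mu a, and nu a goes from the marked
    point to the opposite vertex; origin gives a side of P whose triangle
    contains the given triangle of S. *)
Record split (P S : polygon_gluing R) (iota mu nu : 'I_(nsides P) -> 'I_(nsides S))
    (origin : 'I_(nsides S) -> 'I_(nsides P))
    (A : pred 'I_(nsides P)) (lam : 'I_(nsides P) -> R) : Prop := Split {
  split_triP : triangulated P;
  split_triS : triangulated S;
  split_A : forall x, A (opp P x) = A x;
  split_sep : forall a, A a -> ~~ A (next P a) /\ ~~ A (next P (next P a));
  split_opp : forall x, ~~ A x -> opp S (iota x) = iota (opp P x);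
  split_side : forall x, ~~ A x -> side (iota x) = side x;
  split_lam : forall a, A a -> [/\ 0 < lam a, lam (opp P a) = 1 - lam a &
    side (iota a) = lam a *: side a];
  split_keep : forall x, ~~ A x -> ~~ A (next P x) -> ~~ A (next P (next P x)) ->
    next S (iota x) = iota (next P x);
  split_near : forall a, A a -> [/\ next S (iota a) = nu a,
    next S (nu a) = iota (next P (next P a)) & next S (iota (next P (next P a))) = iota a];
  split_far : forall a, A a -> [/\ next S (mu a) = iota (next P a),
    next S (iota (next P a)) = opp S (nu a) & next S (opp S (nu a)) = mu a];
  split_half : forall a, A a -> opp S (iota a) = mu (opp P a);
  split_cover : forall j, (exists x, j = iota x) \/
    exists2 a, A a & [\/ j = mu a, j = nu a | j = opp S (nu a)];
  split_origin : forall x, origin (iota x) = x;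
  split_origin3 : forall a, A a -> [/\ origin (mu a) = a, origin (nu a) = a & origin (opp S (nu a)) = a] }.

Variables (P S : polygon_gluing R).
Hypotheses (tsP : translation_surface P) (tsS : translation_surface S).
Variables (iota mu nu : 'I_(nsides P) -> 'I_(nsides S)) (origin : 'I_(nsides S) -> 'I_(nsides P)).
Variables (A : pred 'I_(nsides P)) (lam : 'I_(nsides P) -> R).
Hypothesis sp : split iota mu nu origin A lam.
Let triP := split_triP sp.
Let triS := split_triS sp.

Local Notation nP := (next P).
Local Notation nS := (next S).

(** Coordinates in S of a point of P, for the translation that takes the
    origin of x to that of iota x. *)
Let move x z : V := z + (pos (iota x) - pos x).

(** The triangle of a side a of A is cut by nu a into a part next to iota a
    and a part next to the following side. *)
Let piece a z := if 0 <= cross (side (nu a)) (z - pos (nP (nP a)))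
  then pt tsS (iota a) (move a z) else pt tsS (iota (nP a)) (move (nP a) z).

Section Piece.
Variables (a : 'I_(nsides P)) (Aa : A a).
Let a1 := nP a. Let a2 := nP a1. Let b := opp P a. Let b1 := nP b. Let b2 := nP b1.
Let l := lam a. Let m := mu a. Let v := nu a. Let w := opp S v.

Let na2 : nP a2 = a. Proof. exact: triP. Qed.
Let Ab : A b. Proof. by rewrite /b (split_A sp). Qed.
Let l0 : 0 < l. Proof. by case: (split_lam sp Aa). Qed.
Let lb : lam b = 1 - l. Proof. by case: (split_lam sp Aa). Qed.
Let l1 : l < 1. Proof. by case: (split_lam sp Ab); rewrite lb; lra. Qed.
Let q1 : nS (iota a) = v. Proof. by case: (split_near sp Aa). Qed.
Let q2 : nS v = iota a2. Proof. by case: (split_near sp Aa). Qed.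
Let q3 : nS (iota a2) = iota a. Proof. by case: (split_near sp Aa). Qed.
Let q4 : nS m = iota a1. Proof. by case: (split_far sp Aa). Qed.
Let q5 : nS (iota a1) = w. Proof. by case: (split_far sp Aa). Qed.
Let q6 : nS w = m. Proof. by case: (split_far sp Aa). Qed.
Let s0 : side (iota a) = l *: side a. Proof. by case: (split_lam sp Aa). Qed.
Let s1 : side (iota a1) = side a1. Proof. by apply: (split_side sp); case: (split_sep sp Aa). Qed.
Let s2 : side (iota a2) = side a2. Proof. by apply: (split_side sp); case: (split_sep sp Aa). Qed.
Let sa : side a2 = - (side a + side a1).
Proof. by apply/eqP; rewrite -addr_eq0 addrC (tri_sides triP). Qed.
Let sv : side v = (1 - l) *: side a + side a1.
Proof.
have := tri_sides triS (iota a); rewrite q1 q2 s0 s2 => h.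
have : side v = - (l *: side a) - side a2.
  by apply/eqP; rewrite -subr_eq0 -h; apply/eqP; veq.
by move=> ->; rewrite sa; veq.
Qed.
Let sw : side w = - side v. Proof. exact: side_opp. Qed.
Let sm : side m = (1 - l) *: side a.
Proof.
have := tri_sides triS m; rewrite q4 q5 s1 sw => h.
have : side m = side v - side a1 by apply/eqP; rewrite -subr_eq0 -h; apply/eqP; veq.
by move=> ->; rewrite sv; veq.
Qed.
Let p1 : pos a1 = pos a + side a. Proof. exact: pos_next. Qed.
Let p2 : pos a2 = pos a + side a + side a1. Proof. by rewrite /a2 pos_next p1. Qed.
Let r1 : pos v = pos (iota a) + l *: side a. Proof. by rewrite -q1 pos_next s0. Qed.
Let r2 : pos (iota a2) = pos v + side v. Proof. by rewrite -q2 pos_next. Qed.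
Let r3 : pos w = pos (iota a1) + side a1. Proof. by rewrite -q5 pos_next s1. Qed.
Let r4 : pos m = pos w - side v. Proof. by rewrite -q6 pos_next sw. Qed.
Let r5 : pos w = pos v + side v + shift v. Proof. exact: pos_opp. Qed.

Let near z : polygon a z -> 0 <= cross (side v) (z - pos a2) -> polygon (iota a) (move a z).
Proof.
move=> /(tri_polygonP triP) [h1 h2 h3] c; rewrite -/a1 -/a2 in h2 h3.
apply/(tri_polygonP triS); rewrite /move q1 q2 s0 s2; split.
- have -> : z + (pos (iota a) - pos a) - pos (iota a) = z - pos a by veq.
  rewrite (_ : cross _ _ = l * cross (side a) (z - pos a)); last by vring.
  by rewrite mulr_ge0 // ltW.
- have -> : z + (pos (iota a) - pos a) - pos v = (z - pos a2) + side v by rewrite r1 p2 sv; veq.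
  by rewrite crossDr crossvv addr0.
- have -> // : z + (pos (iota a) - pos a) - pos (iota a2) = z - pos a2.
  by rewrite r2 r1 p2 sv; veq.
Qed.

Let far z : polygon a z -> cross (side v) (z - pos a2) <= 0 -> polygon (iota a1) (move a1 z).
Proof.
move=> /(tri_polygonP triP) [h1 h2 h3] c; rewrite -/a1 -/a2 in h2 h3.
apply/(tri_polygonP triS); rewrite /move q5 q6 s1 sw sm; split.
- by have -> : z + (pos (iota a1) - pos a1) - pos (iota a1) = z - pos a1 by veq.
- have -> : z + (pos (iota a1) - pos a1) - pos w = z - pos a2 by rewrite r3 p2 p1; veq.
  by rewrite crossNl oppr_ge0.
- have -> : z + (pos (iota a1) - pos a1) - pos m = (z - pos a) - l *: side a.
    by rewrite r4 r3 sv p1; veq.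
  rewrite (_ : cross _ _ = (1 - l) * cross (side a) (z - pos a)); last by vring.
  by apply: mulr_ge0 => //; rewrite subr_ge0 ltW.
Qed.

Let agree z : polygon a z -> cross (side v) (z - pos a2) = 0 ->
  pt tsS (iota a) (move a z) = pt tsS (iota a1) (move a1 z).
Proof.
move=> hz c; have c0 : 0 <= cross (side v) (z - pos a2) by rewrite c.
have c0' : cross (side v) (z - pos a2) <= 0 by rewrite c.
have h1 := near hz c0; have h2 := far hz c0'.
have h1' : polygon v (move a z) by rewrite -q1 polygon_next.
have os : on_side v (move a z).
  apply: (line_on_side tsS h1').
  have -> : move a z - pos v = (z - pos a2) + side v by rewrite /move r1 p2 sv; veq.
  by rewrite crossDr crossvv addr0.
rewrite -(pt_next tsS h1) q1 -(pt_opp tsS os) -/w -q5.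
have -> : move a z + shift v = move a1 z.
  rewrite /move p1; have -> : pos (iota a1) = pos v + side v + shift v - side a1 by rewrite -r5 r3; veq.
  by rewrite r1 sv; veq.
by rewrite (pt_next tsS).
Qed.

Lemma split_piece_immersion : immersion (polygon a) (piece a).
Proof.
apply: immersion_split.
- by apply: pt_shift_immersion => z [h1 h2]; exact: near.
- by apply: pt_shift_immersion => z [h1 h2]; exact: far.
- by move=> z hz c; exact: agree.
Qed.

Lemma split_piece_side1 z : on_side a1 z -> piece a z = pt tsS (iota a1) (move a1 z).
Proof.
move=> os; have hz : polygon a z by rewrite -polygon_next; exact: (on_side_polygon tsP os).
case: os => t /andP[t0 t1'] ez; rewrite /piece -/a1 -/a2; case: ifPn => // c.
apply: agree => //; apply/eqP; rewrite eq_le c andbT.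
have -> : z - pos a2 = (1 - t) *: - side a1 by rewrite ez p2 p1; veq.
rewrite crossZr crossNr mulrN oppr_le0; apply: mulr_ge0; first by rewrite subr_ge0.
by have := turn_left tsS (iota a1); rewrite q5 sw s1 crossNr crossC opprK => /ltW.
Qed.

Lemma split_piece_side2 z : on_side a2 z -> piece a z = pt tsS (iota a2) (move a2 z).
Proof.
move=> os; have hz : polygon a z.
  by rewrite -na2 polygon_next; exact: (on_side_polygon tsP os).
case: os => t /andP[t0 t1'] ez; rewrite /piece -/a1 -/a2.
have c : 0 <= cross (side v) (z - pos a2).
  have -> : z - pos a2 = t *: side a2 by rewrite ez; veq.
  rewrite crossZr mulr_ge0 //; have := turn_left tsS v; rewrite q2 s2; exact: ltW.
rewrite -/v c -q3; have hn := near hz c; rewrite -q3 polygon_next in hn.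
have -> : move a z = move a2 z by rewrite /move r2 r1 p2 sv; veq.
by rewrite (pt_next tsS) //; move: hn; rewrite /move r2 r1 p2 sv; congr polygon; veq.
Qed.

Let sign (t : R) : cross (side v) (pos a + t *: side a - pos a2) = (l - t) * cross (side a) (side a1).
Proof. by rewrite p2 sv; vring. Qed.

Lemma split_piece_near (t : R) : t <= l -> piece a (pos a + t *: side a) =
  pt tsS (iota a) (move a (pos a + t *: side a)).
Proof.
move=> tl; rewrite /piece -/a1 -/a2 -/v sign mulr_ge0 //; first by rewrite subr_ge0.
exact: ltW (turn_left tsP a).
Qed.

Lemma split_piece_far (t : R) : l <= t -> t <= 1 -> piece a (pos a + t *: side a) =
  pt tsS m (pos m + (t - l) *: side a).
Proof.
move=> tl t1; have c := turn_left tsP a; rewrite -/a1 in c.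
have t01 : 0 <= t by apply: le_trans tl; exact: ltW.
have os : on_side a (pos a + t *: side a) by exists t => //; apply/andP.
have hz := on_side_polygon tsP os.
have hs : cross (side v) (pos a + t *: side a - pos a2) <= 0.
  rewrite sign; have := mulr_ge0 (_ : 0 <= t - l) (ltW c).
  by rewrite subr_ge0 => /(_ tl); lra.
have -> : pt tsS m (pos m + (t - l) *: side a) = pt tsS (iota a1) (move a1 (pos a + t *: side a)).
  have hf := far hz hs; have e : pos m + (t - l) *: side a = move a1 (pos a + t *: side a).
    by rewrite /move r4 r3 sv p1; veq.
  have hm : polygon m (move a1 (pos a + t *: side a)) by rewrite -polygon_next q4.
  by rewrite e -q4 (pt_next tsS hm).
rewrite /piece -/a1 -/a2 -/v; case: ifPn => // h; apply: agree => //.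
by apply/eqP; rewrite eq_le hs h.
Qed.

End Piece.

Lemma split_piece_opp a z : A a -> on_side a z -> piece (opp P a) (z + shift a) = piece a z.
Proof.
move=> Aa [t /andP[t0 t1] ez].
have Ab : A (opp P a) by rewrite (split_A sp).
have [l0 lb s0] := split_lam sp Aa; have [l0' _ s0'] := split_lam sp Ab.
have E : z + shift a = pos (opp P a) + (1 - t) *: side (opp P a).
  by rewrite ez (pos_opp tsP) (side_opp tsP); veq.
have main c (u : R) : A c -> 0 <= u -> u <= lam c -> on_side c (pos c + u *: side c) ->
    piece (opp P c) (pos c + u *: side c + shift c) = piece c (pos c + u *: side c).
  move=> Ac u0 ul os; have Ac' : A (opp P c) by rewrite (split_A sp).
  have [k0 kb k1] := split_lam sp Ac.
  have -> : pos c + u *: side c + shift c = pos (opp P c) + (1 - u) *: side (opp P c).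
    by rewrite (pos_opp tsP) (side_opp tsP); veq.
  rewrite (split_piece_near Ac ul) (split_piece_far Ac'); [|rewrite kb; lra|lra].
  have os' : on_side (iota c) (pos (iota c) + u *: side c).
    exists (u / lam c); last by rewrite k1 scalerA divfK ?gt_eqF.
    by apply/andP; split; [rewrite divr_ge0 // ltW | rewrite ler_pdivrMr // mul1r].
  have -> : move c (pos c + u *: side c) = pos (iota c) + u *: side c by rewrite /move; veq.
  rewrite -(pt_opp tsS os') (split_half sp Ac); congr pt.
  by rewrite -(split_half sp Ac) (pos_opp tsS) k1 kb (side_opp tsP); veq.
have [tl|tl] := leP t (lam a).
  by rewrite ez; apply: main => //; exists t => //; apply/andP.
have os2 : on_side (opp P a) (pos (opp P a) + (1 - t) *: side (opp P a)).
  by exists (1 - t) => //; apply/andP; split; lra.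
have u0 : 0 <= 1 - t by lra.
have ul : 1 - t <= lam (opp P a) by rewrite lb; lra.
have := main _ _ Ab u0 ul os2; rewrite -E => <-.
rewrite (oppK tsP) (shift_opp tsP).
by have -> : z + shift a - shift a = z by veq.
Qed.

Let keyP x a : key A x = Some a -> A a /\ [\/ x = a, x = nP a | x = nP (nP a)].
Proof.
rewrite /key; case: ifP => [h [<-]|_]; first by split => //; constructor 1.
case: ifP => [h [<-]|_]; first by split => //; constructor 3; rewrite triP.
by case: ifP => // h [<-]; split => //; constructor 2; rewrite triP.
Qed.

Let keyN x : key A x = None -> [/\ ~~ A x, ~~ A (nP x) & ~~ A (nP (nP x))].
Proof. by rewrite /key; case: ifP => // _; case: ifP => // _; case: ifP. Qed.

Lemma split_map : exists f : surface P -> surface S, [/\ local_iso f,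
  forall x y z, ~~ A x -> on_side x z -> rep y x z -> rep (f y) (iota x) (z + (pos (iota x) - pos x)) &
  forall a y t, A a -> 0 <= t <= lam a -> rep y a (pos a + t *: side a) ->
    rep (f y) (iota a) (pos (iota a) + t *: side a)].
Proof.
pose phi x := if key A x is Some a then piece a else fun z => pt tsS (iota x) (move x z).
have keyA x : A x -> key A x = Some x by rewrite /key => ->.
have knext x : key A (nP x) = key A x by apply: key_next triP (split_sep sp).
have qx x : key A x = None -> nS (iota x) = iota (nP x).
  by move=> /keyN [h1 h2 h3]; exact: split_keep sp _ h1 h2 h3.
have mem x z : key A x = None -> polygon x z -> polygon (iota x) (move x z).
  move=> k /(tri_polygonP triP) [h1 h2 h3]; have [n1 n2 n3] := keyN k.
  have k1 : key A (nP x) = None by rewrite knext.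
  have e1 := qx x k; have e2 := qx _ k1.
  have s1 := split_side sp n1; have s2 := split_side sp n2; have s3 := split_side sp n3.
  have q1 : pos (iota (nP x)) = pos (iota x) + side x by rewrite -e1 pos_next s1.
  have q2 : pos (iota (nP (nP x))) = pos (iota x) + side x + side (nP x) by rewrite -e2 pos_next s2 q1.
  apply/(tri_polygonP triS); rewrite e1 e2 s1 s2 s3 q1 q2 /move; split.
  - by have -> : z + (pos (iota x) - pos x) - pos (iota x) = z - pos x by veq.
  - by move: h2; rewrite pos_next; congr (0 <= cross _ _); veq.
  - by move: h3; rewrite !pos_next; congr (0 <= cross _ _); veq.
have onside x z : ~~ A x -> on_side x z -> phi x z = pt tsS (iota x) (move x z).
  move=> nA os; rewrite /phi; case E : (key A x) => [a|//].
  have [Aa [ex|ex|ex]] := keyP E; rewrite ex in nA os *.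
  - by rewrite Aa in nA.
  - exact: split_piece_side1.
  - exact: split_piece_side2.
have [|||f [lf fE]] := @map_surface _ P S phi tsP.
- move=> x z hz; rewrite /phi knext; case E : (key A x) => [//|].
  have hm := mem x z E hz; rewrite -(qx x E) -(pt_next tsS hm); congr pt.
  have [n1 _ _] := keyN E.
  by rewrite /move -(qx x E) !pos_next (split_side sp n1); veq.
- move=> x z os; have [Ax|nA] := boolP (A x).
    have Ao : A (opp P x) by rewrite (split_A sp).
    by rewrite /phi (keyA _ Ax) (keyA _ Ao) split_piece_opp.
  have nAo : ~~ A (opp P x) by rewrite (split_A sp).
  have os' := on_side_opp tsP os; rewrite (onside _ _ nA os) (onside _ _ nAo os').
  have osq : on_side (iota x) (move x z).
    case: os => t t01 ->; exists t => //.
    by rewrite /move (split_side sp nA); veq.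
  rewrite -(pt_opp tsS osq) (split_opp sp nA); congr pt.
  by rewrite /move -(split_opp sp nA) (pos_opp tsP) (pos_opp tsS) (split_side sp nA); veq.
- move=> x; rewrite /phi; case E : (key A x) => [a|].
    have [Aa hx] := keyP E; have -> : polygon x = polygon a.
      by case: hx => ->; rewrite ?polygon_next.
    exact: split_piece_immersion.
  by apply: pt_shift_immersion => z; exact: mem.
exists f; split => // [x y z nA os hy|a y t Aa /andP[t0 tl] hy].
  rewrite (fE _ _ _ hy) (onside _ _ nA os).
  apply: pt_rep; apply: (on_side_polygon tsS); case: os => t t01 ->; exists t => //.
  by rewrite /move (split_side sp nA); veq.
have [k0 _ k1] := split_lam sp Aa.
rewrite (fE _ _ _ hy) /phi (keyA _ Aa) (split_piece_near Aa tl).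
have -> : move a (pos a + t *: side a) = pos (iota a) + t *: side a by rewrite /move; veq.
apply: pt_rep; apply: (on_side_polygon tsS).
exists (t / lam a); last by rewrite k1 scalerA divfK ?gt_eqF.
by apply/andP; split; [rewrite divr_ge0 // ltW | rewrite ler_pdivrMr // mul1r].
Qed.

(** The position in P of the origin of a side of S. *)
Let place j : V := let a := origin j in
  if j == iota a then pos a else if j == opp S (nu a) then pos (nP (nP a))
  else pos a + lam a *: side a.

Let placeP : (forall x, place (iota x) = pos x) /\ forall a, A a ->
  [/\ place (mu a) = pos a + lam a *: side a, place (nu a) = pos a + lam a *: side a &
      place (opp S (nu a)) = pos (nP (nP a))].
Proof.
split=> [x|a Aa]; first by rewrite /place (split_origin sp) eqxx.
have [g1 g2 g3] := split_origin3 sp Aa; have [n1 n2 n3] := split_near sp Aa.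
have [m1 m2 m3] := split_far sp Aa.
have ne1 : mu a != iota a.
  apply/eqP => e; have : opp S (nu a) = iota (nP (nP a)).
    by rewrite -m2 -m1 -n2 -n1 e.
  move=> h; have := g3; rewrite h (split_origin sp) => h2.
  by have := next2_neq tsP a; rewrite h2 eqxx.
have ne2 : opp S (nu a) != iota a.
  apply/eqP => e; have : iota (nP a) = iota (nP (nP a)).
    by rewrite -m1 -m3 e n1 n2.
  move/(congr1 origin); rewrite !(split_origin sp) => /esym h2.
  by have := next_neq tsP (nP a); rewrite h2 eqxx.
have ne3 : mu a != opp S (nu a).
  by apply/eqP => e; have := next_neq tsS (opp S (nu a)); rewrite m3 e eqxx.
have ne4 : nu a != iota a by rewrite -n1 next_neq.
have ne5 : nu a != opp S (nu a).
  apply/eqP => e; have : mu a = iota (nP (nP a)) by rewrite -m3 -e n2.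
  move=> h; have := g1; rewrite h (split_origin sp) => h2.
  by have := next2_neq tsP a; rewrite h2 eqxx.
by rewrite /place g1 g2 g3 (negPf ne1) (negPf ne2) (negPf ne3) (negPf ne4) (negPf ne5) eqxx.
Qed.

Lemma split_inclusion : exists f : surface S -> surface P, local_iso f /\
  forall y x z, rep y (iota x) z -> rep (f y) x (z + (pos x - pos (iota x))).
Proof.
have [pl1 pl2] := placeP; have or1 := split_origin sp; have or3 := split_origin3 sp.
have onA a : A a -> on_side a (pos a + lam a *: side a).
  move=> Aa; have [l0 lb _] := split_lam sp Aa.
  have Ab : A (opp P a) by rewrite (split_A sp).
  have [l0' _ _] := split_lam sp Ab; exists (lam a) => //.
  by rewrite lb in l0'; apply/andP; split; lra.
have sv a : A a -> side (nu a) = pos (nP (nP a)) - (pos a + lam a *: side a).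
  move=> Aa; have [n1 n2 n3] := split_near sp Aa; have [l0 lb s0] := split_lam sp Aa.
  have := tri_sides triS (iota a); rewrite n1 n2 s0 (split_side sp); last by case: (split_sep sp Aa).
  have h2 := tri_sides triP a => h.
  have -> : side (nu a) = - (lam a *: side a) - side (nP (nP a)).
    by apply/eqP; rewrite -subr_eq0 -h; apply/eqP; veq.
  have -> : side (nP (nP a)) = - (side a + side (nP a)) by apply/eqP; rewrite -addr_eq0 addrC h2.
  by rewrite !pos_next; veq.
have sm a : A a -> side (mu a) = (1 - lam a) *: side a.
  move=> Aa; have [m1 m2 m3] := split_far sp Aa.
  have := tri_sides triS (mu a); rewrite m1 m2 (side_opp tsS) sv // (split_side sp); last by case: (split_sep sp Aa).
  rewrite !pos_next => h.
  by apply/eqP; rewrite -subr_eq0 -h; apply/eqP; veq.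
have [|||f [lf fE]] := @inclusion_map _ S P tsS tsP triS origin place.
- move=> j; case: (split_cover sp j) => [[x ->]|[a Aa]].
    by rewrite pl1 or1; exact: pos_polygon_id.
  have [e1 e2 e3] := or3 a Aa; have [q1 q2 q3] := pl2 a Aa.
  by case=> ->; rewrite ?e1 ?e2 ?e3 ?q1 ?q2 ?q3; [exact: (on_side_polygon tsP (onA _ Aa))..|
     apply: pos_polygon => //; rewrite !next_porbitE porbit_id].
- move=> j; case: (split_cover sp j) => [[x ->]|[a Aa]].
    rewrite or1 pl1; case E : (key A x) => [a|].
      have [Aa hx] := keyP E; have [e1 e2 e3] := or3 a Aa; have [q1 q2 q3] := pl2 a Aa.
      have [n1 n2 n3] := split_near sp Aa; have [m1 m2 m3] := split_far sp Aa.
      have [k0 _ k1] := split_lam sp Aa; have [g1 g2] := split_sep sp Aa.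
      case: hx => ->.
      + by rewrite n1 e2 q2 k1 porbit_id.
      + by rewrite m2 e3 q3 (split_side sp g1) pos_next porbit_sym next_porbit.
      + rewrite n3 or1 pl1 (split_side sp g2) -pos_next triP; split => //.
        by rewrite porbit_sym !next_porbitE porbit_id.
    have [h1 h2 h3] := keyN E.
    by rewrite (split_keep sp) // or1 pl1 (split_side sp h1) pos_next next_porbit.
  have [e1 e2 e3] := or3 a Aa; have [q1 q2 q3] := pl2 a Aa.
  have [n1 n2 n3] := split_near sp Aa; have [m1 m2 m3] := split_far sp Aa.
  case=> ->.
  + rewrite m1 or1 pl1 e1 q1 sm // pos_next next_porbit; split => //; veq.
  + rewrite n2 or1 pl1 e2 q2 sv // !next_porbitE porbit_id; split => //; veq.
  + rewrite m3 e1 q1 e3 q3 (side_opp tsS) sv // porbit_id; split => //; veq.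
- move=> j; case: (split_cover sp j) => [[x ->]|[a Aa]].
    have [Ax|nA] := boolP (A x).
      have Ab : A (opp P x) by rewrite (split_A sp).
      have [e1 e2 e3] := or3 _ Ab; have [q1 q2 q3] := pl2 _ Ab.
      have [k0 kb k1] := split_lam sp Ax.
      right; exists x; rewrite or1 pl1 (split_half sp Ax) e1 q1 k1 kb !porbit_id; split => //.
      * exact: on_side_pos.
      * exact: onA.
      * by rewrite (pos_opp tsP) (side_opp tsP); veq.
    right; exists x; rewrite (split_opp sp nA) !or1 !pl1 (split_side sp nA) !porbit_id -pos_next; split => //.
    * exact: on_side_pos.
    * exact: on_side_next.
    * by rewrite (pos_opp tsP) pos_next.
  have [e1 e2 e3] := or3 a Aa; have [q1 q2 q3] := pl2 a Aa.
  case=> ->.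
  + have Ab : A (opp P a) by rewrite (split_A sp).
    have eo : opp S (mu a) = iota (opp P a).
      by rewrite -[a in mu a](oppK tsP) -(split_half sp Ab) (oppK tsS).
    right; exists a; rewrite eo or1 pl1 e1 q1 sm // !porbit_id.
    have -> : pos a + lam a *: side a + (1 - lam a) *: side a = pos (nP a) by rewrite pos_next; veq.
    split => //; [exact: onA|exact: on_side_next|].
    by rewrite (pos_opp tsP) pos_next.
  + left; rewrite e2 e3 q2 q3 sv // porbit_id; split => //; veq.
  + left; rewrite (oppK tsS) e2 e3 q2 q3 (side_opp tsS) sv // porbit_id; split => //; veq.
exists f; split => // y x z /fE; by rewrite or1 pl1.
Qed.

(** The map from P is defined by pieces and the map from S is an inclusion.
    The extra conclusions follow the sides, and the first parts of the
    subdivided sides, through the isomorphism. *)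
Theorem split_isomorphic : exists (f : surface P -> surface S) (f' : surface S -> surface P),
  [/\ local_iso f, local_iso f', cancel f f', cancel f' f &
    (forall x y z, ~~ A x -> on_side x z -> rep y x z -> rep (f y) (iota x) (z + (pos (iota x) - pos x))) /\
    (forall a y t, A a -> 0 <= t <= lam a -> rep y a (pos a + t *: side a) ->
       rep (f y) (iota a) (pos (iota a) + t *: side a))].
Proof.
have [f [lf f1 f2]] := split_map; have [f' [lf' f'E]] := split_inclusion.
exists f, f'; split => //.
- apply: (local_iso_rigid tsP (local_iso_comp lf lf')) => d.
  have [x he nA] : exists2 e, e \in porbit nP d & ~~ A e.
    have [Ad|nA] := boolP (A d); last by exists d => //; exact: porbit_id.
    by exists (nP d); [exact: next_porbit | case: (split_sep sp Ad)].
  have os := on_side_midpoint x.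
  have [y hy] := polygon_rep (on_side_polygon tsP os).
  exists x, y; split => //=; apply: (rep_fun _ hy).
  have := f'E _ _ _ (f1 _ _ _ nA os hy); congr rep; veq.
- apply: (local_iso_rigid tsS (local_iso_comp lf' lf)) => j.
  have [x he nA] : exists2 x, iota x \in porbit nS j & ~~ A x.
    have go k : k \in porbit nS j -> (exists2 a, A a & [\/ k = iota a, k = nu a | k = mu a] \/ k = opp S (nu a)) ->
        exists2 x, iota x \in porbit nS j & ~~ A x.
      move=> hk [a Aa hc]; have [g1 g2] := split_sep sp Aa.
      have [n1 n2 n3] := split_near sp Aa; have [m1 m2 m3] := split_far sp Aa.
      case: hc => [[] e|e]; rewrite e in hk.
      + by exists (nP (nP a)) => //; rewrite -n2 -n1 !next_porbitE.
      + by exists (nP (nP a)) => //; rewrite -n2 !next_porbitE.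
      + by exists (nP a) => //; rewrite -m1 !next_porbitE.
      + by exists (nP a) => //; rewrite -m1 -m3 !next_porbitE.
    case: (split_cover sp j) => [[x ex]|[a Aa hc]].
      have [Ax|nA] := boolP (A x); last by exists x => //; rewrite ex porbit_id.
      by apply: (go j); [exact: porbit_id|exists x => //; left; constructor 1].
    apply: (go j); first exact: porbit_id.
    by exists a => //; case: hc => e; [left; constructor 3|left; constructor 2|right].
  have os := on_side_midpoint (iota x).
  have [y hy] := polygon_rep (on_side_polygon tsS os).
  exists (iota x), y; split => //=; apply: (rep_fun _ hy).
  have := f'E _ _ _ hy.
  have em : midpoint (iota x) + (pos x - pos (iota x)) = midpoint x.
    by rewrite /midpoint (split_side sp nA); veq.
  rewrite em => h; have := f1 _ _ _ nA (on_side_midpoint x) h; congr rep.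
  by rewrite -em; veq.
Qed.

End Split.

(** * Triangulated surfaces given by tables *)

Section Tables.
Local Open Scope nat_scope.

(** The side after i in a gluing of triangles, the triangle j having the
    sides 3 j, 3 j + 1 and 3 j + 2. *)
Definition next3 i := if i %% 3 == 2 then i - 2 else i.+1.
Definition prev3 i := if i %% 3 == 0 then i + 2 else i.-1.

Definition ord_fun n (f : nat -> nat) (i : 'I_n) : 'I_n := insubd i (f i).

(** The permutation of 'I_n that f induces, or 1 if f does not permute the
    numbers below n: the tables below are turned into permutations without
    a proof obligation in the definition. *)
Definition ord_perm n (f : nat -> nat) : {perm 'I_n} := insubd (perm_one 'I_n) (finfun (@ord_fun n f)).

Lemma all_iotaP n (Q : pred nat) : all Q (iota 0 n) -> forall i, i < n -> Q i.
Proof. by move=> /allP h i hi; apply: h; rewrite mem_iota. Qed.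

Lemma ord_funE n (f : nat -> nat) (i : 'I_n) : f i < n -> val (ord_fun f i) = f i.
Proof. by move=> h; rewrite /ord_fun val_insubd h. Qed.

Lemma ord_permE n (f g : nat -> nat) : (forall i, i < n -> (f i < n) && (g (f i) == i)) ->
  forall i : 'I_n, val (ord_perm n f i) = f i.
Proof.
move=> h i.
have hf (j : 'I_n) : val (ord_fun f j) = f j.
  by apply: ord_funE; case/andP: (h j (ltn_ord j)).
have inj : injectiveb (finfun (@ord_fun n f)).
  apply/injectiveP => j k; rewrite !ffunE => e; apply: val_inj.
  have := congr1 val e; rewrite !hf => e'.
  have /andP[_ /eqP ej] := h j (ltn_ord j); have /andP[_ /eqP ek] := h k (ltn_ord k).
  by apply: etrans ek; rewrite -e' ej.
by rewrite /ord_perm -pvalE insubdK // ffunE hf.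
Qed.

Lemma next3_lt n i : n %% 3 = 0 -> i < n -> next3 i < n.
Proof. by rewrite /next3 => h hi; case: ifP => //; lia. Qed.

Lemma next3K i : prev3 (next3 i) = i.
Proof. by rewrite /prev3 /next3; case: (eqVneq (i %% 3) 2) => h; case: ifP; lia. Qed.

Lemma next3_3 i : next3 (next3 (next3 i)) = i.
Proof.
rewrite {3}/next3; case: (eqVneq (i %% 3) 2) => h; rewrite {2}/next3;
  case: (eqVneq (_ %% 3) 2) => h'; rewrite /next3; case: ifP; lia.
Qed.

Lemma next3_neq i : next3 i != i.
Proof. by rewrite /next3; case: ifP => h; lia. Qed.

(** Checks by computation that the orbits are the fibers of c. *)
Definition orbits_check n (f c : nat -> nat) :=
  all (fun i => (c (f i) == c i) &&
    all (fun j => (c i == c j) ==> (j \in traject f i n)) (iota 0 n)) (iota 0 n).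

Lemma orbits_checkP n (s : {perm 'I_n}) (f c : nat -> nat) : (forall i : 'I_n, val (s i) = f i) ->
  orbits_check n f c -> forall d e : 'I_n, (e \in porbit s d) = (c e == c d).
Proof.
move=> hs hc d e.
have it k (i : 'I_n) : val ((s ^+ k)%g i) = iter k f i.
  by elim: k => [|k IH]; rewrite ?perm1 // expgSr permM hs IH.
apply/idP/idP.
- case/porbitP => k ->; elim: k => [|k IH]; first by rewrite perm1.
  rewrite expgSr permM hs.
  by have /andP[/eqP -> _] := all_iotaP hc (ltn_ord ((s ^+ k)%g d)).
- move=> h; have /andP[_ /all_iotaP /(_ e (ltn_ord e))] := all_iotaP hc (ltn_ord d).
  rewrite eq_sym h /= => /trajectP [k _ ek].
  have -> : e = (s ^+ k)%g d by apply: val_inj; rewrite it.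
  exact: mem_porbit.
Qed.

Lemma card_porbits n (s : {perm 'I_n}) (c : nat -> nat) k :
  (forall d e : 'I_n, (e \in porbit s d) = (c e == c d)) ->
  all (fun i => c i < k) (iota 0 n) -> all (fun j => has (fun i => c i == j) (iota 0 n)) (iota 0 k) ->
  #|porbits s| = k.
Proof.
move=> hc h1 h2.
have ck (i : 'I_n) : c i < k by exact: (all_iotaP h1 (ltn_ord i)).
have ex (j : 'I_k) : exists i : 'I_n, c i == j.
  have /hasP [i] := all_iotaP h2 (ltn_ord j).
  by rewrite mem_iota => hi ci; exists (Ordinal hi).
pose g (j : 'I_k) := xchoose (ex j).
have gP j : c (g j) = j by apply/eqP; exact: (xchooseP (ex j)).
have -> : porbits s = [set porbit s (g j) | j : 'I_k].
  apply/setP => X; apply/imsetP/imsetP => [[i _ ->]|[j _ ->]]; last by exists (g j).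
  by exists (Ordinal (ck i)) => //; apply/eqP; rewrite eq_porbit_mem hc gP.
rewrite card_imset ?card_ord // => j j' /eqP; rewrite eq_porbit_mem hc !gP => /eqP e.
by apply: val_inj.
Qed.

End Tables.

Section TriGluing.
Variable R : realType.
Local Notation V := (R * R)%type.

Definition entry (t : seq nat) i := nth 0%N t i.

(** The gluing of n / 3 triangles according to the table t of opposite
    sides and the list sd of the side vectors; each triangle has the origin
    of its first side at 0. *)
Definition tri_gluing n (t : seq nat) (sd : seq V) : polygon_gluing R :=
  @PolygonGluing R n (ord_perm n next3) (ord_perm n (entry t))
    (fun i => if (i %% 3 == 0)%N then 0 else if (i %% 3 == 1)%N then sd`_i.-1 else sd`_(i - 2) + sd`_i.-1).

Definition table_check n t :=
  [&& (n %% 3 == 0)%N, (0 < n)%N & all (fun i => (entry t i < n)%N && (entry t (entry t i) == i)) (iota 0 n)].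

(** Connectedness: n rounds of the two permutations from a side reach all
    the sides. *)
Definition reach_check n t :=
  all (fun i => let r := iter n (fun s => undup (s ++ map next3 s ++ map (entry t) s)) [:: i] in
    all (fun j => j \in r) (iota 0 n)) (iota 0 n).

Definition sides_ok n t (sd : seq V) := forall i, (i < n)%N ->
  [/\ sd`_i + sd`_(next3 i) + sd`_(next3 (next3 i)) = 0, 0 < cross sd`_i sd`_(next3 i) &
      sd`_(entry t i) = - sd`_i].

Section Gluing.
Variables (n : nat) (t : seq nat) (sd : seq V).
Hypotheses (ct : table_check n t) (ok : sides_ok n t sd).
Local Notation P := (tri_gluing n t sd).
Implicit Types d e : 'I_(nsides P).

Let n3 : (n %% 3 = 0)%N. Proof. by case/and3P: ct => /eqP. Qed.

Lemma tri_next_val d : val (next P d) = next3 d.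
Proof.
apply: (ord_permE (g := prev3)) => i hi.
by rewrite next3_lt // next3K eqxx.
Qed.

Lemma tri_opp_val d : val (opp P d) = entry t d.
Proof.
case/and3P: ct => _ _ /all_iotaP h.
exact: (ord_permE (g := entry t)) h d.
Qed.

Lemma tri_triangulated : triangulated P.
Proof. by move=> d; apply: val_inj; rewrite /= !tri_next_val next3_3. Qed.

Lemma tri_prev_val d : val (((next P)^-1)%g d) = prev3 d.
Proof. by have := congr1 prev3 (tri_next_val (((next P)^-1)%g d)); rewrite permKV next3K => ->. Qed.

Lemma tri_rot_val d : val (rot P d) = entry t (prev3 d).
Proof. by rewrite rotE tri_opp_val tri_prev_val. Qed.

Lemma tri_side d : side d = sd`_d.
Proof.
rewrite /side /pos /= tri_next_val /next3.
have := ltn_ord d; set i := nat_of_ord d => hi.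
have [h _ _] := ok hi; have h3 : (i %% 3 < 3)%N by rewrite ltn_mod.
have [e|[e|e]] : (i %% 3 = 0 \/ i %% 3 = 1 \/ i %% 3 = 2)%N by lia.
- rewrite e /=; have -> : (i.+1 %% 3 = 1)%N by lia.
  by rewrite /= subr0.
- rewrite e /=; have -> : (i.+1 %% 3 = 2)%N by lia.
  have -> : (i.+1 - 2 = i.-1)%N by lia.
  by rewrite /=; veq.
- have e1 : next3 i = (i - 2)%N by rewrite /next3 e.
  have e0 : ((i - 2) %% 3 = 0)%N by lia.
  have e2 : next3 (i - 2) = i.-1 by rewrite /next3 e0 /=; lia.
  move: h; rewrite e1 e2 e /= e0 /= sub0r => h.
  by apply/esym/eqP; rewrite -addr_eq0 addrA h.
Qed.

Lemma tri_translation_surface : reach_check n t -> translation_surface P.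
Proof.
move=> rc; split.
- by case/and3P: ct.
- move=> d; split; apply/eqP => /(congr1 val); rewrite ?tri_next_val.
    by move=> e; have := next3_neq d; rewrite -[X in _ != X]e ?tri_next_val eqxx.
  move=> e; have := next3_3 d; rewrite -!tri_next_val => e2.
  by have := next3_neq d; rewrite -[X in next3 X]e next3_3 eqxx.
- move=> d e he n1 n2.
  have [e1|e1|->] := tri_porbit tri_triangulated he; rewrite ?e1 ?eqxx // in n1 n2.
  have [_ c _] := ok (ltn_ord d).
  rewrite !pos_next !tri_side tri_next_val.
  by move: c; congr (_ < _); vring.
- move=> d; split; first by apply: val_inj; rewrite !tri_opp_val; case/and3P: ct => _ _ /all_iotaP /(_ d (ltn_ord d)) /andP[_ /eqP].
  by rewrite !tri_side tri_opp_val; case: (ok (ltn_ord d)).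
- move=> d e; have := all_iotaP (all_iotaP rc (ltn_ord d)) (ltn_ord e).
  suff gen k (e' : 'I_(nsides P)) : nat_of_ord e' \in iter k (fun s => undup (s ++ map next3 s ++ map (entry t) s)) [:: nat_of_ord d] ->
      connect (fun x y => (y == next P x) || (y == opp P x)) d e' by exact: gen.
  elim: k e' {e} => [|k IH] e; first by rewrite inE => /eqP /val_inj ->; exact: connect0.
  rewrite iterS mem_undup mem_cat => /orP[/IH //|].
  have lt (f : nat -> nat) i : (forall i, (i < n)%N -> (f i < n)%N) -> i \in iter k (fun s => undup (s ++ map next3 s ++ map (entry t) s)) [:: nat_of_ord d] -> (i < n)%N.
    move=> _; elim: k i {IH} => [|k IH] i; first by rewrite inE => /eqP ->.
    rewrite iterS mem_undup mem_cat => /orP[/IH //|]; rewrite mem_cat => /orP[] /mapP [j /IH hj ->].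
      exact: next3_lt.
    by case/and3P: ct => _ _ /all_iotaP /(_ j hj) /andP[].
  rewrite mem_cat => /orP[] /mapP [i hi ei].
  + have hn := lt id i (fun _ => id) hi.
    have := IH (Ordinal hn) hi => h; apply: (connect_trans h); apply: connect1.
    by apply/orP; left; apply/eqP/val_inj; rewrite tri_next_val.
  + have hn := lt id i (fun _ => id) hi.
    have := IH (Ordinal hn) hi => h; apply: (connect_trans h); apply: connect1.
    by apply/orP; right; apply/eqP/val_inj; rewrite tri_opp_val.
Qed.

Definition corner_at i : R := angle sd`_i (- sd`_(prev3 i)).

Lemma tri_corner d : corner d = corner_at d.
Proof. by rewrite /corner !tri_side tri_prev_val. Qed.

(** The angles of each triangle add up to pi. *)
Lemma tri_corner_sum : \sum_(i < n) corner_at i = pi * (n %/ 3)%:R.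
Proof.
have E : \sum_(i < n) corner_at i = \sum_(d : 'I_(nsides P)) corner_at d by [].
pose F (d : 'I_(nsides P)) := corner_at d.
have inj : injective (next P) by exact: perm_inj.
have s1 : \sum_d F d = \sum_d F (next P d) by exact: reindex_inj.
have s2 : \sum_d F d = \sum_d F (next P (next P d)) by rewrite s1; exact: (reindex_inj inj (F := fun d => F (next P d))).
have s3 : \sum_d (F d + F (next P d) + F (next P (next P d))) = \sum_(d : 'I_(nsides P)) pi.
  apply: eq_bigr => d _; have hn := ltn_ord d; have [h c _] := ok hn.
  rewrite /F /corner_at !tri_next_val !next3K.
  have -> : prev3 d = next3 (next3 d) by rewrite -[RHS]next3K next3_3.
  exact: triangle_angles.
have n33 : n%:R = 3 * (n %/ 3)%:R :> R by rewrite -natrM; congr (_%:R); lia.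
rewrite sumr_const card_ord -mulr_natr !big_split /= -s1 -s2 in s3.
  have s4 : \sum_(i < n) corner_at i + \sum_(i < n) corner_at i + \sum_(i < n) corner_at i = pi * n%:R by exact: s3.
  by move: s4; rewrite n33; move=> h4; lra.
Qed.

End Gluing.

(** Numbers the edges: the position of the edge of i when edges are listed
    by their smaller sides. *)
Definition opp_class (t : seq nat) (i : nat) := count (fun j => (j <= entry t j)%N) (iota 0 (minn i (entry t i))).

(** Checks by computation that there are k vertices, given as the fibers of
    c, and that the genus is 2 by Euler's formula. *)
Definition orbits_in_H2 (n : nat) (t : seq nat) (c : nat -> nat) k :=
  [&& orbits_check n (fun i => entry t (prev3 i)) c, all (fun i => c i < k)%N (iota 0 n),
      all (fun j => has (fun i => c i == j) (iota 0 n)) (iota 0 k),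
      orbits_check n (entry t) (opp_class t),
      all (fun i => opp_class t i < n./2)%N (iota 0 n),
      all (fun j => has (fun i => opp_class t i == j) (iota 0 n)) (iota 0 n./2),
      orbits_check n next3 (fun i => i %/ 3)%N,
      all (fun i => i %/ 3 < n %/ 3)%N (iota 0 n),
      all (fun j => has (fun i => i %/ 3 == j)%N (iota 0 n)) (iota 0 (n %/ 3)) &
      ((k + n %/ 3 + 2).*2 == n)%N].

Section InH2.
Variables (n : nat) (t : seq nat) (sd : seq V) (c : nat -> nat) (k : nat).
Hypotheses (ct : table_check n t) (ok : sides_ok n t sd) (rc : reach_check n t).
Hypothesis orb : orbits_in_H2 n t c k.
Local Notation P := (tri_gluing n t sd).

Lemma tri_rot_porbit (d e : 'I_(nsides P)) : (e \in porbit (rot P) d) = (c e == c d).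
Proof.
case/and3P: orb => h _ _.
exact: (orbits_checkP (s := rot P) (tri_rot_val ct) h).
Qed.

Lemma tri_rot_card : #|porbits (rot P)| = k.
Proof.
case/and4P: orb => _ h2 h3 _; exact: (card_porbits tri_rot_porbit h2 h3).
Qed.

Lemma tri_genus2 : genus2 P.
Proof.
case/and5P: orb => _ _ _ h4 /and5P[h5 h6 h7 h8 /andP[h9 /eqP h10]].
rewrite /genus2 tri_rot_card.
rewrite (card_porbits (orbits_checkP (s := next P) (tri_next_val ct) h7) h8 h9).
by rewrite (card_porbits (orbits_checkP (s := opp P) (tri_opp_val ct) h4) h5 h6) -[in RHS]h10 doubleK.
Qed.

Lemma tri_cone_angle (d : 'I_(nsides P)) :
  cone_angle d = \sum_(0 <= i < n | c i == c d) corner_at sd i.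
Proof.
rewrite big_mkord; apply: eq_big => [e|e _]; first exact: tri_rot_porbit.
exact: tri_corner.
Qed.

Hypothesis regular_sum : forall j, (0 < j < k)%N ->
  \sum_(0 <= i < n | c i == j) corner_at sd i = 2 * pi.

(** If all the vertices but the one of class 0 have a full turn of corners,
    that one has the rest of the angles of the triangles. *)
Lemma tri_cone (d : 'I_(nsides P)) : cone_angle d = if c d == 0%N then 6 * pi else 2 * pi.
Proof.
case/and5P: (orb) => _ hck hk _ /and5P[_ _ _ _ /andP[_ /eqP hn]].
have k0 : (0 < k)%N.
  have n0 : (0 < n)%N by case/and3P: ct.
  have := all_iotaP hck n0; exact: leq_ltn_trans.
case: eqP => [hd0|h]; last first.
  by rewrite tri_cone_angle regular_sum // lt0n; apply/andP; split; [apply/eqP | exact: (all_iotaP hck (ltn_ord d))].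
have p0 := @pi_gt0 R.
have tot : \sum_(j < k) \sum_(0 <= i < n | c i == j) corner_at sd i = pi * (n %/ 3)%:R.
  rewrite -(tri_corner_sum ct ok) -(big_mkord xpredT (corner_at sd)).
  rewrite (eq_bigr (fun j : 'I_k => \sum_(i < n | c i == j) corner_at sd i)) => [|j _]; last by rewrite big_mkord.
  rewrite (exchange_big_dep xpredT) //= big_mkord.
  apply: eq_bigr => i _.
  have ci := all_iotaP hck (ltn_ord i).
  rewrite (bigD1 (Ordinal ci)) //= big1 ?addr0 // => j /andP[/eqP h1 h2].
  by move/eqP: h2; case; apply: val_inj.
rewrite tri_cone_angle hd0.
have [k' ek] : exists k', k = k'.+1 by exists k.-1; rewrite prednK.
have hreg := regular_sum; move: tot hreg hn; rewrite ek => + hreg hn.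
rewrite big_ord_recl /= [X in _ + X](eq_bigr (fun=> 2 * pi)) => [|i _]; last first.
  by apply: hreg; have := ltn_ord i; rewrite /bump; lia.
rewrite sumr_const card_ord -(mulr_natr _ k') => h.
have hn' : (n %/ 3 = 6 + 2 * k')%N.
  by case/and3P: ct => /eqP n3 _ _; move: hn; lia.
by move: h; rewrite hn' natrD natrM; lra.
Qed.

Lemma tri_singular (d : 'I_(nsides P)) : singular d <-> c d = 0%N.
Proof.
have p0 := @pi_gt0 R; rewrite /singular tri_cone; case: eqP => h; split => //; lra.
Qed.

Lemma tri_in_H2 : in_H2 P.
Proof.
case/and5P: (orb) => _ hck hk _ _.
have k0 : (0 < k)%N.
  have n0 : (0 < n)%N by case/and3P: ct.
  have := all_iotaP hck n0; exact: leq_ltn_trans.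
have [d0 hd0] : exists d : 'I_(nsides P), c d = 0%N.
  have /hasP [i] := all_iotaP hk k0; rewrite mem_iota => hi /eqP ci.
  by exists (Ordinal hi : 'I_(nsides P)).
split; [exact: tri_translation_surface | exact: tri_genus2 |].
exists d0; first exact/tri_singular.
by move=> e /tri_singular he; rewrite tri_rot_porbit hd0 he.
Qed.

End InH2.

(** The combinatorial conditions of [flip] on the tables. *)
Definition flip_check n (tP tQ r A : seq nat) :=
  all (fun i => let n1 := next3 i in let n2 := next3 n1 in let o := entry tP i in
    [&& (entry r i < n)%N, entry tQ (entry r i) == entry r o, (i \in A) == (o \in A),
        (i \in A) ==> (n1 \notin A) && (n2 \notin A),
        [&& i \notin A, n1 \notin A & n2 \notin A] ==> (next3 (entry r i) == entry r n1) &
        (i \in A) ==> [&& next3 (entry r i) == entry r n2,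
          next3 (entry r n2) == entry r (next3 o) & next3 (entry r (next3 o)) == entry r i]]) (iota 0 n).

Lemma table_flip n tP tQ sP sQ r A : table_check n tP -> table_check n tQ ->
  sides_ok n tP sP -> sides_ok n tQ sQ -> flip_check n tP tQ r A ->
  (forall i, (i < n)%N -> i \notin A -> sQ`_(entry r i) = sP`_i) ->
  @flip R (tri_gluing n tP sP) (tri_gluing n tQ sQ) (@ord_fun n (entry r)) (fun d => val d \in A).
Proof.
move=> cP cQ oP oQ fc hs.
have C (i : 'I_n) := all_iotaP fc (ltn_ord i).
have V (i : 'I_n) : val (ord_fun (entry r) i) = entry r i.
  by apply: ord_funE; case/and5P: (C i).
split.
- exact: tri_triangulated.
- exact: tri_triangulated.
- move=> x; apply: val_inj; rewrite tri_opp_val // !V tri_opp_val //.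
  by case/and5P: (C x) => _ /eqP.
- by move=> x nA; rewrite !tri_side // V hs.
- by move=> x; rewrite tri_opp_val //; case/and5P: (C x) => _ _ /eqP ->.
- move=> a Aa; rewrite !tri_next_val //; case/and5P: (C a) => _ _ _ /implyP /(_ Aa) /andP[h1 h2] _.
  by split.
- move=> x; rewrite !tri_next_val // => h1 h2 h3; apply: val_inj; rewrite tri_next_val // !V tri_next_val //.
  by case/and5P: (C x) => _ _ _ _ /andP[/implyP]; rewrite h1 h2 h3 => /(_ isT) /eqP.
- move=> a Aa; case/and5P: (C a) => _ _ _ _ /andP[_ /implyP /(_ Aa) /and3P[/eqP h1 /eqP h2 /eqP h3]].
  by split; apply: val_inj; rewrite !tri_next_val // !V !tri_next_val // ?tri_opp_val.
Qed.

Definition inverse_check n (r r' A A' : seq nat) :=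
  all (fun i => (i \notin A) ==> ((entry r i \notin A') && (entry r' (entry r i) == i))) (iota 0 n).

Lemma table_flip_isomorphic n tP tQ sP sQ r r' A A' : table_check n tP -> table_check n tQ ->
  reach_check n tP -> reach_check n tQ -> sides_ok n tP sP -> sides_ok n tQ sQ ->
  flip_check n tP tQ r A -> flip_check n tQ tP r' A' ->
  inverse_check n r r' A A' -> inverse_check n r' r A' A ->
  (forall i, (i < n)%N -> i \notin A -> sQ`_(entry r i) = sP`_i) ->
  isomorphic (tri_gluing n tP sP) (tri_gluing n tQ sQ).
Proof.
move=> cP cQ rP rQ oP oQ fP fQ i1 i2 hs.
have hs' i : (i < n)%N -> i \notin A' -> sP`_(entry r' i) = sQ`_i.
  move=> hi hA; have := all_iotaP i2 hi; rewrite hA => /andP[h1 /eqP h2].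
  rewrite -{2}h2 hs //.
  by have := all_iotaP fQ hi => /andP[].
have tP' := tri_translation_surface cP oP rP; have tQ' := tri_translation_surface cQ oQ rQ.
have f1 := table_flip cP cQ oP oQ fP hs; have f2 := table_flip cQ cP oQ oP fQ hs'.
have V tp tq ss A0 (fc : flip_check n tp tq ss A0) (i : 'I_n) : val (ord_fun (entry ss) i) = entry ss i.
  by apply: ord_funE; have := all_iotaP fc (ltn_ord i) => /andP[].
have V1 := V _ _ _ _ fP; have V2 := V _ _ _ _ fQ.
apply: (flip_isomorphic tP' tQ' f1 f2) => x nA.
- have := all_iotaP i1 (ltn_ord x); rewrite nA => /andP[h1 /eqP h2].
  by rewrite V1; split => //; apply: val_inj; rewrite V2 V1.
- have := all_iotaP i2 (ltn_ord x); rewrite nA => /andP[h1 /eqP h2].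
  by rewrite V2; split => //; apply: val_inj; rewrite V1 V2.
Qed.

End TriGluing.

(** * The two-cylinder surfaces *)

Section Turns.
Variable R : realType.

(** Horizontal half-turns: three, respectively four, consecutive rays of a
    fan of which the first and the last are horizontal. *)
Lemma turn2 (a b c d : R) : 0 < a * b -> 0 < a * d ->
  angle (a, 0) (c, d) + angle (c, d) (- b, 0) = pi.
Proof.
move=> ab ad; have a0 : a != 0 by apply: contraTneq ab => ->; rewrite mul0r ltxx.
rewrite -(half_turn2 (u := (a, 0)) (v := (c, d)) (l := b / a)).
- by congr (_ + angle _ _); apply: vec_eq; rewrite /= !scale_mul ?mulr0 ?oppr0 // divfK.
- by rewrite /cross /= mul0r subr0.
- by rewrite -(pmulr_rgt0 _ (mulr_gt0 ab ab)); have -> : a * b * (a * b) * (b / a) = a * b * (b * b); [field | rewrite pmulr_rgt0 // -expr2 exprn_even_gt0 //=; apply: contraTneq ab => ->; rewrite mulr0 ltxx].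
Qed.

Lemma turn3 (a b c d c' d' : R) : 0 < a * b -> 0 < a * d -> 0 < a * d' -> 0 < c * d' - d * c' ->
  angle (a, 0) (c, d) + angle (c, d) (c', d') + angle (c', d') (- b, 0) = pi.
Proof.
move=> ab ad ad' cr; rewrite angle_add ?turn2 //.
- by rewrite /cross /= mul0r subr0.
- by rewrite /cross /= mul0r subr0 ltW.
Qed.

End Turns.

(** Evaluates the entries of the tables, leaving the coordinates of the
    sides untouched. *)
Ltac entries := repeat match goal with
  | |- context [next3 ?n] => let x := eval vm_compute in (next3 n) in change (next3 n) with x
  | |- context [prev3 ?n] => let x := eval vm_compute in (prev3 n) in change (prev3 n) with x
  | |- context [entry ?t ?n] => let x := eval vm_compute in (entry t n) in change (entry t n) with x
  end.

Section Model.
Local Open Scope nat_scope.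

(** Opposite sides of the triangulations. In [tabT] the triangles 0, 3, 6
    and 9, named after their first sides, form the wide cylinder, and 12
    and 15 the narrow one. The horizontal sides are gamma = 0, opposite to
    10; alpha_1 = 6, opposite to 16; and alpha_2 = 12, opposite to 4.
    [tabT'] is a triangulation halfway through a Dehn twist of the wide
    cylinder. [tabL] and [tabR] subdivide [tabT] at a point of alpha_1,
    respectively alpha_2, which adds the sides 18 to 23; [tabL'] and
    [tabR'] are the results of the surgeries, which exchange the opposites
    of 0 and 6, respectively of 0 and 12. *)
Definition tabT := [:: 10;5;9;8;12;1;16;11;3;2;0;7;4;17;15;14;6;13].
Definition tabT' := [:: 10;11;3;2;12;7;16;5;9;8;0;1;4;17;15;14;6;13].
Definition tabL := [:: 10;5;9;8;12;1;21;20;3;2;0;19;4;22;15;14;18;23;16;11;7;6;13;17].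
Definition tabL' := [:: 21;5;9;8;12;1;10;20;3;2;6;19;4;22;15;14;18;23;16;11;7;0;13;17].
Definition tabR := [:: 10;22;9;8;18;23;16;11;3;2;0;7;21;20;15;14;6;19;4;17;13;12;1;5].
Definition tabR' := [:: 21;22;9;8;18;23;16;11;3;2;12;7;10;20;15;14;6;19;4;17;13;0;1;5].

(** Names of the sides after the flips in [left_model_move] and
    [right_model_move]. *)
Definition flipL := [:: 18;9;11;1;4;2;0;3;5;19;10;20;12;14;17;23;21;22;6;7;8;16;15;13].
Definition flipR := [:: 0;2;11;23;21;22;6;8;5;7;4;3;18;15;17;19;16;20;12;13;14;10;9;1].
End Model.

Section Data.
Variables (R : realType) (l h : R).
Hypotheses (l1 : 1 < l) (h0 : 0 < h).
Local Notation V := (R * R)%type.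
Implicit Types p s lam : R.

Let lh : 0 < l * h. Proof. by rewrite mulr_gt0 // (lt_trans ltr01). Qed.

(** The wide cylinder has gamma and alpha_1 at the bottom, alpha_2 and
    gamma at the top, and (p, h) goes from the start of gamma at the bottom
    to its end at the top. The narrow cylinder has alpha_2 at the bottom
    and alpha_1 at the top, and (s, 1) goes from the end of alpha_2 to the
    end of alpha_1. *)
Definition sidesT p s : seq V :=
  [:: (1, 0); (p - 1, h); (- p, - h);  (p + l - 1, h); (- l, 0); (1 - p, - h);
      (l, 0); (p - 1, h); (- (p + l - 1), - h);  (p, h); (- 1, 0); (1 - p, - h);
      (l, 0); (s, 1); (- (s + l), - 1);  (s + l, 1); (- l, 0); (- s, - 1)].

Definition sidesT' p s : seq V :=
  [:: (1, 0); (p + l - 1, h); (- (p + l), - h);  (p + l, h); (- l, 0); (- p, - h);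
      (l, 0); (p, h); (- (p + l), - h);  (p + l, h); (- 1, 0); (- (p + l - 1), - h);
      (l, 0); (s, 1); (- (s + l), - 1);  (s + l, 1); (- l, 0); (- s, - 1)].

(** The point at distance lam from the origin of alpha_1 is joined to the
    opposite vertices of the two triangles having alpha_1 as a side. *)
Definition sidesL p s lam : seq V :=
  [:: (1, 0); (p - 1, h); (- p, - h);  (p + l - 1, h); (- l, 0); (1 - p, - h);
      (lam, 0); (p + l - 1 - lam, h); (- (p + l - 1), - h);  (p, h); (- 1, 0); (1 - p, - h);
      (l, 0); (s, 1); (- (s + l), - 1);  (s + l, 1); (- (l - lam), 0); (- (s + lam), - 1);
      (l - lam, 0); (p - 1, h); (- (p + l - 1 - lam), - h);  (- lam, 0); (- s, - 1); (s + lam, 1)].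

(** The same with alpha_2. *)
Definition sidesR p s lam : seq V :=
  [:: (1, 0); (p - 1, h); (- p, - h);  (p + l - 1, h); (- (l - lam), 0); (1 - p - lam, - h);
      (l, 0); (p - 1, h); (- (p + l - 1), - h);  (p, h); (- 1, 0); (1 - p, - h);
      (lam, 0); (s + l - lam, 1); (- (s + l), - 1);  (s + l, 1); (- l, 0); (- s, - 1);
      (l - lam, 0); (s, 1); (- (s + l - lam), - 1);  (- lam, 0); (1 - p, - h); (p - 1 + lam, h)].

Let l1h : 0 < (l - 1) * h. Proof. by rewrite mulr_gt0 // subr_gt0. Qed.

Ltac facts := have ? := l1; have ? := h0; have ? := lh; have ? := l1h.

Tactic Notation "sides" integer(n) := let i := fresh "i" in let hi := fresh "hi" in
  facts; move=> i hi; do n (destruct i as [|i]; [by clear hi; entries; rewrite /=; split; [veq | rewrite /cross /=; lra | veq] | ]);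
  by [].

(** The triangles close up, are counterclockwise, and opposite sides are
    opposite vectors (checked side by side). *)
Lemma sides_okT p s : sides_ok 18 tabT (sidesT p s).
Proof. sides 18. Qed.

Lemma sides_okT' p s : sides_ok 18 tabT' (sidesT' p s).
Proof. sides 18. Qed.

Lemma sides_okL p s lam : 0 < lam < l -> sides_ok 24 tabL (sidesL p s lam).
Proof. 
move=> /andP[m0 m1].
have k0 : 0 < lam * h by rewrite mulr_gt0.
have k1 : 0 < (l - lam) * h by rewrite mulr_gt0 // subr_gt0.
sides 24.
Qed.

Lemma sides_okL' p s : sides_ok 24 tabL' (sidesL p s 1).
Proof. sides 24. Qed.

Lemma sides_okR p s lam : 0 < lam < l -> sides_ok 24 tabR (sidesR p s lam).
Proof. 
move=> /andP[m0 m1].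
have k0 : 0 < lam * h by rewrite mulr_gt0.
have k1 : 0 < (l - lam) * h by rewrite mulr_gt0 // subr_gt0.
sides 24.
Qed.

Lemma sides_okR' p s : sides_ok 24 tabR' (sidesR p s 1).
Proof. sides 24. Qed.

Lemma tableT : table_check 18 tabT. Proof. by vm_compute. Qed.
Lemma reachT : reach_check 18 tabT. Proof. by vm_compute. Qed.
Lemma tableT' : table_check 18 tabT'. Proof. by vm_compute. Qed.
Lemma reachT' : reach_check 18 tabT'. Proof. by vm_compute. Qed.
Lemma tableL : table_check 24 tabL. Proof. by vm_compute. Qed.
Lemma reachL : reach_check 24 tabL. Proof. by vm_compute. Qed.
Lemma tableL' : table_check 24 tabL'. Proof. by vm_compute. Qed.
Lemma reachL' : reach_check 24 tabL'. Proof. by vm_compute. Qed.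
Lemma tableR : table_check 24 tabR. Proof. by vm_compute. Qed.
Lemma reachR : reach_check 24 tabR. Proof. by vm_compute. Qed.
Lemma tableR' : table_check 24 tabR'. Proof. by vm_compute. Qed.
Lemma reachR' : reach_check 24 tabR'. Proof. by vm_compute. Qed.

Definition model p s := tri_gluing 18 tabT (sidesT p s).
Definition model' p s := tri_gluing 18 tabT' (sidesT' p s).
Definition left_model p s lam := tri_gluing 24 tabL (sidesL p s lam).
Definition left_model' p s := tri_gluing 24 tabL' (sidesL p s 1).
Definition right_model p s lam := tri_gluing 24 tabR (sidesR p s lam).
Definition right_model' p s := tri_gluing 24 tabR' (sidesR p s 1).

Lemma model_in_H2 p s : in_H2 (model p s).
Proof.
have orb : orbits_in_H2 18 tabT (fun=> 0%N) 1 by vm_compute.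
apply: (tri_in_H2 tableT (sides_okT p s) reachT orb); by case.
Qed.

(** The subdivided surfaces have two vertices; m lists the sides leaving
    the regular one, which has class 1. *)
Definition other_vertex (m : seq nat) i : nat := i \in m.

Ltac corners := rewrite /corner_at; entries; rewrite /sidesL /sidesR /=;
  repeat (congr (_ + _)); (congr angle; veq).

Let big24 (Q : pred nat) (F : nat -> R) : \sum_(0 <= i < 24 | Q i) F i = foldr (fun i x => if Q i then F i + x else x) 0 (iota 0 24).
Proof. by rewrite unlock. Qed.

(** Sides leaving the point that subdivides alpha_1. *)
Definition midL := [:: 7; 21; 17; 18]%N.

Lemma orbitsL : orbits_in_H2 24 tabL (other_vertex midL) 2. Proof. by vm_compute. Qed.

Let sumL p s j : (0 < j < 2)%N ->
  \sum_(0 <= i < 24 | other_vertex midL i == j) corner_at (sidesL p s 1) i = 2 * pi.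
Proof.
facts.
have e1 : corner_at (sidesL p s 1) 18 + corner_at (sidesL p s 1) 7 = pi.
  have <- := @turn2 _ (l - 1) 1 (p + l - 1 - 1) h; try lra.
  corners.
have e2 : corner_at (sidesL p s 1) 21 + corner_at (sidesL p s 1) 17 = pi.
  have <- := @turn2 _ (-1) (- (l - 1)) (- (s + 1)) (- 1); try lra.
  corners.
case: j => [//|[_|//]]; rewrite big24 /= addr0; move: e1 e2; lra.
Qed.

Lemma left_model_in_H2 p s : in_H2 (left_model p s 1).
Proof.
have lam1 : 0 < (1 : R) < l by apply/andP; split.
exact: (tri_in_H2 tableL (sides_okL p s lam1) reachL orbitsL (sumL p s)).
Qed.

Lemma left_model_singular p s (d : 'I_(nsides (left_model p s 1))) : singular d <-> (nat_of_ord d \notin midL).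
Proof.
have lam1 : 0 < (1 : R) < l by apply/andP; split.
rewrite (tri_singular tableL (sides_okL p s lam1) reachL orbitsL (sumL p s)) /other_vertex.
by case: (_ \in _).
Qed.

(** Sides leaving the vertex of total angle 2 pi after the surgery. *)
Definition midL' := [:: 0; 9; 19; 16; 14; 22]%N.

Lemma orbitsL' : orbits_in_H2 24 tabL' (other_vertex midL') 2. Proof. by vm_compute. Qed.

Let sumL' p s j : (0 < j < 2)%N ->
  \sum_(0 <= i < 24 | other_vertex midL' i == j) corner_at (sidesL p s 1) i = 2 * pi.
Proof.
facts.
have e1 : corner_at (sidesL p s 1) 0 + corner_at (sidesL p s 1) 9 + corner_at (sidesL p s 1) 19 = pi.
  have <- := @turn3 _ 1 (l - 1) p h (p - 1) h; try lra.
  corners.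
have e2 : corner_at (sidesL p s 1) 16 + corner_at (sidesL p s 1) 14 + corner_at (sidesL p s 1) 22 = pi.
  have <- := @turn3 _ (- (l - 1)) (- 1) (- (s + l)) (- 1) (- s) (- 1); try lra.
  corners.
case: j => [//|[_|//]]; rewrite big24 /= addr0; move: e1 e2; lra.
Qed.

Lemma left_model'_in_H2 p s : in_H2 (left_model' p s).
Proof.
exact: (tri_in_H2 tableL' (sides_okL' p s) reachL' orbitsL' (sumL' p s)).
Qed.

Definition midR := [:: 5; 18; 13; 21]%N.

Lemma orbitsR : orbits_in_H2 24 tabR (other_vertex midR) 2. Proof. by vm_compute. Qed.

Let sumR p s j : (0 < j < 2)%N ->
  \sum_(0 <= i < 24 | other_vertex midR i == j) corner_at (sidesR p s 1) i = 2 * pi.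
Proof.
facts.
have e1 : corner_at (sidesR p s 1) 18 + corner_at (sidesR p s 1) 13 = pi.
  have <- := @turn2 _ (l - 1) 1 (s + l - 1) 1; try lra.
  corners.
have e2 : corner_at (sidesR p s 1) 21 + corner_at (sidesR p s 1) 5 = pi.
  have <- := @turn2 _ (-1) (- (l - 1)) (1 - p - 1) (- h); try lra.
  corners.
case: j => [//|[_|//]]; rewrite big24 /= addr0; move: e1 e2; lra.
Qed.

Lemma right_model_in_H2 p s : in_H2 (right_model p s 1).
Proof.
have lam1 : 0 < (1 : R) < l by apply/andP; split.
exact: (tri_in_H2 tableR (sides_okR p s lam1) reachR orbitsR (sumR p s)).
Qed.

Lemma right_model_singular p s (d : 'I_(nsides (right_model p s 1))) : singular d <-> (nat_of_ord d \notin midR).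
Proof.
have lam1 : 0 < (1 : R) < l by apply/andP; split.
rewrite (tri_singular tableR (sides_okR p s lam1) reachR orbitsR (sumR p s)) /other_vertex.
by case: (_ \in _).
Qed.

Definition midR' := [:: 4; 8; 11; 12; 15; 19]%N.

Lemma orbitsR' : orbits_in_H2 24 tabR' (other_vertex midR') 2. Proof. by vm_compute. Qed.

Let sumR' p s j : (0 < j < 2)%N ->
  \sum_(0 <= i < 24 | other_vertex midR' i == j) corner_at (sidesR p s 1) i = 2 * pi.
Proof.
facts.
have e1 : corner_at (sidesR p s 1) 4 + corner_at (sidesR p s 1) 8 + corner_at (sidesR p s 1) 11 = pi.
  have <- := @turn3 _ (- (l - 1)) (- 1) (- (p + l - 1)) (- h) (1 - p) (- h); try lra.
  corners.
have e2 : corner_at (sidesR p s 1) 12 + corner_at (sidesR p s 1) 15 + corner_at (sidesR p s 1) 19 = pi.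
  have <- := @turn3 _ 1 (l - 1) (s + l) 1 s 1; try lra.
  corners.
case: j => [//|[_|//]]; rewrite big24 /= addr0; move: e1 e2; lra.
Qed.

Lemma right_model'_in_H2 p s : in_H2 (right_model' p s).
Proof.
exact: (tri_in_H2 tableR' (sides_okR' p s) reachR' orbitsR' (sumR' p s)).
Qed.

(** The angles between the twin and the end of gamma, as required by the
    definition of left and right twins. *)
Lemma left_half_turn p s (S := sidesL p s 1) : corner_at S 6 + corner_at S 3 + corner_at S 1 = pi.
Proof.
facts; have <- := @turn3 _ 1 1 (p + l - 1) h (p - 1) h; try lra.
rewrite /S; corners.
Qed.

Lemma right_half_turn p s (S := sidesR p s 1) : corner_at S 10 + corner_at S 2 + corner_at S 22 = pi.
Proof.
facts; have <- := @turn3 _ (- 1) (- 1) (- p) (- h) (1 - p) (- h); try lra.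
rewrite /S; corners.
Qed.

End Data.

(** * Moves between triangulations of the two-cylinder surfaces *)

Section Moves.
Variables (R : realType) (l h : R).
Hypotheses (l1 : 1 < l) (h0 : 0 < h).
Local Notation V := (R * R)%type.
Implicit Types p s lam : R.

Definition swap_nat (a b i : nat) := if i == a then b else if i == b then a else i.

(** A surgery conjugates the table of opposite sides by a transposition. *)
Lemma tri_resew n t t' (sd : seq V) (g k : 'I_(nsides (tri_gluing n t sd))) :
  table_check n t -> table_check n t' ->
  all (fun i => entry t' i == swap_nat g k (entry t (swap_nat g k i))) (iota 0 n) ->
  resew g k = tri_gluing n t' sd.
Proof.
move=> c c' hs; rewrite /resew /tri_gluing; congr PolygonGluing.
have sw (x : 'I_n) : val (tperm g k x) = swap_nat g k x.
  rewrite /swap_nat; case: tpermP => [->|->|/eqP h1 /eqP h2].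
  - by rewrite eqxx.
  - by rewrite eqxx; case: eqP => [/val_inj ->|].
  - by rewrite !ifF //; apply/negbTE.
apply/permP => x; apply: val_inj.
have -> : x = tperm g k (tperm g k x) by rewrite tpermK.
rewrite permJ sw (tri_opp_val c) sw tpermK.
have := tri_opp_val c' (x : 'I_(nsides (tri_gluing n t' sd))) => /= ->.
by have /eqP := all_iotaP hs (ltn_ord x).
Qed.

Lemma left_resewE p s (g k : 'I_(nsides (left_model l h p s 1))) :
  val g = 0%N -> val k = 6 -> resew g k = left_model' l h p s.
Proof.
move=> eg ek; by apply: (tri_resew tableL tableL'); rewrite eg ek; vm_compute.
Qed.

Lemma right_resewE p s (g k : 'I_(nsides (right_model l h p s 1))) :
  val g = 0%N -> val k = 12 -> resew g k = right_model' l h p s.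
Proof.
move=> eg ek; by apply: (tri_resew tableR tableR'); rewrite eg ek; vm_compute.
Qed.

(** Flipping twice turns a diagonal by a half-turn, hence reverses its
    orientation. *)
Definition inverse_table n (t r A : seq nat) :=
  [seq if index i r \in A then entry t (index i r) else index i r | i <- iota 0 n].

(** Proves that the surfaces of two tables differ by flips of the sides in
    A. *)
Tactic Notation "flipped" integer(n) constr(t) constr(r) constr(A) constr(cP) constr(cQ) constr(rP) constr(rQ) constr(oP) constr(oQ) :=
  apply: (table_flip_isomorphic (r := r) (r' := inverse_table 24 t r A) (A := A) (A' := map (entry r) A) cP cQ rP rQ oP oQ);
  [by vm_compute | by vm_compute | by vm_compute | by vm_compute | ];
  let i := fresh "i" in let hi := fresh "hi" in let hA := fresh "hA" in
  move=> i hi; do n (destruct i as [|i];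
    [by clear hi; move=> hA; first [discriminate hA | clear hA; entries; rewrite /=; veq] |]); by [].

Let laml : 0 < l - 1 < l. Proof. by rewrite subr_gt0 l1 gtrBl ltr01. Qed.

(** After the surgery, three flips turn the cut triangles into those of
    another member of the family, where alpha_1 is split at the other end. *)
Lemma left_model_move p s : isomorphic (left_model' l h p s) (left_model l h (p - 1) (s + 1) (l - 1)).
Proof.
flipped 24 tabL' flipL [:: 2; 9; 3; 8; 13; 22]%N
  tableL' tableL reachL' reachL (sides_okL' l1 h0 p s) (sides_okL l1 h0 (p - 1) (s + 1) laml).
Qed.

Lemma right_model_move p s : isomorphic (right_model' l h p s) (right_model l h (p + 1) (s - 1) (l - 1)).
Proof.
flipped 24 tabR' flipR [:: 1; 22; 7; 11; 14; 15]%N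
  tableR' tableR reachR' reachR (sides_okR' l1 h0 p s) (sides_okR l1 h0 (p + 1) (s - 1) laml).
Qed.

(** A Dehn twist of the narrow cylinder is the flip of one edge across it. *)
Lemma model_twist p s : isomorphic (model l h p s) (model l h p (s + l)).
Proof.
flipped 18 tabT [:: 0;1;2;3;4;5;6;7;8;9;10;11;12;14;17;13;16;15]%N [:: 13; 17]%N
  tableT tableT reachT reachT (sides_okT l1 h0 p s) (sides_okT l1 h0 p (s + l)).
Qed.

(** A Dehn twist of the wide cylinder takes two rounds of flips, each
    consisting of disjoint flips. *)
Lemma model_half_twist p s : isomorphic (model l h p s) (model' l h p s).
Proof.
flipped 18 tabT [:: 0;2;5;1;4;3;6;8;11;7;10;9;12;13;14;15;16;17]%N [:: 1; 5; 7; 11]%N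
  tableT tableT' reachT reachT' (sides_okT l1 h0 p s) (sides_okT' l1 h0 p s).
Qed.

Lemma model'_half_twist p s : isomorphic (model' l h p s) (model l h (p + l + 1) s).
Proof.
flipped 18 tabT' [:: 0;2;11;7;4;3;6;8;5;1;10;9;12;13;14;15;16;17]%N [:: 1; 11; 5; 7]%N
  tableT' tableT reachT' reachT (sides_okT' l1 h0 p s) (sides_okT l1 h0 (p + l + 1) s).
Qed.

Lemma model_twist2 p s : isomorphic (model l h p s) (model l h (p + l + 1) s).
Proof. exact: isomorphic_trans (model_half_twist p s) (model'_half_twist p s). Qed.

End Moves.

(** * Subdivisions of the two-cylinder surfaces *)

Section Splits.
Variable R : realType.
Local Notation V := (R * R)%type.

(** The combinatorial conditions of [split] on the tables. *)
Definition split_check n m (tP tS ti tm tn to A : seq nat) :=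
  all (fun i => let n1 := next3 i in let n2 := next3 n1 in let e := entry in
    [&& [&& e ti i < m, e tm i < m & e tn i < m]%N, (e tP i \in A) == (i \in A),
        (i \in A) ==> (n1 \notin A) && (n2 \notin A),
        (i \notin A) ==> (e tS (e ti i) == e ti (e tP i)),
        [&& i \notin A, n1 \notin A & n2 \notin A] ==> (next3 (e ti i) == e ti n1),
        (i \in A) ==> [&& next3 (e ti i) == e tn i, next3 (e tn i) == e ti n2 & next3 (e ti n2) == e ti i],
        (i \in A) ==> [&& next3 (e tm i) == e ti n1, next3 (e ti n1) == e tS (e tn i) & next3 (e tS (e tn i)) == e tm i],
        (i \in A) ==> (e tS (e ti i) == e tm (e tP i)), e to (e ti i) == i &
        (i \in A) ==> [&& e to (e tm i) == i, e to (e tn i) == i & e to (e tS (e tn i)) == i]]) (iota 0 n) &&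
  all (fun j => [&& (entry to j < n)%N & (has (fun x => j == entry ti x) (iota 0 n)) ||
    has (fun a => (a \in A) && [|| j == entry tm a, j == entry tn a | j == entry tS (entry tn a)]) (iota 0 n)]) (iota 0 m).

Definition ord_map n m (t : seq nat) (i : 'I_n) : 'I_m.+1 := inord (entry t i).

Lemma table_split n m tP tS (sP sS : seq V) ti tm tn to (A : seq nat) (lam : nat -> R) :
  table_check n.+1 tP -> table_check m.+1 tS ->
  sides_ok n.+1 tP sP -> sides_ok m.+1 tS sS -> split_check n.+1 m.+1 tP tS ti tm tn to A ->
  (forall i, (i < n.+1)%N -> i \notin A -> sS`_(entry ti i) = sP`_i) ->
  (forall i, i \in A -> [/\ 0 < lam i, lam (entry tP i) = 1 - lam i & sS`_(entry ti i) = lam i *: sP`_i]) ->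
  @split R (tri_gluing n.+1 tP sP) (tri_gluing m.+1 tS sS) (@ord_map n.+1 m ti) (@ord_map n.+1 m tm)
    (@ord_map n.+1 m tn) (@ord_map m.+1 n to) (fun d => val d \in A) (fun d => lam (val d)).
Proof.
move=> cP cS oP oS /andP[fc cov] hs hl.
have C (i : 'I_n.+1) := all_iotaP fc (ltn_ord i).
have D (j : 'I_m.+1) := all_iotaP cov (ltn_ord j).
have Vi (i : 'I_n.+1) : val (ord_map m ti i) = entry ti i by apply: inordK; case/and5P: (C i) => /and3P[].
have Vm (i : 'I_n.+1) : val (ord_map m tm i) = entry tm i by apply: inordK; case/and5P: (C i) => /and3P[].
have Vn (i : 'I_n.+1) : val (ord_map m tn i) = entry tn i by apply: inordK; case/and5P: (C i) => /and3P[].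
have Vo (i : 'I_m.+1) : val (ord_map n to i) = entry to i by apply: inordK; case/andP: (D i).
split.
- exact: tri_triangulated.
- exact: tri_triangulated.
- by move=> x; rewrite tri_opp_val //; case/and5P: (C x) => _ /eqP ->.
- by move=> a Aa; rewrite !tri_next_val //; case/and5P: (C a) => _ _ /implyP /(_ Aa) /andP[].
- move=> x nA; apply: val_inj; rewrite tri_opp_val // !Vi tri_opp_val //.
  by case/and5P: (C x) => _ _ _ /implyP /(_ nA) /eqP.
- by move=> x nA; rewrite !tri_side // Vi hs.
- by move=> a Aa; rewrite !tri_side // Vi tri_opp_val //; exact: hl.
- move=> x; rewrite !tri_next_val // => h1 h2 h3; apply: val_inj; rewrite tri_next_val // !Vi tri_next_val //.
  by case/and5P: (C x) => _ _ _ _ /and5P[/implyP]; rewrite h1 h2 h3 => /(_ isT) /eqP.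
- move=> a Aa; case/and5P: (C a) => _ _ _ _ /and5P[_ /implyP /(_ Aa) /and3P[/eqP e1 /eqP e2 /eqP e3] _ _ _].
  by split; apply: val_inj; rewrite !tri_next_val // ?Vi ?Vn ?tri_next_val.
- move=> a Aa; case/and5P: (C a) => _ _ _ _ /and5P[_ _ /implyP /(_ Aa) /and3P[/eqP e1 /eqP e2 /eqP e3] _ _].
  by split; apply: val_inj; rewrite !tri_next_val // ?Vi ?Vm ?tri_opp_val // ?Vn ?tri_next_val.
- move=> a Aa; case/and5P: (C a) => _ _ _ _ /and5P[_ _ _ /implyP /(_ Aa) /eqP e1 _].
  by apply: val_inj; rewrite tri_opp_val // Vi Vm tri_opp_val.
- move=> j; case/andP: (D j) => _ /orP[] /hasP [x]; rewrite mem_iota => /andP[_ hx].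
    by move=> /eqP e; left; exists (Ordinal hx); apply: val_inj; rewrite Vi.
  move=> /andP[Ax /or3P[] /eqP e]; right; exists (Ordinal hx) => //.
  + by apply: Or31; apply: val_inj; rewrite Vm.
  + by apply: Or32; apply: val_inj; rewrite Vn.
  + by apply: Or33; apply: val_inj; rewrite tri_opp_val // Vn.
- move=> x; apply: val_inj; rewrite Vo Vi.
  by case/and5P: (C x) => _ _ _ _ /and5P[_ _ _ _ /andP[/eqP]].
- move=> a Aa; case/and5P: (C a) => _ _ _ _ /and5P[_ _ _ _ /andP[_ /implyP /(_ Aa) /and3P[/eqP e1 /eqP e2 /eqP e3]]].
  by split; apply: val_inj; rewrite Vo ?Vm ?Vn ?tri_opp_val // ?Vn.
Qed.

Variables (l h : R).
Hypotheses (l1 : 1 < l) (h0 : 0 < h).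
Implicit Types p s lam : R.

(** Names of the sides when alpha_1, respectively alpha_2, is cut at
    distance lam from its origin; entries of the tables for mu and nu at
    sides which are not cut are arbitrary. *)
Definition left_iota := [:: 0;1;2;3;4;5;6;19;8;9;10;11;12;13;14;15;16;22]%N.
Definition left_mu := (nseq 6 0 ++ [:: 18] ++ nseq 9 0 ++ [:: 21; 0])%N.
Definition left_nu := (nseq 6 0 ++ [:: 7] ++ nseq 9 0 ++ [:: 17; 0])%N.
Definition left_origin := [:: 0;1;2;3;4;5;6;6;8;9;10;11;12;13;14;15;16;16;6;7;6;16;17;16]%N.

(** The side 6 is cut at distance lam from its origin, and its opposite 16
    at distance l - lam. *)
Definition left_ratio lam (i : nat) := if i == 6%N then lam / l else 1 - lam / l.

Definition right_iota := [:: 0;1;2;3;4;22;6;7;8;9;10;11;12;19;14;15;16;17]%N.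
Definition right_mu := (nseq 4 0 ++ [:: 21] ++ nseq 7 0 ++ [:: 18] ++ nseq 5 0)%N.
Definition right_nu := (nseq 4 0 ++ [:: 5] ++ nseq 7 0 ++ [:: 13] ++ nseq 5 0)%N.
Definition right_origin := [:: 0;1;2;3;4;4;6;7;8;9;10;11;12;12;14;15;16;17;12;13;12;4;5;4]%N.
Definition right_ratio lam (i : nat) := if i == 12%N then lam / l else 1 - lam / l.

Let ratio lam : 0 < lam < l -> 0 < lam / l < 1.
Proof.
move=> /andP[m0 m1]; have l0 : 0 < l by exact: lt_trans ltr01 l1.
by rewrite divr_gt0 // ltr_pdivrMr // mul1r.
Qed.

Ltac keep_sides := let i := fresh "i" in let hi := fresh "hi" in let hA := fresh "hA" in
  move=> i hi; do 18 (destruct i as [|i];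
    [by clear hi; move=> hA; first [discriminate hA | clear hA; entries; rewrite /=; veq] |]); by [].

Lemma left_split p s lam : 0 < lam < l ->
  @split R (model l h p s) (left_model l h p s lam) (@ord_map 18 23 left_iota) (@ord_map 18 23 left_mu)
    (@ord_map 18 23 left_nu) (@ord_map 24 17 left_origin) (fun d => val d \in [:: 6; 16]%N)
    (fun d => left_ratio lam (val d)).
Proof.
move=> hlam; have /andP[r0 r1] := ratio hlam.
have ln : l != 0 by rewrite gt_eqF // (lt_trans ltr01).
apply: (table_split (A := [:: 6; 16]%N) (lam := left_ratio lam)
  tableT tableL (sides_okT l1 h0 p s) (sides_okL l1 h0 p s hlam)); first by vm_compute.
  keep_sides.
move=> i; rewrite !inE => /orP[] /eqP ->; rewrite /left_ratio; entries; rewrite /= ?subr_gt0 ?subKr; split => //.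
- by apply: vec_eq; rewrite /= scale_mul ?mulr0 // divfK.
- by apply: vec_eq; rewrite /= scale_mul ?mulr0 // mulrBl mul1r mulrN divfK // opprK opprB addrC.
Qed.

Lemma right_split p s lam : 0 < lam < l ->
  @split R (model l h p s) (right_model l h p s lam) (@ord_map 18 23 right_iota) (@ord_map 18 23 right_mu)
    (@ord_map 18 23 right_nu) (@ord_map 24 17 right_origin) (fun d => val d \in [:: 12; 4]%N)
    (fun d => right_ratio lam (val d)).
Proof.
move=> hlam; have /andP[r0 r1] := ratio hlam.
have ln : l != 0 by rewrite gt_eqF // (lt_trans ltr01).
apply: (table_split (A := [:: 12; 4]%N) (lam := right_ratio lam)
  tableT tableR (sides_okT l1 h0 p s) (sides_okR l1 h0 p s hlam)); first by vm_compute.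
  keep_sides.
move=> i; rewrite !inE => /orP[] /eqP ->; rewrite /right_ratio; entries; rewrite /= ?subr_gt0 ?subKr; split => //.
- by apply: vec_eq; rewrite /= scale_mul ?mulr0 // divfK.
- by apply: vec_eq; rewrite /= scale_mul ?mulr0 // mulrBl mul1r mulrN divfK // opprK opprB addrC.
Qed.

End Splits.

(** * Regular and singular points under isomorphisms *)

Section Saddles.
Variables (R : realType) (P Q : polygon_gluing R).
Hypotheses (tsP : translation_surface P) (tsQ : translation_surface Q).
Local Notation V := (R * R)%type.

Lemma on_side_scale S (d : 'I_(nsides S)) (t : R) : 0 <= t <= 1 -> on_side d (pos d + t *: side d).
Proof. by exists t. Qed.

Lemma side_scale_inj S (tsS : translation_surface S) (d : 'I_(nsides S)) (s t : R) :
  s *: side d = t *: side d -> s = t.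
Proof.
move=> /eqP; rewrite -subr_eq0 -scalerBl scaler_eq0 (negbTE (side_neq0 tsS d)) orbF subr_eq0.
by move/eqP.
Qed.

Lemma side_interior_nonvertex x (d : 'I_(nsides P)) (t : R) : 0 < t < 1 -> rep x d (pos d + t *: side d) -> ~ vertex x.
Proof.
move=> /andP[t0 t1] hx; apply: (off_vertex tsP hx) => f hf ef.
have os : on_side d (pos f) by exists t; rewrite ?(ltW t0) ?(ltW t1).
have [e|e] := vertex_on_side tsP hf os; move: ef; rewrite e => ef.
- have : t *: side d = 0 *: side d by rewrite scale0r; apply: (addrI (pos d)); rewrite addr0.
  by move/(side_scale_inj tsP); lra.
- have : t *: side d = 1 *: side d by rewrite scale1r; apply: (addrI (pos d)); rewrite -pos_next.
  by move/(side_scale_inj tsP); lra.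
Qed.

(** The interior of a side is seen from that side and from the opposite one
    only. *)
Lemma side_interior_rep x (d e : 'I_(nsides P)) (s t : R) : 0 < t < 1 -> 0 <= s <= 1 ->
  rep x d (pos d + t *: side d) -> rep x e (pos e + s *: side e) ->
  (e = d /\ s = t) \/ (e = opp P d /\ s = 1 - t).
Proof.
move=> ht hs hx he; have nv := side_interior_nonvertex ht hx.
have t01 : 0 <= t <= 1 by case/andP: ht => a b; rewrite !ltW.
have not_end (z := pos d + t *: side d) : z = pos d \/ z = pos (next P d) -> False.
  case=> ez; apply: nv.
  - by exists d; rewrite -[in X in rep _ _ X]ez.
  - by exists (next P d); apply/rep_next; rewrite -[in X in rep _ _ X]ez.
have [[ed ez]|[f [fd fe osf ez]]] := nonvertex_rep tsP nv hx he.
- left; have [e1|ne] := eqVneq e d; last first.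
    case: not_end; apply: (two_sides tsP ed ne); first exact: on_side_scale.
    by rewrite -ez; exact: on_side_scale.
  by split => //; move: ez; rewrite e1 => /addrI /(side_scale_inj tsP).
- right; have [e1|ne] := eqVneq f d; last first.
    by case: not_end; apply: (two_sides tsP fd ne) => //; exact: on_side_scale.
  rewrite e1 in fe osf ez.
  have es : pos e + s *: side e = pos (opp P d) + (1 - t) *: side (opp P d).
    by rewrite ez (pos_opp tsP) (side_opp tsP); veq.
  have [e2|ne] := eqVneq e (opp P d).
    by split => //; move: es; rewrite e2 => /addrI /(side_scale_inj tsP).
  have os1 : on_side (opp P d) (pos e + s *: side e).
    by rewrite es; apply: on_side_scale; lra.
  have os2 : on_side e (pos e + s *: side e) by exact: on_side_scale.
  case: nv; have [ev|ev] := two_sides tsP fe (negbT (introF eqP (fun h => negP ne (introT eqP (esym h))))) os2 os1.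
  + by exists e; rewrite ev in he.
  + by exists (next P e); apply/rep_next; rewrite ev in he.
Qed.

(** Two sides leaving a vertex in the same direction: small displacements
    along them reach different points. *)
Lemma two_rays_irregular x (d e : 'I_(nsides P)) (c : R) : rep x d (pos d) -> rep x e (pos e) ->
  e != d -> 0 < c -> side e = c *: side d -> ~ regular x.
Proof.
move=> hd he ne c0 hs [r r0 hr].
have n0 : 0 < `|side d| by rewrite normr_gt0 side_neq0.
pose t := Num.min (Num.min (r / (2 * `|side d|)) 2^-1) (c / 2).
have t0 : 0 < t by rewrite !lt_min !divr_gt0 ?mulr_gt0 // invr_gt0 ltr0n.
have t1 : t < 1.
  have : t <= 2^-1 by rewrite /t !ge_min lexx orbT.
  by lra.
have tc : t / c < 1.
  rewrite ltr_pdivrMr // mul1r.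
  have : t <= c / 2 by rewrite /t !ge_min lexx !orbT.
  by lra.
have tr : `|t *: side d| < r.
  rewrite normrZ gtr0_norm //.
  have : t <= r / (2 * `|side d|) by rewrite /t !ge_min lexx.
  rewrite ler_pdivlMr ?mulr_gt0 // => h.
  by have := mulr_gt0 t0 n0; lra.
have ht : 0 < t < 1 by rewrite t0.
have hc : 0 <= t / c <= 1 by rewrite divr_ge0 ?ltW.
have [y hy] := polygon_rep (on_side_polygon tsP (on_side_scale d (t := t) ltac:(lra))).
have [y' hy'] := polygon_rep (on_side_polygon tsP (on_side_scale e hc)).
have s1 : step x (t *: side d) y by exists d, (pos d).
have s2 : step x (t *: side d) y'.
  exists e, (pos e); split => //; move: hy'; rewrite hs scalerA divfK // gt_eqF //.
have eyy := hr _ _ _ tr s1 s2; rewrite -eyy in hy'.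
have [[e1 _]|[e1 _]] := side_interior_rep ht hc hy hy'.
  by rewrite e1 eqxx in ne.
move: hs; rewrite e1 (side_opp tsP) => /eqP; rewrite eq_sym -subr_eq0 opprK -{2}[side d]scale1r -scalerDl.
by rewrite scaler_eq0 (negbTE (side_neq0 tsP d)) orbF gt_eqF // addr_gt0.
Qed.

Lemma local_iso_regular (f : surface P -> surface Q) x : local_iso f -> injective f ->
  regular (f x) -> regular x.
Proof.
move=> lf fi [r r0 hr]; have [e e0 he] := lf x.
exists (Num.min r e); first by rewrite lt_min r0.
move=> u y y'; rewrite lt_min => /andP[ur ue] s1 s2.
by apply/fi/(hr u) => //; exact: he.
Qed.

End Saddles.

Section SingularPoint.
Variables (R : realType) (P Q : polygon_gluing R).

(** Regularity is invariant under isomorphisms and the singular point of P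
    is its only irregular point. *)
Lemma local_iso_singular (F : surface P -> surface Q) (G : surface Q -> surface P)
    (d : 'I_(nsides P)) x y :
  in_H2 P -> local_iso G -> cancel F G -> cancel G F ->
  singular d -> rep x d (pos d) -> ~ regular y -> F x = y.
Proof.
move=> [tsP _ [d0 _ uniq_d]] lG FK GK sd hx ny.
have ng : ~ regular (G y) by move=> /(local_iso_regular lG (can_inj GK)).
have [d1 h1] : vertex (G y) by apply: contrapT => /(nonvertex_regular tsP).
have s1 : singular d1 by move=> /(full_turn_regular tsP h1).
have e0 := uniq_d _ sd; have e1 := uniq_d _ s1.
have hd : d \in porbit (rot P) d1.
  by move: e0 e1; rewrite -!eq_porbit_mem => /eqP -> /eqP ->.
by rewrite -(GK y); congr F; exact: rep_fun hx (rep_rot_porbit tsP h1 hd).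
Qed.

End SingularPoint.

(** * Horizontal saddle connections *)

Lemma neg1_neq1 (R : realType) : - 1 = 1 :> R -> False.
Proof. lra. Qed.

Lemma half01 (R : realType) : 0 < (2^-1 : R) < 1.
Proof. lra. Qed.

Section Rays.
Variables (R : realType) (l h : R).
Hypotheses (l1 : 1 < l) (h0 : 0 < h).
Local Notation V := (R * R)%type.
Implicit Types p s : R.

Lemma model_surface p s : translation_surface (model l h p s).
Proof. by case: (model_in_H2 l1 h0 p s). Qed.

Definition mside p s (i : 'I_18) : 'I_(nsides (model l h p s)) := i.
Local Notation o i := (@Ordinal 18 i isT).
Local Notation idx i := (nat_of_ord i).

Lemma side_model p s (i : 'I_18) : side (mside p s i) = (sidesT l h p s)`_i.
Proof. exact: (tri_side tableT (sides_okT l1 h0 p s)). Qed.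

Lemma rot_model p s (i : 'I_18) : idx (rot (model l h p s) (mside p s i)) = entry tabT (prev3 i).
Proof. exact: tri_rot_val tableT _. Qed.

Lemma opp_model p s (i : 'I_18) : idx (opp (model l h p s) (mside p s i)) = entry tabT i.
Proof. exact: tri_opp_val tableT _. Qed.

Lemma rot_model_orbit p s (i j : 'I_18) : mside p s i \in porbit (rot (model l h p s)) (mside p s j).
Proof.
have orb : orbits_in_H2 18 tabT (fun=> 0%N) 1 by vm_compute.
by rewrite (tri_rot_porbit tableT orb).
Qed.

(** The singular point of the model, which is its only vertex. *)
Definition apex p s := pt (model_surface p s) (mside p s (o 0)) (pos (mside p s (o 0))).

Lemma rep_apex p s (i : 'I_18) : rep (apex p s) (mside p s i) (pos (mside p s i)).
Proof.
apply: (rep_rot_porbit (model_surface p s) _ (rot_model_orbit p s i (o 0))).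
by apply: pt_rep; apply: (pos_polygon_id (model_surface p s)).
Qed.

Lemma apex_irregular p s : ~ regular (apex p s).
Proof.
apply: (two_rays_irregular (model_surface p s) (rep_apex p s (o 0)) (rep_apex p s (o 6)) (c := l)) => //.
  exact: lt_trans ltr01 l1.
by rewrite !side_model; veq.
Qed.

Let horizontal_corner p s (t : R) (i : nat) : (i < 18)%N -> 0 < t ->
  0 <= cross (sidesT l h p s)`_i (t, 0) ->
  0 <= cross (t, 0) (sidesT l h p s)`_(entry tabT (prev3 i)) ->
  i \in [:: 0; 6; 12]%N \/ (cross (t, 0) (sidesT l h p s)`_(entry tabT (prev3 i)) <= 0 /\
    entry tabT (prev3 i) \in [:: 0; 6; 12]%N).
Proof.
move=> hi t0; have th : 0 < t * h by rewrite mulr_gt0.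
do 18 (destruct i as [|i]; [by clear hi; entries; rewrite /cross /=; (try by left); move=> c1 c2;
  first [exfalso; lra | right; split; [lra | by []]] |]); by [].
Qed.

(** Only the three horizontal saddle connections leave the singular point
    to the right: any other corner that contains the horizontal direction
    has it as its last ray. *)
Lemma apex_ray p s (t : R) y : 0 < t -> step (apex p s) (t, 0) y ->
  exists2 i : 'I_18, idx i \in [:: 0; 6; 12]%N & rep y (mside p s i) (pos (mside p s i) + (t, 0)).
Proof.
move=> t0 [d [z [hz hy]]].
have tsT := model_surface p s.
have [f [_ fd ez]] := vertex_rep tsT (rep_apex p s (o 0)) hz.
have {hy}hy : rep y f (pos f + (t, 0)) by rewrite -ez; apply/(rep_porbit _ _ fd).
have [c1 c2] := cross_corner tsT (rep_polygon hy).
have hr := rep_ray tsT hy.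
have sf := side_model p s f; have sr := side_model p s (rot _ f).
have vr := rot_model p s f.
rewrite /mside in sf sr vr; rewrite sr vr in hr c2; rewrite sf in c1.
have [hi|[c0 hi]] := horizontal_corner (ltn_ord f) t0 c1 c2; first by exists f.
by exists (rot (model l h p s) f); [rewrite vr | exact: hr].
Qed.

Section Identify.
Variables (p s : R) (P : polygon_gluing R).
Hypothesis hP : in_H2 P.
Local Notation T := (model l h p s).
Variables (F : surface P -> surface T) (G : surface T -> surface P).
Hypotheses (lF : local_iso F) (lG : local_iso G) (FK : cancel F G) (GK : cancel G F).
Let tsP : translation_surface P. Proof. by case: hP. Qed.
Let tsT : translation_surface T := model_surface p s.
Implicit Types g k : 'I_(nsides P).

(** F takes the side g, of vector (1, 0), to the saddle connection i of the
    model or to its first unit. *)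
Definition onto g (i : 'I_18) := forall (t : R) x, 0 <= t <= 1 -> rep x g (pos g + t *: side g) ->
  rep (F x) (mside p s i) (pos (mside p s i) + (t, 0)).

Lemma unit_on_side (i : 'I_18) (t : R) : idx i \in [:: 0; 6; 12]%N -> 0 <= t <= 1 ->
  exists2 c : R, 0 <= c <= t & (t, 0) = c *: side (mside p s i) /\ (idx i != 0%N -> c = t / l).
Proof.
move=> hi /andP[t0 t1]; have L1 := l1; have l0 : 0 < l by exact: lt_trans ltr01 l1.
have tl : 0 <= t / l <= t.
  rewrite divr_ge0 ?(ltW l0) //= ler_pdivrMr // ler_peMr // ltW //.
rewrite side_model; move: hi; rewrite !inE => /or3P[] /eqP ->.
- by exists t; rewrite ?t0 ?lexx //; split => //; veq.
- by exists (t / l) => //; split => //; apply: vec_eq; rewrite /= scale_mul ?mulr0 // divfK // gt_eqF.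
- by exists (t / l) => //; split => //; apply: vec_eq; rewrite /= scale_mul ?mulr0 // divfK // gt_eqF.
Qed.

Lemma singular_apex g x : singular g -> rep x g (pos g) -> F x = apex p s.
Proof. by move=> sg hx; apply: (local_iso_singular hP lG FK GK sg hx); exact: apex_irregular. Qed.

(** The image of g starts along one of the three rays by [apex_ray] and
    follows it by unique continuation. *)
Lemma onto_ex g : singular g -> side g = (1, 0) -> exists2 i : 'I_18, idx i \in [:: 0; 6; 12]%N & onto g i.
Proof.
move=> sg s1.
pose ph z := F (pt tsP g (pos g + z)).
pose x0 := pt tsP g (pos g).
have hx0 : rep x0 g (pos g) by apply: pt_rep; exact: pos_polygon_id.
have Fx0 := singular_apex sg hx0.
have seg (t : R) : (t, 0) = t *: side g by rewrite s1; veq.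
have in_g (t : R) : 0 <= t <= 1 -> polygon g (pos g + (t, 0)).
  by move=> ht; rewrite seg; apply/(on_side_polygon tsP)/on_side_scale.
have [e e0 he] := lF x0.
(* A point of g close to its start, from which the continuation proceeds;
   the start itself is singular. *)
pose t0 := Num.min (e / 2) (2^-1 : R).
have t00 : 0 < t0 by rewrite /t0 lt_min !divr_gt0 // invr_gt0 ltr0n.
have t01 : t0 < 1 by have : t0 <= 2^-1 by [rewrite /t0 ge_min lexx orbT]; lra.
have t0e : `|(t0, 0) : V| < e.
  apply/vec_normP; rewrite /= normr0 gtr0_norm //; split => //.
  by have : t0 <= e / 2 by [rewrite /t0 ge_min lexx]; lra.
have st : step (apex p s) (t0, 0) (ph (t0, 0)).
  rewrite -Fx0; apply: he => //; exists g, (pos g); split => //.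
  by apply: pt_rep; apply: in_g; rewrite !ltW.
have [i hi hr] := apex_ray t00 st; exists i => // t x ht hx.
pose K := [set z : V | exists2 c : R, 0 <= c <= 1 & z = (c, 0)].
pose ps z := pt tsT (mside p s i) (pos (mside p s i) + z).
have in_i (c : R) : 0 <= c <= 1 -> polygon (mside p s i) (pos (mside p s i) + (c, 0)).
  move=> hc; have [c' /andP[c1 c2] [-> _]] := unit_on_side hi hc.
  by apply/(on_side_polygon tsT)/on_side_scale; rewrite c1 (le_trans c2) //; case/andP: hc.
have iph : immersion K ph.
  apply: (immersion_comp lF).
  have := immersion_shift (c := pos g) (pt_immersion tsP (d := g)) => im.
  apply: (immersion_eq_in (phi := fun z => pt tsP g (z + pos g))) => [z _|]; first by rewrite addrC.
  by apply: immersionS im => z [c hc ->] /=; rewrite addrC; exact: in_g.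
have ips : immersion K ps.
  have := immersion_shift (c := pos (mside p s i)) (pt_immersion tsT (d := mside p s i)) => im.
  apply: (immersion_eq_in (phi := fun z => pt tsT (mside p s i) (z + pos (mside p s i)))) => [z _|]; first by rewrite addrC.
  by apply: immersionS im => z [c hc ->] /=; rewrite addrC; exact: in_i.
have line (c r : R) : (t0, 0) + r *: ((c, 0) - (t0, 0)) = (t0 + r * (c - t0), 0) :> V by veq.
have E : ph (t, 0) = ps (t, 0).
  have [t1 t2] := andP ht.
  apply: (immersion_unique tsT (a := (t0, 0)) _ iph ips) => [r /andP[r0 r1]||r /andP[r0 r1]].
  - by rewrite line; exists (t0 + r * (t - t0)) => //; apply/andP; split; nra.
  - by apply: rep_fun (pt_rep tsT (in_i _ _)); rewrite // !ltW.
  - rewrite line.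
    have rg : 0 < t0 + r * (t - t0) < 1 by apply/andP; split; nra.
    apply: (local_iso_regular lG (can_inj GK)); rewrite FK.
    apply: (nonvertex_regular tsP); apply: (side_interior_nonvertex tsP (d := g) rg).
    by rewrite -seg; apply: pt_rep; apply: in_g; lra.
have -> : F x = ps (t, 0).
  by rewrite -E /ph; congr F; apply: rep_pt; rewrite seg.
exact: pt_rep (in_i _ ht).
Qed.

Lemma onto_inj g k i : side g = (1, 0) -> side k = (1, 0) ->
  onto g i -> onto k i -> k = g.
Proof.
move=> sg sk og ok.
have h2 : 0 < (2^-1 : R) < 1 by exact: half01.
have h2' : 0 <= (2^-1 : R) <= 1 by case/andP: h2 => a b; rewrite !ltW.
have [x hx] := polygon_rep (on_side_polygon tsP (on_side_scale g h2')).
have [y hy] := polygon_rep (on_side_polygon tsP (on_side_scale k h2')).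
have exy : x = y by apply: (can_inj FK); exact: rep_fun (og _ _ h2' hx) (ok _ _ h2' hy).
rewrite -exy in hy.
have [[-> //]|[e _]] := side_interior_rep tsP h2 h2' hx hy.
by move: sk; rewrite e (side_opp tsP) sg => -[/neg1_neq1].
Qed.

(** The end of g is singular, whereas the point at distance 1 from the
    start of alpha_1 or alpha_2 is inside that side. *)
Lemma onto_closed g i : singular g -> next P g \in porbit (rot P) g -> side g = (1, 0) ->
  idx i \in [:: 0; 6; 12]%N -> onto g i -> idx i = 0%N.
Proof.
move=> sg cg s1 hi og.
have h1 : 0 <= (1 : R) <= 1 by rewrite ler01 /=.
have hx0 : rep (pt tsP g (pos g)) g (pos g) by apply: pt_rep; exact: pos_polygon_id.
have hx1 := rep_rot_porbit tsP hx0 cg.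
have := og _ _ h1; rewrite scale1r -pos_next => /(_ _ (iffLR (rep_next _ _ _) hx1)).
rewrite (singular_apex sg hx0).
have [c /andP[c0 c1] [-> hc]] := unit_on_side hi h1.
move=> hr; apply/eqP/contraT => /hc ec.
have cc : 0 < c < 1.
  have L1 := l1; have l0 : 0 < l by exact: lt_trans ltr01 l1.
  by rewrite ec divr_gt0 //= ltr_pdivrMr // mul1r.
case: (side_interior_nonvertex tsT cc hr); exists (mside p s (o 0)); exact: rep_apex.
Qed.

(** Counterclockwise by pi from the start of alpha_2 one finds its end, not
    that of gamma: the image of g would end along alpha_2. *)
Lemma onto_left g k i : onto g (o 0) -> onto k i -> side g = (1, 0) -> side k = (1, 0) ->
  idx i \in [:: 6; 12]%N -> ccw_angle k (opp P g) pi -> idx i = 6%N.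
Proof.
move=> og ok sg sk hi [m em em'].
apply/eqP/contraT => n6; have ei : i = o 12.
  by apply: val_inj; move: hi; rewrite !inE (negbTE n6) => /eqP.
rewrite ei in ok; have L1 := l1; have l0 : 0 < l by exact: lt_trans ltr01 l1.
have tri (j j' : 'I_18) : idx j' = entry tabT (prev3 j) -> rot T (mside p s j) = mside p s j'.
  by move=> e; apply: val_inj; exact: etrans (rot_model p s j) (esym e).
have r1 : rot T (mside p s (o 12)) = mside p s (o 15) by exact: tri.
have r2 : rot T (mside p s (o 15)) = mside p s (o 13) by exact: tri.
have r3 : rot T (mside p s (o 13)) = mside p s (o 4) by exact: tri.
have [|||||r r0 hr] := @local_iso_half_turn _ _ _ tsP tsT F lF k (mside p s (o 12)) m l 1 (esym em') l0.
- by rewrite side_model sk; veq.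
- by rewrite r1 r2 !side_model /cross /= mulr1 mul0r subr0.
- by rewrite ltr01.
- by rewrite r1 r2 r3 !side_model; veq.
- exists 1; rewrite ?ltr01 // => t x /andP[t0 t1] hx; have -> : t *: side k = (t, 0) by rewrite sk; veq.
  by apply: ok hx; rewrite !ltW.
rewrite em r1 r2 r3 in hr.
pose t := Num.min (r / 2) (2^-1 : R).
have t0 : 0 < t by rewrite /t lt_min !divr_gt0 // invr_gt0 ltr0n.
have tr : t < r by have : t <= r / 2 by [rewrite /t ge_min lexx]; lra.
have t1 : t < 1 by have : t <= 2^-1 by [rewrite /t ge_min lexx orbT]; lra.
have ht : 0 <= 1 - t <= 1 by lra.
have [x hx] := polygon_rep (on_side_polygon tsP (on_side_scale g ht)).
have hx' := rep_on_side tsP (on_side_scale g ht) hx.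
have h4 : rep (F x) (mside p s (o 4)) (pos (mside p s (o 4)) + (t / l) *: side (mside p s (o 4))).
  have -> : (t / l) *: side (mside p s (o 4)) = - (t *: side k).
    by rewrite side_model sk; apply: vec_eq; rewrite /= !scale_mul ?mulr0 ?oppr0 // mulrN divfK ?mulr1 // gt_eqF.
  apply: hr; first by rewrite t0.
  by move: hx'; rewrite (pos_opp tsP) sk sg; congr rep; veq.
have h5 := og _ _ ht hx.
have ht' : 0 < 1 - t < 1 by lra.
have tl : 0 <= t / l <= 1.
  by rewrite divr_ge0 ?(ltW l0) ?(ltW t0) //= ler_pdivrMr // mul1r; lra.
have h5' : rep (F x) (mside p s (o 0)) (pos (mside p s (o 0)) + (1 - t) *: side (mside p s (o 0))).
  by move: h5; congr rep; rewrite side_model; veq.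
case: (side_interior_rep tsT ht' tl h5' h4) => [[/(congr1 val) //]|[/(congr1 val) + _]].
by rewrite [X in _ = X -> _]opp_model.
Qed.

(** Counterclockwise by pi from the end of gamma one finds the start of
    alpha_2. *)
Lemma onto_right g k i : onto g (o 0) -> onto k i -> side g = (1, 0) -> side k = (1, 0) ->
  idx i \in [:: 6; 12]%N -> ccw_angle (opp P g) k pi -> idx i = 12%N.
Proof.
move=> og ok sg sk hi [m em em'].
apply/eqP/contraT => n6; have ei : i = o 6.
  by apply: val_inj; move: hi; rewrite !inE (negbTE n6) orbF => /eqP.
rewrite ei in ok; have L1 := l1; have l0 : 0 < l by exact: lt_trans ltr01 l1.
have so : side (opp P g) = (-1, 0) by rewrite (side_opp tsP) sg; veq.
have tri (j j' : 'I_18) : idx j' = entry tabT (prev3 j) -> rot T (mside p s j) = mside p s j'.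
  by move=> e; apply: val_inj; exact: etrans (rot_model p s j) (esym e).
have r1 : rot T (mside p s (o 10)) = mside p s (o 2) by exact: tri.
have r2 : rot T (mside p s (o 2)) = mside p s (o 5) by exact: tri.
have r3 : rot T (mside p s (o 5)) = mside p s (o 12) by exact: tri.
have [|||||r r0 hr] := @local_iso_half_turn _ _ _ tsP tsT F lF (opp P g) (mside p s (o 10)) m 1 l (esym em') ltr01.
- by rewrite side_model so; veq.
- by rewrite r1 r2 !side_model /cross /= mul0r subr0 mulrNN mul1r.
- exact: l0.
- by rewrite r1 r2 r3 !side_model; veq.
- exists 1; rewrite ?ltr01 // => t x /andP[t0 t1] hx.
  have ht : 0 <= 1 - t <= 1 by lra.
  have hx' : rep x g (pos g + (1 - t) *: side g).
    have os : on_side (opp P g) (pos (opp P g) + t *: side (opp P g)) by apply: on_side_scale; lra.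
    have := rep_on_side tsP os hx; rewrite (oppK tsP) (shift_opp tsP) (pos_opp tsP) so sg.
    by congr rep; veq.
  have := og _ _ ht hx'; have -> : (1 - t, 0) = (1 - t) *: side (mside p s (o 0)) by rewrite side_model; veq.
  move=> /(rep_on_side tsT (on_side_scale _ ht)).
  have -> : opp T (mside p s (o 0)) = mside p s (o 10) by apply: val_inj; rewrite [LHS]opp_model.
  have e10 : mside p s (o 10) = opp T (mside p s (o 0)) by apply: val_inj; rewrite [RHS]opp_model.
  by congr rep; rewrite e10 (pos_opp tsT) so side_model; veq.
rewrite em r1 r2 r3 in hr.
pose t := Num.min (r / 2) (2^-1 : R).
have t0 : 0 < t by rewrite /t lt_min !divr_gt0 // invr_gt0 ltr0n.
have tr : t < r by have : t <= r / 2 by [rewrite /t ge_min lexx]; lra.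
have t1 : t < 1 by have : t <= 2^-1 by [rewrite /t ge_min lexx orbT]; lra.
have ht : 0 <= t <= 1 by lra.
have [x hx] := polygon_rep (on_side_polygon tsP (on_side_scale k ht)).
have tl : 0 < t / l < 1.
  by rewrite divr_gt0 //= ltr_pdivrMr // mul1r; lra.
have tl' : 0 <= t / l <= 1 by lra.
have on (j : 'I_18) : (sidesT l h p s)`_j = (l, 0) -> (t / l) *: side (mside p s j) = (t, 0).
  by move=> e; rewrite side_model e; apply: vec_eq; rewrite /= !scale_mul ?mulr0 // divfK // gt_eqF.
have h12 : rep (F x) (mside p s (o 12)) (pos (mside p s (o 12)) + (t / l) *: side (mside p s (o 12))).
  rewrite on //; have -> : (t, 0) = - (t *: side (opp P g)) by rewrite so; veq.
  apply: hr; first by rewrite t0.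
  by move: hx; congr rep; rewrite so sk; veq.
have h6 := ok _ _ ht hx; rewrite -(on (o 6)) // in h6.
case: (side_interior_rep tsT tl tl' h6 h12) => [[/(congr1 val) //]|[/(congr1 val) + _]].
by rewrite [X in _ = X -> _]opp_model.
Qed.

End Identify.
End Rays.

(** * Surgeries on the two-cylinder surfaces *)

Section Classes.
Variable R : realType.
Implicit Types P Q : polygon_gluing R.

Lemma H2_pointP P Q (hP : in_H2 P) (hQ : in_H2 Q) : H2_point hP = H2_point hQ <-> isomorphic P Q.
Proof.
rewrite /H2_point; split.
- by move/eqquotP => /asboolP.
- by move=> h; apply/eqquotP/asboolP.
Qed.

Lemma isomorphic_maps P Q : translation_surface P -> translation_surface Q -> isomorphic P Q ->
  exists (F : surface P -> surface Q) (G : surface Q -> surface P),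
    [/\ local_iso F, local_iso G, cancel F G & cancel G F].
Proof.
move=> tsP tsQ [F [G [[FK GK] [cF cG] hF hG]]]; exists F, G; split => //.
- exact: isomorphic_local_iso tsP tsQ (can_inj FK) cF hF.
- exact: isomorphic_local_iso tsQ tsP (can_inj GK) cG hG.
Qed.

Lemma singular_rot P (d e : 'I_(nsides P)) : e \in porbit (rot P) d -> singular d -> singular e.
Proof. by rewrite -eq_porbit_mem /singular /cone_angle => /eqP ->. Qed.

End Classes.

Section Surgeries.
Variables (R : realType) (l h : R).
Hypotheses (l1 : 1 < l) (h0 : 0 < h).
Local Notation V := (R * R)%type.
Local Notation o i := (@Ordinal 18 i isT).
Local Notation o' i := (@Ordinal 24 i isT).
Implicit Types p s lam : R.

Definition model_point p s : H2 R := H2_point (model_in_H2 l1 h0 p s).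

Let lam1 : 0 < (1 : R) < l. Proof. by apply/andP; split. Qed.
Let laml : 0 < l - 1 < l. Proof. by rewrite subr_gt0 l1 gtrBl ltr01. Qed.
Let l0 : 0 < l. Proof. exact: lt_trans ltr01 l1. Qed.

Lemma left_model_surface p s lam : 0 < lam < l -> translation_surface (left_model l h p s lam).
Proof. by move=> hl; apply: (tri_translation_surface tableL (sides_okL l1 h0 p s hl) reachL). Qed.

Lemma right_model_surface p s lam : 0 < lam < l -> translation_surface (right_model l h p s lam).
Proof. by move=> hl; apply: (tri_translation_surface tableR (sides_okR l1 h0 p s hl) reachR). Qed.

Lemma side_left p s lam (d : 'I_(nsides (left_model l h p s lam))) : 0 < lam < l ->
  side d = (sidesL l h p s lam)`_d.
Proof. by move=> hl; apply: (tri_side tableL (sides_okL l1 h0 p s hl)). Qed.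

Lemma side_right p s lam (d : 'I_(nsides (right_model l h p s lam))) : 0 < lam < l ->
  side d = (sidesR l h p s lam)`_d.
Proof. by move=> hl; apply: (tri_side tableR (sides_okR l1 h0 p s hl)). Qed.

Lemma model_left p s lam : 0 < lam < l -> isomorphic (model l h p s) (left_model l h p s lam).
Proof.
move=> hl; have tsT := model_surface l1 h0 p s; have tsS := left_model_surface p s hl.
have [f [f' [lf lf' fK fK' _]]] := split_isomorphic tsT tsS (left_split l1 h0 p s hl).
exact: local_iso_isomorphic tsT tsS lf lf' fK fK'.
Qed.

Lemma model_right p s lam : 0 < lam < l -> isomorphic (model l h p s) (right_model l h p s lam).
Proof.
move=> hl; have tsT := model_surface l1 h0 p s; have tsS := right_model_surface p s hl.
have [f [f' [lf lf' fK fK' _]]] := split_isomorphic tsT tsS (right_split l1 h0 p s hl).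
exact: local_iso_isomorphic tsT tsS lf lf' fK fK'.
Qed.

Lemma left_resew_isomorphic p s : isomorphic (left_model' l h p s) (model l h (p - 1) (s + 1)).
Proof.
apply: isomorphic_trans (left_model_move l1 h0 p s) _.
exact/isomorphic_sym/model_left.
Qed.

Lemma right_resew_isomorphic p s : isomorphic (right_model' l h p s) (model l h (p + 1) (s - 1)).
Proof.
apply: isomorphic_trans (right_model_move l1 h0 p s) _.
exact/isomorphic_sym/model_right.
Qed.

(** The surgery is performed on the subdivision of the model at distance 1
    on alpha_1, where the twin of gamma is a side. *)
Lemma left_surgery_model p s : left_surgery (model_point p s) (model_point (p - 1) (s + 1)).
Proof.
pose S := left_model l h p s 1.
have hS : in_H2 S := left_model_in_H2 l1 h0 p s.
pose g : 'I_(nsides S) := o' 0; pose k : 'I_(nsides S) := o' 6.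
have eR : resew g k = left_model' l h p s by apply: left_resewE.
have hQ : in_H2 (resew g k) by rewrite eR; exact: left_model'_in_H2.
have orb (d e : 'I_(nsides S)) : other_vertex midL d = other_vertex midL e -> e \in porbit (rot S) d.
  by move=> e1; rewrite (tri_rot_porbit tableL orbitsL) e1.
have sg : singular g by apply/left_model_singular.
have sdg : side g = (1, 0) by rewrite (side_left _ lam1).
have sdk : side k = (1, 0) by rewrite (side_left _ lam1).
have usc : unit_saddle_connection g.
  split => //; split => //; apply: orb.
  by rewrite (tri_next_val tableL).
have tw : twin g k by split => //; [exact: orb | rewrite sdg sdk].
exists S, (resew g k), hS, hQ, g, k; split => //.
- exact/H2_pointP/model_left.
- by apply/H2_pointP; rewrite eR; exact/isomorphic_sym/left_resew_isomorphic.
- split => //; exists 3%N.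
    by apply: val_inj; rewrite /= !(tri_rot_val tableL) [RHS](tri_opp_val tableL).
  rewrite -(left_half_turn l1 h0 p s) !big_ord_recl big_ord0 /= addr0 addrA.
  by rewrite !(tri_corner tableL (sides_okL l1 h0 p s lam1)) /bump /= !(tri_rot_val tableL).
- split => //; first by case: usc.
  rewrite /embedded (tri_rot_porbit tableL orbitsL) (tri_next_val tableL).
  by [].
Qed.

Lemma right_surgery_model p s : right_surgery (model_point p s) (model_point (p + 1) (s - 1)).
Proof.
pose S := right_model l h p s 1.
have hS : in_H2 S := right_model_in_H2 l1 h0 p s.
pose g : 'I_(nsides S) := o' 0; pose k : 'I_(nsides S) := o' 12.
have eR : resew g k = right_model' l h p s by apply: right_resewE.
have hQ : in_H2 (resew g k) by rewrite eR; exact: right_model'_in_H2.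
have orb (d e : 'I_(nsides S)) : other_vertex midR d = other_vertex midR e -> e \in porbit (rot S) d.
  by move=> e1; rewrite (tri_rot_porbit tableR orbitsR) e1.
have sg : singular g by apply/right_model_singular.
have sdg : side g = (1, 0) by rewrite (side_right _ lam1).
have sdk : side k = (1, 0) by rewrite (side_right _ lam1).
have usc : unit_saddle_connection g.
  split => //; split => //; apply: orb.
  by rewrite (tri_next_val tableR).
have tw : twin g k by split => //; [exact: orb | rewrite sdg sdk].
exists S, (resew g k), hS, hQ, g, k; split => //.
- exact/H2_pointP/model_right.
- by apply/H2_pointP; rewrite eR; exact/isomorphic_sym/right_resew_isomorphic.
- split => //; exists 3%N.
    by apply: val_inj; rewrite /= !(tri_rot_val tableR) (tri_opp_val tableR).
  rewrite -(right_half_turn l1 h0 p s) !big_ord_recl big_ord0 /= addr0 addrA.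
  by rewrite !(tri_corner tableR (sides_okR l1 h0 p s lam1)) /bump /= !(tri_rot_val tableR) (tri_opp_val tableR).
- split => //; first by case: usc.
  rewrite /embedded (tri_rot_porbit tableR orbitsR) (tri_next_val tableR).
  by [].
Qed.

(** A unit saddle connection g of P goes to gamma because it is closed, and
    a twin k of it goes to one of the other two rays because k differs from
    g. *)
Lemma surgery_onto p s P (hP : in_H2 P) (g k : 'I_(nsides P))
    (F : surface P -> surface (model l h p s)) (G : surface (model l h p s) -> surface P) :
  local_iso F -> local_iso G -> cancel F G -> cancel G F ->
  unit_saddle_connection g -> twin g k ->
  onto F g (o 0) /\ exists2 i : 'I_18, nat_of_ord i \in [:: 6; 12]%N & onto F k i.
Proof.
move=> lF lG FK GK [[sg cg] s1] [nk ok sk]; rewrite s1 in sk.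
have skk := singular_rot ok sg.
have [i hi oi] := onto_ex l1 h0 hP lF lG FK GK sg s1.
have ei : i = o 0 by apply: val_inj; exact: (onto_closed l1 h0 hP lG FK GK sg cg s1 hi oi).
rewrite ei in oi; split => //.
have [j hj oj] := onto_ex l1 h0 hP lF lG FK GK skk sk; exists j => //.
move: hj; rewrite in_cons => /orP[/eqP e|//].
have ej : j = o 0 by exact: val_inj.
rewrite ej in oj.
by move: nk; rewrite (onto_inj hP FK s1 sk oi oj) eqxx.
Qed.

(** Composed with the isomorphism of the model to its subdivision S, an
    isomorphism from P to the model takes g and k to sides of S, so that
    the surgery can be performed on S. *)
Lemma resew_subdivision p s (P S : polygon_gluing R) (g k : 'I_(nsides P)) (i : 'I_18)
    (F : surface P -> surface (model l h p s)) (G : surface (model l h p s) -> surface P)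
    iota mu nu origin A (lam : 'I_(nsides (model l h p s)) -> R) (M := mside l h p s) :
  translation_surface P -> translation_surface S ->
  local_iso F -> local_iso G -> cancel F G -> cancel G F ->
  onto F g (o 0) -> onto F k i -> side g = (1, 0) -> side k = (1, 0) ->
  split (P := model l h p s) (S := S) iota mu nu origin A lam ->
  ~~ A (M (o 0)) -> A (M i) -> side (M i) = (l, 0) -> lam (M i) = 1 / l ->
  translation_surface (resew g k) -> translation_surface (resew (iota (M (o 0))) (iota (M i))) ->
  isomorphic (resew g k) (resew (iota (M (o 0))) (iota (M i))).
Proof.
move=> tsP tsS lF lG FK GK og ok sg sk sp nA Ai si li tsR tsR'.
have tsT := model_surface l1 h0 p s; have ln : l != 0 by rewrite gt_eqF.
have s0 : side (M (o 0)) = (1, 0) by rewrite side_model.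
have [f [f' [lf lf' fK fK' [f1 f2]]]] := split_isomorphic tsT tsS sp.
have sg' : side (iota (M (o 0))) = (1, 0) by rewrite (split_side sp nA).
have sk' : side (iota (M i)) = (1, 0).
  have [_ _ ->] := split_lam sp Ai.
  by rewrite si li; apply: vec_eq; rewrite /= scale_mul ?mulr0 // divfK.
apply: (resew_isomorphic (F := f \o F) (G := G \o f') tsP tsS tsR tsR').
- by rewrite sg.
- by rewrite sk'.
- by rewrite sg.
- exact: local_iso_comp.
- exact: local_iso_comp.
- exact: can_comp.
- exact: can_comp.
- move=> t x ht hx; have := og _ _ ht hx.
  have -> : (t, 0) = t *: side (M (o 0)) by rewrite s0; veq.
  move=> /(f1 _ _ _ nA (on_side_scale _ ht)).
  by congr rep; rewrite sg' s0; veq.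
- move=> t x ht hx; have := ok _ _ ht hx.
  have -> : (t, 0) = (t / l) *: side (M i).
    by rewrite si; apply: vec_eq; rewrite /= scale_mul ?mulr0 // divfK.
  have htl : 0 <= t / l <= lam (M i).
    by case/andP: ht => a b; rewrite li divr_ge0 ?(ltW l0) //= ler_pM2r ?invr_gt0.
  move=> /(f2 _ _ _ Ai htl).
  congr rep; congr (_ + _); rewrite si sk'.
  by apply: vec_eq; rewrite /= !scale_mul ?mulr0 // divfK // mulr1.
Qed.

(** The surgery may start from any gluing in the class of the model. *)
Theorem left_surgery_unique p s y : left_surgery (model_point p s) y -> y = model_point (p - 1) (s + 1).
Proof.
move=> [P [Q [hP [hQ [g [k [ex -> ug [tw ang] [_ _ _ eQ]]]]]]]].
apply/H2_pointP; apply: isomorphic_trans (left_resew_isomorphic p s).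
have tsP : translation_surface P by case: (hP).
have tsT := model_surface l1 h0 p s; have tsS := left_model_surface p s lam1.
have /H2_pointP/isomorphic_sym iso := ex.
have [F [G [lF lG FK GK]]] := isomorphic_maps tsP tsT iso.
have [og [i hi ok]] := surgery_onto hP lF lG FK GK ug tw.
have [_ s1] := ug; have sk : side k = (1, 0) by case: tw => _ _ ->.
have ei : i = o 6 by apply: val_inj; exact: (onto_left l1 h0 hP lF og ok s1 sk hi ang).
rewrite ei in ok.
have eR : resew (ord_map 23 left_iota (mside l h p s (o 0)) : 'I_(nsides (left_model l h p s 1)))
    (ord_map 23 left_iota (mside l h p s (o 6))) = left_model' l h p s.
  by apply: left_resewE; rewrite /= inordK.
rewrite eQ -eR; apply: (resew_subdivision tsP tsS lF lG FK GK og ok s1 sk (left_split l1 h0 p s lam1)).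
- by [].
- by [].
- by rewrite side_model.
- by [].
- by rewrite -eQ; case: (hQ).
- by rewrite eR; case: (left_model'_in_H2 l1 h0 p s).
Qed.

Theorem right_surgery_unique p s y : right_surgery (model_point p s) y -> y = model_point (p + 1) (s - 1).
Proof.
move=> [P [Q [hP [hQ [g [k [ex -> ug [tw ang] [_ _ _ eQ]]]]]]]].
apply/H2_pointP; apply: isomorphic_trans (right_resew_isomorphic p s).
have tsP : translation_surface P by case: (hP).
have tsT := model_surface l1 h0 p s; have tsS := right_model_surface p s lam1.
have /H2_pointP/isomorphic_sym iso := ex.
have [F [G [lF lG FK GK]]] := isomorphic_maps tsP tsT iso.
have [og [i hi ok]] := surgery_onto hP lF lG FK GK ug tw.
have [_ s1] := ug; have sk : side k = (1, 0) by case: tw => _ _ ->.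
have ei : i = o 12 by apply: val_inj; exact: (onto_right l1 h0 hP lF og ok s1 sk hi ang).
rewrite ei in ok.
have eR : resew (ord_map 23 right_iota (mside l h p s (o 0)) : 'I_(nsides (right_model l h p s 1)))
    (ord_map 23 right_iota (mside l h p s (o 12))) = right_model' l h p s.
  by apply: right_resewE; rewrite /= inordK.
rewrite eQ -eR; apply: (resew_subdivision tsP tsS lF lG FK GK og ok s1 sk (right_split l1 h0 p s lam1)).
- by [].
- by [].
- by rewrite side_model.
- by [].
- by rewrite -eQ; case: (hQ).
- by rewrite eR; case: (right_model'_in_H2 l1 h0 p s).
Qed.

End Surgeries.

(** * The shear invariant *)

Section Shear.
Variables (R : realType) (l h : R).
Hypotheses (l1 : 1 < l) (h0 : 0 < h).
Local Notation V := (R * R)%type.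
Local Notation o i := (@Ordinal 18 i isT).
Implicit Types p s : R.

Let l0 : 0 < l. Proof. exact: lt_trans ltr01 l1. Qed.

Lemma orbitsT : orbits_in_H2 18 tabT (fun=> 0%N) 1. Proof. by vm_compute. Qed.

Lemma model_singular p s (d : 'I_(nsides (model l h p s))) : singular d.
Proof.
have reg j : (0 < j < 1)%N -> \sum_(0 <= i < 18 | 0%N == j) corner_at (sidesT l h p s) i = 2 * pi.
  by case: j.
by rewrite (tri_singular tableT (sides_okT l1 h0 p s) reachT orbitsT reg).
Qed.

Lemma rotM p s (i j : 'I_18) : nat_of_ord j = entry tabT (prev3 i) ->
  rot (model l h p s) (mside l h p s i) = mside l h p s j.
Proof. by move=> e; apply: val_inj; exact: etrans (rot_model l h p s i) (esym e). Qed.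

Lemma oppM p s (i j : 'I_18) : nat_of_ord j = entry tabT i ->
  opp (model l h p s) (mside l h p s i) = mside l h p s j.
Proof. by move=> e; apply: val_inj; exact: etrans (opp_model l h p s i) (esym e). Qed.

Lemma nextM p s (i j : 'I_18) : nat_of_ord j = next3 i ->
  next (model l h p s) (mside l h p s i) = mside l h p s j.
Proof. by move=> e; apply: val_inj; exact: etrans (tri_next_val tableT _) (esym e). Qed.

(** Isomorphisms preserve gamma, hence alpha_2, whose start is at angle pi
    counterclockwise from the end of gamma. *)
Lemma model_alpha2 p s p' s' (F : surface (model l h p s) -> surface (model l h p' s'))
    (G : surface (model l h p' s') -> surface (model l h p s)) :
  local_iso F -> local_iso G -> cancel F G -> cancel G F ->
  exists2 r : R, 0 < r & forall (t : R) x, 0 < t < r ->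
    rep x (mside l h p s (o 12)) (pos (mside l h p s (o 12)) + (t, 0)) ->
    rep (F x) (mside l h p' s' (o 12)) (pos (mside l h p' s' (o 12)) + (t, 0)).
Proof.
move=> lF lG FK GK.
have tsT := model_surface l1 h0 p s; have tsT' := model_surface l1 h0 p' s'.
have sd q u i := side_model l1 h0 q u i.
have hT := model_in_H2 l1 h0 p s.
have sg : singular (mside l h p s (o 0)) by apply: model_singular.
have s1 : side (mside l h p s (o 0)) = (1, 0) by rewrite sd.
have cg : next _ (mside l h p s (o 0)) \in porbit (rot (model l h p s)) (mside l h p s (o 0)).
  by rewrite (nextM _ _ (j := o 1)) //; exact: rot_model_orbit.
have [i hi oi] := onto_ex l1 h0 hT lF lG FK GK sg s1.
have ei : i = o 0 by apply: val_inj; exact: (onto_closed l1 h0 hT lG FK GK sg cg s1 hi oi).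
rewrite ei in oi.
have R1 q u : rot _ (mside l h q u (o 10)) = mside l h q u (o 2) by exact: rotM.
have R2 q u : rot _ (mside l h q u (o 2)) = mside l h q u (o 5) by exact: rotM.
have R3 q u : rot _ (mside l h q u (o 5)) = mside l h q u (o 12) by exact: rotM.
have O q u : opp _ (mside l h q u (o 0)) = mside l h q u (o 10) by exact: oppM.
have s10 q u : side (mside l h q u (o 10)) = (-1, 0) by rewrite sd.
have sw : sweep 3 (mside l h p s (o 10)) = pi.
  rewrite !sweepS sweep0 add0r /= !R1 R2 !cornerE // R1 R2 R3 !sd /=.
  have L0 := l0; have H0 := h0.
  have <- := @turn3 R (- 1) (- l) (- p) (- h) (1 - p) (- h); try lra.
  by congr (_ + _ + _); congr angle; veq.
have [|||||r r0 hr] := @local_iso_half_turn _ _ _ tsT tsT' F lF (mside l h p s (o 10)) (mside l h p' s' (o 10)) 3 1 l sw ltr01.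
- by rewrite !s10; veq.
- by rewrite R1 R2 !sd /cross /= mul0r subr0 mulrNN mul1r.
- exact: l0.
- by rewrite R1 R2 R3 !sd; veq.
- exists 1; [exact: ltr01 | move=> t x /andP[t0 t1] hx].
  have ht : 0 <= 1 - t <= 1 by lra.
  have hx' : rep x (mside l h p s (o 0)) (pos (mside l h p s (o 0)) + (1 - t) *: side (mside l h p s (o 0))).
    have os : on_side (mside l h p s (o 10)) (pos (mside l h p s (o 10)) + t *: side (mside l h p s (o 10))) by apply: on_side_scale; lra.
    have := rep_on_side tsT os hx; rewrite -O (oppK tsT) (shift_opp tsT) (pos_opp tsT) O s10 s1.
    by congr rep; veq.
  have := oi _ _ ht hx'; have -> : (1 - t, 0) = (1 - t) *: side (mside l h p' s' (o 0)) by rewrite sd; veq.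
  move=> /(rep_on_side tsT' (on_side_scale _ ht)); rewrite O.
  by congr rep; rewrite -[in RHS](O p' s') (pos_opp tsT') s10 sd; veq.
rewrite /= !R1 !R2 !R3 !s10 in hr.
have e (t : R) : - (t *: ((-1, 0) : V)) = (t, 0) by veq.
exists r; first exact: r0.
by move=> t x ht hx; have h1 := hr t x ht; rewrite e in h1; exact: h1.
Qed.

(** The narrow cylinder seen from alpha_2. Take a point a of alpha_2 near
    its start, and the segment from a to the top vertex at displacement (s
    + l, 1) from the start of alpha_2. An isomorphism maps it to the
    segment with the same displacement in the second surface, which for s <
    s' < s + l ends strictly inside alpha_1, at distance s' - s from a
    vertex, whereas the image of the singular point is singular. *)
Lemma model_shear_eq p s p' s' : isomorphic (model l h p s) (model l h p' s') ->
  s <= s' < s + l -> s' = s.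
Proof.
move=> iso /andP[ss' s'l].
have tsT := model_surface l1 h0 p s; have tsT' := model_surface l1 h0 p' s'.
have hT := model_in_H2 l1 h0 p s.
have sd q u i := side_model l1 h0 q u i.
have [F [G [lF lG FK GK]]] := isomorphic_maps tsT tsT' iso.
have [r0 r00 hr] := model_alpha2 lF lG FK GK.
pose r := Num.min (r0 / 2) (l / 2).
have rr0 : 0 < r by rewrite /r lt_min !divr_gt0.
have rr : r < r0 by have : r <= r0 / 2 by [rewrite /r ge_min lexx]; lra.
have rl : r < l by have : r <= l / 2 by [rewrite /r ge_min lexx orbT]; have := l0; lra.
pose a : V := (r, 0); pose b : V := (s + l, 1).
pose K := [set z : V | exists2 t : R, 0 <= t <= 1 & z = a + t *: (b - a)].
have posM q u (i j : 'I_18) : nat_of_ord j = next3 i ->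
    pos (mside l h q u j) = pos (mside l h q u i) + (sidesT l h q u)`_i.
  by move=> e; rewrite -(nextM q u e) pos_next sd.
have pos12 q u : pos (mside l h q u (o 12)) = 0 by [].
have pos13 q u : pos (mside l h q u (o 13)) = (l, 0) by rewrite (posM _ _ (o 12)) // pos12 add0r.
have pos14 q u : pos (mside l h q u (o 14)) = (u + l, 1) by rewrite (posM _ _ (o 13)) // pos13; veq.
have pos15 q u : pos (mside l h q u (o 15)) = 0 by [].
have pos16 q u : pos (mside l h q u (o 16)) = (u + l, 1) by rewrite (posM _ _ (o 15)) // pos15 add0r.
have pos17 q u : pos (mside l h q u (o 17)) = (u, 1) by rewrite (posM _ _ (o 16)) // pos16; veq.
have N5 q u : (next (model l h q u) (mside l h q u (o 12)) = mside l h q u (o 13)) *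
    (next (model l h q u) (mside l h q u (o 13)) = mside l h q u (o 14)) by split; exact: nextM.
have N6 q u : (next (model l h q u) (mside l h q u (o 15)) = mside l h q u (o 16)) *
    (next (model l h q u) (mside l h q u (o 16)) = mside l h q u (o 17)) by split; exact: nextM.
have poly5 q u (z : V) : 0 <= z.2 -> 0 <= u * z.2 - (z.1 - l) -> 0 <= z.1 - (u + l) * z.2 ->
    polygon (mside l h q u (o 12)) z.
  move=> c1 c2 c3; apply/(tri_polygonP (tri_triangulated tableT)).
  rewrite -/(model l h q u) !N5 pos12 pos13 pos14 !sd; split.
  - by have := mulr_ge0 (ltW l0) c1; congr (_ <= _); vring.
  - by move: c2; congr (_ <= _); vring.
  - by move: c3; congr (_ <= _); vring.
have poly6 q u (z : V) : z.2 <= 1 -> 0 <= (u + l) * z.2 - z.1 -> 0 <= z.1 - u * z.2 ->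
    polygon (mside l h q u (o 15)) z.
  move=> c1 c2 c3; apply/(tri_polygonP (tri_triangulated tableT)).
  rewrite -/(model l h q u) !N6 pos15 pos16 pos17 !sd; split.
  - by move: c2; congr (_ <= _); vring.
  - have c1' : 0 <= 1 - z.2 by rewrite subr_ge0.
    by have := mulr_ge0 (ltW l0) c1'; congr (_ <= _); vring.
  - by move: c3; congr (_ <= _); vring.
have K5 z : K z -> polygon (mside l h p s (o 12)) z.
  move=> [t /andP[t0 t1] ->]; have L0 := l0; apply: poly5; rewrite /= !scale_mul; nra.
(* The image of the segment K from a to b, and the segment K drawn in the
   second surface, where it crosses the diagonal of vector d. *)
pose ph z := F (pt tsT (mside l h p s (o 12)) z).
have iph : immersion K ph.
  by apply: (immersion_comp lF); apply: immersionS (pt_immersion tsT (d := mside l h p s (o 12))).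
pose d : V := (s' + l, 1).
pose ps z := if 0 <= cross d (z - 0) then pt tsT' (mside l h p' s' (o 15)) z else pt tsT' (mside l h p' s' (o 12)) z.
have Kz z : K z -> [/\ 0 <= z.2, z.2 <= 1, 0 <= s' * z.2 - (z.1 - l) & 0 <= z.1 - s' * z.2].
  move=> [t /andP[t0 t1] ->]; have L0 := l0; split; rewrite /= !scale_mul; nra.
have cd z : cross d (z - 0) = (s' + l) * z.2 - z.1 by vring.
have ips : immersion K ps.
  apply: immersion_split => [||z Kzz c0].
  - apply: immersionS (pt_immersion tsT' (d := mside l h p' s' (o 15))) => z [/Kz [z0 z1 z2 z3]].
    by rewrite cd => c0; exact: poly6.
  - apply: immersionS (pt_immersion tsT' (d := mside l h p' s' (o 12))) => z [/Kz [z0 z1 z2 z3]].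
    by rewrite cd => c0; apply: poly5 => //; move: c0; lra.
  - have [z0 z1 z2 z3] := Kz z Kzz; rewrite cd in c0.
    have ez : z = z.2 *: d by apply: vec_eq; rewrite /= scale_mul; lra.
    have os : on_side (mside l h p' s' (o 15)) z.
      by exists z.2; [rewrite z0 | rewrite pos15 sd {1}ez add0r].
    have O : opp (model l h p' s') (mside l h p' s' (o 15)) = mside l h p' s' (o 14) by exact: oppM.
    have sh : shift (mside l h p' s' (o 15)) = 0.
      have : pos (opp (model l h p' s') (mside l h p' s' (o 15))) = pos (mside l h p' s' (o 15)) + side (mside l h p' s' (o 15)) + shift (mside l h p' s' (o 15)).
        exact: pos_opp.
      rewrite O pos14 pos15 sd /= add0r => /esym/eqP; rewrite -subr_eq0 addrAC subrr add0r.
      by move/eqP.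
    rewrite -(pt_opp tsT' os) sh addr0 O.
    apply: pt_porbit; last by apply: poly5 => //; move: c0; lra.
    by rewrite -(N5 p' s').2 -(N5 p' s').1 !next_porbitE porbit_id.
have pt12 : rep (pt tsT (mside l h p s (o 12)) a) (mside l h p s (o 12)) (pos (mside l h p s (o 12)) + a).
  by rewrite pos12 add0r; apply: pt_rep; apply: K5; exists 0; rewrite ?lexx ?ler01 // scale0r addr0.
have E : ph b = ps b.
  apply: (immersion_unique tsT' (a := a) _ iph ips) => [t ht||t /andP[t0 t1]].
  - by exists t.
  - have := hr r _ _ pt12; rewrite rr0 rr => /(_ isT); rewrite -/(ph a) pos12 add0r => ha.
    rewrite /ps cd /= mulr0 sub0r oppr_ge0 leNgt rr0 /=.
    exact: rep_pt.
  - suff nv : ~ vertex (pt tsT (mside l h p s (o 12)) (a + t *: (b - a))).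
      have rg := nonvertex_regular tsT nv; rewrite -(FK (pt _ _ _)) in rg.
      exact: (local_iso_regular lG (can_inj GK) rg).
    have hK : K (a + t *: (b - a)) by exists t => //; rewrite t0 ltW.
    apply: (off_vertex tsT (pt_rep tsT (K5 _ hK))) => f /(tri_porbit (tri_triangulated tableT)).
    rewrite -/(model l h p s) !N5 => -[] ->; rewrite ?pos12 ?pos13 ?pos14 => e.
    + have := congr1 fst e; have := congr1 snd e; rewrite /= !scale_mul; have := rr0; nra.
    + have := congr1 fst e; have := congr1 snd e; rewrite /= !scale_mul; have := rr0; have := rl; nra.
    + have := congr1 snd e; rewrite /= !scale_mul; nra.
(* The end b is the singular point of the first surface. *)
have vb : vertex (ps b).
  apply: contrapT => /(nonvertex_regular tsT'); rewrite -E => /(local_iso_regular lF (can_inj FK)).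
  have -> : pt tsT (mside l h p s (o 12)) b = apex l1 h0 p s.
    apply: rep_fun (rep_apex l1 h0 p s (o 14)).
    rewrite pos14; have m14 : mside l h p s (o 14) \in porbit (next (model l h p s)) (mside l h p s (o 12)).
      by rewrite -(N5 p s).2 -(N5 p s).1 !next_porbitE porbit_id.
    apply/(rep_porbit _ _ m14); apply: pt_rep; apply: K5.
    by exists 1; rewrite ?ler01 ?lexx // scale1r addrC subrK.
  exact: apex_irregular.
apply/eqP; apply: contraT => ne; exfalso.
have ss : 0 < (s' - s) / l < 1.
  have lt : s < s' by rewrite lt_neqAle eq_sym ne.
  apply/andP; split; first by rewrite divr_gt0 ?subr_gt0.
  by rewrite ltr_pdivrMr // mul1r ltrBlDl.
have eb : ps b = pt tsT' (mside l h p' s' (o 15)) b.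
  have c0 : 0 <= (s' + l) * b.2 - b.1 by rewrite mulr1 subr_ge0 lerD2r.
  by rewrite /ps cd c0; exact: erefl.
have hb : rep (ps b) (mside l h p' s' (o 16)) (pos (mside l h p' s' (o 16)) + ((s' - s) / l) *: side (mside l h p' s' (o 16))).
  have ez : pos (mside l h p' s' (o 16)) + ((s' - s) / l) *: side (mside l h p' s' (o 16)) = b.
    rewrite pos16 sd; apply: vec_eq; rewrite /= scale_mul ?mulr0 ?addr0 // mulrN divfK ?gt_eqF ?l0 //.
    ring.
  have m16 : mside l h p' s' (o 16) \in porbit (next (model l h p' s')) (mside l h p' s' (o 15)).
    by rewrite -(N6 p' s').1 next_porbit.
  rewrite eb ez; apply/(rep_porbit _ _ m16); apply: pt_rep.
  have os : on_side (mside l h p' s' (o 16)) b by rewrite -ez; apply: on_side_scale; case/andP: ss => c1 c2; rewrite !ltW.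
  by have := on_side_polygon tsT' os; rewrite (porbit_next m16).
exact: (side_interior_nonvertex tsT' ss hb vb).
Qed.

Lemma model_twist_int p s (k : int) : isomorphic (model l h p s) (model l h p (s + l *~ k)).
Proof.
have up (n : nat) u : isomorphic (model l h p u) (model l h p (u + l *+ n)).
  elim: n u => [|n IH] u; first by rewrite mulr0n addr0; exact: isomorphic_refl.
  apply: isomorphic_trans (IH u) _; rewrite mulrSr addrA; exact: model_twist.
case: k => n; first exact: up.
rewrite NegzE mulrNz; apply: isomorphic_sym; have := up n.+1 (s - l *+ n.+1).
by rewrite subrK.
Qed.

(** Reduction to s <= s' < s + l by twists. *)
Theorem model_isomorphic_shear p s p' s' : isomorphic (model l h p s) (model l h p' s') ->
  exists k : int, s' = s + l *~ k.
Proof.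
move=> iso; pose k := Num.floor ((s' - s) / l); exists k.
have L0 := l0.
apply: (@model_shear_eq p (s + l *~ k) p' s').
  exact: isomorphic_trans (isomorphic_sym (model_twist_int p s k)) iso.
have /andP[] := floor_itv ((s' - s) / l); rewrite -/k ler_pdivlMr // ltr_pdivrMr // intrD.
rewrite -[l *~ k]mulrzl; set c := k%:~R : R.
by move=> c1 c2; apply/andP; split; lra.
Qed.

End Shear.

(** * The regular octagon *)

Section Octagon.
Variable R : realType.
Local Notation V := (R * R)%type.
Local Notation q := (cos (pi / 4) : R).
Local Notation O := (octagon R).

Lemma sin_piquarter : sin (pi / 4) = q.
Proof.
have := tan_piquarter R; rewrite /tan => h.
have c0 : q != 0 by apply/eqP => c0; move: h; rewrite c0 invr0 mulr0 => /eqP; rewrite eq_sym oner_eq0.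
by rewrite -(divfK c0 (sin _)) h mul1r.
Qed.

Lemma q_gt0 : 0 < q.
Proof. by apply: cos_gt0_pihalf; have := @pi_gt0 R; lra. Qed.

Lemma q_sqr : q * q = 1 / 2.
Proof. by have := cs (pi / 4 : R); rewrite sin_piquarter; lra. Qed.

Definition octagon_sides : seq V :=
  [:: (1, 0); (q, q); (0, 1); (- q, q); (- 1, 0); (- q, - q); (0, - 1); (q, - q)].

Definition octagon_vertices : seq V :=
  [:: (0, 0); (1, 0); (1 + q, q); (1 + q, 1 + q); (1, 1 + q + q); (0, 1 + q + q); (- q, 1 + q); (- q, q)].

Lemma octagon_next (d : 'I_(nsides O)) : nat_of_ord (next O d) = (d.+1 %% 8)%N.
Proof. by rewrite /octagon /next permE /= addn1. Qed.

Lemma octagon_opp (d : 'I_(nsides O)) : nat_of_ord (opp O d) = ((d + 4) %% 8)%N.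
Proof. by rewrite /octagon /opp permE. Qed.

Lemma octagon_rot (d : 'I_(nsides O)) : nat_of_ord (rot O d) = ((d + 3) %% 8)%N.
Proof.
rewrite rotE octagon_opp; have := octagon_next ((next O)^-1%g d); rewrite permKV => e.
by rewrite [in RHS]e modnDml addSnnS.
Qed.

Lemma eighth_turns (j : nat) : (j < 8)%N ->
  (cos (j%:R * (pi / 4)), sin (j%:R * (pi / 4))) = octagon_sides`_j :> V.
Proof.
have add2 (i : nat) : i.+2%:R * (pi / 4) = i%:R * (pi / 4) + pi / 2 :> R.
  by rewrite -addn2 natrD mulrDl; congr (_ + _); field.
have c0 : cos (0%:R * (pi / 4)) = 1 :> R by rewrite mul0r cos0.
have s0 : sin (0%:R * (pi / 4)) = 0 :> R by rewrite mul0r sin0.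
have c1 : cos (1%:R * (pi / 4)) = q by rewrite mul1r.
have s1 : sin (1%:R * (pi / 4)) = q by rewrite mul1r sin_piquarter.
move=> hj; do 8 (destruct j as [|j]; [by rewrite ?(add2, cosDpihalf, sinDpihalf) ?c0 ?s0 ?c1 ?s1 /= ?opprK ?oppr0 |]).
by [].
Qed.

Lemma octagon_pos (d : 'I_(nsides O)) : pos d = octagon_vertices`_d.
Proof.
have s (j : 'I_(nsides O)) : cos ((j : nat)%:R * (pi / 4)) = (octagon_sides`_j).1 :> R by rewrite -eighth_turns.
have E : forall n (hn : (n <= 8)%N), (\sum_(j < n) cos (j%:R * (pi / 4)), \sum_(j < n) sin (j%:R * (pi / 4))) =
    \sum_(j < n) octagon_sides`_j.
  elim=> [|n IH] hn; first by rewrite !big_ord0.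
  by rewrite !big_ord_recr /= -IH ?(ltnW hn) // -(eighth_turns hn).
rewrite /pos /= E; last by exact: ltnW (ltn_ord d).
case: d => n hn; rewrite /=.
do 8 (destruct n as [|n]; [by clear; rewrite ?big_ord_recr ?big_ord0 /=; veq |]); by [].
Qed.

Lemma octagon_side (d : 'I_(nsides O)) : side d = octagon_sides`_d.
Proof.
rewrite /side !octagon_pos octagon_next; case: d => n hn; rewrite /=.
do 8 (destruct n as [|n]; [by clear; rewrite /=; veq |]); by [].
Qed.

Lemma octagon_orbits (s : {perm 'I_(nsides O)}) (f c : nat -> nat) : (forall d : 'I_(nsides O), nat_of_ord (s d) = f d) ->
  orbits_check 8 f c -> forall d e, (e \in porbit s d) = (c e == c d).
Proof. exact: (@orbits_checkP 8). Qed.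

Lemma octagon_next_orbit (d e : 'I_(nsides O)) : e \in porbit (next O) d.
Proof.
have c : orbits_check 8 (fun i => i.+1 %% 8)%N (fun=> 0%N) by vm_compute.
by rewrite (octagon_orbits octagon_next c).
Qed.

Lemma octagon_rot_orbit (d e : 'I_(nsides O)) : e \in porbit (rot O) d.
Proof.
have c : orbits_check 8 (fun i => (i + 3) %% 8)%N (fun=> 0%N) by vm_compute.
by rewrite (octagon_orbits octagon_rot c).
Qed.

Lemma octagon_genus2 : genus2 O.
Proof.
have c1 : orbits_check 8 (fun i => i.+1 %% 8)%N (fun=> 0%N) by vm_compute.
have c2 : orbits_check 8 (fun i => (i + 3) %% 8)%N (fun=> 0%N) by vm_compute.
have c3 : orbits_check 8 (fun i => (i + 4) %% 8)%N (fun i => i %% 4)%N by vm_compute.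
rewrite /genus2 (@card_porbits 8 _ _ 1 (octagon_orbits octagon_next c1)) //.
rewrite (@card_porbits 8 _ _ 1 (octagon_orbits octagon_rot c2)) //.
by rewrite (@card_porbits 8 _ _ 4 (octagon_orbits octagon_opp c3)).
Qed.

Lemma octagon_surface : translation_surface O.
Proof.
have q0 := q_gt0; have q2 := q_sqr.
split => //.
- by move=> d; split; apply/eqP => /(congr1 val); rewrite /= ?octagon_next; have := ltn_ord d; rewrite -[nsides O]/8%N; lia.
- move=> d e _ n1 n2; rewrite octagon_side !octagon_pos.
  have e1 : nat_of_ord e <> nat_of_ord d by move=> h; move/eqP: n1; apply; exact: val_inj.
  have e2 : nat_of_ord e <> (d.+1 %% 8)%N by move=> h; move/eqP: n2; apply; apply: val_inj; rewrite [RHS]octagon_next.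
  have he := ltn_ord e; have hd := ltn_ord d; move: e1 e2 he hd; rewrite -[nsides O]/8%N.
  move: (nat_of_ord d) (nat_of_ord e) => i j {d e n1 n2} e1 e2 he hd.
  do 8 (destruct i as [|i]; [do 8 (destruct j as [|j]; [first [by case: e1 | by case: e2 | clear e1 e2 he hd; rewrite /cross /=; lra]|]); by [] |]); by [].
- move=> d; split.
    by apply: val_inj; rewrite /= !octagon_opp; have := ltn_ord d; rewrite -[nsides O]/8%N; lia.
  rewrite !octagon_side octagon_opp; case: d => n hn; rewrite /=.
  do 8 (destruct n as [|n]; [by clear; rewrite /=; veq |]); by [].
- move=> d e; have /porbitP[k ->] := octagon_next_orbit d e.
  elim: k => [|k IH]; first by rewrite expg0 perm1 connect0.
  apply: connect_trans IH _; apply: connect1; by rewrite expgSr permM eqxx.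
Qed.

End Octagon.

(** * Dissection of the octagon *)

Section Dissection.
Variable R : realType.
Local Notation V := (R * R)%type.
Local Notation q := (cos (pi / 4) : R).
Local Notation O := (octagon R).
Local Notation l := (1 + q + q).
Local Notation T := (model l q (- q) 0).
Local Notation o i := (@Ordinal 18 i isT).

Lemma l_gt1 : 1 < l.
Proof. by have := q_gt0 R; lra. Qed.

Let tsT : translation_surface T := model_surface l_gt1 (q_gt0 R) (- q) 0.
Let tsO : translation_surface O := octagon_surface R.
Let triT : triangulated T := tri_triangulated tableT.
Local Notation M i := (mside l q (- q) 0 i).
Local Notation sd := (sidesT l q (- q) 0).
Local Notation ov := (octagon_vertices R).

(** The octagon is cut by the horizontal diagonals from the vertex 7 to the
    vertex 2 and from 6 to 3 and by one diagonal of each of the three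
    parts; [place] gives the origins of the sides of the model's triangles.
    The upper and the lower part form the wide cylinder. *)
Definition place : seq V :=
  [seq ov`_i | i <- [:: 0; 1; 7; 1; 2; 7; 6; 3; 5; 3; 4; 5; 7; 2; 3; 7; 3; 6]%N].

(** The point of the model at the point z of the octagon, read in the
    triangle of i. *)
Definition tri_pt (i : 'I_18) z : surface T := pt tsT (M i) (z - (place`_i - pos (M i))).

Definition in_tri (i : 'I_18) z := polygon (M i) (z - (place`_i - pos (M i))).

Lemma sideM (i : 'I_18) : side (M i) = sd`_i.
Proof. exact: side_model l_gt1 (q_gt0 R) _ _ _. Qed.

Lemma place_next (i j : 'I_18) : nat_of_ord j = next3 i -> place`_j = place`_i + sd`_i.
Proof.
move=> ->; case: i => i hi.
by do 18 (destruct i as [|i]; [by rewrite /=; entries; rewrite /place /=; veq |]).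
Qed.

Let nM (i j : 'I_18) : nat_of_ord j = next3 i -> next T (M i) = M j.
Proof. exact: nextM. Qed.

Lemma place_off (i j : 'I_18) : nat_of_ord j = next3 i -> place`_j - pos (M j) = place`_i - pos (M i).
Proof. by move=> e; rewrite (place_next e) -(nM e) pos_next sideM; veq. Qed.

Lemma tri_pt_next (i j : 'I_18) z : nat_of_ord j = next3 i -> in_tri i z -> tri_pt j z = tri_pt i z.
Proof. by move=> e hz; rewrite /tri_pt (place_off e) -(nM e); exact: pt_next. Qed.

Lemma in_tri_next (i j : 'I_18) z : nat_of_ord j = next3 i -> in_tri j z = in_tri i z.
Proof. by move=> e; rewrite /in_tri (place_off e) -(nM e) polygon_next. Qed.

Lemma in_triP (i j k : 'I_18) z : nat_of_ord j = next3 i -> nat_of_ord k = next3 j ->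
  in_tri i z <-> [/\ 0 <= cross sd`_i (z - place`_i), 0 <= cross sd`_j (z - place`_j) &
    0 <= cross sd`_k (z - place`_k)].
Proof.
move=> e1 e2; have E (m : 'I_18) : place`_m - pos (M m) = place`_i - pos (M i) ->
    z - (place`_i - pos (M i)) - pos (M m) = z - place`_m.
  by move=> <-; veq.
have P := tri_polygonP triT (M i) (z - (place`_i - pos (M i))).
rewrite (nM e1) (nM e2) !sideM !E ?(place_off e2) ?(place_off e1) // in P.
exact: iff_sym P.
Qed.

(** Triangles that share a side agree on it; d is 0 for a side inside the
    octagon, and the translation to the opposite side for a side of the
    octagon. *)
Lemma tri_pt_glue (i j : 'I_18) z d : nat_of_ord j = entry tabT i -> in_tri i z ->
  cross sd`_i (z - place`_i) <= 0 -> place`_j = place`_i + sd`_i + d -> tri_pt i z = tri_pt j (z + d).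
Proof.
move=> ej hz c0 hd.
have os : on_side (M i) (z - (place`_i - pos (M i))).
  by apply: line_on_side => //; rewrite sideM; move: c0; congr (cross _ _ <= _); veq.
have O : opp T (M i) = M j by exact: oppM.
rewrite /tri_pt -(pt_opp tsT os) O; congr pt.
rewrite hd -O (pos_opp tsT) sideM; veq.
Qed.

(** Positions with respect to the five diagonals: A and B are the
    horizontal ones, from below, and C, D and E cut the upper, the middle
    and the lower part. *)
Definition above_A z := cross (1, 0) (z - ov`_7).
Definition above_B z := cross (1, 0) (z - ov`_6).
Definition above_C z := cross (- sd`_7) (z - ov`_5).
Definition above_D z := cross sd`_15 (z - ov`_7).
Definition above_E z := cross (- sd`_1) (z - ov`_7).

Definition top_map z := if 0 <= above_C z then tri_pt (o 9) z else tri_pt (o 6) z.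
Definition middle_map z := if 0 <= above_D z then tri_pt (o 15) z else tri_pt (o 12) z.
Definition bottom_map z := if 0 <= above_E z then tri_pt (o 3) z else tri_pt (o 0) z.
Definition upper_map z := if 0 <= above_B z then top_map z else middle_map z.
Definition octagon_map z := if 0 <= above_A z then upper_map z else bottom_map z.

(** The octagon as an intersection of half-planes in explicit coordinates. *)
Definition oct_ineq z := forall k, (k < 8)%N -> 0 <= cross (octagon_sides R)`_k (z - ov`_k).

Lemma octagon_polygon (d : 'I_(nsides O)) z : polygon d z <-> oct_ineq z.
Proof.
split=> h.
- move=> k hk; have := h (Ordinal hk : 'I_(nsides O)) (octagon_next_orbit _ _).
  by rewrite octagon_side octagon_pos.
- by move=> e _; rewrite octagon_side octagon_pos; exact: h (ltn_ord e).
Qed.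

Let q0 : 0 < q := q_gt0 R.
Let q2 : q * q = 1 / 2 := q_sqr R.

Lemma l_ge0 (a : R) : (0 <= l * a) = (0 <= a).
Proof. by rewrite pmulr_rge0 // (lt_trans ltr01 l_gt1). Qed.

Lemma aboveE z : [/\ above_A z = z.2 - q, above_B z = z.2 - (1 + q),
  above_C z = (1 + q) * (z.2 - l) + q * z.1, above_D z = l * (z.2 - q) - (z.1 + q) &
  above_E z = (1 + q) * (z.2 - q) + q * (z.1 + q)].
Proof. by split; rewrite /above_A /above_B /above_C /above_D /above_E; vring. Qed.

Lemma oct_ineqE z : oct_ineq z -> [/\ 0 <= z.2, 0 <= q * z.2 - q * (z.1 - 1), 0 <= 1 + q - z.1 &
  0 <= - q * (z.2 - (1 + q)) - q * (z.1 - (1 + q))] /\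
  [/\ 0 <= l - z.2, 0 <= q * z.1 - q * (z.2 - l), 0 <= z.1 + q & 0 <= q * (z.2 - q) + q * (z.1 + q)].
Proof.
move=> H.
have H0 := H 0 isT; have H1 := H 1 isT; have H2 := H 2 isT; have H3 := H 3 isT.
have H4 := H 4 isT; have H5 := H 5 isT; have H6 := H 6 isT; have H7 := H 7 isT.
rewrite /cross /= in H0 H1 H2 H3 H4 H5 H6 H7.
by split; split; lra.
Qed.

Ltac in_triangle :=
  rewrite /place /cross /=; split; try lra.

Lemma in_tri0 z : oct_ineq z -> above_E z <= 0 -> in_tri (o 0) z.
Proof.
move=> /oct_ineqE [[? ? ? ?] [? ? ? ?]]; have [_ _ _ _ ->] := aboveE z => c1.
by apply/(@in_triP (o 0) (o 1) (o 2)) => //; in_triangle.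
Qed.

Lemma in_tri3 z : oct_ineq z -> above_A z <= 0 -> 0 <= above_E z -> in_tri (o 3) z.
Proof.
move=> /oct_ineqE [[? ? ? ?] [? ? ? ?]]; have [-> _ _ _ ->] := aboveE z => c1 c2.
apply/(@in_triP (o 3) (o 4) (o 5)) => //; in_triangle.
by have : 0 <= l * (q - z.2) by [rewrite l_ge0; lra]; lra.
Qed.

Lemma in_tri6 z : oct_ineq z -> 0 <= above_B z -> above_C z <= 0 -> in_tri (o 6) z.
Proof.
move=> /oct_ineqE [[? ? ? ?] [? ? ? ?]]; have [_ -> -> _ _] := aboveE z => c1 c2.
apply/(@in_triP (o 6) (o 7) (o 8)) => //; in_triangle.
by have : 0 <= l * (z.2 - (1 + q)) by [rewrite l_ge0; lra]; lra.
Qed.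

Lemma in_tri9 z : oct_ineq z -> 0 <= above_C z -> in_tri (o 9) z.
Proof.
move=> /oct_ineqE [[? ? ? ?] [? ? ? ?]]; have [_ _ -> _ _] := aboveE z => c1.
by apply/(@in_triP (o 9) (o 10) (o 11)) => //; in_triangle.
Qed.

Lemma in_tri12 z : oct_ineq z -> 0 <= above_A z -> above_D z <= 0 -> in_tri (o 12) z.
Proof.
move=> /oct_ineqE [[? ? ? ?] [? ? ? ?]]; have [-> _ _ -> _] := aboveE z => c1 c2.
apply/(@in_triP (o 12) (o 13) (o 14)) => //; in_triangle.
by have : 0 <= l * (z.2 - q) by [rewrite l_ge0; lra]; lra.
Qed.

Lemma in_tri15 z : oct_ineq z -> above_B z <= 0 -> 0 <= above_D z -> in_tri (o 15) z.
Proof.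
move=> /oct_ineqE [[? ? ? ?] [? ? ? ?]]; have [_ -> _ -> _] := aboveE z => c1 c2.
apply/(@in_triP (o 15) (o 16) (o 17)) => //; in_triangle.
by have : 0 <= l * (1 + q - z.2) by [rewrite l_ge0; lra]; lra.
Qed.

Lemma tri_pt_next2 (i j k : 'I_18) z : nat_of_ord j = next3 i -> nat_of_ord k = next3 j ->
  in_tri i z -> tri_pt k z = tri_pt i z.
Proof.
by move=> e1 e2 hz; rewrite (tri_pt_next e2) ?(tri_pt_next e1) // (in_tri_next z e1).
Qed.

Lemma tri_pt_diagonal (i j : 'I_18) z : nat_of_ord j = entry tabT i -> in_tri i z ->
  cross sd`_i (z - place`_i) <= 0 -> place`_j = place`_i + sd`_i -> tri_pt i z = tri_pt j z.
Proof. by move=> ej hz c0 hd; rewrite -[in RHS](addr0 z); apply: tri_pt_glue; rewrite ?addr0. Qed.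

Lemma if_tie (A : Type) (a : R) (x y : A) : (0 <= a -> a <= 0 -> x = y) ->
  (0 <= a -> (if 0 <= a then x else y) = x) /\ (a <= 0 -> (if 0 <= a then x else y) = y).
Proof.
by move=> h; split => ha; first rewrite ha //; case: ifP => [hb|//]; exact: h.
Qed.

Lemma top_mapE z : oct_ineq z -> 0 <= above_B z ->
  (0 <= above_C z -> top_map z = tri_pt (o 9) z) /\ (above_C z <= 0 -> top_map z = tri_pt (o 6) z).
Proof.
move=> oz b0; apply: if_tie => c0 c1.
have t6 := in_tri6 oz b0 c1; have t9 := in_tri9 oz c0.
rewrite -(tri_pt_next2 (i := o 9) (j := o 10) (k := o 11)) // -(tri_pt_next (i := o 6) (j := o 7)) //.
symmetry; apply: tri_pt_diagonal => //.
- by rewrite (in_tri_next (i := o 6)).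
- by move: c0; have [_ _ -> _ _] := aboveE z; rewrite /place /cross /=; lra.
- by rewrite /place /=; veq.
Qed.

Lemma middle_mapE z : oct_ineq z -> 0 <= above_A z -> above_B z <= 0 ->
  (0 <= above_D z -> middle_map z = tri_pt (o 15) z) /\ (above_D z <= 0 -> middle_map z = tri_pt (o 12) z).
Proof.
move=> oz a0 b0; apply: if_tie => c0 c1.
have t12 := in_tri12 oz a0 c1; have t15 := in_tri15 oz b0 c0.
rewrite -(tri_pt_next2 (i := o 12) (j := o 13) (k := o 14)) //.
symmetry; apply: tri_pt_diagonal => //.
- by rewrite (in_tri_next (i := o 13)) // (in_tri_next (i := o 12)).
- by move: c0; have [_ _ _ -> _] := aboveE z; rewrite /place /cross /=; lra.
- by rewrite /place /=; veq.
Qed.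

Lemma bottom_mapE z : oct_ineq z -> above_A z <= 0 ->
  (0 <= above_E z -> bottom_map z = tri_pt (o 3) z) /\ (above_E z <= 0 -> bottom_map z = tri_pt (o 0) z).
Proof.
move=> oz a0; apply: if_tie => c0 c1.
have t0 := in_tri0 oz c1; have t3 := in_tri3 oz a0 c0.
rewrite -(tri_pt_next2 (i := o 3) (j := o 4) (k := o 5)) // -(tri_pt_next (i := o 0) (j := o 1)) //.
symmetry; apply: tri_pt_diagonal => //.
- by rewrite (in_tri_next (i := o 0)).
- by move: c0; have [_ _ _ _ ->] := aboveE z; rewrite /place /cross /=; lra.
- by rewrite /place /=; veq.
Qed.

Lemma upper_mapE z : oct_ineq z -> 0 <= above_A z ->
  (0 <= above_B z -> upper_map z = top_map z) /\ (above_B z <= 0 -> upper_map z = middle_map z).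
Proof.
move=> oz a0; apply: if_tie => c0 c1.
have [vA vB vC vD vE] := aboveE z; have [[_ _ x1 _] _] := oct_ineqE oz.
have ey : z.2 = 1 + q by move: c0 c1; rewrite vB; lra.
have hC : above_C z <= 0 by have := mulr_ge0 (ltW q0) x1; rewrite vC ey; lra.
have hD : 0 <= above_D z.
  have : 0 <= l * (z.2 - (1 + q)) by rewrite l_ge0 -vB.
  by rewrite vD; lra.
have t6 := in_tri6 oz c0 hC; have t15 := in_tri15 oz c1 hD.
rewrite (top_mapE oz c0).2 // (middle_mapE oz a0 c1).1 //.
rewrite -(tri_pt_next (i := o 15) (j := o 16)) //; apply: tri_pt_diagonal => //.
- have : 0 <= l * (1 + q - z.2) by rewrite l_ge0; move: c1; rewrite vB; lra.
  by rewrite /place /cross /=; lra.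
- by rewrite /place /=; veq.
Qed.

Lemma octagon_mapE z : oct_ineq z ->
  (0 <= above_A z -> octagon_map z = upper_map z) /\ (above_A z <= 0 -> octagon_map z = bottom_map z).
Proof.
move=> oz; apply: if_tie => c0 c1.
have [vA vB vC vD vE] := aboveE z; have [_ [_ _ x1 _]] := oct_ineqE oz.
have hB : above_B z <= 0 by rewrite vB; move: c1; rewrite vA; lra.
have hD : above_D z <= 0.
  have : 0 <= l * (q - z.2) by rewrite l_ge0; move: c1; rewrite vA; lra.
  by rewrite vD; lra.
have hE : 0 <= above_E z.
  have : 0 <= (1 + q) * (z.2 - q) by rewrite mulr_ge0 -?vA //; lra.
  by have := mulr_ge0 (ltW q0) x1; rewrite vE; lra.
have t3 := in_tri3 oz c1 hE.
rewrite (upper_mapE oz c0).2 // (middle_mapE oz c0 hB).2 // (bottom_mapE oz c1).1 //.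
rewrite -(tri_pt_next (i := o 3) (j := o 4)) //; symmetry; apply: tri_pt_diagonal => //.
- by rewrite (in_tri_next (i := o 3)).
- have : 0 <= l * (z.2 - q) by rewrite l_ge0 -vA.
  by rewrite /place /cross /=; lra.
- by rewrite /place /=; veq.
Qed.

(** At a point of several triangles all the readings agree, so that
    [octagon_map] may be computed in any of them. *)
Lemma octagon_map_tri z : oct_ineq z -> forall i : 'I_18, nat_of_ord i \in [:: 0; 3; 6; 9; 12; 15]%N ->
  in_tri i z -> octagon_map z = tri_pt i z.
Proof.
move=> oz i hi; have [vA vB vC vD vE] := aboveE z.
have [[y0 x1 x2 x3] [x4 x5 x6 x7]] := oct_ineqE oz.
have ex (m : nat) (hm : (m < 18)%N) : nat_of_ord i == m -> i = Ordinal hm by move/eqP => e; exact: val_inj.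
move: hi; rewrite !inE => /or4P[/(ex 0 isT)|/(ex 3 isT)|/(ex 6 isT)|/or3P[/(ex 9 isT)|/(ex 12 isT)|/(ex 15 isT)]] ->.
- move=> /(@in_triP (o 0) (o 1) (o 2)) [] //; rewrite /place /cross /= => c1 c2 c3.
  have hE : above_E z <= 0 by rewrite vE; lra.
  have hA : above_A z <= 0 by rewrite vA; lra.
  by rewrite (octagon_mapE oz).2 // (bottom_mapE oz hA).2.
- move=> /(@in_triP (o 3) (o 4) (o 5)) [] //; rewrite /place /cross /= => c1 c2 c3.
  have hA : above_A z <= 0 by have : 0 <= l * (q - z.2) by [lra]; rewrite l_ge0 vA; lra.
  have hE : 0 <= above_E z by rewrite vE; lra.
  by rewrite (octagon_mapE oz).2 // (bottom_mapE oz hA).1.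
- move=> /(@in_triP (o 6) (o 7) (o 8)) [] //; rewrite /place /cross /= => c1 c2 c3.
  have hB : 0 <= above_B z by have : 0 <= l * (z.2 - (1 + q)) by [lra]; rewrite l_ge0 vB; lra.
  have hA : 0 <= above_A z by move: hB; rewrite vA vB; lra.
  have hC : above_C z <= 0 by rewrite vC; lra.
  by rewrite (octagon_mapE oz).1 // (upper_mapE oz hA).1 // (top_mapE oz hB).2.
- move=> /(@in_triP (o 9) (o 10) (o 11)) [] //; rewrite /place /cross /= => c1 c2 c3.
  have hC : 0 <= above_C z by rewrite vC; lra.
  have hB : 0 <= above_B z by rewrite vB; lra.
  have hA : 0 <= above_A z by move: hB; rewrite vA vB; lra.
  by rewrite (octagon_mapE oz).1 // (upper_mapE oz hA).1 // (top_mapE oz hB).1.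
- move=> /(@in_triP (o 12) (o 13) (o 14)) [] //; rewrite /place /cross /= => c1 c2 c3.
  have hA : 0 <= above_A z by have : 0 <= l * (z.2 - q) by [lra]; rewrite l_ge0 vA.
  have hD : above_D z <= 0 by rewrite vD; lra.
  have hB : above_B z <= 0 by have : 0 <= l * (1 + q - z.2) by [lra]; rewrite l_ge0 vB; lra.
  by rewrite (octagon_mapE oz).1 // (upper_mapE oz hA).2 // (middle_mapE oz hA hB).2.
- move=> /(@in_triP (o 15) (o 16) (o 17)) [] //; rewrite /place /cross /= => c1 c2 c3.
  have hD : 0 <= above_D z by rewrite vD; lra.
  have hA : 0 <= above_A z by have : 0 <= l * (z.2 - q) by [lra]; rewrite l_ge0 vA.
  have hB : above_B z <= 0 by have : 0 <= l * (1 + q - z.2) by [lra]; rewrite l_ge0 vB; lra.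
  by rewrite (octagon_mapE oz).1 // (upper_mapE oz hA).2 // (middle_mapE oz hA hB).1.
Qed.

Let imm (i : 'I_18) : immersion [set z | in_tri i z] (tri_pt i).
Proof. exact: (immersion_shift (c := - (place`_i - pos (M i))) (pt_immersion tsT (d := M i))). Qed.

Lemma octagon_map_immersion : immersion [set z | oct_ineq z] octagon_map.
Proof.
apply: immersion_split => [||z oz a0]; last first.
- have t1 : 0 <= above_A z by rewrite /above_A a0.
  have t2 : above_A z <= 0 by rewrite /above_A a0.
  exact: etrans (esym ((octagon_mapE oz).1 t1)) ((octagon_mapE oz).2 t2).
- apply: immersion_split => [||z [oz a0] e0]; last first.
  + have t1 : 0 <= above_E z by rewrite /above_E e0.
    have t2 : above_E z <= 0 by rewrite /above_E e0.
    exact: etrans (esym ((bottom_mapE oz a0).1 t1)) ((bottom_mapE oz a0).2 t2).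
  + by apply: (immersionS _ (@imm (o 0))) => z [[oz a0] e0]; exact: in_tri0.
  + by apply: (immersionS _ (@imm (o 3))) => z [[oz a0] e0]; exact: in_tri3.
apply: immersion_split => [||z [oz a0] b0]; last first.
- have t1 : 0 <= above_B z by rewrite /above_B b0.
  have t2 : above_B z <= 0 by rewrite /above_B b0.
  exact: etrans (esym ((upper_mapE oz a0).1 t1)) ((upper_mapE oz a0).2 t2).
- apply: immersion_split => [||z [[oz a0] b0] d0]; last first.
  + have t1 : 0 <= above_D z by rewrite /above_D d0.
    have t2 : above_D z <= 0 by rewrite /above_D d0.
    exact: etrans (esym ((middle_mapE oz a0 b0).1 t1)) ((middle_mapE oz a0 b0).2 t2).
  + by apply: (immersionS _ (@imm (o 12))) => z [[[oz a0] b0] d0]; exact: in_tri12.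
  + by apply: (immersionS _ (@imm (o 15))) => z [[[oz a0] b0] d0]; exact: in_tri15.
apply: immersion_split => [||z [[oz a0] b0] d0]; last first.
- have t1 : 0 <= above_C z by rewrite /above_C d0.
  have t2 : above_C z <= 0 by rewrite /above_C d0.
  exact: etrans (esym ((top_mapE oz b0).1 t1)) ((top_mapE oz b0).2 t2).
- by apply: (immersionS _ (@imm (o 6))) => z [[[oz a0] b0] d0]; exact: in_tri6.
- by apply: (immersionS _ (@imm (o 9))) => z [[[oz a0] b0] d0]; exact: in_tri9.
Qed.

End Dissection.

(** * The octagon as a two-cylinder surface *)

Section OctagonModel.
Variable R : realType.
Local Notation V := (R * R)%type.
Local Notation q := (cos (pi / 4) : R).
Local Notation O := (octagon R).
Local Notation l := (1 + q + q).
Local Notation T := (model l q (- q) 0).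
Local Notation o i := (@Ordinal 18 i isT).
Local Notation M i := (mside l q (- q) 0 i).
Local Notation sd := (sidesT l q (- q) 0).
Local Notation ov := (octagon_vertices R).
Local Notation pl := (place R).

Let tsT : translation_surface T := model_surface (l_gt1 R) (q_gt0 R) (- q) 0.
Let tsO : translation_surface O := octagon_surface R.
Let q0 : 0 < q := q_gt0 R.
Let q2 : q * q = 1 / 2 := q_sqr R.

Definition oside (k : 'I_8) : 'I_(nsides O) := k.
Local Notation s8 i := (oside (@Ordinal 8 i isT)).

Lemma octagon_shift (d : 'I_(nsides O)) : shift d = ov`_((d + 5) %% 8) - ov`_d.
Proof.
rewrite /shift !octagon_pos octagon_next octagon_opp; congr (ov`_ _ - _).
by have := ltn_ord d; rewrite -[nsides O]/8%N; lia.
Qed.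

Lemma octagon_cases (Q : 'I_(nsides O) -> Prop) : Q (s8 0) -> Q (s8 1) -> Q (s8 2) -> Q (s8 3) ->
  (forall d, Q (opp O d) -> Q d) -> forall d, Q d.
Proof.
move=> h0 h1 h2 h3 hopp d.
have low (e : 'I_(nsides O)) : (e < 4)%N -> Q e.
  move=> he; have [e0|[e0|[e0|e0]]] : (e = 0 :> nat \/ e = 1 :> nat \/ e = 2 :> nat \/ e = 3 :> nat)%N by lia.
  - by have -> : e = s8 0 by exact: val_inj.
  - by have -> : e = s8 1 by exact: val_inj.
  - by have -> : e = s8 2 by exact: val_inj.
  - by have -> : e = s8 3 by exact: val_inj.
have [|h4] := ltnP d 4; first exact: low.
apply: hopp; apply: low; rewrite octagon_opp.
have : (d < 8)%N := ltn_ord d; move: h4; move: (nat_of_ord d) => n; lia.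
Qed.

Lemma on_side_ineq (d : 'I_(nsides O)) z : on_side d z -> oct_ineq z /\ oct_ineq (z + shift d).
Proof.
move=> os; split; first exact/(octagon_polygon d)/on_side_polygon.
exact/(octagon_polygon (opp O d))/on_side_polygon/on_side_opp.
Qed.

(** Opposite sides of the octagon are opposite sides of the model. *)
Lemma octagon_map_opp (d : 'I_(nsides O)) z : on_side d z ->
  octagon_map (z + shift d) = octagon_map z.
Proof.
have flip (e : 'I_(nsides O)) : (forall w, on_side (opp O e) w -> octagon_map (w + shift (opp O e)) = octagon_map w) ->
    forall w, on_side e w -> octagon_map (w + shift e) = octagon_map w.
  move=> h w /(on_side_opp tsO) /h; rewrite (shift_opp tsO) addrK => ->; by [].
have go (i i' : 'I_18) (w u : V) : nat_of_ord i' = entry tabT i -> oct_ineq w -> oct_ineq (w + u) ->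
    forall (r r' : 'I_18), nat_of_ord r \in [:: 0; 3; 6; 9; 12; 15]%N -> nat_of_ord r' \in [:: 0; 3; 6; 9; 12; 15]%N ->
    in_tri r w -> in_tri r' (w + u) -> in_tri i w -> tri_pt i w = tri_pt r w -> tri_pt i' (w + u) = tri_pt r' (w + u) ->
    cross sd`_i (w - pl`_i) <= 0 -> pl`_i' = pl`_i + sd`_i + u -> octagon_map (w + u) = octagon_map w.
  move=> e ow ou r r' hr hr' tr tr' ti ei ei' c0 hu.
  by rewrite (octagon_map_tri ow hr tr) (octagon_map_tri ou hr' tr') -ei -ei'; symmetry; exact: tri_pt_glue.
have main (k : 'I_8) (i i' r r' : 'I_18) : nat_of_ord i' = entry tabT i ->
    nat_of_ord r \in [:: 0; 3; 6; 9; 12; 15]%N -> nat_of_ord r' \in [:: 0; 3; 6; 9; 12; 15]%N ->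
    pl`_i' = pl`_i + sd`_i + shift (oside k) -> pl`_i = pos (oside k) -> sd`_i = side (oside k) ->
    (forall t w w', 0 <= t <= 1 -> w = pos (oside k) + t *: side (oside k) -> w' = w + shift (oside k) ->
      oct_ineq w -> oct_ineq w' ->
      [/\ in_tri r w, in_tri r' w', in_tri i w, tri_pt i w = tri_pt r w & tri_pt i' w' = tri_pt r' w']) ->
    forall w, on_side (oside k) w -> octagon_map (w + shift (oside k)) = octagon_map w.
  move=> e hr hr' hu ep es h w os; have [ow ou] := on_side_ineq os; have [t ht ew] := os.
  have [tr tr' ti ei ei'] := h t w _ ht ew erefl ow ou.
  apply: (go i i' _ _ e ow ou r r' hr hr' tr tr' ti ei ei' _ hu).
  by rewrite ew ep es; have -> : cross (side (oside k)) (pos (oside k) + t *: side (oside k) - pos (oside k)) = 0 by vring.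
have facts (t : R) : 0 <= t <= 1 -> [/\ 0 <= t * q, t * q <= q & t * q * q = t / 2].
  move=> /andP[t0 t1]; split; first by rewrite mulr_ge0 // ltW.
    by rewrite ler_piMl // ltW.
  by rewrite -mulrA q2; field.
move: z; elim/octagon_cases: d => [||||//].
- apply: (main _ (o 0) (o 10) (o 0) (o 9)) => //.
  + by rewrite octagon_shift /place /=; veq.
  + by rewrite octagon_pos /place /=.
  + by rewrite octagon_side /=.
  move=> t w w' ht; rewrite octagon_pos octagon_side octagon_shift => ew ew' ow ow'.
  have Q2 := q2; have Q0 := q0; have [f1 f2 f3] := facts t ht; have [t0 t1] := andP ht.
  have {}ew' : w' = (t, l) by rewrite ew' ew /=; veq.
  have {}ew : w = (t, 0) by rewrite ew /=; veq.
  have tr : in_tri (o 0) w by apply: (in_tri0 ow); have [v1 v2 v3 v4 v5] := aboveE w; rewrite ?v1 ?v2 ?v3 ?v4 ?v5 ew /=; lra.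
  have tr' : in_tri (o 9) w' by apply: (in_tri9 ow'); have [v1 v2 v3 v4 v5] := aboveE w'; rewrite ?v1 ?v2 ?v3 ?v4 ?v5 ew' /=; lra.
  by split => //; exact: (tri_pt_next (i := o 9)).
- apply: (main _ (o 3) (o 8) (o 3) (o 6)) => //.
  + by rewrite octagon_shift /place /=; veq.
  + by rewrite octagon_pos /place /=.
  + by rewrite octagon_side /=; veq.
  move=> t w w' ht; rewrite octagon_pos octagon_side octagon_shift => ew ew' ow ow'.
  have Q2 := q2; have Q0 := q0; have [f1 f2 f3] := facts t ht; have [t0 t1] := andP ht.
  have {}ew' : w' = (- q + t * q, 1 + q + t * q) by rewrite ew' ew /=; veq.
  have {}ew : w = (1 + t * q, t * q) by rewrite ew /=; veq.
  have tr : in_tri (o 3) w by apply: (in_tri3 ow); have [v1 v2 v3 v4 v5] := aboveE w; rewrite ?v1 ?v2 ?v3 ?v4 ?v5 ew /=; lra.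
  have tr' : in_tri (o 6) w' by apply: (in_tri6 ow'); have [v1 v2 v3 v4 v5] := aboveE w'; rewrite ?v1 ?v2 ?v3 ?v4 ?v5 ew' /=; lra.
  by split => //; exact: (tri_pt_next2 (i := o 6) (j := o 7)).
- apply: (main _ (o 13) (o 17) (o 12) (o 15)) => //.
  + by rewrite octagon_shift /place /=; veq.
  + by rewrite octagon_pos /place /=.
  + by rewrite octagon_side /=.
  move=> t w w' ht; rewrite octagon_pos octagon_side octagon_shift => ew ew' ow ow'.
  have Q2 := q2; have Q0 := q0; have [f1 f2 f3] := facts t ht; have [t0 t1] := andP ht.
  have {}ew' : w' = (- q, q + t) by rewrite ew' ew /=; veq.
  have {}ew : w = (1 + q, q + t) by rewrite ew /=; veq.
  have tr : in_tri (o 12) w by apply: (in_tri12 ow); have [v1 v2 v3 v4 v5] := aboveE w; rewrite ?v1 ?v2 ?v3 ?v4 ?v5 ew /=; lra.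
  have tr' : in_tri (o 15) w' by apply: (in_tri15 ow'); have [v1 v2 v3 v4 v5] := aboveE w'; rewrite ?v1 ?v2 ?v3 ?v4 ?v5 ew' /=; lra.
  split => //; [by rewrite (in_tri_next (i := o 12)) | exact: (tri_pt_next (i := o 12)) |].
  exact: (tri_pt_next2 (i := o 15) (j := o 16)).
- apply: (main _ (o 9) (o 2) (o 9) (o 0)) => //.
  + by rewrite octagon_shift /place /=; veq.
  + by rewrite octagon_pos /place /=.
  + by rewrite octagon_side /=.
  move=> t w w' ht; rewrite octagon_pos octagon_side octagon_shift => ew ew' ow ow'.
  have Q2 := q2; have Q0 := q0; have [f1 f2 f3] := facts t ht; have [t0 t1] := andP ht.
  have {}ew' : w' = (- (t * q), t * q) by rewrite ew' ew /=; veq.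
  have {}ew : w = (1 + q - t * q, 1 + q + t * q) by rewrite ew /=; veq.
  have tr : in_tri (o 9) w by apply: (in_tri9 ow); have [v1 v2 v3 v4 v5] := aboveE w; rewrite ?v1 ?v2 ?v3 ?v4 ?v5 ew /=; lra.
  have tr' : in_tri (o 0) w' by apply: (in_tri0 ow'); have [v1 v2 v3 v4 v5] := aboveE w'; rewrite ?v1 ?v2 ?v3 ?v4 ?v5 ew' /=; lra.
  by split => //; exact: (tri_pt_next2 (i := o 0) (j := o 1)).
Qed.

Let map_spec : exists G : surface O -> surface T, local_iso G /\ forall x d z, rep x d z -> G x = octagon_map z.
Proof.
apply: (map_surface (phi := fun _ => @octagon_map R)) => // [d z /octagon_map_opp //|d].
apply: immersionS (octagon_map_immersion (R := R)) => z.
by move/octagon_polygon.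
Qed.

Lemma place_pos (j : 'I_18) : exists k : 'I_(nsides O), pl`_j = pos k.
Proof.
pose ks := [:: 0; 1; 7; 1; 2; 7; 6; 3; 5; 3; 4; 5; 7; 2; 3; 7; 3; 6]%N.
have k8 : (nth 0 ks j < 8)%N.
  by case: j => j hj; do 18 (destruct j as [|j]; [by [] |]).
by exists (oside (Ordinal k8)); rewrite octagon_pos /place (nth_map 0%N).
Qed.

Let s0 := s8 0.

Let glue_spec (j : 'I_18) : pl`_(entry tabT j) = pl`_j + sd`_j \/
  exists2 d : 'I_8, pl`_j = ov`_d /\ sd`_j = (octagon_sides R)`_d &
    pl`_(entry tabT j) = pl`_j + sd`_j + (ov`_((d + 5) %% 8) - ov`_d).
Proof.
case: j => j hj.
do 18 (destruct j as [|j]; [by clear; entries; first [left; rewrite /place /=; veq |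
  right; first [
    exists (@Ordinal 8 0 isT); [split; rewrite /place /=; veq | rewrite /place /=; veq] |
    exists (@Ordinal 8 1 isT); [split; rewrite /place /=; veq | rewrite /place /=; veq] |
    exists (@Ordinal 8 2 isT); [split; rewrite /place /=; veq | rewrite /place /=; veq] |
    exists (@Ordinal 8 3 isT); [split; rewrite /place /=; veq | rewrite /place /=; veq] |
    exists (@Ordinal 8 4 isT); [split; rewrite /place /=; veq | rewrite /place /=; veq] |
    exists (@Ordinal 8 5 isT); [split; rewrite /place /=; veq | rewrite /place /=; veq] |
    exists (@Ordinal 8 6 isT); [split; rewrite /place /=; veq | rewrite /place /=; veq] |
    exists (@Ordinal 8 7 isT); [split; rewrite /place /=; veq | rewrite /place /=; veq]]] |]).
by [].
Qed.

Let back_spec : exists F : surface T -> surface O, local_iso F /\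
  forall y (j : 'I_18) z, rep y (M j) z -> rep (F y) s0 (z + (pl`_j - pos (M j))).
Proof.
have nsd (j : 'I_18) : side (M j) = sd`_j := sideM R j.
apply: (inclusion_map tsT tsO (tri_triangulated tableT) (e := fun=> s0) (o := fun j => pl`_j)).
- move=> j; have [k ->] := place_pos j; exact: (pos_polygon tsO (octagon_next_orbit _ _)).
- move=> j; split; first exact: octagon_next_orbit.
  by rewrite -[j]/(M j) nsd; apply: place_next; exact: tri_next_val.
- move=> j; rewrite -[j]/(M j) nsd; have := glue_spec j.
  have -> : nat_of_ord (opp T (M j)) = entry tabT j by exact: opp_model.
  case=> [e|[d [e1 e2] e3]]; [left|right].
    by split; first exact: octagon_next_orbit.
  exists (oside d).
  have ep : pl`_j = pos (oside d) by rewrite octagon_pos.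
  have es : sd`_j = side (oside d) by rewrite octagon_side.
  split; try exact: octagon_next_orbit.
  - by rewrite [pl`_(M j)]ep; exact: on_side_pos.
  - by rewrite [pl`_(M j)]ep es -pos_next; exact: on_side_next.
  - by rewrite octagon_shift.
Qed.

(** The map from the octagon is [octagon_map], and the map from the model
    is the inclusion of its triangles in the octagon. *)
Theorem octagon_model : exists (F : surface O -> surface T) (G : surface T -> surface O),
  [/\ local_iso F, local_iso G, cancel F G & cancel G F].
Proof.
have [G [lG Gs]] := map_spec; have [F [lF Fs]] := back_spec.
have onF (j : 'I_18) z : polygon (M j) z -> nat_of_ord j \in [:: 0; 3; 6; 9; 12; 15]%N ->
    G (F (pt tsT (M j) z)) = pt tsT (M j) z.
  move=> hz hj; have r := Fs _ j _ (pt_rep tsT hz).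
  rewrite (Gs _ _ _ r).
  have oz : oct_ineq (z + (pl`_j - pos (M j))) by apply/(octagon_polygon s0); exact: rep_polygon r.
  have ez : z + (pl`_j - pos (M j)) - (pl`_j - pos (M j)) = z by rewrite addrK.
  rewrite (octagon_map_tri oz hj); first by rewrite /tri_pt ez.
  by rewrite /in_tri ez.
exists G, F; split => //.
- apply: (local_iso_rigid tsO (local_iso_comp lG lF)) => d.
  have os := on_side_midpoint s0.
  have [x hx] := polygon_rep (on_side_polygon tsO os).
  exists s0, x; split; [exact: octagon_next_orbit | exact: hx |].
  rewrite /= (Gs _ _ _ hx).
  have oz : oct_ineq (midpoint s0) by apply/(octagon_polygon s0); exact: rep_polygon hx.
  have em : midpoint s0 = (2^-1, 0) by rewrite /midpoint octagon_pos octagon_side /=; veq.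
  have tr : in_tri (o 0) (midpoint s0).
    by have Q0 := q0; apply: (in_tri0 oz); have [v1 v2 v3 v4 v5] := aboveE (midpoint s0); rewrite v5 em /=; lra.
  rewrite (octagon_map_tri oz (i := o 0)) // /tri_pt.
  apply: (rep_fun _ hx).
  by have := Fs _ (o 0) _ (pt_rep tsT tr); rewrite subrK.
- apply: (local_iso_rigid tsT (local_iso_comp lF lG)) => d.
  have os (j : 'I_18) := on_side_polygon tsT (on_side_midpoint (M j)).
  have ex (j : 'I_18) : nat_of_ord j \in [:: 0; 3; 6; 9; 12; 15]%N -> M j \in porbit (next T) d ->
      exists e x, [/\ e \in porbit (next T) d, rep x e (midpoint e) & (G \o F) x = x].
    move=> hj hd; exists (M j), (pt tsT (M j) (midpoint (M j))); split; [exact: hd | exact: pt_rep |].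
    exact: onF.
  have r3 : (nat_of_ord d %/ 3 * 3)%N \in [:: 0; 3; 6; 9; 12; 15]%N.
    case: (d) => j hj; do 18 (destruct j as [|j]; [by [] |]); by [].
  have r18 : (nat_of_ord d %/ 3 * 3 < 18)%N.
    by move: r3; rewrite !inE; lia.
  apply: (ex (Ordinal r18)) => //.
  have [e|[e|e]] : (nat_of_ord d = nat_of_ord d %/ 3 * 3 \/ nat_of_ord d = next3 (nat_of_ord d %/ 3 * 3) \/
      nat_of_ord d = next3 (next3 (nat_of_ord d %/ 3 * 3)))%N.
    by case: (d) => j hj; do 18 (destruct j as [|j]; [by vm_compute; auto |]).
  - by have -> : M (Ordinal r18) = d; [apply: val_inj | exact: porbit_id].
  - have h : next T (M (Ordinal r18)) = d by apply: val_inj; rewrite [LHS](tri_next_val tableT).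
    by rewrite porbit_sym -[X in X \in _]h next_porbit.
  - have h : next T (next T (M (Ordinal r18))) = d.
      by apply: val_inj; rewrite [LHS](tri_next_val tableT) (tri_next_val tableT).
    by rewrite porbit_sym -[X in X \in _]h !next_porbitE porbit_id.
Qed.

Lemma octagon_in_H2 : in_H2 O.
Proof.
split; [exact: octagon_surface | exact: octagon_genus2 |].
exists s0; last by move=> e _; exact: octagon_rot_orbit.
have [F [G [lF lG FK GK]]] := octagon_model.
have irr : ~ regular (G (apex (l_gt1 R) (q_gt0 R) (- q) 0)).
  by move=> /(local_iso_regular lG (can_inj GK)); exact: apex_irregular.
have [d hd] : vertex (G (apex (l_gt1 R) (q_gt0 R) (- q) 0)).
  by apply: contrapT => /(nonvertex_regular tsO).
apply: (singular_rot (octagon_rot_orbit d s0)) => hs.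
exact/irr/(full_turn_regular tsO hd hs).
Qed.

Lemma octagon_isomorphic : isomorphic O T.
Proof.
have [F [G [lF lG FK GK]]] := octagon_model.
exact: local_iso_isomorphic tsO tsT lF lG FK GK.
Qed.
End OctagonModel.

(** * Homology and neighbourhoods of the two-cylinder surfaces *)

Section Homology.
Variables (R : realType) (l h : R).
Hypotheses (l1 : 1 < l) (h0 : 0 < h).
Local Notation V := (R * R)%type.
Local Notation o i := (@Ordinal 18 i isT).
Implicit Types p s : R.
Local Notation chain := {ffun 'I_18 -> int}.

Lemma tri_porbit_sum (P : polygon_gluing R) (Z : nmodType) (F : 'I_(nsides P) -> Z) e :
  translation_surface P -> triangulated P ->
  \sum_(d in porbit (next P) e) F d = F e + F (next P e) + F (next P (next P e)).
Proof.
move=> tsP triP; have [m0 m1 m2] := tri_in e.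
rewrite (bigD1 e) //= (bigD1 (next P e)) ?m1 ?next_neq //= (bigD1 (next P (next P e))) /=; last first.
  by rewrite m2 (next2_neq tsP) (next_neq tsP).
rewrite big1 ?addr0 ?addrA // => d /andP[/andP[/andP[hd n0] n1] n2].
by have [e1|e1|e1] := tri_porbit triP hd; rewrite e1 eqxx in n0 n1 n2.
Qed.

(** There is only one vertex, so that every chain is a cycle. *)
Lemma model_cycle p s (c : chain) : cycle (P := model l h p s) c.
Proof.
move=> d; have all (e : 'I_(nsides (model l h p s))) : e \in porbit (rot (model l h p s)) d by exact: rot_model_orbit.
rewrite (eq_bigl xpredT) // [RHS](eq_bigl xpredT) //.
exact: (reindex_inj (h := fun e => ((next (model l h p s))^-1)%g e) perm_inj).
Qed.

Definition basis_side (j : 'I_4) : nat := nth 0%N [:: 0; 6; 9; 13]%N j.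

(** gamma, alpha_1, and the segments (p, h) and (s, 1) that cross the
    cylinders. *)
Definition basis_chain (j : 'I_4) : chain := [ffun e : 'I_18 => (nat_of_ord e == basis_side j)%:Z].

Let cut (c : chain) (m : {ffun 'I_4 -> int}) := c - \sum_j basis_chain j *~ m j.

Local Notation j4 i := (@Ordinal 4 i isT).

Let cutE (c : chain) m (e : 'I_18) : cut c m e = c e -
  (if nat_of_ord e == 0%N then m (j4 0) else if nat_of_ord e == 6%N then m (j4 1)
   else if nat_of_ord e == 9%N then m (j4 2) else if nat_of_ord e == 13%N then m (j4 3) else 0).
Proof.
rewrite /cut !ffunE sum_ffunE; congr (_ - _).
have mz (b : chain) (z : int) : (b *~ z) e = b e * z.
  case: z => n; first by rewrite -pmulrn ffunMnE -mulr_natr natz.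
  by rewrite NegzE mulrNz -pmulrn !ffunE ffunMnE -mulr_natr natz mulrN.
rewrite (eq_bigr (fun j => (nat_of_ord e == basis_side j)%:Z * m j)) => [|j _]; last by rewrite mz ffunE.
rewrite !big_ord_recl big_ord0 /basis_side /= addr0.
have -> : ord0 = j4 0 by exact: val_inj.
have -> : fintype.lift (j4 0) ord0 = j4 1 by exact: val_inj.
have -> : fintype.lift (j4 0) (fintype.lift ord0 ord0) = j4 2 by exact: val_inj.
have -> : fintype.lift (j4 0) (fintype.lift ord0 (fintype.lift ord0 ord0)) = j4 3 by exact: val_inj.
case: e {mz} => i hi /=; do 18 (destruct i as [|i]; [by rewrite /= ?mul0r ?mul1r ?addr0 ?add0r|]).
by [].
Qed.

(** Chains matter only through these differences, as d + opp d is
    null-homologous. *)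
Let flux (c : chain) i j := c i - c j.

(** Obtained by solving the relations given by the six triangles for the
    coefficients of the basis. *)
Definition coordinate (c : chain) (j : 'I_4) : int :=
  nth 0 [:: flux c (o 0) (o 10) - flux c (o 1) (o 5) - flux c (o 3) (o 8) - flux c (o 7) (o 11);
    flux c (o 3) (o 8) - flux c (o 4) (o 12) + flux c (o 6) (o 16) - flux c (o 14) (o 15);
    flux c (o 1) (o 5) - flux c (o 2) (o 9) + flux c (o 3) (o 8) + flux c (o 7) (o 11);
    flux c (o 13) (o 17) - flux c (o 14) (o 15)] j.

Let four (Q : 'I_4 -> Prop) : Q (@Ordinal 4 0 isT) -> Q (@Ordinal 4 1 isT) -> Q (@Ordinal 4 2 isT) ->
  Q (@Ordinal 4 3 isT) -> forall j, Q j.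
Proof.
move=> q0 q1 q2 q3 [j hj].
by do 4 (destruct j as [|j]; [by rewrite (bool_irrelevance hj isT) |]).
Qed.

Let cut_coordinate c m j : coordinate (cut c m) j = coordinate c j - m j.
Proof.
rewrite /coordinate /flux !cutE /= !subr0; elim/four: j => /=; lia.
Qed.

Let null_of_coordinate p s c : (forall j, coordinate c j = 0) -> null_homologous (P := model l h p s) c.
Proof.
move=> h4; have H0 := h4 (j4 0); have H1 := h4 (j4 1); have H2 := h4 (j4 2); have H3 := h4 (j4 3).
rewrite /coordinate /flux /= in H0 H1 H2 H3.
pose F k := nth 0 [:: 0; - flux c (o 1) (o 5); - flux c (o 1) (o 5) - flux c (o 3) (o 8);
  - flux c (o 1) (o 5) - flux c (o 3) (o 8) - flux c (o 7) (o 11); - flux c (o 1) (o 5) - flux c (o 4) (o 12);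
  - flux c (o 1) (o 5) - flux c (o 4) (o 12) - flux c (o 14) (o 15)] k.
exists (fun e : 'I_18 => if (e < entry tabT e)%N then c e - F (e %/ 3)%N else 0).
exists (fun d : 'I_18 => if (d %% 3 == 0)%N then F (d %/ 3)%N else 0).
move=> e; rewrite (tri_porbit_sum _ e (model_surface l1 h0 p s) (tri_triangulated tableT)).
rewrite !(tri_next_val tableT); have := opp_model l h p s e.
move: (opp (model l h p s) (mside l h p s e)) => e'.
rewrite /mside; case: e => i hi; case: e' => k hk; rewrite /= => ek.
do 18 (destruct i as [|i]; [
  match type of ek with _ = entry tabT ?n => let v := eval vm_compute in (entry tabT n) in change (k = v) in ek end;
  subst k; rewrite (bool_irrelevance hi isT) (bool_irrelevance hk isT); entries;
  rewrite /F /flux /=; lia |]).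
by [].
Qed.

Let coordinate_of_null p s c : null_homologous (P := model l h p s) c -> forall j, coordinate c j = 0.
Proof.
move=> [a [f hc]].
have E (i j n1 n2 : 'I_18) : nat_of_ord j = entry tabT i -> nat_of_ord n1 = next3 i -> nat_of_ord n2 = next3 n1 ->
    c i = a i + a j + (f i + f n1 + f n2).
  move=> e1 e2 e3; rewrite hc (tri_porbit_sum _ (mside l h p s i) (model_surface l1 h0 p s) (tri_triangulated tableT)).
  have -> : next (tri_gluing 18 tabT (sidesT l h p s)) i = n1 by exact: nextM.
  have -> : next (tri_gluing 18 tabT (sidesT l h p s)) n1 = n2 by exact: nextM.
  by have -> : opp (model l h p s) i = j by exact: oppM.
rewrite /coordinate /flux.
rewrite (@E (o 0) (o 10) (o 1) (o 2)) // (@E (o 10) (o 0) (o 11) (o 9)) // (@E (o 1) (o 5) (o 2) (o 0)) //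
  (@E (o 5) (o 1) (o 3) (o 4)) // (@E (o 3) (o 8) (o 4) (o 5)) // (@E (o 8) (o 3) (o 6) (o 7)) //
  (@E (o 7) (o 11) (o 8) (o 6)) // (@E (o 11) (o 7) (o 9) (o 10)) // (@E (o 4) (o 12) (o 5) (o 3)) //
  (@E (o 12) (o 4) (o 13) (o 14)) // (@E (o 6) (o 16) (o 7) (o 8)) // (@E (o 16) (o 6) (o 17) (o 15)) //
  (@E (o 14) (o 15) (o 12) (o 13)) // (@E (o 15) (o 14) (o 16) (o 17)) // (@E (o 2) (o 9) (o 0) (o 1)) //
  (@E (o 9) (o 2) (o 10) (o 11)) // (@E (o 13) (o 17) (o 14) (o 12)) // (@E (o 17) (o 13) (o 15) (o 16)) //.
by elim/four => /=; lia.
Qed.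

(** The coordinates vanish on null-homologous chains and take a chain to
    its coefficients along the basis. *)
Lemma model_H1_basis p s : H1_basis (P := model l h p s) basis_chain.
Proof.
split; first by move=> j; exact: model_cycle.
move=> c _; exists [ffun j => coordinate c j]; split.
  apply: null_of_coordinate => j.
  by rewrite -/(cut c [ffun j => coordinate c j]) cut_coordinate ffunE subrr.
move=> m /coordinate_of_null hm; apply/ffunP => j; rewrite ffunE.
by apply/eqP; rewrite -subr_eq0 -cut_coordinate; apply/eqP; exact: hm.
Qed.

Lemma model_period p s j : period (P := model l h p s) (basis_chain j) =
  nth 0 [:: (1, 0); (l, 0); (p, h); (s, 1)] j.
Proof.
have B (i : 'I_18) : basis_side j = i -> period (P := model l h p s) (basis_chain j) = (sidesT l h p s)`_i.
  move=> e; rewrite /period (bigD1 (mside l h p s i)) //= big1 => [|d nd]; last first.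
    rewrite ffunE e; have -> : (nat_of_ord d == nat_of_ord i) = false; last by rewrite mulr0z.
    by apply/negbTE; apply: contra nd => /eqP h'; apply/eqP/val_inj.
  by rewrite addr0 ffunE e eqxx mulr1z side_model.
elim/four: j B => /= B.
- exact: (B (o 0)).
- exact: (B (o 6)).
- exact: (B (o 9)).
- exact: (B (o 13)).
Qed.

Lemma model_vertices p s : #|porbits (rot (model l h p s))| = 1%N.
Proof. exact: tri_rot_card tableT orbitsT. Qed.

(** The period coordinates of the model along the basis are its parameters,
    together with the constants (1, 0) and (l, 0). *)
Lemma model_nbhs p s (U : set (H2 R)) : nbhs (model_point l1 h0 p s) U ->
  exists2 eps : R, 0 < eps & forall p' s', `|p' - p| < eps -> `|s' - s| < eps -> U (model_point l1 h0 p' s').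
Proof.
rewrite nbhsE => -[B [oB Bx] BU].
have [eps e0 he] := oB 18%N (next (model l h p s)) (opp (model l h p s)) (@pos R (model l h p s)) basis_chain
  (model_in_H2 l1 h0 p s) (model_vertices p s) (model_H1_basis p s) Bx.
exists eps => // p' s' hp hs; apply: BU.
apply: (he (@pos R (model l h p' s')) (model_in_H2 l1 h0 p' s')) => j.
have := model_period p' s' j; have := model_period p s j.
rewrite /model /tri_gluing /= => -> ->.
apply/vec_normP; elim/four: j => /=; rewrite ?subrr ?normr0; split => //.
Qed.

End Homology.

(** * The sequence of fake octagons *)

Section Sequence.
Variable R : realType.
Local Notation q := (cos (pi / 4) : R).
Local Notation l := (1 + q + q).
Local Notation r := (q + q).

(** The n-th surface of the sequence: n left surgeries change T(-h, 0) into
    T(-h - n, n). *)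
Definition fake (k : int) : H2 R := model_point (l_gt1 R) (q_gt0 R) (- q - k%:~R) k%:~R.

Lemma r_sqr : r * r = 2.
Proof. by have := q_sqr R; lra. Qed.

Lemma r_gt1 : 1 < r.
Proof.
rewrite ltNge; apply/negP => h; have q0 := q_gt0 R; have r2 := r_sqr.
by have := ler_pM _ _ h h; nra.
Qed.

(** 2-adic valuations in x^2 = 2 y^2. *)
Lemma r_irrational (x y : int) : x%:~R = r * y%:~R -> y = 0.
Proof.
move=> e; apply/eqP; case: (eqVneq y 0) => // y0.
have e2 : (x * x = 2 * (y * y))%R.
  apply: (@intr_inj R); rewrite !intrM e.
  by have := r_sqr; set u := y%:~R => h; nra.
have := congr1 absz e2; rewrite !abszM => e3.
have y1 : (0 < `|y|)%N by rewrite absz_gt0.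
have x1 : (0 < `|x|)%N.
  by rewrite lt0n; apply/eqP => x0; move: e3; rewrite x0 => /esym/eqP; rewrite !muln_eq0 /= orbb; apply/negP; rewrite -lt0n.
have := congr1 (logn 2) e3; rewrite !lognM ?muln_gt0 ?y1 // (_ : `|2%:Z|%N = 2%N) // (logn_prime 2 (isT : prime 2)) /=.
lia.
Qed.

(** The shear invariant gives m - n = l k with l irrational. *)
Lemma fake_inj n m : fake n = fake m -> n = m.
Proof.
move=> /H2_pointP /(model_isomorphic_shear (l_gt1 R) (q_gt0 R)) [k e].
have k0 : k = 0.
  apply: (@r_irrational (m - n - k)); rewrite !intrB e -mulrzr; ring.
by move: e; rewrite k0 mulr0z addr0 => /intr_inj.
Qed.

(** 0 < x < 1/2 implies x^j (j + 1) <= 1. *)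
Lemma small_power (e : R) : 0 < e -> exists2 j : nat, (0 < j)%N & (3 - 2 * r) ^+ j < e.
Proof.
move=> e0; have r1 := r_gt1; have r2 := r_sqr.
have x0 : 0 < 3 - 2 * r by nra.
have x1 : 3 - 2 * r < 1 / 2 by nra.
have b (j : nat) : (3 - 2 * r) ^+ j * j.+1%:R <= 1.
  elim: j => [|j IH]; first by rewrite expr0 mul1r.
  have xj : 0 <= (3 - 2 * r) ^+ j by rewrite exprn_ge0 // ltW.
  have jj : 0 <= j%:R :> R by rewrite ler0n.
  have E1 : j.+1%:R = j%:R + 1 :> R by rewrite natr1.
  have E2 : j.+2%:R = j%:R + 1 + 1 :> R by rewrite !natr1.
  rewrite exprS E2; move: IH; rewrite E1; move: (_ ^+ j) xj jj x0 x1; move: (3 - 2 * r) (j%:R) => x v u u0 v0 x0 x1 h1.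
  have h2 : 0 <= (1 / 2 - x) * (u * (v + 1 + 1)) by rewrite !mulr_ge0 //; lra.
  by have h3 : 0 <= u * v by [rewrite mulr_ge0]; lra.
pose j := (Num.bound e^-1).+1; exists j => //.
have hb : e^-1 < j.+1%:R.
  apply: lt_trans (archi_boundP _) _; first by rewrite invr_ge0 ltW.
  by rewrite ltr_nat /j.
have := b j; rewrite -ler_pdivlMr ?ltr0n // => h; apply: le_lt_trans h _.
by rewrite mul1r invf_plt ?posrE ?ltr0n.
Qed.

(** Positivity of both coefficients is preserved by multiplication by 3 - 2
    sqrt 2. *)
Lemma unit_power (j : nat) : (0 < j)%N -> exists a b : int, 0 < b /\ (3 - 2 * r) ^+ j = a%:~R - b%:~R * r.
Proof.
suff h i : exists a b : int, [/\ 0 < a, 0 < b & (3 - 2 * r) ^+ i.+1 = a%:~R - b%:~R * r].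
  by case: j => // j _; have [a [b [_ b0 e]]] := h j; exists a, b.
elim: i => [|i [a [b [a0 b0 e]]]]; first by exists 3, 2; rewrite expr1; split => //; ring.
exists (3 * a + 4 * b), (2 * a + 3 * b); split; [lia|lia|].
rewrite exprS e !intrD !intrM; have h2 := congr1 (fun z => b%:~R * z) r_sqr.
have -> : (3 : int)%:~R = 3 :> R by []; have -> : (4 : int)%:~R = 4 :> R by [].
have -> : (2 : int)%:~R = 2 :> R by [].
by move: h2; set u := a%:~R; set v := b%:~R; lra.
Qed.

Lemma model_point_twists p s (i k : int) : model_point (l_gt1 R) (q_gt0 R) p s =
  model_point (l_gt1 R) (q_gt0 R) (p + (l + 1) *~ i) (s + l *~ k).
Proof.
apply/H2_pointP; apply: isomorphic_trans (model_twist_int (l_gt1 R) (q_gt0 R) _ _ k).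
have up (n : nat) u : isomorphic (model l q u s) (model l q (u + (l + 1) *+ n) s).
  elim: n u => [|n IH] u; first by rewrite mulr0n addr0; exact: isomorphic_refl.
  apply: isomorphic_trans (IH u) _.
  have -> : u + (l + 1) *+ n.+1 = u + (l + 1) *+ n + l + 1 by rewrite [(l + 1) *+ n.+1]mulrSr !addrA.
  exact: model_twist2 (l_gt1 R) (q_gt0 R) _ _.
case: i => n; first exact: up.
rewrite NegzE mulrNz; apply: isomorphic_sym; have := up n.+1 (p - (l + 1) *+ n.+1).
by rewrite subrK.
Qed.

(** With x = (3 - 2 sqrt 2)^j = a - b sqrt 2, the integer 2 b is close both
    to a multiple of l and to a multiple of l + 1: 2 b = 2 l (a - b) - 2 l
    x and 2 b = (l + 1) (2 b - a) + (l + 1) x. *)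
Lemma fake_dense (m : int) (U : set (H2 R)) : nbhs (fake m) U -> exists n : int, U (fake n) /\ fake n <> fake m.
Proof.
move=> /model_nbhs [eps e0 he].
have l1 := l_gt1 R; have r1 := r_gt1; have r2 := r_sqr.
have d0 : 0 < 2 * l + 2 + r by lra.
have e1 : 0 < eps / (2 * l + 2 + r) by rewrite divr_gt0.
have [j j0] := small_power e1; rewrite ltr_pdivlMr // => hj.
have [a [b [b0 e]]] := unit_power j0.
have x0 : 0 < (3 - 2 * r) ^+ j by rewrite exprn_gt0 //; nra.
move: e x0 hj; set x := _ ^+ j => e x0 hj.
have lx : 0 < l * x by rewrite mulr_gt0 // (lt_trans ltr01).
have rx : 0 < r * x by rewrite mulr_gt0 // (lt_trans ltr01).
have hb := congr1 (fun z => b%:~R * z) r2.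
exists (m - 2 * b); split; last by move=> /fake_inj; lia.
rewrite /fake (model_point_twists _ _ (a - 2 * b) (2 * (a - b))).
have -> : - q - (m - 2 * b)%:~R + (l + 1) *~ (a - 2 * b) = - q - m%:~R + (2 + r) * x.
  rewrite -mulrzr e !(intrB, intrM); have -> : (2 : int)%:~R = 2 :> R by [].
  by move: hb; set u := a%:~R; set v := b%:~R; set w := m%:~R; lra.
have -> : (m - 2 * b)%:~R + l *~ (2 * (a - b)) = m%:~R + 2 * (l * x).
  rewrite -mulrzr e !(intrB, intrM); have -> : (2 : int)%:~R = 2 :> R by [].
  by move: hb; set u := a%:~R; set v := b%:~R; set w := m%:~R; lra.
apply: he; rewrite addrC addKr gtr0_norm; lra.
Qed.

Lemma octagon_sequence_fake (Oct : int -> H2 R) : octagon_sequence Oct -> forall k, Oct k = fake k.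
Proof.
move=> [[h O0] hl hr].
have e0 : Oct 0 = fake 0.
  rewrite O0 /fake /model_point; apply/H2_pointP; rewrite mulr0z subr0; exact: octagon_isomorphic.
have E (k : nat) : k.+1%:~R = k%:~R + 1 :> R by rewrite -addn1 PoszD intrD.
have up (k : nat) : Oct k%:Z = fake k%:Z.
  elim: k => [//|k IH]; have := hl k; rewrite IH => /left_surgery_unique ->.
  by rewrite /fake E; congr (model_point _ _ _ _); ring.
have down (k : nat) : Oct (- k%:Z) = fake (- k%:Z).
  elim: k => [|k IH]; first by rewrite oppr0.
  have := hr k; rewrite IH => /right_surgery_unique ->.
  by rewrite /fake !intrN E; congr (model_point _ _ _ _); ring.
by case=> k; [exact: up | rewrite NegzE; exact: down].
Qed.

Lemma octagon_sequence_ex : octagon_sequence fake.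
Proof.
have E (k : nat) : k.+1%:~R = k%:~R + 1 :> R by rewrite -addn1 PoszD intrD.
split.
- exists (octagon_in_H2 R); apply/H2_pointP; rewrite mulr0z subr0; apply/isomorphic_sym; exact: octagon_isomorphic.
- move=> k; have := left_surgery_model (l_gt1 R) (q_gt0 R) (- q - k%:~R) k%:~R.
  by rewrite -/(fake k); congr left_surgery; rewrite /fake E; congr (model_point _ _ _ _); ring.
- move=> k; have := right_surgery_model (l_gt1 R) (q_gt0 R) (- q - (- k%:Z)%:~R) (- k%:Z)%:~R.
  by rewrite -/(fake (- k%:Z)); congr right_surgery; rewrite /fake !intrN E; congr (model_point _ _ _ _); ring.
Qed.

End Sequence.

Theorem mainTheorem1 (R : realType) :
  (exists Oct : int -> H2 R, octagon_sequence Oct) /\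
  forall Oct : int -> H2 R, octagon_sequence Oct ->
    (forall n m : int, n <> m -> Oct n <> Oct m) /\
    (forall (m : int) (U : set (H2 R)), nbhs (Oct m) U ->
       exists n : int, U (Oct n) /\ Oct n <> Oct m).
Proof.
split; first by exists (@fake R); exact: octagon_sequence_ex.
move=> Oct /octagon_sequence_fake hO; split=> [n m nm|m U].
- by rewrite !hO => /fake_inj.
- by rewrite hO => /fake_dense [n [Un nm]]; exists n; rewrite !hO.
Qed.
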